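(* Let $(M,c,\sigma)$ be Poincar\'e--Einstein with conformal infinity $(\Sigma,c_\Sigma)$ of even dimension $n\ge4$. For any choice of $g_\Sigma\in c_\Sigma$, the conformally invariant detour operators $$L_k:\Omega^k\Sigma\to\Omega_k\Sigma,\qquad 0\le k\le\frac n2-1,$$ can be expressed as the composition $$L_k=\gamma_k\,\boldsymbol\delta_\Sigma\,Q^{g_\Sigma}_{k+1}\,\mathbf d_\Sigma ,$$ where $Q^{g_\Sigma}_{k+1}:\Omega^{k+1}\Sigma\to\Omega_{k+1}\Sigma$ is the Q-operator and $$\gamma_k=-(n-2k)(n-2k+2)(n-2k-1)^2 .$$
   Context: Conformal conventions. $M$ is a smooth manifold of dimension $d=n+1$ with boundary $\Sigma$ and conformal class $c$; $c_\Sigma$ is the induced class. $\mathcal EM[w]$: conformal densities of weight $w$ (families $\mu_g$, $g\in c$, with $\mu_{\Omega^2g}=\Omega^w\mu_g$); each scale $g\in c$ trivialises them; indices are moved with the conformal metric $\boldsymbol g$; a positive $\tau\in\Gamma\mathcal EM[1]$ (true scale) gives $\tau^{-2}\boldsymbol g\in c$. $\mathcal E^kM[w]=\Lambda^kT^*M\otimes\mathcal EM[w]$, $\Omega^k=\Gamma\mathcal E^k[0]$, $\Omega_k\Sigma:=\Gamma\mathcal E^k\Sigma[2k-n]$. In a scale $g$: $\varepsilon,\iota$ are exterior/interior multiplication, $\mathbf d=\varepsilon(\nabla)$, $\boldsymbol\delta=\iota(\nabla)$ (minus the formal adjoint of $\mathbf d$; similarly $\mathbf d_\Sigma,\boldsymbol\delta_\Sigma$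 on $\Sigma$), $\boldsymbol\Delta=\mathbf d\boldsymbol\delta+\boldsymbol\delta\mathbf d$; $\mathrm{Ric}=(d-2)P+Jg$, $J=P^a{}_a$, and $\mathbb P$ is the endomorphism $P^a{}_b$ extended to forms as a derivation. Forms on $\Sigma$ are identified with forms along $\Sigma$ annihilated by $\iota(\nu)$. Poincar\'e--Einstein: $\sigma\in\Gamma\mathcal EM[1]$ is positive in the interior, vanishes exactly on $\Sigma$ with $\nabla\sigma\ne0$ there, and $g^o=\sigma^{-2}\boldsymbol g$ satisfies $\mathrm{Ric}(g^o)=-n g^o$. In a scale $g$: $\nu=\nabla\sigma$, $\rho=-\frac1d(\nabla^a\nabla_a\sigma+J\sigma)$. Tractor forms. For $g\in c$, $\mathcal T^kM[w]\cong\mathcal E^{k-1}M[w+k]\oplus\mathcal E^kM[w+k]\oplus\mathcal E^{k-2}M[w+k-2]\oplus\mathcal E^{k-1}M[w+k-2]$; sections are $\mathcal F=(F^+,F,F^{+-},F^-)$ (north, west, east, south slots). Under $\hat g=\Omega^2g$, $\Upsilon=\mathbf d\log\Omega$: $\hat F^+=F^+$, $\hat F=F+\varepsilon(\Upsilon)F^+$, $\hat F^{+-}=F^{+-}-\iota(\Upsilon)F^+$, $\hat F^-=F^-+\frac12(\varepsilon(\Upsilon)\iota(\Upsilon)-\iota(\Upsilon)\varepsilon(\Upsilon))F^+-\iota(\Upsilon)F-\varepsilon(\Upsilon)F^{+-}$. Invariant operators on $\mathcal T^kM[w]$: $\mathscr X\mathcal F=(0,0,-F^+,F)\in\Gamma\mathcal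 T^{k+1}M[w+1]$; $\mathscr X^\star\mathcal F=(0,F^+,0,F^{+-})\in\Gamma\mathcal T^{k-1}M[w+1]$; $\mathscr I^\star\mathcal F=(-\iota(\nu)F^+-\sigma F^{+-},\ \rho F^++\iota(\nu)F+\sigma F^-,\ \iota(\nu)F^{+-},\ \rho F^{+-}-\iota(\nu)F^-)$; $\mathscr D:\Gamma\mathcal T^kM[w]\to\Gamma\mathcal T^{k+1}M[w-1]$ with slots north: $(d+2w-2)\big((w+k)F-\mathbf dF^+\big)$; west: $(d+2w-2)\mathbf dF$; east: $\big(\boldsymbol\Delta+(w+k-2)(J-2\mathbb P)\big)F^+-2\boldsymbol\delta F+(d+2w)\big(\mathbf dF^{+-}+(w+k-2)F^-\big)$; south: $[J-2\mathbb P,\mathbf d]F^+-\big(\boldsymbol\Delta+(w+k)(J-2\mathbb P)\big)F-(d+2w)\mathbf dF^-$; $\mathscr D^\star:\Gamma\mathcal T^kM[w]\to\Gamma\mathcal T^{k-1}M[w-1]$ with slots north: $-(d+2w-2)\big(\boldsymbol\delta F^++(d+w-k+2)F^{+-}\big)$; west: $\big(-\boldsymbol\Delta+(d+w-k)(J-2\mathbb P)\big)F^++(d+2w)\boldsymbol\delta F-2\mathbf dF^{+-}+(d+2w)(d+w-k)F^-$; east: $(d+2w-2)\boldsymbol\delta F^{+-}$; south: $[J-2\mathbb P,\boldsymbol\delta]F^++\big(-\boldsymbol\Delta+(d+w-k+2)(J-2\mathbb P)\big)F^{+-}-(d+2w)\boldsymbol\delta F^-$. $y:=-(\mathscr I^\star\mathscr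 D+\mathscr D\mathscr I^\star):\Gamma\mathcal T^kM[w]\to\Gamma\mathcal T^kM[w-1]$. $\overline{\mathscr D}^\star:=\frac{d+2w-3}{d+2w-2}\Big(\mathscr D^\star+\mathscr I^\star y+\frac1{(d+2w-3)(d+2w-4)}\mathscr X^\star y^2\Big)$ on $\mathcal T^kM[w]$, at the weights where this is defined (as it is below). Detour operator $L_k$: for $A_\Sigma\in\Omega^k\Sigma$ take an extension $A\in\Omega^kM$, form $\mathscr XqA=(0,0,0,A)\in\Gamma\mathcal T^{k+1}M[1-k]$, and apply $y^{n-2k}\,\overline{\mathscr D}^\star$, giving an element of $\Gamma\mathcal T^kM[k-n]$ which along $\Sigma$ depends only on $A_\Sigma$ and lies in the range of $\mathscr X^\star$. $L_kA_\Sigma\in\Omega_k\Sigma$ is its western slot restricted to $\Sigma$. Q-operator: given $g_\Sigma\in c_\Sigma$, choose a true scale $\tau\in\Gamma\mathcal EM[1]$ with $g=\tau^{-2}\boldsymbol g$ inducing $g_\Sigma$ and satisfying the conformal Robin condition $(\delta_R\tau)|_\Sigma=0$, i.e. $\Sigma$ has zero mean curvature in $g$ (equivalently $\rho|_\Sigma=0$ in the scale $g$). Let $\mathscr Y,\mathscr Y^\star$ be exterior and interior multiplication by the tractor $\frac1{d-2}D\log\tau$ of weight $-1$, which in the scale $g$ is $(1,0,-\frac J{d-2})$: explicitly in that scale, with $\kappa=-\frac J{d-2}$, $\mathscr Y\mathcal F=(F,0,-\kappa F^++F^-,\kappa F)$ and $\mathscr Y^\star\mathcal F=(-F^{+-},\kappa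 F^++F^-,0,\kappa F^{+-})$. For $k\in\{0,\dots,\frac n2\}$, $Q_k^{g_\Sigma}:\Omega^k\Sigma\to\Omega_k\Sigma$ is the restriction to $\Sigma$ of $Q^g_k=q^*\,\mathscr Y^\star\mathscr X^\star\,y^{n-2k}\,\mathscr X\mathscr Y\,q$ applied to an extension $A\in\Omega^kM$ of $A_\Sigma$, where $qA$ is any tractor $(0,A,*,* )\in\mathcal T^kM[-k]$ (the unspecified slots do not matter) and $q^*$ takes the western slot; explicitly, in the scale $g$, $Q^g_kA$ is the eastern slot of $y^{n-2k}$ applied to $(0,0,-A,0)\in\Gamma\mathcal T^{k+2}M[-k]$. *)

(* Defs.v *)
From HB Require Import structures.
From mathcomp Require Import all_boot all_order all_algebra.
From mathcomp Require Import all_classical all_reals all_analysis.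

Set Implicit Arguments.
Unset Strict Implicit.
Unset Printing Implicit Defensive.

Import Order.TTheory GRing.Theory Num.Theory numFieldNormedType.Exports.
Local Open Scope classical_set_scope.
Local Open Scope ring_scope.

(* A manifold is given by an atlas with values in a
   model region E of R^m (a half-space, or everything), and a tensor field by
   its components in every chart, subject to the transformation law.  All
   differential operators are given by their coordinate formulas. *)

(** * Exterior algebra at a point *)

(* A covector of mixed degree is given by its components: a S is the
   coefficient of dx^{i_1} /\ ... /\ dx^{i_k}, S = {i_1 < ... < i_k}.  Degrees
   need no bookkeeping this way, and forms of negative degree are 0. *)
Section Exterior.
Context {R : realType} {m : nat}.
Local Notation cov := ({set 'I_m} -> R).

Definition sgn (i : 'I_m) (S : {set 'I_m}) : R :=
  (-1) ^+ #|[pred j in S | (j < i)%N]|.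

(* eps i is dx^i /\ _, and iot i is contraction with the i-th coordinate
   vector in the first argument. *)
Definition eps (i : 'I_m) (a : cov) : cov :=
  fun S => if i \in S then sgn i S * a (S :\ i)%SET else 0.
Definition iot (i : 'I_m) (a : cov) : cov :=
  fun S => if i \in S then 0 else sgn i S * a (i |: S)%SET.

(* Pullback along a linear map with matrix L, i.e. dy^t = sum_s L t s dx^s. *)
Definition pullback (L : 'M[R]_m) (a : cov) : cov :=
  fun S => \sum_(T : {set 'I_m}) a T *
    foldr (fun t (b : cov) S' => \sum_s L t s * eps s b S')
          (fun S' => (S' == finset.set0)%:R) (enum T) S.
End Exterior.

(** * Calculus on a region of R^m *)
Section Calculus.
Context {R : realType} {m : nat}.
Variable E : set 'rV[R]_m.
Implicit Types (f : 'rV[R]_m -> R) (i : 'I_m) (x : 'rV[R]_m) (V : set 'rV[R]_m).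

Definition quotient_at i f x (t : R) : R :=
  t^-1 * (f (x + t *: delta_mx ord0 i) - f x).
Definition along i x : set_system R :=
  within [set t | E (x + t *: delta_mx ord0 i)] 0^'.

(* Partial derivative relative to E: one-sided at boundary points of a
   half-space in the transverse direction, two-sided otherwise. *)
Definition pd i f x : R := lim (quotient_at i f x @ along i x).

Definition smooth_on V f : Prop := forall s : seq 'I_m,
  {within V, continuous (foldr pd f s)} /\
  forall i x, V x -> cvg (quotient_at i (foldr pd f s) x @ along i x).
End Calculus.

(** * Riemannian geometry in a chart *)
Section Riemannian.
Context {R : realType} {m : nat}.
Variable E : set 'rV[R]_m.
Local Notation form := ('rV[R]_m -> {set 'I_m} -> R).
Variable g : 'rV[R]_m -> 'M[R]_m.
Implicit Types (A : form) (x : 'rV[R]_m) (a b c e : 'I_m).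

Definition fmul (f : 'rV[R]_m -> R) A : form := fun x S => f x * A x S.

Definition ginv x : 'M[R]_m := invmx (g x).

(* Levi-Civita connection Gamma^c_{ab}. *)
Definition Gamma c a b x : R := 2^-1 * \sum_e ginv x c e *
  (pd E a (fun y => g y b e) x + pd E b (fun y => g y a e) x
   - pd E e (fun y => g y a b) x).

(* R_{ab}^c_e, with the sign making Ric positive on round spheres. *)
Definition Riem a b c e x : R :=
  pd E a (Gamma c b e) x - pd E b (Gamma c a e) x
  + \sum_f (Gamma c a f x * Gamma f b e x - Gamma c b f x * Gamma f a e x).
Definition Ric b e x : R := \sum_a Riem a b a e x.
Definition Scal x : R := \sum_a \sum_b ginv x a b * Ric a b x.

(* Ric = (m - 2) P + J g with J the trace of P, solved for J and P. *)
Definition J x : R := Scal x / (2 * (m%:R - 1)).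
Definition P a b x : R := (Ric a b x - J x * g x a b) / (m%:R - 2).
Definition Pmix a b x : R := \sum_c P a c x * ginv x c b.

Definition Pder A : form :=
  fun x S => \sum_a \sum_b Pmix a b x * eps a (iot b (A x)) S.
Definition J2P A : form := fmul J A - 2 *: Pder A.

Definition nabla a A : form := fun x S =>
  pd E a (fun y => A y S) x
  - \sum_b \sum_c Gamma c a b x * eps b (iot c (A x)) S.

(* The exterior derivative; it is eps(nabla), the connection being
   torsion-free. *)
Definition ext_d A : form :=
  fun x S => \sum_a eps a (fun T => pd E a (fun y => A y T) x) S.

(* iota(nabla): minus the formal adjoint of ext_d. *)
Definition codiff A : form :=
  fun x S => \sum_a \sum_b ginv x a b * iot b (nabla a A x) S.

Definition Lapl A : form := ext_d (codiff A) + codiff (ext_d A).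

(* sigma in the scale g: gradient and rho. *)
Variable sigma : 'rV[R]_m -> R.

Definition nu b x : R := \sum_a ginv x b a * pd E a sigma x.
Definition iota_nu A : form := fun x S => \sum_a nu a x * iot a (A x) S.
Definition hess a b x : R :=
  pd E a (pd E b sigma) x - \sum_c Gamma c a b x * pd E c sigma x.
Definition rho x : R :=
  - (m%:R)^-1 * (\sum_a \sum_b ginv x a b * hess a b x + J x * sigma x).

(* Unit conormal and mean curvature of the level sets of sigma; the
   conformal Robin operator on densities of weight w. *)
Definition conormal a x : R :=
  pd E a sigma x / Num.sqrt (\sum_b nu b x * pd E b sigma x).
Definition normal b x : R := \sum_a ginv x b a * conormal a x.
Definition mean_curvature x : R := (m%:R - 1)^-1 *
  \sum_a \sum_b (ginv x a b - normal a x * normal b x) *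
    (pd E a (conormal b) x - \sum_c Gamma c a b x * conormal c x).
Definition robin (w : R) (mu : 'rV[R]_m -> R) x : R :=
  \sum_a normal a x * pd E a mu x - w * mean_curvature x * mu x.

(** ** Tractor forms in the scale g *)
Record tractor := Tractor {
  north : form; west : form; east : form; south : form }.
Implicit Types (F : tractor) (k w : R).

Definition tadd F G : tractor :=
  Tractor (north F + north G) (west F + west G)
          (east F + east G) (south F + south G).
Definition tscale k F : tractor :=
  Tractor (k *: north F) (k *: west F) (k *: east F) (k *: south F).

(* In the operators below, k and w are those of the source T^k M[w]. *)
Local Notation d := (m%:R : R) (only parsing).

Definition Xt F : tractor := Tractor 0 0 (- north F) (west F).
Definition Xs F : tractor := Tractor 0 (north F) 0 (east F).

Definition Is F : tractor := Tractor
  (- iota_nu (north F) - fmul sigma (east F))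
  (fmul rho (north F) + iota_nu (west F) + fmul sigma (south F))
  (iota_nu (east F))
  (fmul rho (east F) - iota_nu (south F)).

Definition Dt k w F : tractor := Tractor
  ((d + 2 * w - 2) *: ((w + k) *: west F - ext_d (north F)))
  ((d + 2 * w - 2) *: ext_d (west F))
  (Lapl (north F) + (w + k - 2) *: J2P (north F) - 2 *: codiff (west F)
   + (d + 2 * w) *: (ext_d (east F) + (w + k - 2) *: south F))
  (J2P (ext_d (north F)) - ext_d (J2P (north F))
   - (Lapl (west F) + (w + k) *: J2P (west F))
   - (d + 2 * w) *: ext_d (south F)).

Definition Ds k w F : tractor := Tractor
  (- (d + 2 * w - 2) *: (codiff (north F) + (d + w - k + 2) *: east F))
  (- Lapl (north F) + (d + w - k) *: J2P (north F)
   + (d + 2 * w) *: codiff (west F) - 2 *: ext_d (east F)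
   + ((d + 2 * w) * (d + w - k)) *: south F)
  ((d + 2 * w - 2) *: codiff (east F))
  (J2P (codiff (north F)) - codiff (J2P (north F))
   + (- Lapl (east F) + (d + w - k + 2) *: J2P (east F))
   - (d + 2 * w) *: codiff (south F)).

Definition yt k w F : tractor :=
  tscale (-1) (tadd (Is (Dt k w F)) (Dt (k - 1) w (Is F))).

Fixpoint ypow (j : nat) k w F : tractor :=
  if j is j'.+1 then ypow j' k (w - 1) (yt k w F) else F.

Definition Dbar k w F : tractor :=
  tscale ((d + 2 * w - 3) / (d + 2 * w - 2))
    (tadd (tadd (Ds k w F) (Is (yt k w F)))
       (tscale ((d + 2 * w - 3) * (d + 2 * w - 4))^-1 (Xs (ypow 2 k w F)))).

(* The last two slots of the lift may be chosen arbitrarily: they do not enter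
   in Xt (q A) or Xt (Yt (q A)). *)
Definition q A : tractor := Tractor 0 A 0 0.

(* Multiplication by the scale tractor (1, 0, kappa) of g. *)
Definition kappa x : R := - J x / (d - 2).
Definition Yt F : tractor := Tractor
  (west F) 0 (- fmul kappa (north F) + south F) (fmul kappa (west F)).
Definition Ys F : tractor := Tractor
  (- east F) (fmul kappa (north F) + south F) 0 (fmul kappa (east F)).

(* Before restriction to the boundary; the boundary has dimension m - 1. *)
Definition detour_local (k : nat) A : form :=
  west (ypow (m.-1 - 2 * k) k%:R (- k%:R)
          (Dbar (k%:R + 1) (1 - k%:R) (Xt (q A)))).

Definition Q_local (k : nat) A : form :=
  west (Ys (Xs (ypow (m.-1 - 2 * k) (k%:R + 2) (- k%:R) (Xt (Yt (q A)))))).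
End Riemannian.

(** * Manifolds and tensor fields *)
Record atlas (R : realType) (m : nat) (M : Type) := Atlas {
  chart : Type;
  dom : chart -> set M;
  crd : chart -> M -> 'rV[R]_m;
  par : chart -> 'rV[R]_m -> M }.

Section Fields.
Context {R : realType} {m : nat} {M : Type}.
Variables (E : set 'rV[R]_m) (U : atlas R m M).

Definition img (i : chart U) : set 'rV[R]_m := crd i @` dom i.
Definition overlap (i j : chart U) : set 'rV[R]_m := crd i @` (dom i `&` dom j).
Definition jacobian (i j : chart U) (x : 'rV[R]_m) : 'M[R]_m :=
  \matrix_(t, s) pd E s (fun y => crd j (par i y) ord0 t) x.

Definition formf := chart U -> 'rV[R]_m -> {set 'I_m} -> R.
Definition metricf := chart U -> 'rV[R]_m -> 'M[R]_m.

Definition smooth_fun (f : M -> R) : Prop :=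
  forall i : chart U, smooth_on E (img i) (fun x => f (par i x)).

Definition is_form (k : nat) (A : formf) : Prop :=
  [/\ forall i S, smooth_on E (img i) (fun x => A i x S),
      forall i x (S : {set 'I_m}), img i x -> #|S| <> k -> A i x S = 0
    & forall i j x S, overlap i j x ->
        A i x S = pullback (jacobian i j x) (A j (crd j (par i x))) S].

Definition is_metric (g : metricf) : Prop :=
  [/\ forall i a b, smooth_on E (img i) (fun x => g i x a b),
      forall i x, img i x -> (g i x)^T = g i x,
      forall i x (v : 'rV[R]_m), img i x -> v != 0 ->
        0 < (v *m g i x *m v^T) ord0 ord0
    & forall i j x, overlap i j x ->
        g i x = (jacobian i j x)^T *m g j (crd j (par i x)) *m jacobian i j x].

(* h = Omega^2 g with Omega smooth and positive on the union of the chart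
   domains. *)
Definition conformal (Omega : M -> R) (g h : metricf) : Prop :=
  [/\ smooth_fun Omega,
      forall (i : chart U) p, dom i p -> 0 < Omega p
    & forall i x, img i x -> h i x = (Omega (par i x)) ^+ 2 *: g i x].

Definition is_conformal_class (c : set metricf) : Prop :=
  exists2 g, is_metric g & c = [set h | exists Omega, conformal Omega g h].

Definition is_density (c : set metricf) (w : int) (mu : metricf -> M -> R) :=
  (forall g, c g -> smooth_fun (mu g)) /\
  forall g h Omega, c g -> c h -> conformal Omega g h ->
    forall p, mu h p = Omega p ^ w * mu g p.
End Fields.

Definition is_manifold (R : realType) (m : nat) (M : topologicalType)
    (E : set 'rV[R]_m) (U : atlas R m M) : Prop :=
  [/\ hausdorff_space M,
      @second_countable M,
      forall p, exists i : chart U, dom i p,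
      forall i : chart U,
        [/\ open (dom i),
            exists2 W : set 'rV[R]_m, open W & img i = W `&` E,
            forall p, dom i p -> par i (crd i p) = p,
            {within dom i, continuous (crd i)}
          & {within img i, continuous (par i)}]
    & forall (i j : chart U) a, smooth_on E (overlap i j)
        (fun x => crd j (par i x) ord0 a)].

(** * The boundary *)
Section Boundary.
Context {R : realType} {n : nat} {M : Type}.

Definition halfspace : set 'rV[R]_n.+1 := [set x | 0 <= x ord0 ord0].

Definition emb (x : 'rV[R]_n) : 'rV[R]_n.+1 :=
  \row_a oapp (x ord0) 0 (unlift ord0 a).

Variable U : atlas R n.+1 M.

Definition bd : atlas R n M := @Atlas R n M (chart U)
  (fun i => [set p | dom i p /\ crd i p ord0 ord0 = 0])
  (fun i p => \row_a crd i p ord0 (lift ord0 a))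
  (fun i x => par i (emb x)).

Definition boundary : set M := [set p | exists i : chart bd, dom i p].

Definition res_metric (g : metricf U) : metricf bd :=
  fun i x => \matrix_(a, b) g i (emb x) (lift ord0 a) (lift ord0 b).

Definition res_form (A : formf U) : formf bd :=
  fun i x S => A i (emb x) (lift ord0 @: S)%SET.

Definition boundary_class (c : set (metricf U)) : set (metricf bd) :=
  [set h | exists2 g, c g &
     exists Omega, conformal setT Omega (res_metric g) h].

Definition induces (g : metricf U) (gS : metricf bd) : Prop :=
  forall (i : chart bd) x, img i x -> gS i x = res_metric g i x.

Definition d_bd (A : formf bd) : formf bd := fun i => ext_d setT (A i).
Definition delta_bd (gS : metricf bd) (A : formf bd) : formf bd :=
  fun i => codiff setT (gS i) (A i).

Definition rep (f : M -> R) (i : chart U) : 'rV[R]_n.+1 -> R :=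
  fun x => f (par i x).

Definition poincare_einstein (c : set (metricf U))
    (sigma : metricf U -> M -> R) : Prop :=
  [/\ is_conformal_class halfspace c,
      is_density halfspace c 1 sigma
    & forall g, c g ->
      [/\ forall p, ~ boundary p -> 0 < sigma g p,
          forall p, boundary p -> sigma g p = 0,
          forall (i : chart bd) x, img i x ->
            exists a, pd halfspace a (rep (sigma g) i) (emb x) <> 0
        & forall (i : chart U) x a b, img i x -> ~ boundary (par i x) ->
            let go y := (rep (sigma g) i y) ^- 2 *: g i y in
            Ric halfspace go a b x = - n%:R * go x a b]].

(* A form on the boundary is identified with a form along the boundary
   annihilated by iota(nu); A restricts to AS under this identification. *)
Definition extends (g : metricf U) (sg : M -> R)
    (AS : formf bd) (A : formf U) : Prop :=
  forall (i : chart bd) x, img i x ->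
    (forall S, res_form A i x S = AS i x S) /\
    (forall S, iota_nu halfspace (g i) (rep sg i) (A i) (emb x) S = 0).

Variables (c : set (metricf U)) (sigma : metricf U -> M -> R).

(* BS is the weighted form L_k AS, trivialised by hS in the boundary class. *)
Definition is_detour (k : nat) (AS : formf bd) (hS : metricf bd)
    (BS : formf bd) : Prop :=
  exists h A,
    [/\ c h, induces h hS, is_form halfspace k A, extends h (sigma h) AS A
      & forall (i : chart bd) x S, img i x ->
          BS i x S = res_form (fun j => detour_local halfspace
                       (h j) (rep (sigma h) j) k (A j)) i x S].

(* CS is Q_k^{gS} AS, trivialised by gS.  The metric tau^{-2} bg of a true
   scale tau is the g in c for which tau g is constantly 1. *)
Definition is_Q (gS : metricf bd) (k : nat) (AS CS : formf bd) : Prop :=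
  exists tau g A,
    [/\ is_density halfspace c 1 tau /\ (forall h, c h -> forall p, 0 < tau h p),
        c g /\ (forall p, tau g p = 1),
        induces g gS /\
        (forall (i : chart bd) x, img i x ->
           robin halfspace (g i) (rep (sigma g) i) 1 (rep (tau g) i) (emb x) = 0),
        is_form halfspace k A /\ extends g (sigma g) AS A
      & forall (i : chart bd) x S, img i x ->
          CS i x S = res_form (fun j => Q_local halfspace
                       (g j) (rep (sigma g) j) k (A j)) i x S].
End Boundary.

Definition gamma {R : realType} (n k : nat) : R :=
  - ((n%:R - 2 * k%:R) * (n%:R - 2 * k%:R + 2) * (n%:R - 2 * k%:R - 1) ^+ 2).

(* Main.v *)
Require Import Defs.
From HB Require Import structures.
From mathcomp Require Import all_boot all_order all_algebra.
From mathcomp Require Import all_classical all_reals all_analysis.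
From mathcomp Require Import ring lra zify.
Import Order.TTheory GRing.Theory Num.Theory numFieldNormedType.Exports.
Local Open Scope classical_set_scope.
Local Open Scope ring_scope.

Set Implicit Arguments.
Unset Strict Implicit.
Unset Printing Implicit Defensive.

(* On the interior write everything in terms of the Einstein metric
   g_o = sigma^-2 g.  The tractor I_A of sigma is parallel, and splitting
   tractor forms along it turns y into an explicit operator built from d, the
   codifferential delta_o of g_o and powers of sigma, all of which obey the
   commutation rules recorded in the structure [calculus].  Applied to a form
   B with iota(nu) B = O(sigma), D-bar-star lets one correct B by a multiple of
   sigma so that delta_o d B = sigma^(n-2k) H with H smooth up to the boundary,
   and L_k is a constant times H|_Sigma.  On the other hand D := d B is closed,
   restricts to d_Sigma A_Sigma and satisfies delta_o D = sigma^(n-2k) H; on such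
   a form y^(n-2k-2) produces, in a scale with zero mean curvature, a tangential
   form Y extending Q_{k+1} d_Sigma A_Sigma whose divergence is, up to the normal
   derivative which delta_Sigma does not see, a constant times H.  Comparing the
   two constants gives gamma_k.  Smooth functions near a boundary point form a
   ring with commuting derivations, in which a function vanishing on Sigma is
   divisible by sigma (Hadamard); the computations take place in that ring. *)

(** * Calculus of a scale: operators with powers of sigma *)

(** Put l = n - 2k. The Einstein condition expresses rho and J - 2P through d, delta, eps(d sigma),
    iota(nu) and sigma^-1. With these two eliminated, the remaining letters satisfy a few quadratic
    relations and mixed words are free, so every tractor identity is decided by a normal form. The
    price is negative powers of sigma, hence a separate predicate for smoothness up to Sigma.
    delta_o d multiplies the leading coefficient of sigma^j B by j (j - l): corrections exist for 0
    < j < l, and H is the obstruction at the root j = l. In the Einstein splitting the weight enters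
    y only through the scalar U (K - U), U being weight plus degree; its symmetry under U -> K - U
    lets sigma pass through the critical power of y, which makes the choice of extension irrelevant.
    Products of such scalars are factorials: L_k yields l (l+2) ((l-1)!)^2 H and the divergence of
    Q_{k+1} yields - ((l-2)!)^2 H, with quotient - l (l+2) (l-1)^2. *)

Inductive letter := Ld | Lx | Le | Li.

Definition eqlet (a b : letter) : bool :=
  match a, b with
  | Ld, Ld | Lx, Lx | Le, Le | Li, Li => true | _, _ => false end.

Lemma eqletP a b : eqlet a b -> a = b.
Proof. by case: a; case: b. Qed.

Fixpoint eqword (v w : seq letter) : bool :=
  match v, w with
  | [::], [::] => true
  | a :: v', b :: w' => eqlet a b && eqword v' w'
  | _, _ => false
  end.

Lemma eqwordP v w : eqword v w -> v = w.
Proof.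
elim: v w => [|a v IH] [|b w] //= /andP[/eqletP -> /IH ->] //.
Qed.

Definition eqz (a b : int) : bool :=
  match a, b with
  | Posz p, Posz q | Negz p, Negz q => eqn p q | _, _ => false end.

Lemma eqzP a b : eqz a b -> a = b.
Proof. by case: a; case: b => p q //= /eqnP ->. Qed.

(** Coefficients stay symbolic, so a normal form is computed without evaluating anything in [R]; the
    vanishing of each collected coefficient is left to [field]. [CU] is the exponent u, [CA] the
    eigenvalue of m - 2 deg on an atom, [CV] a scalar of the goal. *)
Inductive coef :=
  | CZ of int | CU | CA of nat | CV of nat
  | CD of coef & coef | CM of coef & coef.

(* A term stands for c * sigma^(a u + j) w v, with u a fixed integer, w a word
   in the four operators and v an atom. *)
Record term := Term {
  t_coef : coef; t_mul : nat; t_off : int; t_word : seq letter; t_atom : nat }.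

Inductive expr :=
  | EA of nat | EO of letter & expr | ES of nat & int & expr | EC of expr
  | EZ of coef & expr | ED of expr & expr | E0.

(* d eps = - eps d and delta iota = - iota delta move d and delta to the right
   of eps and iota. *)
Fixpoint lmul (l : letter) (w : seq letter) : option (bool * seq letter) :=
  match w with
  | [::] => Some (false, [:: l])
  | b :: w' =>
    if eqlet l b then None else
    match l, b with
    | Ld, Le => if lmul Ld w' is Some (s, v) then
                  if v is Le :: _ then None else Some (~~ s, Le :: v)
                else None
    | Lx, Li => if lmul Lx w' is Some (s, v) then
                  if v is Li :: _ then None else Some (~~ s, Li :: v)
                else None
    | _, _ => Some (false, l :: w)
    end
  end.

Definition sgnc (s : bool) (c : coef) := if s then CM (CZ (Negz 0)) c else c.

(** The second list is the Leibniz term: d and delta applied to sigma^p leave p sigma^(p-1) with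
    eps, respectively iota, in place of the letter. *)
Definition tmul (l : letter) (t : term) : seq term :=
  let: Term c a j w v := t in
  (if lmul l w is Some (s, w') then [:: Term (sgnc s c) a j w' v] else [::]) ++
  (let der l' := if lmul l' w is Some (s, w') then
      [:: Term (sgnc s (CM (CD (CM (CZ a) CU) (CZ j)) c)) a (j - 1) w' v]
      else [::] in
   match l with Ld => der Le | Lx => der Li | _ => [::] end).

Definition ldeg (l : letter) : int :=
  match l with Ld | Le => 1 | Lx | Li => -1 end.

Fixpoint wdeg (w : seq letter) : int :=
  if w is l :: w' then ldeg l + wdeg w' else 0.

Fixpoint norm (x : expr) : seq term :=
  match x with
  | EA i => [:: Term (CZ 1) 0 0 [::] i]
  | EO l y => flatten (map (tmul l) (norm y))
  | ES a j y => map (fun t => let: Term c b i w v := t in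
                      Term c (a + b) (j + i) w v) (norm y)
  | EC y => map (fun t => let: Term c b i w v := t in
      Term (CM (CD (CA v) (CM (CZ (Negz 1)) (CZ (wdeg w)))) c) b i w v) (norm y)
  | EZ k y => map (fun t => let: Term c b i w v := t in
                      Term (CM k c) b i w v) (norm y)
  | ED y z => norm y ++ norm z
  | E0 => [::]
  end.

Fixpoint ins (t : term) (s : seq term) : seq term :=
  match s with
  | [::] => [:: t]
  | t' :: s' =>
    if [&& eqn (t_mul t) (t_mul t'), eqz (t_off t) (t_off t'),
           eqword (t_word t) (t_word t') & eqn (t_atom t) (t_atom t')]
    then Term (CD (t_coef t) (t_coef t')) (t_mul t') (t_off t') (t_word t')
           (t_atom t') :: s'
    else t' :: ins t s'
  end.

Definition collect (s : seq term) : seq coef := map t_coef (foldr ins [::] s).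

Section Normalize.
Context {R : realType} {F : lmodType R} (d x e i cc : {linear F -> F})
  (sp : int -> {linear F -> F}).
Hypothesis dd : forall v, d (d v) = 0.
Hypothesis xx : forall v, x (x v) = 0.
Hypothesis ee : forall v, e (e v) = 0.
Hypothesis ii : forall v, i (i v) = 0.
Hypothesis de : forall v, d (e v) = - e (d v).
Hypothesis xi : forall v, x (i v) = - i (x v).
Hypothesis spD : forall a b v, sp a (sp b v) = sp (a + b) v.
Hypothesis sp0 : forall v, sp 0 v = v.
Hypothesis d_sp : forall a v, d (sp a v) = sp a (d v) + a%:~R *: sp (a - 1) (e v).
Hypothesis x_sp : forall a v, x (sp a v) = sp a (x v) + a%:~R *: sp (a - 1) (i v).
Hypothesis e_sp : forall a v, e (sp a v) = sp a (e v).
Hypothesis i_sp : forall a v, i (sp a v) = sp a (i v).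
Hypothesis cc_d : forall v, cc (d v) = d (cc v) - 2 *: d v.
Hypothesis cc_x : forall v, cc (x v) = x (cc v) + 2 *: x v.
Hypothesis cc_e : forall v, cc (e v) = e (cc v) - 2 *: e v.
Hypothesis cc_i : forall v, cc (i v) = i (cc v) + 2 *: i v.
Hypothesis cc_sp : forall a v, cc (sp a v) = sp a (cc v).

Variables (u : int) (vs : seq (F * R)) (cs : seq R).

Definition vat (i : nat) : F := (nth (0, 0) vs i).1.
Definition cat_ (i : nat) : R := (nth (0, 0) vs i).2.

Hypothesis cc_at : forall i, cc (vat i) = cat_ i *: vat i.

Fixpoint cint (c : coef) : R :=
  match c with
  | CZ (Posz p) => p%:R
  | CZ (Negz p) => - p.+1%:R
  | CU => u%:~R
  | CA i => cat_ i
  | CV i => nth 0 cs i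
  | CD a b => cint a + cint b
  | CM a b => cint a * cint b
  end.

Lemma cintZ z : cint (CZ z) = z%:~R.
Proof. by case: z => p //=; rewrite NegzE mulrNz. Qed.

Definition lint (l : letter) : F -> F :=
  match l with Ld => d | Lx => x | Le => e | Li => i end.

Fixpoint wint (w : seq letter) (v : F) : F :=
  if w is l :: w' then lint l (wint w' v) else v.

Definition tint (t : term) : F :=
  let: Term c a j w v := t in cint c *: sp (a%:Z * u + j) (wint w (vat v)).

Definition sint (s : seq term) : F := foldr (fun t v => tint t + v) 0 s.

(** The exponent is an iterated addition so that, for [a] equal to 1 or 0, the interpretation is
    convertible to [u + j] or [j], exactly as in the goal that was reified. *)
Fixpoint eint (y : expr) : F :=
  match y with
  | EA i => vat i
  | EO l z => lint l (eint z)
  | ES a j z => sp (iter a (+%R u) j) (eint z)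
  | EC z => cc (eint z)
  | EZ k z => cint k *: eint z
  | ED y z => eint y + eint z
  | E0 => 0
  end.

Lemma sint_cat s t : sint (s ++ t) = sint s + sint t.
Proof. by elim: s => [|a s IH] /=; rewrite ?add0r // IH addrA. Qed.

Lemma lint0 l : lint l 0 = 0. Proof. by case: l => /=; rewrite linear0. Qed.
Lemma lintD l v w : lint l (v + w) = lint l v + lint l w.
Proof. by case: l => /=; rewrite linearD. Qed.
Lemma lintZ l c v : lint l (c *: v) = c *: lint l v.
Proof. by case: l => /=; rewrite linearZ. Qed.

Lemma spZ a c v : sp a (c *: v) = c *: sp a v.
Proof. exact: linearZ. Qed.

Lemma lmulP l w v : lint l (wint w v) =
  if lmul l w is Some (s, w') then (-1) ^+ s *: wint w' v else 0.
Proof.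
elim: w => [|b w IH] /=; first by rewrite scale1r.
have [/eqletP <-|] := boolP (eqlet l b).
  by case: l {IH} => /=; rewrite (dd, xx, ee, ii).
have sgE (r : bool) (z : F) : - ((-1) ^+ r *: z) = (-1) ^+ (~~ r) *: z.
  by case: r; rewrite /= expr0 expr1 scaleN1r scale1r ?opprK.
move: IH; case: l => IH; case: b => // _ /=; rewrite ?scale1r //.
- rewrite de; move: IH => /= ->; case: (lmul Ld w) => [[s q]|] /=;
    last by rewrite linear0 oppr0.
  by rewrite linearZ /= sgE; case: q => [|[] q] //=; rewrite ee scaler0.
- rewrite xi; move: IH => /= ->; case: (lmul Lx w) => [[s q]|] /=;
    last by rewrite linear0 oppr0.
  by rewrite linearZ /= sgE; case: q => [|[] q] //=; rewrite ii scaler0.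
Qed.

Lemma cint_sgnc s c : cint (sgnc s c) = (-1) ^+ s * cint c.
Proof. by case: s; rewrite /= ?mul1r ?expr1. Qed.

Lemma lint_sp l a v : lint l (sp a v) = sp a (lint l v) +
  match l with Ld => a%:~R *: sp (a - 1) (e v)
             | Lx => a%:~R *: sp (a - 1) (i v) | _ => 0 end.
Proof. by case: l => /=; rewrite (d_sp, x_sp, e_sp, i_sp) ?addr0. Qed.

Lemma tmulP l t : lint l (tint t) = sint (tmul l t).
Proof.
case: t => c a j w v; rewrite /tint lintZ lint_sp scalerDr /tmul sint_cat.
congr (_ + _).
  rewrite lmulP; case: (lmul l w) => [[s w']|] /=; last by rewrite linear0 scaler0.
  by rewrite addr0 cint_sgnc spZ scalerA mulrC.
have H l' : cint c *: ((a%:Z * u + j)%:~R *: sp (a%:Z * u + j - 1) (lint l' (wint w (vat v))))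
   = sint (if lmul l' w is Some (s, w') then
      [:: Term (sgnc s (CM (CD (CM (CZ a) CU) (CZ j)) c)) a (j - 1) w' v]
      else [::]).
  rewrite lmulP; case: (lmul l' w) => [[s w']|] /=; last by rewrite linear0 !scaler0.
  rewrite addr0 cint_sgnc spZ !scalerA -addrA; congr (_ *: _).
  have -> : cint (CM (CD (CM (CZ a) CU) (CZ j)) c) =
      (a%:~R * u%:~R + j%:~R) * cint c by rewrite -(cintZ j).
  by rewrite intrD intrM; move: ((-1) ^+ s) => r; ring.
by case: l => /=; rewrite ?scaler0 // -(H Le, H Li).
Qed.

Lemma wdegP w v :
  cc (wint w (vat v)) = (cat_ v + -2 * (wdeg w)%:~R) *: wint w (vat v).
Proof.
elim: w => [|l w IH] /=; first by rewrite cc_at mulr0 addr0.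
have -> : cc (lint l (wint w (vat v))) = lint l (cc (wint w (vat v)))
    - (2 * (ldeg l)%:~R) *: lint l (wint w (vat v)).
  by case: l => /=; rewrite (cc_d, cc_x, cc_e, cc_i) ?mulr1 // mulrN1 scaleNr opprK.
rewrite IH lintZ -scalerBl intrD; congr (_ *: _); ring.
Qed.

Lemma sint_map (G : F -> F) (f : term -> term) s :
  G 0 = 0 -> (forall v w, G (v + w) = G v + G w) ->
  (forall t, tint (f t) = G (tint t)) -> sint (map f s) = G (sint s).
Proof.
by move=> G0 GD fG; elim: s => [|t s IH] //=; rewrite IH fG GD.
Qed.

Let iterE a j : iter a (+%R u) j = a%:Z * u + j.
Proof.
by elim: a => [|a IH] /=; rewrite ?mul0r ?add0r // IH intS mulrDl mul1r addrA.
Qed.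

Lemma norm_sound y : eint y = sint (norm y).
Proof.
elim: y => [i'|l y IHy|a j y IHy|y IHy|k y IHy|y IHy z IHz|] /=;
  rewrite ?IHy ?IHz //.
- by rewrite addr0 scale1r mul0r addr0 sp0.
- elim: (norm y) => [|t s IH] /=; first exact: lint0.
  by rewrite sint_cat -IH lintD tmulP.
- rewrite iterE (@sint_map (sp (a%:Z * u + j))) ?linear0 //; first exact: linearD.
  case=> c b i' w v /=; rewrite spZ spD; congr (_ *: sp _ _).
  by rewrite PoszD; ring.
- rewrite (@sint_map cc) ?linear0 //; first exact: linearD.
  case=> c b i' w v /=; rewrite linearZ /= cc_sp wdegP spZ scalerA.
  by congr (_ *: _); rewrite -(cintZ (wdeg w)) /= mulrC.
- rewrite (@sint_map (GRing.scale (cint k))) ?scaler0 //; first exact: scalerDr.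
  by case=> c b i' w v /=; rewrite scalerA.
- by rewrite sint_cat.
Qed.

Lemma ins_sound t s : sint (ins t s) = tint t + sint s.
Proof.
elim: s => [|t' s IH] //=; case: ifP => [/and4P[]|_] /=; last by rewrite IH addrCA.
case: t {IH} => c a j w v; case: t' => c' a' j' w' v' /=.
by move=> /eqnP -> /eqzP -> /eqwordP -> /eqnP ->; rewrite scalerDl addrA.
Qed.

Lemma collect_sound s :
  foldr (fun c P => cint c = 0 /\ P) True (collect s) -> sint s = 0.
Proof.
have -> : sint s = sint (foldr ins [::] s).
  by elim: s => //= t s ->; rewrite ins_sound.
rewrite /collect; elim: (foldr ins [::] s) => //= t s' IH [c0 /IH ->].
by case: t c0 => c a j w v /= ->; rewrite scale0r addr0.
Qed.

(* An identity between operators of the algebra follows by comparing the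
   coefficients of the normal forms. *)
Lemma norm_eq y z :
  foldr (fun c P => cint c = 0 /\ P) True
    (collect (norm (ED y (EZ (CZ (Negz 0)) z)))) -> eint y = eint z.
Proof.
move=> /collect_sound; rewrite -norm_sound /= scaleN1r => /eqP.
by rewrite subr_eq0 => /eqP.
Qed.
End Normalize.

(** * Tractor forms and their operators over an abstract module *)

Section Tractors.
Context {F : Type}.

Record tr := Tr { nN : F; nW : F; nE : F; nS : F }.
End Tractors.
Arguments tr F : clear implicits.

Section TractorOps.
Context {R : realType} {F : lmodType R} (m : R).

Definition addT (S T : tr F) : tr F :=
  Tr (nN S + nN T) (nW S + nW T) (nE S + nE T) (nS S + nS T).
Definition scaleT (c : R) (T : tr F) : tr F :=
  Tr (c *: nN T) (c *: nW T) (c *: nE T) (c *: nS T).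

Definition XtT (T : tr F) : tr F := Tr 0 0 (- nN T) (nW T).
Definition XsT (T : tr F) : tr F := Tr 0 (nN T) 0 (nE T).

Section Ops.
Variables d x J s i r : F -> F.

Definition LapF v := d (x v) + x (d v).

(** The operators of the scale are parameters because the same formulas serve for the scale g on the
    interior, for g on a region reaching the boundary, and for the Einstein scale, where sigma = 1,
    iota(nu) = 0 and rho = 1/2. *)
Definition IsT (T : tr F) : tr F := Tr (- i (nN T) - s (nE T))
  (r (nN T) + i (nW T) + s (nS T)) (i (nE T)) (r (nE T) - i (nS T)).

Definition DtT (k w : R) (T : tr F) : tr F := Tr
  ((m + 2 * w - 2) *: ((w + k) *: nW T - d (nN T)))
  ((m + 2 * w - 2) *: d (nW T))
  (LapF (nN T) + (w + k - 2) *: J (nN T) - 2 *: x (nW T)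
   + (m + 2 * w) *: (d (nE T) + (w + k - 2) *: nS T))
  (J (d (nN T)) - d (J (nN T)) - (LapF (nW T) + (w + k) *: J (nW T))
   - (m + 2 * w) *: d (nS T)).

Definition DsT (k w : R) (T : tr F) : tr F := Tr
  (- (m + 2 * w - 2) *: (x (nN T) + (m + w - k + 2) *: nE T))
  (- LapF (nN T) + (m + w - k) *: J (nN T) + (m + 2 * w) *: x (nW T)
   - 2 *: d (nE T) + ((m + 2 * w) * (m + w - k)) *: nS T)
  ((m + 2 * w - 2) *: x (nE T))
  (J (x (nN T)) - x (J (nN T)) + (- LapF (nE T) + (m + w - k + 2) *: J (nE T))
   - (m + 2 * w) *: x (nS T)).

Definition yT (k w : R) (T : tr F) : tr F :=
  scaleT (-1) (addT (IsT (DtT k w T)) (DtT (k - 1) w (IsT T))).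

Fixpoint ypowT (j : nat) (k w : R) (T : tr F) : tr F :=
  if j is j'.+1 then ypowT j' k (w - 1) (yT k w T) else T.

Definition DbarT (k w : R) (T : tr F) : tr F :=
  scaleT ((m + 2 * w - 3) / (m + 2 * w - 2))
    (addT (addT (DsT k w T) (IsT (yT k w T)))
       (scaleT ((m + 2 * w - 3) * (m + 2 * w - 4))^-1 (XsT (ypowT 2 k w T)))).
End Ops.
End TractorOps.

(* The differential operators of a scale: d, delta, exterior and interior
   multiplication by d sigma, m - 2 deg, multiplication by powers of sigma and
   by rho, and J - 2 P.  The last two fields are all that is left of the
   Poincare-Einstein condition. *)
Record calculus (R : realType) (F : lmodType R) (m : R) := Calculus {
  op_d : {linear F -> F}; op_x : {linear F -> F};
  op_e : {linear F -> F}; op_i : {linear F -> F}; op_cc : {linear F -> F};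
  op_sp : int -> {linear F -> F}; op_rho : F -> F; op_J2 : F -> F;
  op_dd : forall v, op_d (op_d v) = 0;
  op_xx : forall v, op_x (op_x v) = 0;
  op_spD : forall a b v, op_sp a (op_sp b v) = op_sp (a + b) v;
  op_sp0 : forall v, op_sp 0 v = v;
  op_d_sp : forall a v,
    op_d (op_sp a v) = op_sp a (op_d v) + a%:~R *: op_sp (a - 1) (op_e v);
  op_x_sp : forall a v,
    op_x (op_sp a v) = op_sp a (op_x v) + a%:~R *: op_sp (a - 1) (op_i v);
  op_e_sp : forall a v, op_e (op_sp a v) = op_sp a (op_e v);
  op_i_sp : forall a v, op_i (op_sp a v) = op_sp a (op_i v);
  op_cc_d : forall v, op_cc (op_d v) = op_d (op_cc v) - 2 *: op_d v;
  op_cc_x : forall v, op_cc (op_x v) = op_x (op_cc v) + 2 *: op_x v;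
  op_cc_e : forall v, op_cc (op_e v) = op_e (op_cc v) - 2 *: op_e v;
  op_cc_i : forall v, op_cc (op_i v) = op_i (op_cc v) + 2 *: op_i v;
  op_cc_sp : forall a v, op_cc (op_sp a v) = op_sp a (op_cc v);
  op_rhoE : forall v,
    op_rho v = 2^-1 *: op_sp (-1) (v - op_e (op_i v) - op_i (op_e v));
  op_J2E : forall v, op_J2 v = op_sp (-1) (op_d (op_i v) + op_i (op_d v)
    - op_x (op_e v) - op_e (op_x v) - op_rho (op_cc v)) }.

(** * Relations in the algebra of a scale *)

Section Relations.
Context {R : realType} {F : lmodType R} {m : R} (C : calculus F m).
Local Notation d := (op_d C).
Local Notation x := (op_x C).
Local Notation e := (op_e C).
Local Notation i := (op_i C).
Local Notation cc := (op_cc C).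
Local Notation sp := (op_sp C).
Local Notation rho := (op_rho C).
Local Notation J2 := (op_J2 C).
Let dd := op_dd C.
Let xx := op_xx C.
Let spD := op_spD C.
Let sp0 := op_sp0 C.
Let d_sp := op_d_sp C.
Let x_sp := op_x_sp C.
Let e_sp := op_e_sp C.
Let i_sp := op_i_sp C.
Let cc_d := op_cc_d C.
Let cc_x := op_cc_x C.
Let cc_e := op_cc_e C.
Let cc_i := op_cc_i C.
Let cc_sp := op_cc_sp C.
Let rhoE := op_rhoE C.
Let J2E := op_J2E C.

Let sp1_inj v w : sp 1 v = sp 1 w -> v = w.
Proof. by move=> /(congr1 (sp (-1))); rewrite !spD addNr !sp0. Qed.

Let d_sp1 v : e v = d (sp 1 v) - sp 1 (d v).
Proof. by rewrite d_sp scale1r subrr sp0 addrAC subrr add0r. Qed.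

Let x_sp1 v : i v = x (sp 1 v) - sp 1 (x v).
Proof. by rewrite x_sp scale1r subrr sp0 addrAC subrr add0r. Qed.

(** eps is the commutator of d with sigma, so the relation is a consequence of d d = 0; the same
    holds for delta and iota. *)
Lemma de v : d (e v) = - e (d v).
Proof. by rewrite !d_sp1 linearB /= !dd linear0 subr0 sub0r. Qed.

Lemma xi v : x (i v) = - i (x v).
Proof. by rewrite !x_sp1 linearB /= !xx linear0 subr0 sub0r. Qed.

Let eq_opp0 (v : F) : v = - v -> v = 0.
Proof.
move/eqP; rewrite -subr_eq0 opprK -mulr2n -scaler_nat scaler_eq0 pnatr_eq0 /=.
by move/eqP.
Qed.

(** Expanding d eps on sigma v before and after exchanging d with eps gives eps eps = - eps eps. *)
Lemma ee v : e (e v) = 0.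
Proof.
apply: eq_opp0; have := de (sp 1 v).
rewrite e_sp !d_sp !scale1r subrr !sp0 de linearD linearN /= e_sp opprD.
by move/addrI.
Qed.

Lemma ii v : i (i v) = 0.
Proof.
apply: eq_opp0; have := xi (sp 1 v).
rewrite i_sp !x_sp !scale1r subrr !sp0 xi linearD linearN /= i_sp opprD.
by move/addrI.
Qed.

Definition hasdeg (p : R) (v : F) := cc v = (m - 2 * p) *: v.

Definition degT (k : R) (T : tr F) :=
  [/\ hasdeg (k - 1) (nN T), hasdeg k (nW T), hasdeg (k - 2) (nE T)
    & hasdeg (k - 1) (nS T)].

(* The codifferential and J - 2 P of the Einstein metric sigma^-2 g. *)
Definition codE (v : F) : F := sp 2 (x v) - sp 1 (i (cc v)).
Definition schE (v : F) : F := - (2^-1 *: cc v).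
Definition half (v : F) : F := 2^-1 *: v.
Definition zero (v : F) : F := 0.

(** The change of slots from g to the Einstein metric: Omega = sigma^-1, Upsilon = - d sigma /
    sigma, and u = -(w + k) is the power of sigma that retrivialises the northern slot. The summands
    [u + 0] and [u + -1] keep exponents in the shape that the reification recognises. *)
Definition Th (u : int) (T : tr F) : tr F := Tr (sp (u + 0) (nN T))
  (sp (u + 0) (nW T) - sp (u + -1) (e (nN T)))
  (sp (u + 2) (nE T) + sp (u + 1) (i (nN T)))
  (sp (u + 2) (nS T)
   + 2^-1 *: (sp (u + 0) (e (i (nN T))) - sp (u + 0) (i (e (nN T))))
   + sp (u + 1) (i (nW T)) + sp (u + 1) (e (nE T))).

(** The reification has no case for negation; signs become scalars. *)
Lemma opp_scale (v : F) : - v = (-1)%:~R *: v.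
Proof. by rewrite scaleN1r. Qed.

Lemma Tr_eq (T T' : tr F) : nN T = nN T' -> nW T = nW T' -> nE T = nE T' ->
  nS T = nS T' -> T = T'.
Proof. by case: T T' => ? ? ? ? [? ? ? ?] /= -> -> -> ->. Qed.

Lemma regroup (u a b : int) v : sp (u + a + b) v = sp (u + (a + b)) v.
Proof. by rewrite addrA. Qed.

(** An index beyond the list of atoms reads the default 0, and the eigenvalue equation must hold
    there too. *)
Lemma cat_0 (j : nat) : cc (vat (F := F) (R := R) [::] j) =
  cat_ (F := F) [::] j *: vat [::] j.
Proof. by case: j => [|j]; rewrite /vat /= linear0 scaler0. Qed.

End Relations.

(** * Reification of operator identities *)

Ltac idx t l :=
  lazymatch l with
  | (t, _) :: _ => constr:(0%N)
  | t :: _ => constr:(0%N)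
  | _ :: ?l' => let n := idx t l' in constr:(S n)
  end.

Ltac reify u vs cs t :=
  lazymatch t with
  | GRing.Linear.sort (op_d _) ?v => let p := reify u vs cs v in constr:(EO Ld p)
  | GRing.Linear.sort (op_x _) ?v => let p := reify u vs cs v in constr:(EO Lx p)
  | GRing.Linear.sort (op_e _) ?v => let p := reify u vs cs v in constr:(EO Le p)
  | GRing.Linear.sort (op_i _) ?v => let p := reify u vs cs v in constr:(EO Li p)
  | GRing.Linear.sort (op_cc _) ?v => let p := reify u vs cs v in constr:(EC p)
  | GRing.Linear.sort (op_sp _ (u + ?j)) ?v => let p := reify u vs cs v in constr:(ES 1 j p)
  | GRing.Linear.sort (op_sp _ ?j) ?v => let p := reify u vs cs v in constr:(ES 0 j p)
  | ?c *: ?v => let p := reify u vs cs v in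
      let n := idx c cs in constr:(EZ (CV n) p)
  | ?v + ?w => let p := reify u vs cs v in let q := reify u vs cs w in
      constr:(ED p q)
  | 0 => constr:(E0)
  | _ => let n := idx t vs in constr:(EA n)
  end.

Ltac normalize C u vs cs :=
  lazymatch goal with
  | |- ?l = ?r =>
    let p := reify u vs cs l in let q := reify u vs cs r in
    refine (norm_eq (op_dd C) (op_xx C) (ee C) (ii C) (de C) (xi C) (op_spD C)
      (op_sp0 C) (op_d_sp C) (op_x_sp C) (op_e_sp C) (op_i_sp C) (op_cc_d C)
      (op_cc_x C) (op_cc_e C) (op_cc_i C) (op_cc_sp C) (u := u) (vs := vs)
      (cs := cs) _ (y := p) (z := q) _);
    [ | let c := eval vm_compute in
          (collect (norm (ED p (EZ (CZ (Negz 0)) q)))) in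
        change (foldr (fun k P => @cint _ _ u vs cs k = 0 /\ P) True c);
        cbn [foldr cint cat_ nth fst snd] ]
  end.

Ltac scal t l :=
  lazymatch t with
  | GRing.Linear.sort _ ?v => scal v l
  | ?c *: ?v =>
    let l' := lazymatch l with
      | context [c :: _] => l | _ => constr:(c :: l) end in scal v l'
  | ?v + ?w => let l' := scal v l in scal w l'
  | _ => l
  end.

Ltac normal_by C u vs tac :=
  lazymatch goal with |- @eq _ ?p ?q =>
    let R := lazymatch type of C with @calculus ?R _ _ => R end in
    let cs := scal p (@nil R) in let cs' := scal q cs in
    normalize C u vs cs' end;
  [ by repeat (case; [assumption|]); move=> ?; apply: (cat_0 C)
  | repeat (split; [by tac|]); exact: I ].

Ltac normal C u vs := normal_by C u vs ltac:(field).

(** J - 2P and rho are replaced by their expressions, so only letters with a normal form remain. The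
    list attaches to each slot its eigenvalue of m - 2 deg. *)
Ltac covariant C m u k N W E S :=
  let R := lazymatch type of C with @calculus ?R _ _ => R end in
  let F := lazymatch type of C with @calculus _ ?F _ => F end in
  repeat match goal with H : hasdeg _ _ |- _ => red in H end;
  rewrite /Th /IsT /DtT /DsT /XsT /LapF /zero /half /=; apply: Tr_eq => /=;
  rewrite ?regroup ?(op_J2E C) ?(op_rhoE C) /codE /schE ?(@opp_scale R F);
  normal C u [:: (N, m - 2 * (k - 1)); (W, m - 2 * k); (E, m - 2 * (k - 2));
        (S, m - 2 * (k - 1))].

(** * Passing to the Einstein scale *)

Section Covariance.
Context {R : realType} {F : lmodType R} {m : R} (C : calculus F m).
Local Notation d := (op_d C).
Local Notation x := (op_x C).
Local Notation e := (op_e C).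
Local Notation i := (op_i C).
Local Notation cc := (op_cc C).
Local Notation sp := (op_sp C).
Local Notation rho := (op_rho C).
Local Notation J2 := (op_J2 C).
Local Notation hasdeg := (hasdeg C).
Local Notation degT := (degT C).
Local Notation x0 := (codE C).
Local Notation J0 := (schE C).
Local Notation Th := (Th C).
Let dd := op_dd C.
Let xx := op_xx C.
Let spD := op_spD C.
Let sp0 := op_sp0 C.
Let d_sp := op_d_sp C.
Let x_sp := op_x_sp C.
Let e_sp := op_e_sp C.
Let i_sp := op_i_sp C.
Let cc_d := op_cc_d C.
Let cc_x := op_cc_x C.
Let cc_e := op_cc_e C.
Let cc_i := op_cc_i C.
Let cc_sp := op_cc_sp C.
Let rhoE := op_rhoE C.
Let J2E := op_J2E C.

(** In this lemma and the next three, the shift of u is the change of -(w + k): 1 for I-star, 0 for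
    X-star and D, 2 for D-star. *)
Lemma Th_Is (u : int) k T : degT k T ->
  Th (u + 1) (IsT (sp 1) i rho T) = IsT id zero half (Th u T).
Proof.
case: T => N W E S [/= hN hW hE hS]; covariant C m u k N W E S.
Qed.

Lemma Th_Xs (u : int) k T : degT k T -> Th u (XsT T) = XsT (Th u T).
Proof.
case: T => N W E S [/= hN hW hE hS]; covariant C m u k N W E S.
Qed.

Lemma Th_Dt (u : int) k w T : degT k T -> w + k = - u%:~R ->
  Th u (DtT m d x J2 k w T) = DtT m d x0 J0 k w (Th u T).
Proof.
case: T => N W E S [/= hN hW hE hS] hu.
(* Differentiating sigma^u produces factors u, which match the coefficients w + k of D only for this
   k. *)
have {}hu : k = - u%:~R - w by rewrite -hu addrAC subrr add0r.
subst k.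
covariant C m u (- u%:~R - w) N W E S.
Qed.

Lemma Th_Ds (u : int) k w T : degT k T -> w + k = - u%:~R ->
  Th (u + 2) (DsT m d x J2 k w T) = DsT m d x0 J0 k w (Th u T).
Proof.
case: T => N W E S [/= hN hW hE hS] hu.
have {}hu : k = - u%:~R - w by rewrite -hu addrAC subrr add0r.
subst k.
covariant C m u (- u%:~R - w) N W E S.
Qed.

Lemma hasdegD p v w : hasdeg p v -> hasdeg p w -> hasdeg p (v + w).
Proof. by move=> hv hw; rewrite /hasdeg linearD /= hv hw scalerDr. Qed.

Lemma hasdegZ p c v : hasdeg p v -> hasdeg p (c *: v).
Proof. by move=> hv; rewrite /hasdeg [LHS]linearZ /= hv !scalerA mulrC. Qed.

Lemma hasdegN p v : hasdeg p v -> hasdeg p (- v).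
Proof. by rewrite opp_scale; apply: hasdegZ. Qed.

Lemma hasdegB p v w : hasdeg p v -> hasdeg p w -> hasdeg p (v - w).
Proof. by move=> hv hw; apply: hasdegD => //; apply: hasdegN. Qed.

Lemma hasdeg0 p : hasdeg p 0.
Proof. by rewrite /hasdeg linear0 scaler0. Qed.

Lemma hasdeg_d p q v : q = p + 1 -> hasdeg p v -> hasdeg q (d v).
Proof.
by move=> -> hv; rewrite /hasdeg cc_d hv [d _]linearZ -scalerBl; congr (_ *: _); ring.
Qed.

Lemma hasdeg_e p q v : q = p + 1 -> hasdeg p v -> hasdeg q (e v).
Proof.
by move=> -> hv; rewrite /hasdeg cc_e hv [e _]linearZ -scalerBl; congr (_ *: _); ring.
Qed.

Lemma hasdeg_x p q v : q = p - 1 -> hasdeg p v -> hasdeg q (x v).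
Proof.
by move=> -> hv; rewrite /hasdeg cc_x hv [x _]linearZ -scalerDl; congr (_ *: _); ring.
Qed.

Lemma hasdeg_i p q v : q = p - 1 -> hasdeg p v -> hasdeg q (i v).
Proof.
by move=> -> hv; rewrite /hasdeg cc_i hv [i _]linearZ -scalerDl; congr (_ *: _); ring.
Qed.

Lemma hasdeg_sp p a v : hasdeg p v -> hasdeg p (sp a v).
Proof. by move=> hv; rewrite /hasdeg cc_sp hv linearZ. Qed.

Lemma hasdeg_rho p v : hasdeg p v -> hasdeg p (rho v).
Proof.
move=> hv; rewrite rhoE; apply/hasdegZ/hasdeg_sp/hasdegB; first apply: hasdegB => //.
  by apply: (@hasdeg_e (p - 1)); [ring | apply: (hasdeg_i _ hv)].
by apply: (@hasdeg_i (p + 1)); [ring | apply: (hasdeg_e _ hv)].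
Qed.

Lemma hasdeg_J2 p v : hasdeg p v -> hasdeg p (J2 v).
Proof.
move=> hv; rewrite J2E; apply: hasdeg_sp; apply: hasdegB; last first.
  by rewrite hv; apply: hasdeg_rho; apply: hasdegZ.
apply: hasdegB; first apply: hasdegB; first apply: hasdegD.
- by apply: (@hasdeg_d (p - 1)); [ring | apply: (hasdeg_i _ hv)].
- by apply: (@hasdeg_i (p + 1)); [ring | apply: (hasdeg_d _ hv)].
- by apply: (@hasdeg_x (p + 1)); [ring | apply: (hasdeg_e _ hv)].
- by apply: (@hasdeg_e (p - 1)); [ring | apply: (hasdeg_x _ hv)].
Qed.

Lemma hasdeg_x0 p q v : q = p - 1 -> hasdeg p v -> hasdeg q (x0 v).
Proof.
move=> hq hv; apply: hasdegB; apply: hasdeg_sp; first exact: (hasdeg_x hq).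
by rewrite hv; apply: (hasdeg_i hq); apply: hasdegZ.
Qed.

Lemma hasdeg_J0 p v : hasdeg p v -> hasdeg p (J0 v).
Proof. by move=> hv; rewrite /schE hv; apply/hasdegN/hasdegZ/hasdegZ. Qed.
End Covariance.

Ltac hdeg :=
  solve [ repeat match goal with
  | |- hasdeg _ _ (_ + _) => apply: hasdegD
  | |- hasdeg _ _ (- _) => apply: hasdegN
  | |- hasdeg _ _ (_ *: _) => apply: hasdegZ
  | |- hasdeg _ _ 0 => exact: hasdeg0
  | |- hasdeg _ _ (op_rho _ _) => apply: hasdeg_rho
  | |- hasdeg _ _ (op_J2 _ _) => apply: hasdeg_J2
  | |- hasdeg _ _ (schE _ _) => apply: hasdeg_J0
  | |- hasdeg _ _ (GRing.Linear.sort (op_sp _ _) _) => apply: hasdeg_sp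
  | |- hasdeg _ ?q (codE _ _) => apply: (@hasdeg_x0 _ _ _ _ (q + 1)); [by ring|]
  | |- hasdeg _ ?q (GRing.Linear.sort (op_d _) _) => apply: (@hasdeg_d _ _ _ _ (q - 1)); [by ring|]
  | |- hasdeg _ ?q (GRing.Linear.sort (op_e _) _) => apply: (@hasdeg_e _ _ _ _ (q - 1)); [by ring|]
  | |- hasdeg _ ?q (GRing.Linear.sort (op_x _) _) => apply: (@hasdeg_x _ _ _ _ (q + 1)); [by ring|]
  | |- hasdeg _ ?q (GRing.Linear.sort (op_i _) _) => apply: (@hasdeg_i _ _ _ _ (q + 1)); [by ring|]
  | H : hasdeg _ ?p ?v |- hasdeg _ ?p ?v => exact: H
  | H : hasdeg _ ?p ?v |- hasdeg _ ?q ?v =>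
    (have -> : q = p by ring); exact: H
  end ].

(** * Degrees, and the operator y in the Einstein scale *)

Section Degrees.
Context {R : realType} {F : lmodType R} {m : R} (C : calculus F m).
Local Notation d := (op_d C).
Local Notation x := (op_x C).
Local Notation e := (op_e C).
Local Notation i := (op_i C).
Local Notation cc := (op_cc C).
Local Notation sp := (op_sp C).
Local Notation rho := (op_rho C).
Local Notation J2 := (op_J2 C).
Local Notation hasdeg := (hasdeg C).
Local Notation degT := (degT C).
Local Notation x0 := (codE C).
Local Notation J0 := (schE C).
Local Notation Th := (Th C).
Let dd := op_dd C.
Let xx := op_xx C.
Let spD := op_spD C.
Let sp0 := op_sp0 C.
Let d_sp := op_d_sp C.
Let x_sp := op_x_sp C.
Let e_sp := op_e_sp C.
Let i_sp := op_i_sp C.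
Let cc_d := op_cc_d C.
Let cc_x := op_cc_x C.
Let cc_e := op_cc_e C.
Let cc_i := op_cc_i C.
Let cc_sp := op_cc_sp C.
Let rhoE := op_rhoE C.
Let J2E := op_J2E C.

Lemma degT_Dt k w T : degT k T -> degT (k + 1) (DtT m d x J2 k w T).
Proof.
case: T => N W E S [/= hN hW hE hS]; rewrite /DtT /LapF; split=> /=; hdeg.
Qed.

Lemma degT_Is k T : degT k T -> degT (k - 1) (IsT (sp 1) i rho T).
Proof. case: T => N W E S [/= hN hW hE hS]; rewrite /IsT; split=> /=; hdeg. Qed.

Lemma degT_Ds k w T : degT k T -> degT (k - 1) (DsT m d x J2 k w T).
Proof.
case: T => N W E S [/= hN hW hE hS]; rewrite /DsT /LapF; split=> /=; hdeg.
Qed.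

Lemma degT_Xs k T : degT k T -> degT (k - 1) (XsT T).
Proof. case: T => N W E S [/= hN hW hE hS]; rewrite /XsT; split=> /=; hdeg. Qed.

Lemma degT_add k S T : degT k S -> degT k T -> degT k (addT S T).
Proof. by move=> [? ? ? ?] [? ? ? ?]; split; apply: hasdegD. Qed.

Lemma degT_scale k c T : degT k T -> degT k (scaleT c T).
Proof. by move=> [? ? ? ?]; split; apply: hasdegZ. Qed.

Lemma degT_Th k u T : degT k T -> degT k (Th u T).
Proof. case: T => N W E S [/= hN hW hE hS]; rewrite /Th; split=> /=; hdeg. Qed.

Notation y := (yT m d x J2 (sp 1) i rho).
Notation ypow := (ypowT m d x J2 (sp 1) i rho).
Notation y0 := (yT m d x0 J0 id zero half).
Notation ypow0 := (ypowT m d x0 J0 id zero half).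

Lemma degT_y k w T : degT k T -> degT k (y k w T).
Proof.
move=> h; apply/degT_scale/degT_add.
  by have := degT_Is (degT_Dt w h); rewrite addrK.
by have := degT_Dt w (degT_Is h); rewrite subrK.
Qed.

Lemma degT_ypow j k w T : degT k T -> degT k (ypow j k w T).
Proof. by elim: j w T => [|j IH] w T h //=; apply/IH/degT_y. Qed.

Lemma Th_scale u c T : Th u (scaleT c T) = scaleT c (Th u T).
Proof.
have L (f : {linear F -> F}) v : f (c *: v) = c *: f v by exact: linearZ.
by apply: Tr_eq => /=; rewrite !L -?scalerBr -?scalerDr // [2^-1 *: (c *: _)]scalerA
  mulrC -scalerA -!scalerDr.
Qed.

Lemma Th_add u S T : Th u (addT S T) = addT (Th u S) (Th u T).
Proof.
have Ls a v w : sp a (v + w) = sp a v + sp a w by exact: linearD.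
have Li v w : i (v + w) = i v + i w by exact: linearD.
have Le v w : e (v + w) = e v + e w by exact: linearD.
have L4 (a a' b b' c c' f f' : F) : a + a' + (b + b') + (c + c') + (f + f') =
    a + b + c + f + (a' + b' + c' + f').
  by rewrite (addrACA a a') (addrACA _ _ c) (addrACA _ _ f).
apply: Tr_eq; rewrite /= ?(Ls, Li, Le) ?opprD; [by []|exact: addrACA|exact: addrACA|].
by rewrite [X in _ *: X]addrACA scalerDr L4.
Qed.

Lemma Th_y (u : int) k w T : degT k T -> w + k = - u%:~R ->
  Th (u + 1) (y k w T) = y0 k w (Th u T).
Proof.
move=> h hu; rewrite /yT Th_scale Th_add (Th_Is _ (degT_Dt w h)) (Th_Dt h hu).
rewrite (Th_Dt (degT_Is h)) ?(Th_Is _ h) // intrD opprD -hu; ring.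
Qed.

Lemma Th_ypow j (u : int) k w T : degT k T -> w + k = - u%:~R ->
  Th (u + j%:Z) (ypow j k w T) = ypow0 j k w (Th u T).
Proof.
elim: j u w T => [|j IH] u w T h hu /=; first by rewrite addr0.
rewrite intS addrA IH ?Th_y //; first exact: degT_y.
by rewrite intrD opprD -hu; ring.
Qed.

(* Einstein components split along the parallel tractor: z and s are the
   eigencombinations of the north and south slots. *)
Definition split (T : tr F) : tr F :=
  Tr (2^-1 *: nN T - nS T) (nW T) (nE T) (2^-1 *: nN T + nS T).

(** The operator y in split Einstein components: north and west decouple from east and south, K
    depends on the degree only, and the weight enters through the scalar q alone. *)
Definition ysplit (K q : R) (T : tr F) : tr F := Tr
  (LapF d x0 (nN T) + (q - 2 * K + 4) *: nN T - 2 *: x0 (nW T))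
  (LapF d x0 (nW T) + q *: nW T - 2 *: d (nN T))
  (LapF d x0 (nE T) + (q - 3 * K + 9) *: nE T + 2 *: x0 (nS T))
  (LapF d x0 (nS T) + (q - K + 1) *: nS T + 2 *: d (nE T)).

Lemma split_y0 k w T : degT k T ->
  split (y0 k w T) =
  ysplit (2 * k - m + 1) ((w + k) * (k - m - w + 1)) (split T).
Proof.
case: T => N W E S [/= hN hW hE hS].
rewrite /yT /split /ysplit /addT /scaleT.
covariant C m (0:int) k N W E S.
Qed.
End Degrees.

(** * Tractor operators in the Einstein splitting *)

Section Criticality.
Context {R : realType} {F : lmodType R} {m : R} (C : calculus F m).
Local Notation d := (op_d C).
Local Notation x := (op_x C).
Local Notation e := (op_e C).
Local Notation i := (op_i C).
Local Notation cc := (op_cc C).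
Local Notation sp := (op_sp C).
Local Notation rho := (op_rho C).
Local Notation J2 := (op_J2 C).
Local Notation hasdeg := (hasdeg C).
Local Notation degT := (degT C).
Local Notation x0 := (codE C).
Local Notation J0 := (schE C).
Local Notation Th := (Th C).
Local Notation y := (yT m d x J2 (sp 1) i rho).
Local Notation ypow := (ypowT m d x J2 (sp 1) i rho).
Local Notation y0 := (yT m d x0 J0 id (@zero R F) (@half R F)).
Local Notation ypow0 := (ypowT m d x0 J0 id (@zero R F) (@half R F)).
Local Notation split := (@split R F).
Local Notation ysplit := (ysplit C).
Let dd := op_dd C.
Let xx := op_xx C.
Let spD := op_spD C.
Let sp0 := op_sp0 C.
Let d_sp := op_d_sp C.
Let x_sp := op_x_sp C.
Let e_sp := op_e_sp C.
Let i_sp := op_i_sp C.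
Let cc_d := op_cc_d C.
Let cc_x := op_cc_x C.
Let cc_e := op_cc_e C.
Let cc_i := op_cc_i C.
Let cc_sp := op_cc_sp C.
Let rhoE := op_rhoE C.
Let J2E := op_J2E C.

Definition Phi (u : int) (T : tr F) : tr F := split (Th u T).

Lemma sp_inj a v w : sp a v = sp a w -> v = w.
Proof. by move=> /(congr1 (sp (- a))); rewrite !spD addNr !sp0. Qed.

Lemma Th_inj u S T : Th u S = Th u T -> S = T.
Proof.
case: S T => N W E S [N' W' E' S'] [/sp_inj <- /addIr /sp_inj <- /addIr /sp_inj <-].
by move=> /addIr /addIr /addIr /sp_inj <-.
Qed.

(** Powers of sigma are invertible and the slot change is triangular, so identities between tractors
    may be checked on their split Einstein components. *)
Lemma Phi_inj u S T : Phi u S = Phi u T -> S = T.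
Proof.
move=> h; apply: (@Th_inj u); move: h; rewrite /Phi.
case: (Th u S) (Th u T) => N W E Z [N' W' E' Z'] [] h1 -> -> h2.
have {h1 h2} : N = N' /\ Z = Z'; last by case=> -> ->.
have hN : N = N'.
  have : 2^-1 *: N - Z + (2^-1 *: N + Z) = 2^-1 *: N' - Z' + (2^-1 *: N' + Z').
    by rewrite h1 h2.
  rewrite !(addrACA _ (- _)) !addNr !addr0 -!scalerDl.
  have -> : 2^-1 + 2^-1 = 1 :> R by field.
  by rewrite !scale1r.
by split=> //; move: h2; rewrite hN => /addrI.
Qed.

Fixpoint ysplits (j : nat) (K U : R) (T : tr F) : tr F :=
  if j is j'.+1 then ysplits j' K (U - 1) (ysplit K (U * (K - U)) T) else T.

Lemma degT_split k T : degT k T -> degT k (split T).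
Proof. case: T => N W E S [/= hN hW hE hS]; rewrite /split; split=> /=; hdeg. Qed.

Lemma degT_ysplit k K q T : degT k T -> degT k (ysplit K q T).
Proof.
case: T => N W E S [/= hN hW hE hS]; rewrite /ysplit /LapF; split=> /=; hdeg.
Qed.

Lemma degT_ysplits j k K U T : degT k T -> degT k (ysplits j K U T).
Proof. by elim: j U T => [|j IH] U T h //=; apply/IH/degT_ysplit. Qed.

Lemma Phi_ypow j (u : int) k w T : degT k T -> w + k = - u%:~R ->
  Phi (u + j%:Z) (ypow j k w T) = ysplits j (2 * k - m + 1) (w + k) (Phi u T).
Proof.
elim: j u w T => [|j IH] u w T h hu /=; first by rewrite addr0.
rewrite intS addrA IH; first last.
- by rewrite intrD opprD -hu; ring.
- exact: degT_y.
rewrite /Phi Th_y // split_y0; last exact: degT_Th.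
have -> : w - 1 + k = w + k - 1 by ring.
by have -> : k - m - w + 1 = 2 * k - m + 1 - (w + k) by ring.
Qed.

(** The two operators differ by the multiple q - q' of the identity. *)
Lemma ysplitC k K q q' T : degT k T ->
  ysplit K q (ysplit K q' T) = ysplit K q' (ysplit K q T).
Proof.
case: T => N W E S [/= hN hW hE hS].
rewrite /ysplit /=; covariant C m (0:int) k N W E S.
Qed.

Lemma ysplits_comm j k K U q T : degT k T ->
  ysplits j K U (ysplit K q T) = ysplit K q (ysplits j K U T).
Proof.
elim: j U T => [|j IH] U T h //=.
by rewrite (ysplitC _ _ _ h) IH //; apply: degT_ysplit.
Qed.

Lemma ysplits_last j k K U T : degT k T -> ysplits j.+1 K U T =
  ysplit K ((U - j%:R) * (K - (U - j%:R))) (ysplits j K U T).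
Proof.
elim: j U T => [|j IH] U T h; first by rewrite /= subr0.
have -> : ysplits j.+2 K U T =
  ysplits j.+1 K (U - 1) (ysplit K (U * (K - U)) T) by [].
rewrite (IH _ _ (degT_ysplit _ _ h)).
have -> : U - 1 - j%:R = U - j.+1%:R by rewrite -addn1 natrD; ring.
by [].
Qed.

(** The commuting factors on both sides carry the parameters U, ..., U - j + 1 and U - 1, ..., U -
    j. They differ only in U against U - j = K - U, and these two give the same scalar U (K - U). *)
Lemma ysplits_shift j k K U T : degT k T -> j%:R = 2 * U - K ->
  ysplits j K U T = ysplits j K (U - 1) T.
Proof.
case: j => [|j] h hj //.
rewrite [RHS](ysplits_last _ _ _ h) /= -(ysplits_comm _ _ _ _ h).
congr (ysplits _ _ _ (ysplit _ _ _)).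
have -> : K = 2 * U - j.+1%:R by rewrite hj; ring.
by rewrite -addn1 natrD; ring.
Qed.

Definition spT (T : tr F) : tr F :=
  Tr (sp 1 (nN T)) (sp 1 (nW T)) (sp 1 (nE T)) (sp 1 (nS T)).

Lemma degT_spT k T : degT k T -> degT k (spT T).
Proof. by case: T => N W E S [/= hN hW hE hS]; split=> /=; hdeg. Qed.

Lemma Th_spT u T : Th u (spT T) = Th (u + 1) T.
Proof.
case: T => N W E S; rewrite /Th /=.
have E1 a v : sp (u + a) (sp 1 v) = sp (u + 1 + a) v.
  by rewrite spD -!addrA [a + 1]addrC.
by rewrite ?i_sp ?e_sp ?i_sp !E1.
Qed.

(** At the critical weight the j-th power of y is tangential. Multiplication by sigma does not
    change Einstein components except through the weight, that is U becomes U - 1, and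
    [ysplits_shift] removes the difference. *)
Lemma ypow_spT j k w (u : int) T : degT k T -> w + k = - u%:~R ->
  j%:R = 2 * w + m - 1 ->
  ypow j k w (spT T) = spT (ypow j k (w - 1) T).
Proof.
move=> h hu hj; apply: (@Phi_inj (u + j%:Z)).
rewrite Phi_ypow //; last exact: degT_spT.
have -> : Phi u (spT T) = Phi (u + 1) T by rewrite /Phi Th_spT.
have -> : Phi (u + j%:Z) (spT (ypow j k (w - 1) T)) =
    Phi (u + 1 + j%:Z) (ypow j k (w - 1) T).
  by rewrite /Phi Th_spT -!addrA [_ + 1]addrC.
rewrite Phi_ypow //; last by rewrite intrD opprD -hu; ring.
rewrite (@ysplits_shift _ k); first by congr (ysplits _ _ _ _); ring.
  by apply/degT_split/degT_Th.
by rewrite hj; ring.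
Qed.
End Criticality.

(** * The operator D-bar-star *)

Section Dbar.
Context {R : realType} {F : lmodType R} {m : R} (C : calculus F m).
Local Notation d := (op_d C).
Local Notation x := (op_x C).
Local Notation e := (op_e C).
Local Notation i := (op_i C).
Local Notation cc := (op_cc C).
Local Notation sp := (op_sp C).
Local Notation rho := (op_rho C).
Local Notation J2 := (op_J2 C).
Local Notation hasdeg := (hasdeg C).
Local Notation degT := (degT C).
Local Notation x0 := (codE C).
Local Notation J0 := (schE C).
Local Notation Th := (Th C).
Local Notation y := (yT m d x J2 (sp 1) i rho).
Local Notation ypow := (ypowT m d x J2 (sp 1) i rho).
Local Notation y0 := (yT m d x0 J0 id (@zero R F) (@half R F)).
Local Notation ypow0 := (ypowT m d x0 J0 id (@zero R F) (@half R F)).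
Local Notation split := (@split R F).
Local Notation ysplit := (ysplit C).
Let dd := op_dd C.
Let xx := op_xx C.
Let spD := op_spD C.
Let sp0 := op_sp0 C.
Let d_sp := op_d_sp C.
Let x_sp := op_x_sp C.
Let e_sp := op_e_sp C.
Let i_sp := op_i_sp C.
Let cc_d := op_cc_d C.
Let cc_x := op_cc_x C.
Let cc_e := op_cc_e C.
Let cc_i := op_cc_i C.
Let cc_sp := op_cc_sp C.
Let rhoE := op_rhoE C.
Let J2E := op_J2E C.

Definition botT (A : F) : tr F := Tr 0 0 0 A.

Lemma degT_bot k A : hasdeg k A -> degT (k + 1) (botT A).
Proof. by move=> h; split=> /=; hdeg. Qed.

Lemma Th_bot u A : Th u (botT A) = botT (sp (u + 2) A).
Proof.
by apply: Tr_eq; rewrite /= ?(linear0 e) ?(linear0 i) ?linear0 ?addr0 ?scaler0 ?addr0.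
Qed.

(* The operator below D-bar-star, with free coefficients for the first and last
   terms. *)
Definition preDbar (a c k w : R) (T : tr F) : tr F :=
  addT (addT (scaleT a (DsT m d x J2 k w T)) (IsT (sp 1) i rho (y k w T)))
       (scaleT c (XsT (ypow 2 k w T))).

Definition preDbar0 (a c k w : R) (T : tr F) : tr F :=
  addT (addT (scaleT a (DsT m d x0 J0 k w T)) (IsT id zero half (y0 k w T)))
       (scaleT c (XsT (ypow0 2 k w T))).

Lemma degT_preDbar a c k w T : degT k T -> degT (k - 1) (preDbar a c k w T).
Proof.
move=> h; apply: degT_add; first apply: degT_add.
- exact/degT_scale/degT_Ds.
- exact/degT_Is/degT_y.
- exact/degT_scale/degT_Xs/degT_ypow.
Qed.

Lemma Th_preDbar a c (u : int) k w T : degT k T -> w + k = - u%:~R ->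
  Th (u + 2) (preDbar a c k w T) = preDbar0 a c k w (Th u T).
Proof.
move=> h hu; rewrite /preDbar !Th_add !Th_scale (Th_Ds h hu).
rewrite (Th_Xs _ (degT_ypow 2 _ h)) (Th_ypow 2 h hu).
by rewrite (_ : u + 2 = u + 1 + 1) ?(Th_Is _ (degT_y _ h)) ?Th_y //; ring.
Qed.

Section Detour.
Variables (k l c : R) (A : F).
Hypothesis hA : hasdeg k A.
Hypothesis hm : m = l + 1 + 2 * k.

Lemma split_preDbar0 : split (preDbar0 1 c (k + 1) (1 - k) (botT A)) =
  Tr ((l + 1) *: x0 A - c *: (4 *: x0 (d (x0 A)) + (2 * (l + 3)) *: x0 A))
     (((l + 1) * (l + 2)) *: A + (1 - c * (2 * l - 2)) *: d (x0 A)
      + (1 - c * (2 * l + 6)) *: x0 (d A))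
     0
     (- (l + 3) *: x0 A + c *: (4 *: x0 (d (x0 A)) + (2 * (l + 3)) *: x0 A)).
Proof.
rewrite /preDbar0 /split /yT /= /yT /addT /scaleT /botT /=.
rewrite /IsT /DtT /DsT /XsT /LapF /zero /half /=; apply: Tr_eq => /=;
  rewrite ?regroup ?J2E ?rhoE /codE /schE ?(@opp_scale R F); red in hA;
  normal_by C (0:int) [:: (A, m - 2 * k)] ltac:(rewrite ?hm; field).
Qed.

(** A southern slot sigma B at weight 1 - k and a southern slot B at weight -k have the same
    Einstein components. The identity therefore moves sigma out of D-bar-star, leaving at weight -k
    an operator that preserves smoothness up to the boundary. *)
Lemma preDbar0_shift : l != 0 -> l - 1 != 0 -> c = (l * (l - 1))^-1 ->
  preDbar0 1 c (k + 1) (1 - k) (botT A) =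
  preDbar0 ((l + 1) / (l - 1)) c (k + 1) (- k) (botT A).
Proof.
move=> l0 l1 ->.
rewrite /preDbar0 /yT /= /yT /addT /scaleT /botT /=.
rewrite /IsT /DtT /DsT /XsT /LapF /zero /half /=; apply: Tr_eq => /=;
  rewrite ?regroup ?J2E ?rhoE /codE /schE ?(@opp_scale R F); red in hA;
  normal_by C (0:int) [:: (A, m - 2 * k)] ltac:(rewrite ?hm; field; rewrite ?l0 ?l1 //=).
Qed.
End Detour.
End Dbar.

(** A calculus contains all powers of sigma and so lives on the interior; [reg] singles out the
    elements that extend smoothly to Sigma. rho and J - 2P are listed separately because their
    expressions in the other operators contain sigma^-1. *)
Record regular (R : realType) (F : lmodType R) (m : R) (C : calculus F m) := Regular {
  reg :> F -> Prop;
  reg0 : reg 0;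
  regD : forall v w, reg v -> reg w -> reg (v + w);
  regZ : forall a v, reg v -> reg (a *: v);
  reg_d : forall v, reg v -> reg (op_d C v);
  reg_x : forall v, reg v -> reg (op_x C v);
  reg_e : forall v, reg v -> reg (op_e C v);
  reg_i : forall v, reg v -> reg (op_i C v);
  reg_sp1 : forall v, reg v -> reg (op_sp C 1 v);
  reg_rho : forall v, reg v -> reg (op_rho C v);
  reg_J2 : forall v, reg v -> reg (op_J2 C v) }.

Section Order.
Context {R : realType} {F : lmodType R} {m : R} (C : calculus F m) (G : regular C).
Local Notation d := (op_d C).
Local Notation x := (op_x C).
Local Notation e := (op_e C).
Local Notation i := (op_i C).
Local Notation cc := (op_cc C).
Local Notation sp := (op_sp C).
Local Notation rho := (op_rho C).
Local Notation J2 := (op_J2 C).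
Local Notation hasdeg := (hasdeg C).
Local Notation degT := (degT C).
Local Notation x0 := (codE C).
Local Notation J0 := (schE C).
Local Notation Th := (Th C).
Let dd := op_dd C.
Let xx := op_xx C.
Let spD := op_spD C.
Let sp0 := op_sp0 C.
Let d_sp := op_d_sp C.
Let x_sp := op_x_sp C.
Let e_sp := op_e_sp C.
Let i_sp := op_i_sp C.
Let cc_d := op_cc_d C.
Let cc_x := op_cc_x C.
Let cc_e := op_cc_e C.
Let cc_i := op_cc_i C.
Let cc_sp := op_cc_sp C.
Let rhoE := op_rhoE C.
Let J2E := op_J2E C.

Lemma d_D v w : d (v + w) = d v + d w.
Proof. exact: linearD. Qed.
Lemma d_Z c v : d (c *: v) = c *: d v.
Proof. exact: linearZ. Qed.
Lemma d_N v : d (- v) = - d v.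
Proof. exact: linearN. Qed.
Lemma d_0 : d 0 = 0.
Proof. exact: linear0. Qed.
Lemma x_Z c v : x (c *: v) = c *: x v.
Proof. exact: linearZ. Qed.
Lemma x_N v : x (- v) = - x v.
Proof. exact: linearN. Qed.
Lemma e_D v w : e (v + w) = e v + e w.
Proof. exact: linearD. Qed.
Lemma e_Z c v : e (c *: v) = c *: e v.
Proof. exact: linearZ. Qed.
Lemma e_N v : e (- v) = - e v.
Proof. exact: linearN. Qed.
Lemma e_0 : e 0 = 0.
Proof. exact: linear0. Qed.
Lemma i_Z c v : i (c *: v) = c *: i v.
Proof. exact: linearZ. Qed.
Lemma i_N v : i (- v) = - i v.
Proof. exact: linearN. Qed.
Lemma i_0 : i 0 = 0.
Proof. exact: linear0. Qed.
Lemma sp_D a v w : sp a (v + w) = sp a v + sp a w.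
Proof. exact: linearD. Qed.
Lemma sp_Z a c v : sp a (c *: v) = c *: sp a v.
Proof. exact: linearZ. Qed.
Lemma sp_N a v : sp a (- v) = - sp a v.
Proof. exact: linearN. Qed.
Lemma sp_0 a : sp a 0 = 0.
Proof. exact: linear0. Qed.

Lemma regN v : G v -> G (- v).
Proof. by rewrite -scaleN1r; apply: regZ. Qed.

Lemma regB v w : G v -> G w -> G (v - w).
Proof. by move=> hv hw; apply: regD => //; apply: regN. Qed.

Lemma reg_spn (j : nat) v : G v -> G (sp j%:Z v).
Proof.
move=> h; elim: j => [|j IH]; first by rewrite sp0.
by rewrite intS -spD; apply: reg_sp1.
Qed.

Lemma spK a v : sp a (sp (- a) v) = v.
Proof. by rewrite spD addrN sp0. Qed.

Lemma spNK a v : sp (- a) (sp a v) = v.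
Proof. by rewrite spD addNr sp0. Qed.

Definition O (a : int) (v : F) := G (sp (- a) v).

Lemma O_sp a v : G v -> O a (sp a v).
Proof. by rewrite /O spNK. Qed.

Lemma OP a v : O a v -> exists2 w, G w & v = sp a w.
Proof. by move=> h; exists (sp (- a) v); rewrite ?spK. Qed.

Lemma OD a v w : O a v -> O a w -> O a (v + w).
Proof. by rewrite /O linearD; apply: regD. Qed.

Lemma OZ a c v : O a v -> O a (c *: v).
Proof. by move=> h; rewrite /O [sp _ _]linearZ; apply: regZ. Qed.

Lemma ON a v : O a v -> O a (- v).
Proof. by rewrite -scaleN1r; apply: OZ. Qed.

Lemma OB a v w : O a v -> O a w -> O a (v - w).
Proof. by move=> hv hw; apply: OD => //; apply: ON. Qed.

Lemma O0 a : O a 0.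
Proof. by rewrite /O linear0; apply: reg0. Qed.

Lemma O_reg v : O 0 v <-> G v.
Proof. by rewrite /O oppr0 sp0. Qed.

Lemma O_shift a b v : O a v -> O (b + a) (sp b v).
Proof. by rewrite /O spD opprD addrAC addNr add0r. Qed.

Lemma O_le a b v : a <= b -> O b v -> O a v.
Proof.
move=> ab /OP[w hw ->]; rewrite /O spD.
have : 0 <= - a + b by rewrite addrC subr_ge0.
by case: (- a + b) => // j _; apply: reg_spn.
Qed.

Lemma O_d a v : O a v -> O (a - 1) (d v).
Proof.
move=> /OP[w hw ->]; rewrite d_sp; apply: OD; last first.
  by apply/OZ/O_sp/reg_e.
by apply: (@O_le _ a); [rewrite gerBl | apply/O_sp/reg_d].
Qed.

Lemma O_e a v : O a v -> O a (e v).
Proof. by move=> /OP[w hw ->]; rewrite e_sp; apply/O_sp/reg_e. Qed.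

Lemma O_i a v : O a v -> O a (i v).
Proof. by move=> /OP[w hw ->]; rewrite i_sp; apply/O_sp/reg_i. Qed.

Lemma x0D v w : x0 (v + w) = x0 v + x0 w.
Proof.
have L (f : {linear F -> F}) a b : f (a + b) = f a + f b by exact: linearD.
by rewrite /codE !(L cc, L x, L i) (L (sp 2)) (L (sp 1)) opprD addrACA.
Qed.

Lemma x0Z c v : x0 (c *: v) = c *: x0 v.
Proof.
have L (f : {linear F -> F}) w : f (c *: w) = c *: f w by exact: linearZ.
by rewrite /codE !(L cc, L x, L i) (L (sp 2)) (L (sp 1)) scalerBr.
Qed.

Lemma x0N v : x0 (- v) = - x0 v.
Proof. by rewrite -scaleN1r x0Z scaleN1r. Qed.

Lemma x00 : x0 0 = 0.
Proof. by have := x0Z 0 0; rewrite !scale0r. Qed.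

(** The codifferential of the Einstein metric raises the order by one, and its leading part is the
    normal component of v, with the single root a = m - 2p. *)
Lemma x0_sp p a v : hasdeg p v -> x0 (sp a v) =
  sp (a + 1) (sp 1 (x v) + (a%:~R - (m - 2 * p)) *: i v).
Proof.
move=> hv; have L b (c : R) (w : F) : sp b (c *: w) = c *: sp b w by exact: linearZ.
have Li (c : R) (w : F) : i (c *: w) = c *: i w by exact: linearZ.
rewrite /codE cc_sp hv !(L, Li) i_sp x_sp !(linearD (sp _)) !(L, Li) /= !spD.
rewrite [in RHS](scalerBl a%:~R) -[LHS]addrA; congr (sp _ _ + (_ *: sp _ _ - _ *: sp _ _)); ring.
Qed.

Lemma O_x0 p a v : hasdeg p v -> O a v -> O (a + 1) (x0 v).
Proof.
move=> hv /OP[w hw ev]; have hw' : hasdeg p w by rewrite -(spNK a w) -ev; hdeg.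
rewrite ev (x0_sp _ hw'); apply/O_sp/regD; first exact/reg_sp1/reg_x.
exact/regZ/reg_i.
Qed.

Lemma x0x0 p v : hasdeg p v -> x0 (x0 v) = 0.
Proof.
by move=> hv; red in hv; rewrite /codE !(@opp_scale R F);
  normal C (0:int) [:: (v, m - 2 * p)].
Qed.

Lemma reg_O a v w : v = sp a w -> O a v -> G w.
Proof. by move=> ->; rewrite /O spNK. Qed.

Lemma iE v : i (e v) = v - e (i v) - 2 *: sp 1 (rho v).
Proof.
have L b (c : R) (w : F) : sp b (c *: w) = c *: sp b w by exact: linearZ.
by rewrite rhoE L spD addrN sp0 scalerA divff ?pnatr_eq0 // scale1r subKr.
Qed.

(** eps iota + iota eps is multiplication by |d sigma|^2 = 1 - 2 sigma rho, the identity to first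
    order. *)
Lemma O_ie v : G v -> O 1 (i v) -> O 1 (i (e v) - v).
Proof.
move=> hv hi; rewrite iE [_ - v]addrAC [v - _ - v]addrAC subrr sub0r.
apply: OB; first exact/ON/O_e.
by apply/OZ/O_sp/reg_rho.
Qed.

(** The indicial polynomial of delta_o d on p-forms: its roots are 0 and m - 1 - 2p, the latter
    being n - 2p. *)
Lemma X_sp p a v : G v -> hasdeg p v ->
  O (a + 1) (x0 (d (sp a v))
    - (a%:~R * (a%:~R - (m - 1 - 2 * p))) *: sp a (i (e v))).
Proof.
move=> hv hp; rewrite d_sp x0D x0Z (@x0_sp (p + 1)); last by hdeg.
rewrite (@x0_sp (p + 1)) ?subrK; last by hdeg.
have L b (c : R) (w : F) : sp b (c *: w) = c *: sp b w by exact: linearZ.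
rewrite -addrA; apply: OD.
  apply/O_sp/regD; first exact/reg_sp1/reg_x/reg_d.
  exact/regZ/reg_i/reg_d.
rewrite linearD /= spD L scalerDr scalerA -addrA.
rewrite (_ : (a - 1)%:~R - _ = a%:~R - (m - 1 - 2 * p)); last by rewrite intrB; ring.
by rewrite subrr addr0; apply/OZ/O_sp/reg_x/reg_e.
Qed.

(** Away from the root the leading coefficient of a form with small divergence is tangential.
    Applied to divergences, where delta_o delta_o = 0 supplies the hypothesis, it makes every
    obstruction tangential. *)
Lemma O_i_coclosed p a v : G v -> hasdeg p v -> O (a + 2) (x0 (sp a v)) ->
  a%:~R - (m - 2 * p) != 0 -> O 1 (i v).
Proof.
move=> hv hp h nz; suff h' : O 1 ((a%:~R - (m - 2 * p)) *: i v).
  by rewrite -[i v]scale1r -(mulVf nz) -scalerA; apply: OZ.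
have -> : (a%:~R - (m - 2 * p)) *: i v = sp (- (a + 1)) (x0 (sp a v)) - sp 1 (x v).
  by rewrite (x0_sp _ hp) spNK addrAC subrr add0r.
apply: OB; last exact/O_sp/reg_x.
by have := O_shift (- (a + 1)) h; congr O; ring.
Qed.
End Order.

Section LinearCombinations.
Context {R : realType} {F : lmodType R}.

Let nul : {linear F -> F} := \0.
Let idl : int -> {linear F -> F} := fun=> idfun.

(** Taking all operators to be 0 and all powers of sigma the identity turns the normal form into a
    decision procedure for linear combinations in a module. *)
Lemma lin_eq (vs : seq (F * R)) (cs : seq R) (y z : expr) :
  (forall i, cat_ vs i = 0) ->
  foldr (fun c P => cint 0 vs cs c = 0 /\ P) True
    (collect (norm (ED y (EZ (CZ (Negz 0)) z)))) ->
  eint nul nul nul nul nul idl 0 vs cs y = eint nul nul nul nul nul idl 0 vs cs z.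
Proof.
move=> h; apply: norm_eq => //=.
- by move=> ?; rewrite oppr0.
- by move=> ?; rewrite oppr0.
- by move=> a v; rewrite scaler0 addr0.
- by move=> a v; rewrite scaler0 addr0.
- by move=> v; rewrite scaler0 subr0.
- by move=> v; rewrite scaler0 addr0.
- by move=> v; rewrite scaler0 subr0.
- by move=> v; rewrite scaler0 addr0.
- by move=> i; rewrite h scale0r.
Qed.
End LinearCombinations.

Ltac latoms R t l :=
  lazymatch t with
  | ?v + ?w => let l' := latoms R v l in latoms R w l'
  | _ *: ?v => latoms R v l
  | 0 => l
  | _ => lazymatch l with context [(t, _) :: _] => l | _ => constr:((t, 0 : R) :: l) end
  end.

Ltac reifyl vs cs t :=
  lazymatch t with
  | ?c *: ?v => let p := reifyl vs cs v in let n := idx c cs in constr:(EZ (CV n) p)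
  | ?v + ?w => let p := reifyl vs cs v in let q := reifyl vs cs w in
      constr:(ED p q)
  | 0 => constr:(E0)
  | _ => let n := idx t vs in constr:(EA n)
  end.

Ltac scall t l :=
  lazymatch t with
  | ?c *: ?v =>
    let l' := lazymatch l with
      | context [c :: _] => l | _ => constr:(c :: l) end in scall v l'
  | ?v + ?w => let l' := scall v l in scall w l'
  | _ => l
  end.

(* Identities between linear combinations in a module over R. *)
Ltac lmod R F :=
  rewrite ?(@opp_scale R F);
  lazymatch goal with |- @eq _ ?p ?q =>
    let cs := scall p (@nil R) in let cs' := scall q cs in
    let vs := latoms R p (@nil (F * R)) in let vs' := latoms R q vs in
    let p' := reifyl vs' cs' p in let q' := reifyl vs' cs' q in
    refine (lin_eq (vs := vs') (cs := cs') (y := p') (z := q') _ _);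
    [ by repeat (case=> //)
    | let c := eval vm_compute in
          (collect (norm (ED p' (EZ (CZ (Negz 0)) q')))) in
        change (foldr (fun k P => @cint R F 0 vs' cs' k = 0 /\ P) True c);
        cbn [foldr cint cat_ nth fst snd];
        repeat (split; [by field|]); exact: I ]
  end.

(** * Order of vanishing along the boundary *)

Section GoodExtension.
Context {R : realType} {F : lmodType R} {m : R} (C : calculus F m) (G : regular C).
Local Notation d := (op_d C).
Local Notation x := (op_x C).
Local Notation e := (op_e C).
Local Notation i := (op_i C).
Local Notation cc := (op_cc C).
Local Notation sp := (op_sp C).
Local Notation rho := (op_rho C).
Local Notation J2 := (op_J2 C).
Local Notation hasdeg := (hasdeg C).
Local Notation degT := (degT C).
Local Notation Th := (Th C).
Local Notation x0 := (codE C).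
Local Notation J0 := (schE C).
Local Notation O := (O G).
Let dd := op_dd C.
Let xx := op_xx C.
Let spD := op_spD C.
Let sp0 := op_sp0 C.
Let d_sp := op_d_sp C.
Let x_sp := op_x_sp C.
Let e_sp := op_e_sp C.
Let i_sp := op_i_sp C.
Let cc_d := op_cc_d C.
Let cc_x := op_cc_x C.
Let cc_e := op_cc_e C.
Let cc_i := op_cc_i C.
Let cc_sp := op_cc_sp C.
Let rhoE := op_rhoE C.
Let J2E := op_J2E C.
Variables (k : R) (l : nat).
Hypothesis hm : m = l%:R + 1 + 2 * k.

(* One order of the normal component of the divergence. *)
Lemma coclosed_step (j : nat) A : (j <= l)%N -> hasdeg k A ->
  O (j%:Z + 1) (x0 A) ->
  exists B, [/\ G B, hasdeg k B, O (j%:Z + 2) (x0 (A + sp j%:Z B))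
    & O (j%:Z + 1) (x0 (d (sp j%:Z B)))].
Proof.
move=> jl hA /OP[f Gf ef].
have hf : hasdeg (k - 1) f by rewrite -(spNK C (j%:Z + 1) f) -ef; hdeg.
have if1 : O 1 (i f).
  apply: (@O_i_coclosed _ _ _ _ _ (k - 1) (j%:Z + 1)) => //.
    rewrite -ef (x0x0 (p := k)) //; exact: O0.
  rewrite hm intrD; have -> : j%:~R + 1%:~R - (l%:R + 1 + 2 * k - 2 * (k - 1)) =
    - (l - j + 2)%:R :> R by rewrite natrD natrB //; ring.
  by rewrite oppr_eq0 pnatr_eq0 addn2.
(* Minus the coefficient of iota in [x0_sp] at exponent j, since m - 2k = l + 1. As iota eps f
   agrees with f to first order, adding sigma^j eps f / s cancels f; s is nonzero up to j = l. *)
pose s : R := (l - j + 1)%:R.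
have s0 : s != 0 by rewrite /s pnatr_eq0 addn1.
have hs : s = l%:R - j%:R + 1 by rewrite /s natrD natrB.
exists (s^-1 *: e f); split.
- exact/regZ/reg_e.
- hdeg.
- rewrite x0D ef (x0_sp _ (p := k)); last by hdeg.
  rewrite -sp_D (_ : j%:Z + 2 = j%:Z + 1 + 1); last by ring.
  apply: O_shift; rewrite x_Z i_Z sp_Z scalerA (_ : _ * s^-1 = -1); last first.
    by rewrite hm -pmulrn; apply: (mulIf s0); rewrite mulfVK // hs; ring.
  rewrite scaleN1r addrC -addrA; apply: OD; first exact/OZ/O_sp/reg_x/reg_e.
  by rewrite addrC -opprB; apply/ON/O_ie.
(* eps eps = 0 removes the term in which d would lower the order, so the correction does not disturb
   delta_o d A. *)
- have -> : d (sp j%:Z (s^-1 *: e f)) = sp j%:Z (- (s^-1 *: e (d f))).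
    by rewrite d_sp e_Z (ee C) scaler0 sp_0 scaler0 addr0 d_Z (de C) scalerN.
  apply: (@O_x0 _ _ _ _ _ (k + 1)); first by hdeg.
  by apply/O_sp/regN/regZ/reg_e/reg_d.
Qed.

(** The leading coefficient H of delta_o d A is tangential, and the indicial value j (j - l) is
    nonzero strictly between the roots, so sigma^j H / (j (l - j)) removes it. At j = l this
    fails. *)
Lemma closed_step (j : nat) A : (0 < j < l)%N -> hasdeg k A ->
  O j%:Z (x0 (d A)) -> O (j%:Z + 1) (x0 A) ->
  exists B, [/\ G B, hasdeg k B, O (j%:Z + 1) (x0 (d (A + sp j%:Z B)))
    & O (j%:Z + 1) (x0 (A + sp j%:Z B))].
Proof.
move=> /andP[j0 jl] hA /OP[H GH eH] oA.
have hH : hasdeg k H by rewrite -(spNK C j%:Z H) -eH; hdeg.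
have iH : O 1 (i H).
  apply: (@O_i_coclosed _ _ _ _ _ k j%:Z) => //.
    rewrite -eH (x0x0 (p := k + 1)); [exact: O0 | hdeg].
  rewrite hm -pmulrn; have -> : j%:R - (l%:R + 1 + 2 * k - 2 * k) = - (l - j + 1)%:R :> R.
    by rewrite natrD natrB 1?ltnW //; ring.
  by rewrite oppr_eq0 pnatr_eq0 addn1.
pose s : R := (j * (l - j))%:R.
have s0 : s != 0 by rewrite pnatr_eq0 muln_eq0 negb_or -!lt0n j0 subn_gt0 jl.
have hs : s = j%:R * (l%:R - j%:R) by rewrite /s natrM natrB // ltnW.
have GB : G (s^-1 *: H) by apply: regZ.
have hB : hasdeg k (s^-1 *: H) by hdeg.
exists (s^-1 *: H); split=> //.
- rewrite d_D x0D eH -[x0 (d (sp _ _))](subrK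
    ((j%:~R * (j%:~R - (m - 1 - 2 * k))) *: sp j%:Z (i (e (s^-1 *: H))))).
  rewrite addrCA; apply: OD; first exact: X_sp.
  rewrite e_Z i_Z sp_Z scalerA (_ : _ * s^-1 = -1); last first.
    by rewrite hm -pmulrn; apply: (mulIf s0); rewrite mulfVK // hs; ring.
  rewrite scaleN1r -sp_N -sp_D; apply: O_shift.
  by rewrite -opprB; apply/ON/O_ie.
- by rewrite x0D; apply: OD => //; apply: (@O_x0 _ _ _ _ _ k); [hdeg | exact: O_sp].
Qed.

(** Each [closed_step] costs one order of delta_o A, which the following [coclosed_step] restores.
    At j = l only the latter is still possible, which leaves order l for delta_o d and order l + 2
    for delta_o. *)
Lemma good_extension A : (0 < l)%N -> G A -> hasdeg k A -> O 1 (i A) ->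
  exists B, [/\ G B, hasdeg k B, O l%:Z (x0 (d (A + sp 1 B)))
    & O (l%:Z + 2) (x0 (A + sp 1 B))].
Proof.
move=> l0 GA hA iA.
(* Every correction has positive order, so all of them combine into one term sigma B and the
   boundary value is kept. *)
have add1 (j : nat) B : (0 < j)%N -> G B -> exists2 B', G B' & sp j%:Z B = sp 1 B'.
  case: j => // j _ GB; exists (sp j%:Z B); first exact: reg_spn.
  by rewrite spD intS.
have base : O 1 (x0 (d A)) /\ O (1 + 1) (x0 A).
  split.
    by apply: (@O_x0 _ _ _ _ _ (k + 1) 0); [hdeg | apply/O_reg/reg_d].
  rewrite /codE; apply: OB; first exact/O_sp/reg_x.
  rewrite hA i_Z sp_Z; exact/OZ/O_shift.
have [B [GB hB oB1 oB2]] : exists B, [/\ G B, hasdeg k B,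
    O l%:Z (x0 (d (A + sp 1 B))) & O (l%:Z + 1) (x0 (A + sp 1 B))].
  have: (0 < l <= l)%N by rewrite l0 /=.
  (* The order reached is generalised to j; the occurrence left alone is the upper bound for j. *)
  move: {1 2 4 5}l => j; elim: j => // -[|j] IH jl.
    by exists 0; rewrite sp_0 addr0; case: base => b1 b2; split;
      [exact: reg0 | hdeg | exact: b1 | exact: b2].
  have [|B [GB hB oB1 oB2]] := IH; first by move: jl; lia.
  have [||||D [GD hD oD1 oD2]] := closed_step (j := j.+1) (A := A + sp 1 B);
    [by move: jl; lia|hdeg|exact: oB1|exact: oB2|].
  have [|||E [GE hE oE1 oE2]] := coclosed_step (j := j.+1)
    (A := A + sp 1 B + sp j.+1%:Z D); [by move: jl; lia|hdeg|exact: oD2|].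
  have [D' GD' eD] := add1 j.+1 D isT GD.
  have [E' GE' eE] := add1 j.+1 E isT GE.
  exists (B + D' + E'); rewrite !sp_D -eD -eE !addrA.
  have e2 : j.+2%:Z = j.+1%:Z + 1 by rewrite -addn1 PoszD.
  split.
  - by do ?apply: regD.
  - have -> : D' = sp (- 1) (sp j.+1%:Z D) by rewrite eD spNK.
    have -> : E' = sp (- 1) (sp j.+1%:Z E) by rewrite eE spNK.
    hdeg.
  - by rewrite e2 d_D x0D; apply: OD => //.
  - by rewrite (_ : j.+2%:Z + 1 = j.+1%:Z + 2) // e2; ring.
have [|||D [GD hD oD1 oD2]] := coclosed_step (j := l) (A := A + sp 1 B); [by []|hdeg|exact: oB2|].
have [D' GD' eD] := add1 l D l0 GD.
exists (B + D'); rewrite sp_D -eD addrA; split=> //.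
- exact: regD.
- have -> : D' = sp (- 1) (sp l%:Z D) by rewrite eD spNK.
  hdeg.
- rewrite d_D x0D; apply: OD => //.
  by apply: O_le oD2; rewrite lerDl.
Qed.
End GoodExtension.

(** * Additivity and regularity of the powers of y *)

Section Linearity.
Context {R : realType} {F : lmodType R} {m : R} (C : calculus F m) (G : regular C).
Local Notation d := (op_d C).
Local Notation x := (op_x C).
Local Notation e := (op_e C).
Local Notation i := (op_i C).
Local Notation cc := (op_cc C).
Local Notation sp := (op_sp C).
Local Notation rho := (op_rho C).
Local Notation J2 := (op_J2 C).
Local Notation hasdeg := (hasdeg C).
Local Notation degT := (degT C).
Local Notation Th := (Th C).
Local Notation x0 := (codE C).
Local Notation J0 := (schE C).
Local Notation O := (O G).
Let dd := op_dd C.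
Let xx := op_xx C.
Let spD := op_spD C.
Let sp0 := op_sp0 C.
Let d_sp := op_d_sp C.
Let x_sp := op_x_sp C.
Let e_sp := op_e_sp C.
Let i_sp := op_i_sp C.
Let cc_d := op_cc_d C.
Let cc_x := op_cc_x C.
Let cc_e := op_cc_e C.
Let cc_i := op_cc_i C.
Let cc_sp := op_cc_sp C.
Let rhoE := op_rhoE C.
Let J2E := op_J2E C.
Local Notation y := (yT m d x J2 (sp 1) i rho).
Local Notation ypow := (ypowT m d x J2 (sp 1) i rho).
Local Notation split := (@split R F).
Local Notation ysplit := (ysplit C).
Lemma split_add S T : split (addT S T) = addT (split S) (split T).
Proof.
by apply: Tr_eq; rewrite //= scalerDr ?opprD addrACA.
Qed.

Lemma split_scale c T : split (scaleT c T) = scaleT c (split T).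
Proof.
by apply: Tr_eq; rewrite //= ?scalerBr ?scalerDr !scalerA mulrC.
Qed.

Lemma ysplit_add K q k S T : degT k S -> degT k T ->
  ysplit K q (addT S T) = addT (ysplit K q S) (ysplit K q T).
Proof.
case: S T => N W E Z [N' W' E' Z'] [/= h1 h2 h3 h4] [/= h1' h2' h3' h4'].
red in h1, h2, h3, h4, h1', h2', h3', h4'.
by apply: Tr_eq; rewrite /= /LapF /codE !(@opp_scale R F);
  normal C (0:int) [:: (N, m - 2 * (k - 1)); (W, m - 2 * k); (E, m - 2 * (k - 2));
    (Z, m - 2 * (k - 1)); (N', m - 2 * (k - 1)); (W', m - 2 * k);
    (E', m - 2 * (k - 2)); (Z', m - 2 * (k - 1))].
Qed.

Lemma ysplits_add j K U k S T : degT k S -> degT k T ->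
  ysplits C j K U (addT S T) = addT (ysplits C j K U S) (ysplits C j K U T).
Proof.
elim: j U S T => //= j IH U S T hS hT.
by rewrite (ysplit_add _ _ hS hT) IH //; apply: degT_ysplit.
Qed.

Lemma ypow_add j (u : int) k w S T : degT k S -> degT k T -> w + k = - u%:~R ->
  ypow j k w (addT S T) = addT (ypow j k w S) (ypow j k w T).
Proof.
move=> hS hT hu; apply: (@Phi_inj _ _ _ C (u + j%:Z)).
rewrite Phi_ypow //; last exact: degT_add.
rewrite /Phi !Th_add !split_add -/(Phi C _ _) -/(Phi C _ _).
rewrite (@ysplits_add _ _ _ k); [|exact/degT_split/degT_Th..].
by rewrite -/(Phi C _ (ypow j k w S)) -/(Phi C _ (ypow j k w T)) !Phi_ypow.
Qed.

Definition regT (T : tr F) := [/\ G (nN T), G (nW T), G (nE T) & G (nS T)].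

Ltac treg := repeat first
  [ assumption | apply: regD | apply: regN | apply: regZ | apply: reg_d
  | apply: reg_x | apply: reg_e | apply: reg_i | apply: reg_sp1
  | apply: reg_rho | apply: reg_J2 | apply: reg0 ].

Lemma regT_add S T : regT S -> regT T -> regT (addT S T).
Proof. by move=> [? ? ? ?] [? ? ? ?]; split; apply: regD. Qed.

Lemma regT_scale c T : regT T -> regT (scaleT c T).
Proof. by move=> [? ? ? ?]; split; apply: regZ. Qed.

Lemma regT_Is T : regT T -> regT (IsT (sp 1) i rho T).
Proof. by move=> [? ? ? ?]; split=> /=; treg. Qed.

Lemma regT_Dt k w T : regT T -> regT (DtT m d x J2 k w T).
Proof. by move=> [? ? ? ?]; split=> /=; rewrite /LapF; treg. Qed.

Lemma regT_Ds k w T : regT T -> regT (DsT m d x J2 k w T).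
Proof. by move=> [? ? ? ?]; split=> /=; rewrite /LapF; treg. Qed.

Lemma regT_Xs T : regT T -> regT (XsT T).
Proof. by move=> [? ? ? ?]; split=> /=; treg. Qed.

Lemma regT_y k w T : regT T -> regT (y k w T).
Proof.
by move=> h; apply/regT_scale/regT_add; [apply/regT_Is/regT_Dt | apply/regT_Dt/regT_Is].
Qed.

Lemma regT_ypow j k w T : regT T -> regT (ypow j k w T).
Proof. by elim: j w T => //= j IH w T h; apply/IH/regT_y. Qed.

Lemma regT_preDbar a c k w T : regT T -> regT (preDbar C a c k w T).
Proof.
move=> h; do 2?apply: regT_add.
- exact/regT_scale/regT_Ds.
- exact/regT_Is/regT_y.
- exact/regT_scale/regT_Xs/regT_ypow.
Qed.
End Linearity.

(** * The boundary value of the detour operator *)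

Section Leading.
Context {R : realType} {F : lmodType R} {m : R} (C : calculus F m) (G : regular C).
Local Notation d := (op_d C).
Local Notation x := (op_x C).
Local Notation e := (op_e C).
Local Notation i := (op_i C).
Local Notation cc := (op_cc C).
Local Notation sp := (op_sp C).
Local Notation rho := (op_rho C).
Local Notation J2 := (op_J2 C).
Local Notation hasdeg := (hasdeg C).
Local Notation degT := (degT C).
Local Notation Th := (Th C).
Local Notation x0 := (codE C).
Local Notation J0 := (schE C).
Local Notation O := (O G).
Let dd := op_dd C.
Let xx := op_xx C.
Let spD := op_spD C.
Let sp0 := op_sp0 C.
Let d_sp := op_d_sp C.
Let x_sp := op_x_sp C.
Let e_sp := op_e_sp C.
Let i_sp := op_i_sp C.
Let cc_d := op_cc_d C.
Let cc_x := op_cc_x C.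
Let cc_e := op_cc_e C.
Let cc_i := op_cc_i C.
Let cc_sp := op_cc_sp C.
Let rhoE := op_rhoE C.
Let J2E := op_J2E C.
Local Notation y := (yT m d x J2 (sp 1) i rho).
Local Notation ypow := (ypowT m d x J2 (sp 1) i rho).
Local Notation split := (@split R F).
Local Notation ysplit := (ysplit C).
Local Notation regT := (regT G).
Variables (k : R) (l : nat).
Hypothesis hm : m = l%:R + 1 + 2 * k.
Hypothesis l2 : (2 <= l)%N.

Let l0 : l%:R != 0 :> R. Proof. by rewrite pnatr_eq0; lia. Qed.
Let l1 : l%:R - 1 != 0 :> R. Proof. by rewrite subr_eq0 pnatr_eq1; lia. Qed.
Let lp1 : l%:R + 1 != 0 :> R. Proof. by rewrite natr1 pnatr_eq0. Qed.

Local Notation Dbar := (DbarT m d x J2 (sp 1) i rho (k + 1) (1 - k)).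
Local Notation pre := (l%:R / (l%:R + 1)).
Local Notation c0 := ((l%:R * (l%:R - 1))^-1 : R).

Lemma DbarE T : Dbar T = scaleT pre (preDbar C 1 c0 (k + 1) (1 - k) T).
Proof.
rewrite /DbarT /preDbar.
have -> : m + 2 * (1 - k) - 3 = l%:R by rewrite hm; ring.
have -> : m + 2 * (1 - k) - 2 = l%:R + 1 by rewrite hm; ring.
have -> : m + 2 * (1 - k) - 4 = l%:R - 1 by rewrite hm; ring.
by congr (scaleT _ (addT (addT _ _) _)); apply: Tr_eq; rewrite /= scale1r.
Qed.

(** The split Einstein components of D-bar-star applied to (0, 0, 0, A), from which the iteration of
    y starts. *)
Definition start (A : F) : tr F := scaleT pre (Tr
  ((l%:R + 1) *: x0 A - c0 *: (4 *: x0 (d (x0 A)) + (2 * (l%:R + 3)) *: x0 A))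
  (((l%:R + 1) * (l%:R + 2)) *: A + (1 - c0 * (2 * l%:R - 2)) *: d (x0 A)
   + (1 - c0 * (2 * l%:R + 6)) *: x0 (d A))
  0
  (- (l%:R + 3) *: x0 A + c0 *: (4 *: x0 (d (x0 A)) + (2 * (l%:R + 3)) *: x0 A))).

Lemma Th_pre0 a A : hasdeg k A ->
  Th 0 (preDbar C a c0 (k + 1) (1 - k) (botT A)) =
  preDbar0 C a c0 (k + 1) (1 - k) (botT A).
Proof.
move=> hA; have := @Th_preDbar _ _ _ C a c0 (-2) _ (1 - k) _ (degT_bot hA).
rewrite (_ : -2 + 2 = 0) // Th_bot sp0 => -> //.
by rewrite mulrNz opprK; ring.
Qed.

Lemma Phi_Dbar A : hasdeg k A -> Phi C 0 (Dbar (botT A)) = start A.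
Proof.
move=> hA; rewrite DbarE /Phi Th_scale split_scale; congr (scaleT _ _).
rewrite (Th_pre0 _ hA).
by rewrite (@split_preDbar0 _ _ _ C k l%:R).
Qed.

Lemma degT_Dbar A : hasdeg k A -> degT k (Dbar (botT A)).
Proof.
move=> hA; rewrite DbarE; apply: degT_scale.
by have := degT_preDbar 1 c0 (1 - k) (degT_bot hA); rewrite addrK.
Qed.

Lemma start_add A B : hasdeg k A -> hasdeg k B ->
  start (A + B) = addT (start A) (start B).
Proof.
move=> hA hB; red in hA, hB; rewrite /start /addT /scaleT.
move: c0 pre => c p; apply: Tr_eq; rewrite /= /codE ?(@opp_scale R F);
  normal C (0:int) [:: (A, m - 2 * k); (B, m - 2 * k)].
Qed.

Lemma Dbar_add A B : hasdeg k A -> hasdeg k B ->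
  Dbar (botT (A + B)) = addT (Dbar (botT A)) (Dbar (botT B)).
Proof.
move=> hA hB; apply: (@Phi_inj _ _ _ C 0).
rewrite {2}/Phi Th_add split_add -!/(Phi C 0 _) !Phi_Dbar ?start_add //; hdeg.
Qed.

Lemma Dbar_sp B : hasdeg k B -> Dbar (botT (sp 1 B)) = spT C
  (scaleT pre (preDbar C ((l%:R + 1) / (l%:R - 1)) c0 (k + 1) (- k) (botT B))).
Proof.
move=> hB; rewrite DbarE; apply: (@Th_inj _ _ _ C 0).
rewrite Th_spT !Th_scale; congr (scaleT _ _).
have hsB : hasdeg k (sp 1 B) by hdeg.
rewrite (Th_pre0 _ hsB) (@preDbar0_shift _ _ _ C k l%:R) //.
have := @Th_preDbar _ _ _ C ((l%:R + 1) / (l%:R - 1)) c0 (-1) _ (- k) _ (degT_bot hB).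
rewrite (_ : -1 + 2 = 0 + 1) // Th_bot => -> //.
by rewrite mulrNz opprK; ring.
Qed.

Definition detour (A : F) : tr F := ypow l k (- k) (Dbar (botT A)).

Lemma detour_add A B : hasdeg k A -> hasdeg k B ->
  detour (A + B) = addT (detour A) (detour B).
Proof.
move=> hA hB; rewrite /detour Dbar_add // (@ypow_add _ _ _ C l 0) //; try exact: degT_Dbar.
by rewrite addNr oppr0.
Qed.

Lemma regT_bot A : G A -> regT (botT A).
Proof. by move=> h; split=> //=; apply: reg0. Qed.

(** Independence of the extension: sigma passes through D-bar-star by [Dbar_sp], and then through
    the l-th power of y because 2w + m - 1 = l at w = -k. *)
Lemma detour_sp B : G B -> hasdeg k B -> O 1 (nW (detour (sp 1 B))).
Proof.
move=> GB hB; rewrite /detour Dbar_sp //.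
set T := scaleT _ _.
have hT : degT k T.
  by apply: degT_scale; have := degT_preDbar ((l%:R + 1) / (l%:R - 1)) c0 (- k) (degT_bot hB); rewrite addrK.
rewrite (@ypow_spT _ _ _ C l k (- k) 0) //; first last.
- by rewrite hm; ring.
- by rewrite addNr oppr0.
apply: O_sp; have : regT T by apply/regT_scale/regT_preDbar/regT_bot.
by move=> /(regT_ypow l k (- k - 1))[].
Qed.

Section Coclosed.
Variable A : F.
Hypothesis hA : hasdeg k A.
Hypothesis oH : O l%:Z (x0 (d A)).
Hypothesis of_ : O (l%:Z + 2) (x0 A).

Let h0 := x0 (d A).
Let hh0 : hasdeg k h0. Proof. rewrite /h0; hdeg. Qed.
Let x0h0 : x0 h0 = 0. Proof. by apply: (x0x0 (p := k + 1)); hdeg. Qed.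

(** The exponent l is a root of the indicial polynomial in degree k, so one order is gained. *)
Let X_h0 : O (l%:Z + 1) (x0 (d h0)).
Proof.
case/OP: oH => H GH eH; rewrite /h0 eH.
have hH : hasdeg k H by rewrite -(spNK C l%:Z H) -eH; hdeg.
have := X_sp l%:Z GH hH; rewrite -pmulrn.
have -> : l%:R * (l%:R - (m - 1 - 2 * k)) = 0 by rewrite hm; ring.
by rewrite scale0r subr0.
Qed.

Lemma O_X p a v : hasdeg p v -> O a v -> O a (x0 (d v)).
Proof.
move=> hv ov; rewrite -[a](subrK 1); apply: (@O_x0 _ _ _ _ _ (p + 1)); first hdeg.
exact: O_d.
Qed.

Lemma O_Lap p a v : hasdeg p v -> O a v -> O a (LapF d x0 v).
Proof.
move=> hv ov; apply: OD; last exact: (O_X hv).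
by rewrite -[a](addrK 1); apply/O_d/(O_x0 hv).
Qed.

(* The shape of the iterates of y on a coclosed form: a multiple of x0 (d A),
   an exact form of high order, and negligible other components. *)
Definition shape (a pi : R) (T : tr F) := [/\ nE T = 0, x0 (nS T) = 0,
  O (l%:Z + 2) (nS T), O (l%:Z + 2) (nN T) &
  exists f h, [/\ nW T = a *: A + d f + h, hasdeg (k - 1) f /\ O (l%:Z + 2) f,
    hasdeg k h, x0 h = 0 & O (l%:Z + 1) (h - pi *: h0)]].

Let K := 2 * k - m + 1.

(** The Laplacian of y turns a A into a delta_o d A plus an exact form, and maps the h-part to
    higher order by [X_h0], so on the latter y acts as the scalar q. The condition a q = 0 is what
    makes the multiple of A disappear. *)
Lemma shape_step a pi q T : degT k T -> a * q = 0 -> shape a pi T ->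
  shape 0 (a + q * pi) (ysplit K q T).
Proof.
case: T => N W E S [/= hN hW hE hS] aq [/= E0 xS oS oN [f [h [eW [hf of'] hh xh oh]]]].
have hAf : hasdeg (k - 1) (x0 A) by hdeg.
split=> /=.
- by rewrite E0 xS /LapF x00 d_0 x00 !scaler0 !addr0.
- rewrite E0 d_0 scaler0 addr0 x0D x0Z xS scaler0 addr0 /LapF x0D xS d_0.
  by rewrite x00 add0r (x0x0 (p := k)) //; hdeg.
- rewrite E0 d_0 scaler0 addr0; apply: OD; last exact: OZ.
  exact: (O_Lap hS).
- apply: OB; first by apply: OD; [exact: (O_Lap hN) | exact: OZ].
  rewrite eW !x0D xh addr0 x0Z; apply/OZ/OD; first exact: OZ.
  exact: (O_X hf).
- exists (a *: x0 A + x0 (d f) + q *: f - 2 *: N), (a *: h0 + x0 (d h) + q *: h).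
  split.
  + have e1 : x0 W = a *: x0 A + x0 (d f) by rewrite eW !x0D xh addr0 x0Z.
    have e2 : x0 (d W) = a *: h0 + x0 (d h).
      by rewrite eW !d_D (op_dd C) addr0 d_Z x0D x0Z.
    have e3 (u v : F) (b : R) : d (b *: u + v) = b *: d u + d v by rewrite d_D d_Z.
    have -> : a *: x0 A + x0 (d f) + q *: f - 2 *: N =
        a *: x0 A + (q *: f + (-2 *: N + x0 (d f))) by lmod R F.
    rewrite /LapF e1 e2 eW !e3.
    have -> : q *: (a *: A + d f + h) = q *: d f + q *: h.
      by rewrite !scalerDr scalerA [q * a]mulrC aq scale0r add0r.
    lmod R F.
  + split; first by hdeg.
    apply: OB; last exact: OZ.
    by apply: OD; last exact: OZ; apply: OD; [exact: OZ | exact: (O_X hf)].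
  + by apply: hasdegD; last exact: hasdegZ; apply: hasdegD; [exact: hasdegZ | hdeg].
  + have e4 (u v : F) (b : R) : x0 (b *: u + v) = b *: x0 u + x0 v by rewrite x0D x0Z.
    have -> : a *: h0 + x0 (d h) + q *: h = a *: h0 + (q *: h + x0 (d h)) by lmod R F.
    rewrite !e4 xh x0h0 (x0x0 (p := k + 1)); last by hdeg.
    by rewrite !scaler0 !addr0.
  + have -> : a *: h0 + x0 (d h) + q *: h - (a + q * pi) *: h0 =
      x0 (d (h - pi *: h0)) + pi *: x0 (d h0) + q *: (h - pi *: h0).
      rewrite d_D x0D d_N x0N d_Z x0Z; lmod R F.
    apply: OD; last exact: OZ.
    by apply: OD; [apply: (@O_X k) => //; hdeg | exact: OZ].
Qed.

Lemma shape_steps j U pi T : degT k T -> shape 0 pi T ->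
  shape 0 (pi * \prod_(i < j) ((U - i%:R) * (K - (U - i%:R)))) (ysplits C j K U T).
Proof.
elim: j U pi T => [|j IH] U pi T hT hs /=; first by rewrite big_ord0 mulr1.
rewrite big_ord_recl /= subr0 mulrA.
under eq_bigr => i _ do rewrite /bump /= natrD opprD addrA.
apply: IH; first exact: degT_ysplit.
by have := shape_step hT (mul0r (U * (K - U))) hs; rewrite add0r [_ * pi]mulrC.
Qed.

(** With j = l - 1 these are the scalars U (K - U) of the remaining powers of y, where K = -l and U
    runs down from -1. *)
Lemma fact_sqr_prod j : \prod_(i < j) ((- 1 - i%:R) * (- j.+1%:R - (- 1 - i%:R))) =
  (j`!)%:R ^+ 2 :> R.
Proof.
have -> : \prod_(i < j) ((- 1 - i%:R) * (- j.+1%:R - (- 1 - i%:R))) =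
  \prod_(i < j) ((i.+1)%:R * (j - i)%:R) :> R.
  apply: eq_bigr => i _; rewrite natrB 1?ltnW // -!natr1; ring.
rewrite big_split /= -!natr_prod expr2; congr (_%:R * _%:R).
  by rewrite fact_prod big_add1 /= big_mkord.
rewrite fact_prod big_add1 /= big_mkord (reindex_inj rev_ord_inj) /=.
by apply: eq_bigr => i0 _; rewrite subKn.
Qed.

(** The coefficient of A in [start] is l (l + 2); the first y passes it on to delta_o d A, and the
    other l - 1 contribute the squared factorial. *)
Lemma detour_coclosed :
  O 1 (nW (detour A) - (l%:R * (l%:R + 2) * ((l.-1)`!)%:R ^+ 2) *: sp (- l%:Z) h0).
Proof.
have hAf : hasdeg (k - 1) (x0 A) by hdeg.
pose T := start A.
have hT : degT k T by rewrite /T -Phi_Dbar //; apply/degT_split/degT_Th/degT_Dbar.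
have eT : Phi C (0 + l%:Z) (detour A) = ysplits C l K 0 T.
  by rewrite /detour (Phi_ypow _ (k := k)) ?addNr ?oppr0 //;
    [rewrite Phi_Dbar | exact: degT_Dbar].
have s0 : shape (pre * ((l%:R + 1) * (l%:R + 2))) (pre * (1 - c0 * (2 * l%:R + 6))) T.
  have Of : O (l%:Z + 2) (x0 (d (x0 A))) by exact: (O_X hAf).
  rewrite /T /start /scaleT; split=> /=.
  - by rewrite scaler0.
  - move: c0 pre => c p; set v := p *: _.
    have -> : v = (p * (c * (2 * (l%:R + 3)) - (l%:R + 3))) *: x0 A
        + (p * c * 4) *: x0 (d (x0 A)) by rewrite /v; lmod R F.
    rewrite x0D !x0Z (x0x0 hA) (x0x0 (p := k)); last by hdeg.
    by rewrite !scaler0 addr0.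
  - by apply/OZ/OD; [exact: OZ | apply/OZ/OD; exact: OZ].
  - by apply/OZ/OB; [exact: OZ | apply/OZ/OD; exact: OZ].
  - exists ((pre * (1 - c0 * (2 * l%:R - 2))) *: x0 A),
      ((pre * (1 - c0 * (2 * l%:R + 6))) *: h0); split.
    + by rewrite /h0 d_Z; move: c0 pre => c p; lmod R F.
    + by split; [hdeg | exact: OZ].
    + hdeg.
    + by rewrite x0Z x0h0 scaler0.
    + by rewrite subrr; apply: O0.
(* The first y has U = 0 and hence scalar 0: the coefficient of delta_o d A becomes that of A, and
   the one it had in [start] drops out. *)
have hT' := degT_ysplit K 0 hT.
have /shape_steps := shape_step hT (mulr0 _) s0.
move=> /(_ l.-1 (- 1) hT'); rewrite mul0r addr0.
have eK : K = - l.-1.+1%:R by rewrite prednK 1?ltnW // /K hm; ring.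
rewrite [X in _ * X](_ : _ = (l.-1)`!%:R ^+ 2); last by rewrite -fact_sqr_prod -eK.
have -> : ysplits C l.-1 K (- 1) (ysplit K 0 T) = ysplits C l K 0 T.
  by rewrite -[in RHS](@prednK l) 1?ltnW //= sub0r mul0r.
rewrite -eT /Phi add0r.
case=> /= _ _ oS oN [f [h [eW [hf of'] hh xh oh]]].
(* The two eigencombinations add up to the northern Einstein slot. Its high order makes the term eps
   of north, by which the western slots of the two scales differ, negligible. *)
have oN' : O (l%:Z + 2) (sp (l%:Z + 0) (nN (detour A))).
  have -> : sp (l%:Z + 0) (nN (detour A)) =
    nN (split (Th l%:Z (detour A))) + nS (split (Th l%:Z (detour A))) by
    rewrite /=; lmod R F.
  exact: OD.
have -> : nW (detour A) = sp (- l%:Z) (sp (l%:Z + 0) (nW (detour A))).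
  by rewrite addr0 spNK.
move: eW oN'; rewrite /= scale0r add0r => /eqP; rewrite subr_eq => /eqP -> oN'.
set M := pre * _ * _ in oh *.
have -> : l%:R * (l%:R + 2) * (l.-1)`!%:R ^+ 2 = M.
  by rewrite /M; field.
rewrite -sp_Z -!sp_N -!sp_D.
suff : O (- l%:Z + (l%:Z + 1)) (sp (- l%:Z) (d f + h +
    sp (l%:Z - 1) (e (nN (detour A))) - M *: h0)) by rewrite addKr.
apply: O_shift.
have -> : d f + h + sp (l%:Z - 1) (e (nN (detour A))) - M *: h0 =
  d f + (h - M *: h0) + sp (-1) (e (sp (l%:Z + 0) (nN (detour A)))).
  have -> : sp (-1) (e (sp (l%:Z + 0) (nN (detour A)))) =
      sp (l%:Z - 1) (e (nN (detour A))).
    by rewrite e_sp spD; congr (sp _ _); ring.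
  by lmod R F.
apply: OD; last first.
  have -> : l%:Z + 1 = -1 + (l%:Z + 2) by ring.
  by apply/O_shift/O_e.
apply: OD => //.
have -> : l%:Z + 1 = l%:Z + 2 - 1 by ring.
exact: O_d.
Qed.
End Coclosed.

Theorem detour_leading A : G A -> hasdeg k A -> O 1 (i A) ->
  exists B, [/\ G B, hasdeg k B, O l%:Z (x0 (d (A + sp 1 B))) &
    O 1 (nW (detour A) - (l%:R * (l%:R + 2) * ((l.-1)`!)%:R ^+ 2) *:
      sp (- l%:Z) (x0 (d (A + sp 1 B))))].
Proof.
move=> GA hA iA; have l_gt0 : (0 < l)%N by apply: ltnW.
have [B [GB hB o1 o2]] := good_extension hm l_gt0 GA hA iA.
exists B; split=> //.
have hA' : hasdeg k (A + sp 1 B) by hdeg.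
have hB' : hasdeg k (- B) by hdeg.
have := OD (detour_coclosed hA' o1 o2) (detour_sp (regN GB) hB').
have eA : detour A = addT (detour (A + sp 1 B)) (detour (sp 1 (- B))).
  by rewrite -detour_add; [rewrite sp_N addrK | hdeg | hdeg].
rewrite [nW (detour A)](congr1 (@nW _) eA) /=.
by rewrite addrAC.
Qed.
End Leading.

(** * The Q-operator on closed forms *)

Section QOperator.
Context {R : realType} {F : lmodType R} {m : R} (C : calculus F m) (G : regular C).
Local Notation d := (op_d C).
Local Notation x := (op_x C).
Local Notation e := (op_e C).
Local Notation i := (op_i C).
Local Notation cc := (op_cc C).
Local Notation sp := (op_sp C).
Local Notation rho := (op_rho C).
Local Notation J2 := (op_J2 C).
Local Notation hasdeg := (hasdeg C).
Local Notation degT := (degT C).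
Local Notation Th := (Th C).
Local Notation x0 := (codE C).
Local Notation J0 := (schE C).
Local Notation O := (O G).
Let dd := op_dd C.
Let xx := op_xx C.
Let spD := op_spD C.
Let sp0 := op_sp0 C.
Let d_sp := op_d_sp C.
Let x_sp := op_x_sp C.
Let e_sp := op_e_sp C.
Let i_sp := op_i_sp C.
Let cc_d := op_cc_d C.
Let cc_x := op_cc_x C.
Let cc_e := op_cc_e C.
Let cc_i := op_cc_i C.
Let cc_sp := op_cc_sp C.
Let rhoE := op_rhoE C.
Let J2E := op_J2E C.
Local Notation y := (yT m d x J2 (sp 1) i rho).
Local Notation ypow := (ypowT m d x J2 (sp 1) i rho).
Local Notation split := (@split R F).
Local Notation ysplit := (ysplit C).
Local Notation regT := (regT G).
Variables (k : R) (l : nat).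
Hypothesis hm : m = l%:R + 1 + 2 * k.
Hypothesis l2 : (2 <= l)%N.

Definition eastT (B : F) : tr F := Tr 0 0 (- B) 0.
Definition qop (B : F) : tr F := ypow (l - 2) (k + 3) (- k - 1) (eastT B).

Let hl : (l - 2)%N%:R = l%:R - 2 :> R. Proof. by rewrite natrB. Qed.

Lemma regT_east B : G B -> regT (eastT B).
Proof. by move=> h; split=> //=; [apply: reg0..| exact: regN | apply: reg0]. Qed.

Lemma degT_east B : hasdeg (k + 1) B -> degT (k + 3) (eastT B).
Proof. by move=> h; split=> /=; hdeg. Qed.

Lemma qop_reg B : G B -> regT (qop B).
Proof. by move=> h; apply/regT_ypow/regT_east. Qed.

Lemma qop_add B B' : hasdeg (k + 1) B -> hasdeg (k + 1) B' ->
  qop (B + B') = addT (qop B) (qop B').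
Proof.
move=> hB hB'; rewrite /qop.
have -> : eastT (B + B') = addT (eastT B) (eastT B').
  by rewrite /eastT /addT /= opprD !addr0.
rewrite (@ypow_add _ _ _ C (l - 2) (-2)) //; try exact: degT_east.
by rewrite mulrNz opprK; ring.
Qed.

(** Independence of the extension again: n - 2(k + 1) = l - 2 is the critical power of y at weight
    -k - 1. *)
Lemma qop_sp B : hasdeg (k + 1) B -> G B -> O 1 (nE (qop (sp 1 B))).
Proof.
move=> hB GB; rewrite /qop.
have -> : eastT (sp 1 B) = spT C (eastT B).
  by rewrite /eastT /spT /= sp_N !sp_0.
rewrite (@ypow_spT _ _ _ C (l - 2) (k + 3) (- k - 1) (-2)) //; first last.
- by rewrite hl hm; ring.
- by rewrite mulrNz opprK; ring.
- exact: degT_east.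
by apply: O_sp; case: (regT_ypow (l - 2) (k + 3) (- k - 1 - 1) (regT_east GB)).
Qed.

Section Closed.
Variable B : F.
Hypothesis GB : G B.
Hypothesis hB : hasdeg (k + 1) B.
Hypothesis dB : d B = 0.
Hypothesis oH : O l%:Z (x0 B).

Let H := sp (- l%:Z) (x0 B).

(** In degree k + 1 the root of [x0_sp] is l - 1, which differs from the exponent 0 because l is at
    least 2. *)
Let iB : O 1 (i B).
Proof.
apply: (O_i_coclosed (p := k + 1) (a := 0)) => //.
  by rewrite sp0 add0r; apply: O_le oH; rewrite lez_nat.
rewrite hm; have -> : 0%:~R - (l%:R + 1 + 2 * k - 2 * (k + 1)) = - (l%:R - 1) :> R.
  by rewrite mulr0z; ring.
by rewrite oppr_eq0 subr_eq0 pnatr_eq1; lia.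
Qed.

Let K := 2 * (k + 3) - m + 1.

(** Minus the indicial polynomial of delta_o d in degree k + 1, and at the same time the scalar by
    which the y of parameter U = 2 - j acts on the northern component. *)
Definition qcoef (j : nat) : R := j%:R * (l%:R - 2 - j%:R).

(** The northern component stays exact, with a coclosed potential f. Since d B = 0, only D
    contributes to d f, and coclosedness ties delta_o D to delta_o B = sigma^l H; the order of D
    rises with each y. *)
Definition qshape (j : nat) (pi : R) (T : tr F) := nW T = 0 /\
  exists f D, [/\ nN T = d f, f = (- (l%:R - 2) * pi) *: B + D, O j%:Z D,
    hasdeg (k + 1) D & x0 f = 0].

Lemma qshape_step (j : nat) pi T : (j.+2 <= l)%N -> qshape j pi T ->
  qshape j.+1 (qcoef j * pi) (ysplit K ((2 - j%:R) * (K - (2 - j%:R))) T).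
Proof.
case: T => N W E S jl [/= -> [f [D [-> ef oD hD xf]]]]; split=> /=.
  by rewrite /LapF x00 !d_0 x00 (op_dd C) !(scaler0, addr0, oppr0).
have eq : (2 - j%:R) * (K - (2 - j%:R)) - 2 * K + 4 = qcoef j.
  by rewrite /K hm /qcoef; ring.
rewrite eq x00 scaler0 subr0 /LapF (op_dd C) x00 addr0.
have hf : hasdeg (k + 1) f by rewrite ef; hdeg.
have xD : x0 D = ((l%:R - 2) * pi) *: x0 B.
  have -> : D = f + ((l%:R - 2) * pi) *: B by rewrite ef; lmod R F.
  by rewrite x0D xf add0r x0Z.
have df : d f = d D by rewrite ef d_D d_Z dB scaler0 add0r.
exists (x0 (d f) + qcoef j *: f), (x0 (d D) + qcoef j *: D); split.
- by rewrite [RHS]d_D d_Z.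
- by rewrite df ef; lmod R F.
(* delta_o D is a multiple of delta_o B, of order l, so the leading coefficient of D is tangential;
   then [qcoef j] cancels the indicial value and the order rises by one. *)
- case/OP: (oD) => D' GD' eD.
  have hD' : hasdeg (k + 1) D' by rewrite -(spNK C j%:Z D') -eD; hdeg.
  have iD : O 1 (i D').
    apply: (O_i_coclosed (p := k + 1) (a := j%:Z)) => //.
      by rewrite -eD xD; apply/OZ; apply: O_le oH; rewrite -PoszD lez_nat addn2.
    rewrite hm -pmulrn.
    have -> : j%:R - (l%:R + 1 + 2 * k - 2 * (k + 1)) = - (l - j.+1)%:R :> R.
      by rewrite natrB 1?ltnW // -natr1; ring.
    by rewrite oppr_eq0 pnatr_eq0 -lt0n subn_gt0.
  have := X_sp j%:Z GD' hD'; rewrite -pmulrn -eD.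
  have -> : j%:R * (j%:R - (m - 1 - 2 * (k + 1))) = - qcoef j.
    by rewrite hm /qcoef; ring.
  rewrite scaleNr opprK => h.
  have -> : x0 (d D) + qcoef j *: D = x0 (d D) + qcoef j *: sp j%:Z (i (e D'))
      - qcoef j *: (sp j%:Z (i (e D')) - sp j%:Z D').
    by rewrite -eD; lmod R F.
  have e1 : j.+1%:Z = j%:Z + 1 by rewrite -addn1.
  rewrite e1; apply: OB => //; apply: OZ; rewrite -sp_N -sp_D; apply: O_shift.
  exact: O_ie.
- by hdeg.
- rewrite x0D (x0x0 (p := k + 1 + 1)); last by hdeg.
  by rewrite x0Z xf scaler0 addr0.
Qed.

Lemma qshape_steps n j pi T : (j + n.+1 <= l)%N -> qshape j pi T ->
  qshape (j + n) (pi * \prod_(a < n) qcoef (j + a)) (ysplits C n K (2 - j%:R) T).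
Proof.
elim: n j pi T => [|n IH] j pi T jl hs; first by rewrite big_ord0 mulr1 addn0.
rewrite big_ord_recl /= addn0 mulrA.
have -> : 2 - j%:R - 1 = 2 - j.+1%:R :> R by rewrite -natr1; ring.
under eq_bigr => a _ do rewrite /bump /= addnCA addnA add1n.
rewrite -addSnnS [pi * _]mulrC; apply: IH; first by move: jl; lia.
by apply: qshape_step => //; move: jl; lia.
Qed.

Lemma qcoef_prod n : \prod_(a < n) ((1 + a)%:R * (n.+1%:R - (1 + a)%:R)) =
  (n`!)%:R ^+ 2 :> R.
Proof.
have -> : \prod_(a < n) ((1 + a)%:R * (n.+1%:R - (1 + a)%:R)) =
  \prod_(a < n) ((a.+1)%:R * (n - a)%:R) :> R.
  by apply: eq_bigr => a _; rewrite add1n -natrB ?subSS // ltnS (ltnW (ltn_ord a)).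
rewrite big_split /= -!natr_prod expr2; congr (_%:R * _%:R).
  by rewrite fact_prod big_add1 /= big_mkord.
rewrite fact_prod big_add1 /= big_mkord (reindex_inj rev_ord_inj) /=.
by apply: eq_bigr => a _; rewrite subKn.
Qed.

(** Where sigma = rho = 0, the eastern slot and Y differ by a multiple of d sigma and so restrict to
    the same form. As iota(nu) Y = sigma Y1 has normal derivative Y1 there, delta Y - Y1 is the
    divergence of that restriction along Sigma. *)
Definition boundary_div (T : tr F) (r : F) := exists Y Y1 N S,
  [/\ [/\ G Y, G Y1, G N & G S], e (nE T - Y) = rho N + sp 1 S,
      i Y = sp 1 Y1 & x Y - Y1 = r].

(** No y is applied, so the tangential form is -B itself. The general argument needs at least one y
    to replace the singular initial northern component. *)
Lemma qop_two : l = 2%N -> boundary_div (qop B) (- H).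
Proof.
move=> el; exists (- B), (- (x B - H)), 0, 0.
have e2 : qop B = eastT B by rewrite /qop el.
split=> /=.
- split; [exact: regN | | exact: reg0 | exact: reg0].
  by apply/regN/regB => //; exact: reg_x.
- rewrite e2 /= subrr e_0 sp_0 addr0 rhoE.
  by rewrite e_0 i_0 e_0 !subr0 sp_0 scaler0.
- have := x0_sp 0 hB; rewrite sp0 add0r.
  have -> : 0%:~R - (m - 2 * (k + 1)) = -1 :> R by rewrite mulr0z hm el; ring.
  rewrite scaleN1r => e1.
  have -> : x B - H = sp (-1) (i B).
    have e2' : - l%:Z + 1 = -1 by rewrite el.
    by rewrite /H e1 spD e2' sp_D sp_N spD addNr sp0; lmod R F.
  by rewrite i_N sp_N spD addrN sp0.
- by rewrite x_N; lmod R F.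
Qed.

Lemma Phi_north u N W E S : nN (Phi C u (Tr N W E S)) = 2^-1 *: sp (u + 0) N -
  (sp (u + 2) S + 2^-1 *: (sp (u + 0) (e (i N)) - sp (u + 0) (i (e N)))
   + sp (u + 1) (i W) + sp (u + 1) (e E)).
Proof. by []. Qed.

Lemma Phi_west u N W E S :
  nW (Phi C u (Tr N W E S)) = sp (u + 0) W - sp (u + -1) (e N).
Proof. by []. Qed.

(** After all l - 2 powers, D = sigma^(l-2) Z, and Y = -(l - 2) Z. The squared factorial is (l -
    2)^2 times the product ((l - 3)!)^2 of the scalars met after the first y. *)
Lemma qop_closed : (2 < l)%N -> boundary_div (qop B) (- ((l - 2)`!)%:R ^+ 2 *: H).
Proof.
move=> l3.
have hT := degT_east hB.
move eT0 : (split (Th (-2) (eastT B))) => T0.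
have eT : Phi C (-2 + (l - 2)%N%:Z) (qop B) = ysplits C (l - 2) K 2 T0.
  rewrite /qop (Phi_ypow _ (k := k + 3)) //; last by rewrite mulrNz opprK; ring.
  by rewrite /Phi eT0; congr (ysplits _ _ _ _ _); ring.
have z0 : nN T0 = sp (-1) (e B).
  rewrite -eT0 /= !(i_0, e_0, sp_0, addr0, scaler0, subr0, sub0r, add0r, oppr0).
  by rewrite e_N sp_N opprK.
have w0 : nW T0 = 0.
  by rewrite -eT0 /= !(i_0, e_0, sp_0, addr0, scaler0, subr0, sub0r, add0r, oppr0).
have ds : d (sp (-1) (e B)) = 0.
  by rewrite d_sp (de C) dB e_0 oppr0 sp_0 (ee C) sp_0 scaler0 addr0.
pose f1 := x0 (sp (-1) (e B)).
(* Initially the northern component is eps B / sigma, which is closed but has a pole. The scalar of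
   the first y vanishes on it, leaving the exact form d f1 with f1 = delta_o (eps B / sigma) equal
   to -(l - 2) B to leading order. *)
have s1 : qshape 1 1 (ysplit K (2 * (K - 2)) T0).
  split=> /=; first by rewrite w0 z0 ds /LapF x00 !d_0 x00 !scaler0 !addr0 subr0.
  rewrite w0 z0 /LapF ds !x00 scaler0 subr0 addr0.
  have -> : 2 * (K - 2) - 2 * K + 4 = 0 by ring.
  rewrite scale0r addr0.
  exists f1, (f1 + (l%:R - 2) *: B); split=> //.
  - by lmod R F.
  - have heB : hasdeg (k + 2) (e B) by hdeg.
    rewrite /f1 (x0_sp _ heB) addNr sp0.
    have -> : (-1)%:~R - (m - 2 * (k + 2)) = - (l%:R - 2) :> R.
      by rewrite hm mulrN1z; ring.
    have -> : sp 1 (x (e B)) + - (l%:R - 2) *: i (e B) + (l%:R - 2) *: B =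
      sp 1 (x (e B)) - (l%:R - 2) *: (i (e B) - B) by lmod R F.
    by apply: OB; [apply/O_sp/reg_x/reg_e | apply/OZ/O_ie].
  - by rewrite /f1; hdeg.
  - by rewrite /f1 (x0x0 (p := k + 2)) //; hdeg.
have := qshape_steps (n := (l - 3)) (j := 1) _ s1; rewrite mul1r.
have -> : ysplits C (l - 3) K (2 - 1) (ysplit K (2 * (K - 2)) T0) =
    ysplits C (l - 2) K 2 T0.
  by have -> : (l - 2 = (l - 3).+1)%N by lia.
have -> : (1 + (l - 3) = l - 2)%N by lia.
have hl3 : (l - 3).+1%:R = l%:R - 2 :> R.
  by rewrite -hl; congr (_%:R); lia.
rewrite [X in qshape _ X](_ : _ = ((l - 3)`!)%:R ^+ 2); last first.
  by rewrite -qcoef_prod; apply: eq_bigr => a _; rewrite /qcoef hl3.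
move=> /(_ ltac:(lia)); rewrite -eT => -[eW [f [D [eN ef oD hD xf]]]].
have [Z GZ eZ] := OP oD.
have hZ : hasdeg (k + 1) Z by rewrite -(spNK C (l - 2)%N%:Z Z) -eZ; hdeg.
set pi := ((l - 3)`!)%:R ^+ 2 in ef *.
set c := l%:R - 2 in ef *.
have xD : x0 D = (c * pi) *: x0 B.
  have -> : D = f + (c * pi) *: B by rewrite ef; lmod R F.
  by rewrite x0D xf add0r x0Z.
have df : d f = d D by rewrite ef d_D d_Z dB scaler0 add0r.
have [rN rW rE rS] := qop_reg GB.
have eu : (l - 2)%N%:Z = -2 + (l - 2)%N%:Z + 2 by rewrite [RHS]addrC addrA addrN add0r.
have [u eu0] : exists u : int, -2 + (l - 2)%N%:Z = u by eexists.
move: eu eN eW {eT}; rewrite eu0 => eu eN eW; move: eN eW.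
case: (qop B) rN rW rE rS => N W E S rN rW rE rS.
rewrite Phi_north Phi_west => eN /eqP; rewrite subr_eq0 => /eqP eW.
(* The western Einstein component is 0, so W is determined by N. Inserted into the northern
   component, it completes the half-sums of eps iota N and iota eps N to sigma rho N. *)
have {}eW : W = sp (-1) (e N).
  by apply: (@sp_inj _ _ _ C (u + 0)); rewrite eW spD -addrA.
have eiW : sp (u + 1) (i W) = sp (u + 0) (i (e N)).
  by rewrite eW i_sp spD -addrA.
have erho : sp (u + 1) (rho N) =
    2^-1 *: (sp (u + 0) N - sp (u + 0) (e (i N)) - sp (u + 0) (i (e N))).
  have e1 : u + 1 - 1 = u + 0 by ring.
  by rewrite rhoE sp_Z spD e1 !sp_D !sp_N.
have edf : d f = sp (u + 2) (d Z) + c *: sp (u + 1) (e Z).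
  rewrite df eZ d_sp -pmulrn hl eu; congr (_ + _ *: sp _ _); ring.
(* The northern component equals d f = d (sigma^(l-2) Z), whose lowest term is (l - 2) sigma^(l-3)
   eps Z; here u + 1 = l - 3. *)
have eE : sp (u + 1) (e E) = sp (u + 1) (rho N) - sp (u + 2) S - sp (u + 2) (d Z)
    - c *: sp (u + 1) (e Z).
  have : sp (u + 2) (d Z) = d f - c *: sp (u + 1) (e Z) by rewrite edf; lmod R F.
  by move=> ->; rewrite -eN eiW erho; lmod R F.
exists (- c *: Z), (- c *: (x Z - (c * pi) *: H)), N, (- (S + d Z)); split.
- split=> //; first exact: regZ.
    apply/regZ/regB; [exact: reg_x | apply: regZ; exact: oH].
  by apply/regN/regD => //; exact: reg_d.
- apply: (@sp_inj _ _ _ C (u + 1)); rewrite !(e_D, e_N, e_Z, sp_D, sp_N, sp_Z) eE.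
  have e2 : u + 1 + 1 = u + 2 by ring.
  by rewrite !spD !e2; lmod R F.
- rewrite i_Z sp_Z; congr (_ *: _).
  (* At exponent l - 2 the coefficient of iota is -1, so the known value of delta_o D determines
     iota Z to first order. *)
  have := x0_sp (l - 2)%N%:Z hZ; rewrite -eZ xD -pmulrn hl.
  have -> : l%:R - 2 - (m - 2 * (k + 1)) = -1 :> R by rewrite hm; ring.
  rewrite scaleN1r => e1; apply: (@sp_inj _ _ _ C ((l - 2)%N%:Z + 1)).
  have -> : sp ((l - 2)%N%:Z + 1) (i Z) =
      sp ((l - 2)%N%:Z + 1) (sp 1 (x Z)) - (c * pi) *: x0 B.
    by rewrite e1 -sp_N -sp_D; congr (sp _ _); lmod R F.
  rewrite !sp_D !sp_N !sp_Z /H !spD; congr (_ - _ *: _).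
  have -> : (l - 2)%N%:Z + 1 + 1 - l%:Z = 0 by rewrite -subzn //; ring.
  by rewrite sp0.
- rewrite x_Z; have -> : (l - 2)`!%:R ^+ 2 = c ^+ 2 * pi :> R.
    have -> : (l - 2 = (l - 3).+1)%N by lia.
    by rewrite factS natrM hl3 exprMn.
  by lmod R F.
Qed.
End Closed.

(** The term sigma B1 allows for any extension of the same boundary value; by [qop_sp] it only
    changes S. *)
Theorem qop_leading B B1 : G B -> hasdeg (k + 1) B -> d B = 0 -> O l%:Z (x0 B) ->
  G B1 -> hasdeg (k + 1) B1 ->
  boundary_div (qop (B + sp 1 B1)) (- ((l - 2)`!)%:R ^+ 2 *: sp (- l%:Z) (x0 B)).
Proof.
move=> GB hB dB oH GB1 hB1.
have [Y [Y1 [N [S [[GY GY1 GN GS] eY iY xY]]]]] :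
    boundary_div (qop B) (- ((l - 2)`!)%:R ^+ 2 *: sp (- l%:Z) (x0 B)).
  have [l3|] := ltnP 2 l; first exact: qop_closed.
  move=> l2'; have el : l = 2%N by apply/eqP; rewrite eqn_leq l2' l2.
  have := qop_two GB hB oH el.
  by rewrite (_ : (l - 2)`! = 1%N) ?expr1n ?scaleN1r // el.
have [D GD eD] := OP (qop_sp hB1 GB1).
exists Y, Y1, N, (S + e D); split=> //.
  by split=> //; apply: regD => //; apply: reg_e.
rewrite qop_add //=; last by hdeg.
by rewrite eD addrAC e_D eY e_sp sp_D addrA.
Qed.
End QOperator.

(** * Forms over a ring with derivations *)

Section ExteriorAlgebra.
Context {O : comNzRingType} {m : nat}.
Local Notation cov := ({set 'I_m} -> O).
Implicit Types (a b : 'I_m) (A B : cov) (S : {set 'I_m}).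

(** The coordinate formulas of the exterior algebra again, now with coefficients in a ring on which
    derivations will act, instead of numbers at a point. *)
Definition gsgn a S : O := (-1) ^+ #|[pred j in S | (j < a)%N]|.
Definition geps a A : cov := fun S => if a \in S then gsgn a S * A (S :\ a)%SET else 0.
Definition giot a A : cov := fun S => if a \in S then 0 else gsgn a S * A (a |: S)%SET.
Definition gmul (f : O) A : cov := fun S => f * A S.

Lemma gsgn_sqr a S : gsgn a S * gsgn a S = 1.
Proof. by rewrite -expr2 sqrr_sign. Qed.

Lemma gsgnU a b S : b \notin S ->
  gsgn a (b |: S) = (-1) ^+ (b < a)%N * gsgn a S.
Proof.
move=> bS; rewrite /gsgn -exprD; congr (_ ^+ _).
rewrite (cardD1 b) !inE eqxx /=; congr (_ + _)%N.
apply: eq_card => j; rewrite !inE; case: eqP => [->|] //=.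
by rewrite (negbTE bS).
Qed.

Lemma gsgnD a b S : b \in S ->
  gsgn a (S :\ b) = (-1) ^+ (b < a)%N * gsgn a S.
Proof.
move=> bS; rewrite -{2}(finset.setD1K bS) gsgnU ?finset.setD11 // mulrA.
by rewrite -expr2 sqrr_sign mul1r.
Qed.

Lemma sign_flip a b : a != b -> (-1) ^+ (a < b)%N = - (-1) ^+ (b < a)%N :> O.
Proof. by rewrite -val_eqE /=; case: ltngtP => //= _ _; rewrite ?expr0 ?expr1 ?opprK. Qed.

Lemma geps_geps a b A : geps a (geps b A) = - geps b (geps a A).
Proof.
apply/funext => S; rewrite /geps /= opprfctE !finset.in_setD1.
have [<-|ab] := eqVneq a b; first by rewrite /= !mulr0 !if_same oppr0.
rewrite /=.
case: ifP => aS; case: ifP => bS; rewrite ?mulr0 ?oppr0 //.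
rewrite !gsgnD // (sign_flip ab) finset.setDDl finset.setUC -finset.setDDl.
ring.
Qed.

Lemma giot_giot a b A : giot a (giot b A) = - giot b (giot a A).
Proof.
apply/funext => S; rewrite /giot /= opprfctE !finset.in_setU1.
have [<-|ab] := eqVneq a b; first by rewrite /= !mulr0 !if_same oppr0.
rewrite /=.
case: ifPn => aS; case: ifPn => bS; rewrite ?mulr0 ?oppr0 //.
rewrite !gsgnU // (sign_flip ab) finset.setUCA.
ring.
Qed.

Lemma geps_giot a b A :
  geps a (giot b A) = (if a == b then A else 0) - giot b (geps a A).
Proof.
apply/funext => S; rewrite /geps /giot /= addrfctE opprfctE finset.in_setD1 finset.in_setU1.
have [<-|ab] := eqVneq a b.
  rewrite /=; case: ifPn => aS; last first.
    by rewrite finset.setU1K // gsgnU // ltnn expr0 mul1r mulrA gsgn_sqr mul1r subrr.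
  by rewrite finset.setD1K // gsgnD // ltnn expr0 mul1r mulrA gsgn_sqr mul1r subr0.
rewrite add0r /=.
case: ifPn => aS; case: ifPn => bS; rewrite ?mulr0 ?oppr0 //.
rewrite gsgnD // gsgnU // (sign_flip ab).
have -> : (b |: S :\ a)%SET = ((b |: S) :\ a)%SET.
  by apply/finset.setP => j; rewrite !inE; case: (eqVneq j b) => [->|] //=; rewrite eq_sym ab.
ring.
Qed.

Lemma gepsD a A B : geps a (A + B) = geps a A + geps a B.
Proof. by apply/funext => S; rewrite /geps /= !addrfctE; case: ifP; rewrite ?addr0 ?mulrDr. Qed.
Lemma giotD a A B : giot a (A + B) = giot a A + giot a B.
Proof. by apply/funext => S; rewrite /giot /= !addrfctE; case: ifP; rewrite ?addr0 ?mulrDr. Qed.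
Lemma gmulD f A B : gmul f (A + B) = gmul f A + gmul f B.
Proof. by apply/funext => S; rewrite /gmul /= !addrfctE mulrDr. Qed.
Lemma geps0 a : geps a 0 = 0.
Proof. by apply/funext => S; rewrite /geps /= mulr0 if_same. Qed.
Lemma giot0 a : giot a 0 = 0.
Proof. by apply/funext => S; rewrite /giot /= mulr0 if_same. Qed.
Lemma gmul0 f : gmul f 0 = 0.
Proof. by apply/funext => S; rewrite /gmul /= mulr0. Qed.
Lemma g0mul A : gmul 0 A = 0.
Proof. by apply/funext => S; rewrite /gmul /= mul0r. Qed.
Lemma g1mul A : gmul 1 A = A.
Proof. by apply/funext => S; rewrite /gmul /= mul1r. Qed.
Lemma gmulDl f h A : gmul (f + h) A = gmul f A + gmul h A.
Proof. by apply/funext => S; rewrite /gmul /= !addrfctE mulrDl. Qed.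
Lemma gmulNl f A : gmul (- f) A = - gmul f A.
Proof. by apply/funext => S; rewrite /gmul /= !opprfctE mulNr. Qed.
Lemma gmulN f A : gmul f (- A) = - gmul f A.
Proof. by apply/funext => S; rewrite /gmul /= !opprfctE mulrN. Qed.
Lemma gepsN a A : geps a (- A) = - geps a A.
Proof. by apply/funext => S; rewrite /geps /= !opprfctE; case: ifP; rewrite ?oppr0 ?mulrN. Qed.
Lemma giotN a A : giot a (- A) = - giot a A.
Proof. by apply/funext => S; rewrite /giot /= !opprfctE; case: ifP; rewrite ?oppr0 ?mulrN. Qed.
Lemma gmulA f h A : gmul f (gmul h A) = gmul (f * h) A.
Proof. by apply/funext => S; rewrite /gmul /= mulrA. Qed.
Lemma geps_mul a f A : geps a (gmul f A) = gmul f (geps a A).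
Proof. by apply/funext => S; rewrite /geps /gmul /=; case: ifP; rewrite ?mulr0 // mulrCA. Qed.
Lemma giot_mul a f A : giot a (gmul f A) = gmul f (giot a A).
Proof. by apply/funext => S; rewrite /giot /gmul /=; case: ifP; rewrite ?mulr0 // mulrCA. Qed.

Lemma geps_sum a (I : Type) (r : seq I) (P : pred I) (A_ : I -> cov) :
  geps a (\sum_(i <- r | P i) A_ i) = \sum_(i <- r | P i) geps a (A_ i).
Proof. exact: (big_morph _ (gepsD a) (geps0 a)). Qed.
Lemma giot_sum a (I : Type) (r : seq I) (P : pred I) (A_ : I -> cov) :
  giot a (\sum_(i <- r | P i) A_ i) = \sum_(i <- r | P i) giot a (A_ i).
Proof. exact: (big_morph _ (giotD a) (giot0 a)). Qed.
Lemma gmul_sum f (I : Type) (r : seq I) (P : pred I) (A_ : I -> cov) :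
  gmul f (\sum_(i <- r | P i) A_ i) = \sum_(i <- r | P i) gmul f (A_ i).
Proof. exact: (big_morph _ (gmulD f) (gmul0 f)). Qed.
Lemma gmul_suml A (I : Type) (r : seq I) (P : pred I) (f_ : I -> O) :
  gmul (\sum_(i <- r | P i) f_ i) A = \sum_(i <- r | P i) gmul (f_ i) A.
Proof. by apply: (big_morph (gmul^~ A)) => [f h|]; rewrite ?gmulDl ?g0mul. Qed.

Lemma geps_set0 a A : geps a A finset.set0 = 0.
Proof. by rewrite /geps finset.in_set0. Qed.

(** Up to sign, a component is the degree-0 part of an iterated contraction. This reduces identities
    between forms to scalar ones. *)
Lemma giot_inj A : (forall s : seq 'I_m, foldr giot A s finset.set0 = 0) -> A = 0.
Proof.
move=> h; apply/funext => S; rewrite /=.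
pose fs (s : seq 'I_m) : {set 'I_m} := finset.finset (fun j => j \in s).
suff H s (B : cov) : (forall t, foldr giot B t finset.set0 = 0) -> uniq s ->
    B (fs s) = 0.
  have := H (enum S) A h (enum_uniq _); congr (A _ = 0).
  by apply/finset.setP => j; rewrite finset.in_set mem_enum.
elim: s B => [|a s IH] B hB /=.
  have -> : fs [::] = finset.set0 by apply/finset.setP => j; rewrite !finset.in_set.
  by move=> _; exact: (hB [::]).
move=> /andP[aS us].
have H0 t : foldr giot (giot a B) t finset.set0 = 0.
  by have := hB (rcons t a); rewrite foldr_rcons.
have := IH (giot a B) H0 us; rewrite /giot finset.in_set (negbTE aS).
move=> /(congr1 ( *%R (gsgn a (fs s)))); rewrite mulr0 mulrA gsgn_sqr mul1r => <-.
by congr B; apply/finset.setP => j; rewrite finset.in_setU1 !finset.in_set in_cons.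
Qed.
End ExteriorAlgebra.

(** * Riemannian geometry over a ring with derivations *)

Section Metric.
Context {R : realType} {O : comAlgType R} {m : nat} (D : 'I_m -> O -> O).
Hypothesis DD : forall a f h, D a (f + h) = D a f + D a h.
Hypothesis DM : forall a f h, D a (f * h) = D a f * h + f * D a h.
Hypothesis DZ : forall a (r : R) f, D a (r *: f) = r *: D a f.
Hypothesis DC : forall a b f, D a (D b f) = D b (D a f).
Implicit Types (a b c e : 'I_m).

Lemma D0 a : D a 0 = 0.
Proof. by have := DZ a 0 0; rewrite !scale0r. Qed.

Lemma D1 a : D a 1 = 0.
Proof.
have := DM a 1 1; rewrite !mulr1 mul1r => /eqP.
by rewrite -subr_eq0 opprD addrA subrr add0r oppr_eq0 => /eqP.
Qed.

Lemma DN a f : D a (- f) = - D a f.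
Proof. by rewrite -scaleN1r DZ scaleN1r. Qed.

Lemma DB a f h : D a (f - h) = D a f - D a h.
Proof. by rewrite DD DN. Qed.

Lemma DA a (r : R) : D a (r%:A) = 0.
Proof. by rewrite DZ D1 scaler0. Qed.

Lemma D_sum a (I : Type) (r : seq I) (P : pred I) (f : I -> O) :
  D a (\sum_(i <- r | P i) f i) = \sum_(i <- r | P i) D a (f i).
Proof. exact: (big_morph _ (DD a) (D0 a)). Qed.

Definition dM a (M : 'M[O]_m) : 'M[O]_m := map_mx (D a) M.

Lemma dM_mul a M N : dM a (M *m N) = dM a M *m N + M *m dM a N.
Proof.
apply/matrixP => i j; rewrite !mxE D_sum -big_split /=.
by apply: eq_bigr => k _; rewrite !mxE DM.
Qed.

Lemma dM_1 a : dM a 1%:M = 0.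
Proof.
by apply/matrixP => i j; rewrite !mxE; case: eqP => _; rewrite ?mulr1n ?D1 ?D0.
Qed.

Lemma D_trace a M : D a (\tr M) = \tr (dM a M).
Proof. by rewrite /mxtrace D_sum; apply: eq_bigr => i _; rewrite mxE. Qed.

Variables g gi : 'M[O]_m.
Hypothesis gT : g^T = g.
Hypothesis gig : gi *m g = 1%:M.

Lemma ggi : g *m gi = 1%:M.
Proof. exact: mulmx1C. Qed.

Lemma giT : gi^T = gi.
Proof.
have h : gi^T *m g = 1%:M by rewrite -[X in _ *m X]gT -trmx_mul ggi trmx1.
by rewrite -[gi^T]mulmx1 -ggi mulmxA h mul1mx.
Qed.

Lemma g_sym a b : g a b = g b a.
Proof. by rewrite -[in LHS]gT mxE. Qed.

Lemma gi_sym a b : gi a b = gi b a.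
Proof. by rewrite -[in LHS]giT mxE. Qed.

Definition hf : O := (2^-1)%:A.

Lemma hf2 : hf + hf = 1.
Proof.
rewrite /hf -scalerDl (_ : 2^-1 + 2^-1 = 1) ?scale1r //; by field.
Qed.

(* Christoffel symbols, with the derivative direction as index of the matrix. *)
Definition low a : 'M[O]_m :=
  \matrix_(e, b) (hf * (D a (g b e) + D b (g a e) - D e (g a b))).
Definition gam a : 'M[O]_m := gi *m low a.

Lemma gamC c a b : gam a c b = gam b c a.
Proof.
rewrite !mxE; apply: eq_bigr => e _; rewrite !mxE (g_sym a b); ring.
Qed.

Lemma compat a : dM a g = (gam a)^T *m g + g *m gam a.
Proof.
rewrite /gam mulmxA ggi mul1mx trmx_mul giT -mulmxA gig mulmx1.
apply/matrixP => b c; rewrite !mxE (g_sym c b).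
have {1}-> : D a (g b c) = (hf + hf) * D a (g b c) by rewrite hf2 mul1r.
rewrite (g_sym a b) (g_sym a c); ring.
Qed.

Lemma dgi a : dM a gi = - (gi *m (gam a)^T + gam a *m gi).
Proof.
have h : dM a gi *m g = - (gi *m dM a g).
  by apply/eqP; rewrite -addr_eq0 -dM_mul gig dM_1.
rewrite -[dM a gi]mulmx1 -ggi mulmxA h compat mulmxDr mulNmx; congr (- _).
by rewrite mulmxDl -!mulmxA ggi mulmx1 !mulmxA gig mul1mx.
Qed.

Definition ctr a : O := \sum_c gam c c a.

(** The part of [low] antisymmetric in its two matrix indices has zero trace against the symmetric
    inverse metric. *)
Lemma trE a : ctr a = hf * \tr (gi *m dM a g).
Proof.
rewrite /ctr; under eq_bigr => c _ do rewrite gamC.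
rewrite -/(mxtrace (gam a)) /gam.
have -> : low a = hf *: (dM a g + \matrix_(e, b) (D b (g a e) - D e (g a b))).
  by apply/matrixP => e b; rewrite !mxE (g_sym b e) addrA.
rewrite -scalemxAr linearZ /= mulmxDr linearD /=; congr (_ * _).
rewrite [X in _ + X](_ : _ = 0) ?addr0 //.
set B := \matrix_(e, b) _; suff h : \tr (gi *m B) = - \tr (gi *m B).
  have : (hf + hf) * \tr (gi *m B) = 0 by rewrite mulrDl {1}h mulrN addNr.
  by rewrite hf2 mul1r.
rewrite -{1}mxtrace_tr trmx_mul giT mxtrace_mulC -[RHS]linearN /= -mulmxN.
by congr (\tr (_ *m _)); apply/matrixP => e b; rewrite !mxE opprB.
Qed.

(** [ctr] is the logarithmic derivative of the volume density. Neither a square root nor a logarithm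
    of the determinant need exist in the ring, so closedness comes from differentiating the trace
    formula. *)
Lemma tr_closed a b : D a (ctr b) = D b (ctr a).
Proof.
have h c e : D c (ctr e) = hf * (\tr (gi *m dM c (dM e g))
    - \tr (gi *m dM c g *m gi *m dM e g)).
  rewrite trE DM DA mul0r add0r D_trace dM_mul linearD /= addrC; congr (_ * (_ + _)).
  have -> : dM c gi = - (gi *m dM c g *m gi).
    rewrite dgi compat mulmxDr mulmxDl -!mulmxA ggi mulmx1 !mulmxA gig mul1mx.
    by [].
  by rewrite mulNmx linearN.
rewrite !h; congr (_ * (_ - _)); last by rewrite -mulmxA mxtrace_mulC !mulmxA.
by congr (\tr (_ *m _)); apply/matrixP => i j; rewrite !mxE DC.
Qed.
End Metric.

Lemma antisum0 (R : realType) (V : lmodType R) (I : finType) (F : I -> I -> V) :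
  (forall a b, F a b = - F b a) -> \sum_a \sum_b F a b = 0.
Proof.
move=> h; set s := LHS; have : s = - s.
  rewrite /s {1}exchange_big /= -sumrN; apply: eq_bigr => a _.
  by rewrite -sumrN; apply: eq_bigr => b _; rewrite h.
move/eqP; rewrite -addr_eq0 -mulr2n -scaler_nat scaler_eq0 pnatr_eq0 /=.
by move/eqP.
Qed.

(** * Covariant derivatives of forms *)

Section MetricForms.
Context {R : realType} {O : comAlgType R} {m : nat} (D : 'I_m -> O -> O).
Hypothesis DD : forall a f h, D a (f + h) = D a f + D a h.
Hypothesis DM : forall a f h, D a (f * h) = D a f * h + f * D a h.
Hypothesis DZ : forall a (r : R) f, D a (r *: f) = r *: D a f.
Hypothesis DC : forall a b f, D a (D b f) = D b (D a f).
Local Notation cov := ({set 'I_m} -> O).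
Implicit Types (a b c e : 'I_m) (A B : cov) (S : {set 'I_m}) (u v : 'I_m -> O).
Let D_0 := D0 DZ.
Let D_1 := D1 DM.
Let D_N := DN DZ.

Definition gD a A : cov := fun S => D a (A S).

Lemma gDD a A B : gD a (A + B) = gD a A + gD a B.
Proof. by apply/funext => S; rewrite /gD /= !addrfctE DD. Qed.
Lemma gD0 a : gD a 0 = 0.
Proof. by apply/funext => S; rewrite /gD /= D_0. Qed.
Lemma gDZ a (r : R) A : gD a (r *: A) = r *: gD a A.
Proof. by apply/funext => S; rewrite /gD /= DZ. Qed.
Lemma gD_sum a (I : Type) (r : seq I) (P : pred I) (A_ : I -> cov) :
  gD a (\sum_(i <- r | P i) A_ i) = \sum_(i <- r | P i) gD a (A_ i).
Proof. exact: (big_morph _ (gDD a) (gD0 a)). Qed.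
Lemma gD_mul a f A : gD a (gmul f A) = gmul (D a f) A + gmul f (gD a A).
Proof. by apply/funext => S; rewrite /gD /gmul /= DM. Qed.
Lemma gDC a b A : gD a (gD b A) = gD b (gD a A).
Proof. by apply/funext => S; rewrite /gD DC. Qed.

Lemma D_sgn a b S f : D a (gsgn b S * f) = gsgn b S * D a f.
Proof.
by rewrite /gsgn -signr_odd; case: odd; rewrite ?expr0 ?expr1 ?mul1r ?mulN1r ?D_N.
Qed.

Lemma gD_eps a b A : gD a (geps b A) = geps b (gD a A).
Proof. by apply/funext => S; rewrite /gD /geps; case: ifP; rewrite ?D_sgn ?D_0. Qed.
Lemma gD_iot a b A : gD a (giot b A) = giot b (gD a A).
Proof. by apply/funext => S; rewrite /gD /giot; case: ifP; rewrite ?D_sgn ?D_0. Qed.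

Lemma gepsZ a (r : R) A : geps a (r *: A) = r *: geps a A.
Proof. by apply/funext => S; rewrite /geps /= !scalrfctE; case: ifP; rewrite ?scaler0 // scalerAr. Qed.
Lemma giotZ a (r : R) A : giot a (r *: A) = r *: giot a A.
Proof. by apply/funext => S; rewrite /giot /= !scalrfctE; case: ifP; rewrite ?scaler0 // scalerAr. Qed.
Lemma gmulZ f (r : R) A : gmul f (r *: A) = r *: gmul f A.
Proof. by apply/funext => S; rewrite /gmul /= !scalrfctE scalerAr. Qed.
Lemma gmulZl f (r : R) A : gmul (r *: f) A = r *: gmul f A.
Proof. by apply/funext => S; rewrite /gmul /= !scalrfctE scalerAl. Qed.

Definition gd A : cov := \sum_a geps a (gD a A).

Lemma gd_dd A : gd (gd A) = 0.
Proof.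
rewrite /gd; under eq_bigr => a _ do rewrite gD_sum geps_sum.
by apply: antisum0 => a b; rewrite !gD_eps geps_geps gDC.
Qed.

Definition eps1 u A : cov := \sum_a gmul (u a) (geps a A).

Lemma gd_mul f A : gd (gmul f A) = gmul f (gd A) + eps1 (D^~ f) A.
Proof.
rewrite /gd /eps1 gmul_sum -big_split /=; apply: eq_bigr => a _.
by rewrite gD_mul gepsD !geps_mul addrC.
Qed.

Variables g gi : 'M[O]_m.
Hypothesis gT : g^T = g.
Hypothesis gig : gi *m g = 1%:M.
Let giC := gi_sym gT gig.
Local Notation gam := (gam D g gi).
Local Notation ctr := (ctr D g gi).

(** Contraction with the vector metrically dual to dx^a. *)
Definition up a A : cov := \sum_b gmul (gi a b) (giot b A).

Lemma upD a A B : up a (A + B) = up a A + up a B.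
Proof. by rewrite /up -big_split; apply: eq_bigr => b _; rewrite giotD gmulD. Qed.
Lemma up0 a : up a 0 = 0.
Proof. by rewrite /up big1 // => b _; rewrite giot0 gmul0. Qed.
Lemma upN a A : up a (- A) = - up a A.
Proof. by apply/eqP; rewrite -addr_eq0 -upD addNr up0. Qed.
Lemma up_sum a (I : Type) (r : seq I) (P : pred I) (A_ : I -> cov) :
  up a (\sum_(i <- r | P i) A_ i) = \sum_(i <- r | P i) up a (A_ i).
Proof. exact: (big_morph _ (upD a) (up0 a)). Qed.
Lemma up_mul a f A : up a (gmul f A) = gmul f (up a A).
Proof.
by rewrite /up gmul_sum; apply: eq_bigr => b _; rewrite giot_mul !gmulA mulrC.
Qed.
Lemma upZ a (r : R) A : up a (r *: A) = r *: up a A.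
Proof. by rewrite /up scaler_sumr; apply: eq_bigr => b _; rewrite giotZ gmulZ. Qed.

Lemma up_iot a b A : up a (giot b A) = - giot b (up a A).
Proof.
rewrite /up giot_sum -sumrN; apply: eq_bigr => c _.
by rewrite giot_mul giot_giot gmulN.
Qed.

Lemma up_up a b A : up a (up b A) = - up b (up a A).
Proof.
rewrite {2 4}/up up_sum -sumrN; apply: eq_bigr => c _.
by rewrite up_mul up_iot gmulN.
Qed.

Lemma eps_up a b A : geps a (up b A) = gmul (gi b a) A - up b (geps a A).
Proof.
rewrite /up geps_sum.
under eq_bigr => c _ do rewrite geps_mul geps_giot gmulD gmulN.
rewrite big_split /= sumrN; congr (_ - _).
rewrite (bigD1 a) //= eqxx big1 ?addr0 // => c ca.
by rewrite eq_sym (negbTE ca) gmul0.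
Qed.

Lemma iot_up a A : giot a A = \sum_b gmul (g a b) (up b A).
Proof.
rewrite /up; under eq_bigr => b _ do rewrite gmul_sum.
rewrite exchange_big /= (bigD1 a) //= [X in _ + X]big1 ?addr0 => [|c ca]; last first.
  under eq_bigr => b _ do rewrite gmulA.
  rewrite -gmul_suml; have := congr1 (fun M : 'M[O]_m => M a c) (ggi gig).
  by rewrite !mxE eq_sym (negbTE ca) => ->; rewrite g0mul.
under eq_bigr => b _ do rewrite gmulA.
rewrite -gmul_suml; have := congr1 (fun M : 'M[O]_m => M a a) (ggi gig).
by rewrite !mxE eqxx => ->; rewrite g1mul.
Qed.

Definition nab a A : cov :=
  gD a A - \sum_b \sum_c gmul (gam a c b) (geps b (giot c A)).

Lemma nabD a A B : nab a (A + B) = nab a A + nab a B.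
Proof.
rewrite /nab gDD addrACA -opprD -big_split /=; congr (_ - _).
apply: eq_bigr => b _; rewrite -big_split; apply: eq_bigr => c _ /=.
by rewrite giotD gepsD gmulD.
Qed.
Lemma nab0 a : nab a 0 = 0.
Proof. by apply: (addrI (nab a 0)); rewrite -nabD !addr0. Qed.
Lemma nab_sum a (I : Type) (r : seq I) (P : pred I) (A_ : I -> cov) :
  nab a (\sum_(i <- r | P i) A_ i) = \sum_(i <- r | P i) nab a (A_ i).
Proof. exact: (big_morph _ (nabD a) (nab0 a)). Qed.
Lemma nabZ a (r : R) A : nab a (r *: A) = r *: nab a A.
Proof.
rewrite /nab gDZ scalerDr scalerN scaler_sumr; congr (_ - _).
apply: eq_bigr => b _; rewrite scaler_sumr; apply: eq_bigr => c _ /=.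
by rewrite giotZ gepsZ gmulZ.
Qed.
Lemma nab_mul a f A : nab a (gmul f A) = gmul (D a f) A + gmul f (nab a A).
Proof.
rewrite /nab gD_mul gmulD gmulN gmul_sum addrA; congr (_ - _).
apply: eq_bigr => b _; rewrite gmul_sum; apply: eq_bigr => c _ /=.
by rewrite giot_mul geps_mul !gmulA mulrC.
Qed.

Lemma nab_set0 a A : nab a A finset.set0 = D a (A finset.set0).
Proof.
rewrite /nab addrfctE opprfctE fct_sumE big1 ?oppr0 ?addr0 // => b _.
by rewrite fct_sumE big1 // => c _; rewrite /gmul geps_set0 mulr0.
Qed.

(** Of the two Christoffel terms in the derivative of the inverse metric, one cancels against the
    connection acting on the form; the term of the raised index b remains. *)
Lemma nab_up a b A :
  nab a (up b A) = up b (nab a A) - \sum_c gmul (gam a b c) (up c A).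
Proof.
have -> : nab a (up b A) = up b (nab a A) + \sum_c gmul (D a (gi b c)) (giot c A)
    + \sum_p \sum_q gmul (gam a q p * gi b p) (giot q A).
  rewrite /nab upD upN up_sum.
  have -> : gD a (up b A) = up b (gD a A) + \sum_c gmul (D a (gi b c)) (giot c A).
    rewrite /up gD_sum -big_split; apply: eq_bigr => c _ /=.
    by rewrite gD_mul gD_iot addrC.
  have zm (p q r t : cov) : p + q - (r - t) = p - r + q + t.
    by rewrite opprB [t - r]addrC !addrA; congr (_ + _); exact: addrAC.
  rewrite -zm; congr (_ - _); rewrite -sumrB; apply: eq_bigr => p _.
  rewrite up_sum -sumrB.
  apply: eq_bigr => q _; rewrite up_mul -gmulA -gmulN -gmulD; congr gmul.
  have -> : geps p (giot q (up b A)) = - geps p (up b (giot q A)).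
    by rewrite up_iot gepsN opprK.
  by rewrite eps_up opprB.
rewrite -addrA; congr (_ + _).
rewrite [X in _ + X = _]exchange_big -big_split /=.
have h c : D a (gi b c) = - (\sum_p gi b p * gam a c p + \sum_p gam a b p * gi p c).
  have := congr1 (fun M : 'M[O]_m => M b c) (dgi DD DM DZ gT gig a).
  by rewrite !mxE => ->; congr (- (_ + _)); apply: eq_bigr => p _; rewrite mxE.
rewrite -sumrN [RHS](_ : _ = \sum_c - \sum_p gmul (gam a b p * gi p c) (giot c A)).
  apply: eq_bigr => c _; rewrite h gmulNl gmulDl opprD addrAC -!gmul_suml.
  rewrite (eq_bigr (fun p => gam a c p * gi b p)) => [|p _]; last by rewrite mulrC.
  by rewrite addNr add0r.
rewrite !sumrN exchange_big; congr (- _); apply: eq_bigr => c _ /=.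
by rewrite /up gmul_sum; apply: eq_bigr => p _; rewrite gmulA.
Qed.

Lemma nab_eps a b A :
  nab a (geps b A) = geps b (nab a A) - \sum_p gmul (gam a b p) (geps p A).
Proof.
rewrite /nab gD_eps gepsD gepsN geps_sum -addrA -opprD -big_split /=; congr (_ - _).
apply: eq_bigr => p _; rewrite geps_sum.
have h q : gmul (gam a q p) (geps p (giot q (geps b A))) =
    geps b (gmul (gam a q p) (geps p (giot q A)))
    + (if b == q then gmul (gam a b p) (geps p A) else 0).
  have -> : giot q (geps b A) = (if b == q then A else 0) - geps b (giot q A).
    by rewrite geps_giot opprB addrC subrK.
  rewrite gepsD gepsN (geps_geps p) opprK gmulD addrC geps_mul; congr (_ + _).
  by case: (eqVneq b q) => [<-|_]; rewrite ?geps0 ?gmul0.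
under eq_bigr => q _ do rewrite h.
rewrite big_split /=; congr (_ + _).
by rewrite -big_mkcond /= (bigD1 b) //= big1 ?addr0 // => q /andP[/eqP-> /eqP].
Qed.
End MetricForms.

Lemma module_regroup (R : realType) (F : lmodType R) (p q t z : F) :
  q + p - (- z + q + (t - p)) - z = 2 *: p - t.
Proof. lmod R F. Qed.

(** * The codifferential *)

Section Codifferential.
Context {R : realType} {O : comAlgType R} {m : nat} (D : 'I_m -> O -> O).
Hypothesis DD : forall a f h, D a (f + h) = D a f + D a h.
Hypothesis DM : forall a f h, D a (f * h) = D a f * h + f * D a h.
Hypothesis DZ : forall a (r : R) f, D a (r *: f) = r *: D a f.
Hypothesis DC : forall a b f, D a (D b f) = D b (D a f).
Variables g gi : 'M[O]_m.
Hypothesis gT : g^T = g.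
Hypothesis gig : gi *m g = 1%:M.
Local Notation cov := ({set 'I_m} -> O).
Implicit Types (a b c e : 'I_m) (A B : cov) (S : {set 'I_m}) (u v : 'I_m -> O).
Let D_0 := D0 DZ.
Let D_N := DN DZ.
Let giC := gi_sym gT gig.
Local Notation gam := (gam D g gi).
Local Notation ctr := (ctr D g gi).
Local Notation up := (up gi).
Local Notation nab := (nab D g gi).
Local Notation gd := (gd D).
Let gamC := gamC D gi gT.

Lemma up_addsum a A (I : Type) (r : seq I) (P : pred I) (A_ : I -> cov) :
  up a (A + \sum_(i <- r | P i) A_ i) = up a A + \sum_(i <- r | P i) up a (A_ i).
Proof. by rewrite upD; congr (_ + _); exact: up_sum. Qed.

Lemma eps_addsum a A (I : Type) (r : seq I) (P : pred I) (A_ : I -> cov) :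
  geps a (A + \sum_(i <- r | P i) A_ i) = geps a A + \sum_(i <- r | P i) geps a (A_ i).
Proof. by rewrite gepsD; congr (_ + _); exact: geps_sum. Qed.

Definition gx A : cov := \sum_a up a (nab a A).

Lemma gxD A B : gx (A + B) = gx A + gx B.
Proof. by rewrite /gx -big_split; apply: eq_bigr => a _; rewrite nabD // upD. Qed.
Lemma gx0 : gx 0 = 0.
Proof. by apply: (addrI (gx 0)); rewrite -gxD !addr0. Qed.
Lemma gxN A : gx (- A) = - gx A.
Proof. by apply/eqP; rewrite -addr_eq0 -gxD addNr gx0. Qed.
Lemma gxZ (r : R) A : gx (r *: A) = r *: gx A.
Proof. by rewrite /gx scaler_sumr; apply: eq_bigr => a _; rewrite nabZ // upZ. Qed.

Lemma nab_upC a b A :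
  up b (nab a A) = nab a (up b A) + \sum_c gmul (gam a b c) (up c A).
Proof. by rewrite (nab_up DD DM DZ gT gig) subrK. Qed.

Lemma sum_gam_up2 b A : \sum_a \sum_c gmul (gam a b c) (up a (up c A)) = 0.
Proof. by apply: antisum0 => a c; rewrite up_up gmulN gamC. Qed.

(** The dual of d eps(dx^b) = - eps(dx^b) d: the Christoffel symbol is symmetric in the two indices
    that the anticommuting contractions sum over. *)
Lemma gx_up b A : gx (up b A) = - up b (gx A).
Proof.
rewrite /gx up_sum -sumrN.
under eq_bigr => a _ do
  rewrite (nab_up DD DM DZ gT gig) -sumrN up_addsum up_up.
rewrite big_split /=.
rewrite [X in _ + X](_ : _ = 0) ?addr0 //.
apply/eqP; rewrite -oppr_eq0 -sumrN; apply/eqP; rewrite -[RHS](sum_gam_up2 b A).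
apply: eq_bigr => a _; rewrite -sumrN; apply: eq_bigr => c _.
by rewrite upN opprK up_mul.
Qed.

Lemma gx_set0 A : gx A finset.set0 =
  \sum_a (D a (up a A finset.set0) + ctr a * up a A finset.set0).
Proof.
rewrite /gx fct_sumE; under eq_bigr => a _ do rewrite nab_upC addrfctE nab_set0.
rewrite !big_split /=; congr (_ + _).
under eq_bigr => a _ do rewrite fct_sumE.
rewrite exchange_big; apply: eq_bigr => c _ /=; rewrite /ctr mulr_suml.
by apply: eq_bigr.
Qed.

(** A double divergence of an antisymmetric array: second derivatives commute, and the terms with
    [ctr] cancel by [tr_closed]. *)
Lemma gx_gx_set0 A : gx (gx A) finset.set0 = 0.
Proof.
rewrite gx_set0.
have h a : up a (gx A) finset.set0 = - \sum_b (D b (up b (up a A) finset.set0)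
    + ctr b * up b (up a A) finset.set0).
  by rewrite -gx_set0 gx_up opprfctE opprK.
under eq_bigr => a _ do rewrite h.
rewrite [RHS](_ : _ = - \sum_a \sum_b (D a (D b (up b (up a A) finset.set0)
  + ctr b * up b (up a A) finset.set0)
  + ctr a * (D b (up b (up a A) finset.set0) + ctr b * up b (up a A) finset.set0))).
  rewrite -sumrN; apply: eq_bigr => a _.
  by rewrite D_N (D_sum DD DZ) mulrN mulr_sumr -opprD -big_split.
rewrite antisum0 ?oppr0 // => a b.
rewrite !DD !DM (DC a b) up_up opprfctE !D_N (tr_closed DD DM DZ DC gT gig a b).
ring.
Qed.

Lemma up_inj A : (forall s : seq 'I_m, foldr up A s finset.set0 = 0) -> A = 0.
Proof.
move=> hA; apply: giot_inj => s; elim/last_ind: s A hA => [|s a IH] A hA.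
  exact: (hA [::]).
rewrite foldr_rcons; apply: IH => t.
have fl (I : Type) (r : seq I) (f_ : I -> O) (A_ : I -> cov) :
  foldr up (\sum_(i <- r) gmul (f_ i) (A_ i)) t =
    \sum_(i <- r) gmul (f_ i) (foldr up (A_ i) t).
  elim: t => [//|b t IHt] /=; rewrite IHt up_sum.
  by apply: eq_bigr => i _; rewrite up_mul.
rewrite (iot_up gig) fl fct_sumE big1 // => b _.
by have := hA (rcons t b); rewrite foldr_rcons /gmul => ->; rewrite mulr0.
Qed.

(** Contractions anticommute with the codifferential, so every scalar component of delta delta A is
    the degree-0 part of some delta delta B. *)
Lemma gx_gx A : gx (gx A) = 0.
Proof.
apply: up_inj => s.
have [B ->] : exists B, foldr up (gx (gx A)) s = gx (gx B).
  elim: s => [|a s [B hB]] /=; first by exists A.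
  by rewrite hB; exists (up a B); rewrite !gx_up gxN gx_up opprK.
exact: gx_gx_set0.
Qed.

Definition iot1 u A : cov := \sum_a gmul (u a) (up a A).

Lemma gx_mul f A : gx (gmul f A) = gmul f (gx A) + iot1 (D^~ f) A.
Proof.
rewrite /gx /iot1 gmul_sum -big_split /=; apply: eq_bigr => a _.
by rewrite nab_mul // upD !up_mul addrC.
Qed.

Definition gpair u v : O := \sum_a \sum_b gi a b * u a * v b.

Lemma eps1_iot1 u v A :
  eps1 u (iot1 v A) + iot1 v (eps1 u A) = gmul (gpair u v) A.
Proof.
rewrite /eps1 /iot1 /gpair gmul_suml.
under [X in _ + X]eq_bigr => b _ do rewrite up_sum gmul_sum.
rewrite [X in _ + X]exchange_big -big_split; apply: eq_bigr => a _ /=.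
rewrite geps_sum gmul_sum gmul_suml -big_split; apply: eq_bigr => b _ /=.
rewrite geps_mul eps_up up_mul !gmulA gmulD gmulN !gmulA [v b * u a]mulrC.
by rewrite subrK (giC b a) [X in gmul X]mulrC mulrA.
Qed.

Lemma eps1_D u A B : eps1 u (A + B) = eps1 u A + eps1 u B.
Proof. by rewrite /eps1 -big_split; apply: eq_bigr => a _; rewrite gepsD gmulD. Qed.
Lemma iot1_D u A B : iot1 u (A + B) = iot1 u A + iot1 u B.
Proof. by rewrite /iot1 -big_split; apply: eq_bigr => a _; rewrite upD gmulD. Qed.
Lemma eps1_Z u (r : R) A : eps1 u (r *: A) = r *: eps1 u A.
Proof. by rewrite /eps1 scaler_sumr; apply: eq_bigr => a _; rewrite gepsZ gmulZ. Qed.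
Lemma iot1_Z u (r : R) A : iot1 u (r *: A) = r *: iot1 u A.
Proof. by rewrite /iot1 scaler_sumr; apply: eq_bigr => a _; rewrite upZ gmulZ. Qed.
Lemma eps1_mul u f A : eps1 u (gmul f A) = gmul f (eps1 u A).
Proof.
by rewrite /eps1 gmul_sum; apply: eq_bigr => a _; rewrite geps_mul !gmulA mulrC.
Qed.
Lemma iot1_mul u f A : iot1 u (gmul f A) = gmul f (iot1 u A).
Proof.
by rewrite /iot1 gmul_sum; apply: eq_bigr => a _; rewrite up_mul !gmulA mulrC.
Qed.

Definition ghess u a b : O := D a (u b) - \sum_c gam a c b * u c.

Lemma nab_eps1 u a A : nab a (eps1 u A) =
  eps1 u (nab a A) + \sum_b gmul (ghess u a b) (geps b A).
Proof.
rewrite /eps1 nab_sum //; under eq_bigr => b _ do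
  rewrite nab_mul // (nab_eps DZ) gmulD gmulN gmul_sum addrCA.
rewrite big_split /=; congr (_ + _).
rewrite sumrB exchange_big -sumrB; apply: eq_bigr => b _ /=.
rewrite /ghess gmulDl gmulNl gmul_suml; congr (_ - _).
by apply: eq_bigr => c _; rewrite gmulA mulrC.
Qed.

Lemma nab_iot1 u a A : nab a (iot1 u A) =
  iot1 u (nab a A) + \sum_b gmul (ghess u a b) (up b A).
Proof.
rewrite /iot1 nab_sum //; under eq_bigr => b _ do
  rewrite nab_mul // (nab_up DD DM DZ gT gig) gmulD gmulN gmul_sum addrCA.
rewrite big_split /=; congr (_ + _).
rewrite sumrB exchange_big -sumrB; apply: eq_bigr => b _ /=.
rewrite /ghess gmulDl gmulNl gmul_suml; congr (_ - _).
by apply: eq_bigr => c _; rewrite gmulA mulrC.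
Qed.

Lemma gd_nab A : gd A = \sum_a geps a (nab a A).
Proof.
rewrite /gd /nab; under [RHS]eq_bigr => a _ do rewrite gepsD gepsN geps_sum.
rewrite sumrB [X in _ - X]antisum0 ?subr0 // => a b.
rewrite !geps_sum -sumrN; apply: eq_bigr => c _.
by rewrite !geps_mul geps_geps gmulN gamC.
Qed.

Lemma gpair_up u a A :
  geps a (iot1 u A) + iot1 u (geps a A) = gmul (\sum_b gi b a * u b) A.
Proof.
rewrite /iot1 geps_sum -big_split gmul_suml; apply: eq_bigr => b _ /=.
by rewrite geps_mul eps_up gmulD gmulN subrK gmulA mulrC.
Qed.

Lemma gpair_eps u a A :
  up a (eps1 u A) + eps1 u (up a A) = gmul (\sum_b gi b a * u b) A.
Proof.
rewrite /eps1 up_sum -big_split gmul_suml; apply: eq_bigr => b _ /=.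
by rewrite up_mul eps_up gmulD gmulN addrCA subrr addr0 gmulA giC mulrC.
Qed.

Definition gPder (h : 'I_m -> 'I_m -> O) A : cov :=
  \sum_a \sum_b gmul (h a b) (geps a (up b A)).
Definition gtr (h : 'I_m -> 'I_m -> O) : O := \sum_a \sum_b gi a b * h a b.

(** Both anticommutators contain the covariant derivative along the dual vector of u. It cancels,
    leaving algebraic terms in the Hessian, which is symmetric because u is closed. *)
Lemma commutators u A : (forall a b, D a (u b) = D b (u a)) ->
  gd (iot1 u A) + iot1 u (gd A) - gx (eps1 u A) - eps1 u (gx A) =
  2 *: gPder (ghess u) A - gmul (gtr (ghess u)) A.
Proof.
move=> uC.
have hC a b : ghess u a b = ghess u b a.
  by rewrite /ghess uC; congr (_ - _); apply: eq_bigr => c _; rewrite gamC.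
have -> : gd (iot1 u A) + iot1 u (gd A) =
    \sum_a gmul (\sum_b gi b a * u b) (nab a A) + gPder (ghess u) A.
  rewrite !gd_nab.
  have -> : iot1 u (\sum_a geps a (nab a A)) = \sum_a iot1 u (geps a (nab a A)).
    apply: (big_morph _ (iot1_D u)).
    by apply: (addrI (iot1 u 0)); rewrite -iot1_D !addr0.
  under eq_bigr => a _ do rewrite nab_iot1 eps_addsum.
  rewrite big_split /= addrAC -big_split /=; congr (_ + _).
    by apply: eq_bigr => a _; rewrite gpair_up.
  by apply: eq_bigr => a _; apply: eq_bigr => b _; rewrite geps_mul.
have -> : gx (eps1 u A) =
    - eps1 u (gx A) + \sum_a gmul (\sum_b gi b a * u b) (nab a A)
    + (gmul (gtr (ghess u)) A - gPder (ghess u) A).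
  rewrite /gx.
  have -> : eps1 u (\sum_a up a (nab a A)) = \sum_a eps1 u (up a (nab a A)).
    apply: (big_morph _ (eps1_D u)).
    by apply: (addrI (eps1 u 0)); rewrite -eps1_D !addr0.
  under eq_bigr => a _ do rewrite nab_eps1 up_addsum.
  rewrite big_split /= -sumrN -[X in _ = X + _]big_split /=; congr (_ + _).
    by apply: eq_bigr => a _; rewrite -gpair_eps addrCA addNr addr0.
  rewrite /gPder /gtr gmul_suml exchange_big -sumrB; apply: eq_bigr => a _ /=.
  rewrite gmul_suml -sumrB; apply: eq_bigr => b _.
  by rewrite up_mul hC eps_up gmulD gmulN opprD opprK addrA gmulA (giC b a) mulrC
    subrr add0r.
by rewrite module_regroup.
Qed.
End Codifferential.

Local Notation christoffel := gam.

Lemma module_regroup2 (R : realType) (F : lmodType R) (r : R) (p q : F) :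
  - (p + q - (r *: p - (q - p))) = r *: p + - 2 *: q.
Proof. lmod R F. Qed.

Lemma sum_delta (O : comNzRingType) m (b : 'I_m) (F : 'I_m -> O) :
  \sum_a (a == b)%:R * F a = F b.
Proof.
rewrite (bigD1 b) //= eqxx mul1r big1 ?addr0 // => a ab.
by rewrite (negbTE ab) mul0r.
Qed.

(** * Conformal change of the metric *)

Section Conformal.
Context {R : realType} {O : comAlgType R} {m : nat} (D : 'I_m -> O -> O).
Hypothesis DD : forall a f h, D a (f + h) = D a f + D a h.
Hypothesis DM : forall a f h, D a (f * h) = D a f * h + f * D a h.
Hypothesis DZ : forall a (r : R) f, D a (r *: f) = r *: D a f.
Hypothesis DC : forall a b f, D a (D b f) = D b (D a f).
Variables g gi : 'M[O]_m.
Hypothesis gT : g^T = g.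
Hypothesis gig : gi *m g = 1%:M.
Local Notation cov := ({set 'I_m} -> O).
Implicit Types (a b c e : 'I_m) (A B : cov) (S : {set 'I_m}).
Let D_0 := D0 DZ.
Let D_N := DN DZ.
Let giC := gi_sym gT gig.
Let gC := g_sym gT.
Local Notation gam := (gam D g gi).
Local Notation ctr := (ctr D g gi).
Let gamC := gamC D gi gT.

Definition gRic b e : O := \sum_a (D a (gam b a e) - D b (gam a a e)
  + \sum_f (gam a a f * gam b f e - gam b a f * gam a f e)).

Lemma giK a b : \sum_c gi a c * g c b = (a == b)%:R.
Proof. by have := congr1 (fun M : 'M[O]_m => M a b) gig; rewrite !mxE. Qed.

Variables u : 'I_m -> O.
Let U c : O := \sum_e gi c e * u e.
Let q : O := \sum_c u c * U c.

Lemma gU b : \sum_c g b c * U c = u b.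
Proof.
rewrite /U; under eq_bigr => c _ do rewrite mulr_sumr.
rewrite exchange_big -[RHS](sum_delta b u); apply: eq_bigr => e _ /=.
rewrite -giK mulr_suml; apply: eq_bigr => c _.
by rewrite (gC b) (giC c) mulrCA mulrA.
Qed.

Lemma pair_U : q = gpair gi u u.
Proof.
rewrite /q /gpair; apply: eq_bigr => c _; rewrite mulr_sumr; apply: eq_bigr => e _.
by rewrite mulrCA mulrA.
Qed.

(** The difference of the Levi-Civita connections of f^2 g and g, with u = d log f and U its dual
    vector. *)
Definition ctor a c b : O := (c == a)%:R * u b + (c == b)%:R * u a - g a b * U c.

Lemma ctor_up (X : 'I_m -> O) b e : \sum_f X f * ctor b f e =
  X b * u e + X e * u b - g b e * \sum_f X f * U f.
Proof.
rewrite mulr_sumr -(sum_delta b (fun f => X f * u e)).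
rewrite -(sum_delta e (fun f => X f * u b)) -big_split -sumrB.
apply: eq_bigr => f _ /=; rewrite /ctor; ring.
Qed.

Lemma ctor_dn (X : 'I_m -> O) b a : \sum_f ctor b a f * X f =
  (a == b)%:R * (\sum_f u f * X f) + X a * u b - U a * \sum_f g b f * X f.
Proof.
rewrite !mulr_sumr -(sum_delta a (fun f => X f * u b)) -big_split -sumrB.
apply: eq_bigr => f _ /=; rewrite /ctor (eq_sym f); ring.
Qed.

Lemma ctor_tr e : \sum_a ctor a a e = m%:R * u e.
Proof.
rewrite /ctor !big_split /= (sum_delta e (fun a => u a)).
rewrite (eq_bigr (fun=> u e)) => [|a _]; last by rewrite eqxx mul1r.
rewrite sumr_const card_ord sumrN (eq_bigr (fun a => g e a * U a)) => [|a _].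
  by rewrite gU addrK mulr_natl.
by rewrite gC.
Qed.

Definition gdiv : O := \sum_a (D a (U a) + ctr a * U a).

Lemma gdiv_hess : gdiv = gtr gi (ghess D g gi u).
Proof.
have h a : D a (U a) = \sum_e gi a e * D a (u e)
    - \sum_e \sum_p gi a p * gam a e p * u e - \sum_p gam a a p * U p.
  rewrite /U (D_sum DD DZ).
  under [X in _ = _ - _ - X]eq_bigr => p _ do rewrite mulr_sumr.
  rewrite [X in _ = _ - _ - X]exchange_big -!sumrB; apply: eq_bigr => e _ /=.
  rewrite DM; have := congr1 (fun M : 'M[O]_m => M a e) (dgi DD DM DZ gT gig a).
  rewrite !mxE => ->; rewrite mulNr mulrDl opprD addrC addrA; congr (_ - _ + _).
    by rewrite mulr_suml; apply: eq_bigr => p _; rewrite mxE.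
  by rewrite mulr_suml; congr (- _); apply: eq_bigr => p _; rewrite mulrA.
rewrite /gdiv /gtr /ghess; under eq_bigr => a _ do rewrite h.
rewrite big_split sumrB sumrB /= [X in _ - _ - X + _]exchange_big.
rewrite [X in _ - _ - X + _](eq_bigr (fun p => ctr p * U p)) ?subrK; last first.
  by move=> p _; rewrite /ctr mulr_suml.
rewrite -sumrB; apply: eq_bigr => a _.
under [RHS]eq_bigr => b _ do rewrite mulrBr.
rewrite sumrB; congr (_ - _); rewrite exchange_big; apply: eq_bigr => p _ /=.
by rewrite mulr_sumr; apply: eq_bigr => e _; rewrite mulrA.
Qed.

Lemma compat_U b e : \sum_a D a (g b e) * U a =
  \sum_a (\sum_f g b f * gam a f e) * U a + \sum_a (\sum_f g a e * gam b a f * U f).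
Proof.
under [X in _ = _ + X]eq_bigr => a _ do under eq_bigr => f _ do rewrite gamC.
rewrite [X in _ = _ + X]exchange_big -big_split; apply: eq_bigr => a _ /=.
rewrite -mulr_suml -mulrDl; congr (_ * _).
have := congr1 (fun M : 'M[O]_m => M b e) (compat D gT gig a).
rewrite !mxE => ->; rewrite addrC; congr (_ + _); apply: eq_bigr => f _.
by rewrite mxE mulrC.
Qed.

(** The conformal transformation law of the Ricci tensor; it uses only that the connection changes
    by [ctor] and that u is closed. *)
Lemma Ric_shift (gam' : 'I_m -> 'I_m -> 'I_m -> O) b e :
  (forall a c b, gam' a c b = gam a c b + ctor a c b) ->
  (forall a b, D a (u b) = D b (u a)) ->
  \sum_a (D a (gam' b a e) - D b (gam' a a e)
  + \sum_f (gam' a a f * gam' b f e - gam' b a f * gam' a f e)) =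
  gRic b e - (m%:R - 2) * (ghess D g gi u b e - u b * u e)
  - (gdiv + (m%:R - 2) * q) * g b e.
Proof.
move=> hg uC.
have natM a (k : bool) x : D a (k%:R * x) = k%:R * D a x.
  by case: k; rewrite ?mul1r ?mul0r ?D_0.
pose S (F : 'I_m -> 'I_m -> O) : O := \sum_a \sum_f F a f.
(* The curvature expression is quadratic in the connection: two derivative terms, four mixed
   products and two products of [ctor] with itself, each contracted separately below. *)
transitivity (gRic b e + (\sum_a D a (ctor b a e) - \sum_a D b (ctor a a e)
    + (S (fun a f => gam a a f * ctor b f e) + S (fun a f => ctor a a f * gam b f e)
    - S (fun a f => gam b a f * ctor a f e) - S (fun a f => ctor b a f * gam a f e)
    + S (fun a f => ctor a a f * ctor b f e) - S (fun a f => ctor b a f * ctor a f e)))).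
  transitivity (\sum_a ((D a (gam b a e) - D b (gam a a e)
      + \sum_f (gam a a f * gam b f e - gam b a f * gam a f e))
    + ((D a (ctor b a e) - D b (ctor a a e))
      + (\sum_f gam a a f * ctor b f e + \sum_f ctor a a f * gam b f e
         - \sum_f gam b a f * ctor a f e - \sum_f ctor b a f * gam a f e
         + \sum_f ctor a a f * ctor b f e - \sum_f ctor b a f * ctor a f e)))).
    apply: eq_bigr => a _; rewrite !hg !DD.
    rewrite (eq_bigr (fun f => (gam a a f * gam b f e - gam b a f * gam a f e)
      + (gam a a f * ctor b f e + ctor a a f * gam b f e - gam b a f * ctor a f e
      - ctor b a f * gam a f e
      + ctor a a f * ctor b f e - ctor b a f * ctor a f e))) => [|f _]; last first.
      by rewrite !hg; ring.
    do ?rewrite big_split /=; rewrite !sumrN; ring.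
  rewrite big_split /=; congr (_ + _).
  by do ?rewrite big_split /=; rewrite !sumrN.
have T1 : \sum_a D a (ctor b a e) = D b (u e) + D e (u b)
    - \sum_a D a (g b e) * U a - g b e * \sum_a D a (U a).
  rewrite mulr_sumr -(sum_delta b (fun a => D a (u e))).
  rewrite -(sum_delta e (fun a => D a (u b))) -big_split -!sumrB.
  apply: eq_bigr => a _ /=; rewrite /ctor !DD D_N !natM DM; ring.
have T2 : \sum_a D b (ctor a a e) = m%:R * D b (u e).
  by rewrite -(D_sum DD DZ) ctor_tr !mulr_natl -[u e *+ m]scaler_nat DZ scaler_nat.
have S1 : S (fun a f => gam a a f * ctor b f e) =
    ctr b * u e + ctr e * u b - g b e * \sum_f ctr f * U f.
  rewrite /S exchange_big -ctor_up; apply: eq_bigr => f _ /=.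
  by rewrite -mulr_suml.
have S2 : S (fun a f => ctor a a f * gam b f e) = m%:R * \sum_c gam b c e * u c.
  rewrite /S exchange_big mulr_sumr; apply: eq_bigr => f _ /=.
  by rewrite -mulr_suml ctor_tr -mulrA [u f * _]mulrC.
have S3 : S (fun a f => gam b a f * ctor a f e) = ctr b * u e
    + \sum_c gam b c e * u c - \sum_a \sum_f g a e * gam b a f * U f.
  rewrite /ctr mulr_suml -big_split -sumrB; apply: eq_bigr => a _ /=.
  rewrite ctor_up (gamC a); congr (_ - _); rewrite mulr_sumr.
  by apply: eq_bigr => f _; rewrite mulrA.
have S4 : S (fun a f => ctor b a f * gam a f e) = \sum_c gam b c e * u c
    + ctr e * u b - \sum_a (\sum_f g b f * gam a f e) * U a.
  rewrite -(sum_delta b (fun a => \sum_c gam a c e * u c)) mulr_suml.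
  rewrite -big_split -sumrB; apply: eq_bigr => a _ /=.
  rewrite ctor_dn [U a * _]mulrC; congr (_ * _ + _ - _).
  by apply: eq_bigr => f _; rewrite mulrC.
have S5 : S (fun a f => ctor a a f * ctor b f e) =
    m%:R * (u b * u e + u e * u b - g b e * q).
  rewrite /S exchange_big -ctor_up mulr_sumr; apply: eq_bigr => f _ /=.
  by rewrite -mulr_suml ctor_tr mulrA.
have S6 : S (fun a f => ctor b a f * ctor a f e) =
    (u b * u e + u e * u b - g b e * q) + m%:R * u e * u b
    - (u b * u e + g b e * q - u e * u b).
  transitivity (\sum_a ((a == b)%:R * (u a * u e + u e * u a - g a e * q)
      + ctor a a e * u b - (g b a * U a * u e + g b e * (u a * U a)
      - g e a * U a * u b))).
    apply: eq_bigr => a _ /=; rewrite ctor_dn (ctor_up u) (ctor_up (g b)) gU (gC a e) -/q; ring.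
  rewrite sumrB sumrB big_split /= (sum_delta b (fun a => u a * u e + u e * u a - g a e * q)).
  rewrite -mulr_suml ctor_tr big_split /= -!mulr_suml !gU -mulr_sumr -/q.
  ring.
rewrite T1 T2 S1 S2 S3 S4 S5 S6 compat_U /gdiv big_split /= /ghess (uC e b).
ring.
Qed.

Variables f f' : O.
Hypothesis fK : f * f' = 1.
Hypothesis fu : forall a, D a f = f * u a.
Let g' := (f ^+ 2) *: g.
Let gi' := (f' ^+ 2) *: gi.

Lemma gam_conformal a c b : christoffel D g' gi' a c b = gam a c b + ctor a c b.
Proof.
have lowE e : low D g' a e b = f ^+ 2 * (low D g a e b + (g e b * u a + g a e * u b
    - g a b * u e)).
  rewrite !mxE expr2 !DM !fu (gC b e) -[X in _ = _ * (_ + X)]mul1r -{1}hf2; ring.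
rewrite mxE; transitivity (\sum_e (gi c e * low D g a e b + (gi c e * g e b) * u a
    + gi c e * g e a * u b - g a b * (gi c e * u e))).
  apply: eq_bigr => e _; rewrite lowE mxE (gC a e).
  rewrite -[RHS]mul1r -(expr1n _ 2) -fK; ring.
rewrite sumrB !big_split /= -mulr_suml -[X in _ + X - _]mulr_suml !giK -mulr_sumr.
rewrite -/(U c) [gam a c b]mxE /ctor.
ring.
Qed.

End Conformal.

(** * The degree operator and the conformal codifferential *)

Section Degree.
Context {R : realType} {O : comAlgType R} {m : nat}.
Local Notation cov := ({set 'I_m} -> O).
Implicit Types (a b c e : 'I_m) (A B : cov) (S : {set 'I_m}).

Definition gN A : cov := fun S => (#|S|%:R : R) *: A S.

Lemma gND A B : gN (A + B) = gN A + gN B.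
Proof. by apply/funext => S; rewrite /gN addrfctE scalerDr. Qed.
Lemma gN0 : gN 0 = 0.
Proof. by apply: (addrI (gN 0)); rewrite -gND !addr0. Qed.
Lemma gNZ (r : R) A : gN (r *: A) = r *: gN A.
Proof. by apply/funext => S; rewrite /gN !scalrfctE !scalerA [r * _]mulrC. Qed.
Lemma gN_sum (I : Type) (r : seq I) (P : pred I) (A_ : I -> cov) :
  gN (\sum_(i <- r | P i) A_ i) = \sum_(i <- r | P i) gN (A_ i).
Proof. exact: (big_morph _ gND gN0). Qed.
Lemma gN_mul f A : gN (gmul f A) = gmul f (gN A).
Proof. by apply/funext => S; rewrite /gN /gmul scalerAr. Qed.

Lemma gN_eps a A : gN (geps a A) = geps a (gN A) + geps a A.
Proof.
apply/funext => S; rewrite addrfctE /gN /geps; case: ifP => aS; last by rewrite scaler0 addr0.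
by rewrite (cardsD1 a S) aS natrD addrC scalerDl scale1r scalerAr.
Qed.

Lemma gN_iot a A : gN (giot a A) = giot a (gN A) - giot a A.
Proof.
apply/funext => S; rewrite addrfctE opprfctE /gN /giot.
case: ifP => aS; first by rewrite scaler0 subr0.
by rewrite cardsU1 aS natrD scalerDl scale1r mulrDr addrAC subrr add0r scalerAr.
Qed.

Lemma sum_eps_iot A : \sum_a geps a (giot a A) = gN A.
Proof.
apply/funext => S; rewrite fct_sumE /gN -[#|S|]sum1_card natr_sum scaler_suml.
rewrite [RHS]big_mkcond; apply: eq_bigr => a _; rewrite /geps /giot.
case: ifP => // aS; rewrite finset.setD11 finset.setD1K // scale1r mulrA.
by rewrite gsgnD // ltnn mul1r gsgn_sqr mul1r.
Qed.

Definition gcc A : cov := m%:R *: A - 2 *: gN A.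
End Degree.

Section ConformalCodifferential.
Context {R : realType} {O : comAlgType R} {m : nat} (D : 'I_m -> O -> O).
Hypothesis DD : forall a f h, D a (f + h) = D a f + D a h.
Hypothesis DM : forall a f h, D a (f * h) = D a f * h + f * D a h.
Hypothesis DZ : forall a (r : R) f, D a (r *: f) = r *: D a f.
Hypothesis DC : forall a b f, D a (D b f) = D b (D a f).
Variables g gi : 'M[O]_m.
Hypothesis gT : g^T = g.
Hypothesis gig : gi *m g = 1%:M.
Local Notation cov := ({set 'I_m} -> O).
Implicit Types (a b c e : 'I_m) (A B : cov) (S : {set 'I_m}).
Let giC := gi_sym gT gig.
Let gC := g_sym gT.

Lemma gN_gd A : gN (gd D A) = gd D (gN A) + gd D A.
Proof.
rewrite /gd gN_sum -big_split; apply: eq_bigr => a _; rewrite gN_eps; congr (geps _ _ + _).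
by apply/funext => S; rewrite /gN /gD DZ.
Qed.

Lemma gN_up a A : gN (up gi a A) = up gi a (gN A) - up gi a A.
Proof.
rewrite /up gN_sum -sumrB; apply: eq_bigr => b _.
by rewrite gN_mul gN_iot gmulD gmulN.
Qed.

Lemma gN_nab a A : gN (nab D g gi a A) = nab D g gi a (gN A).
Proof.
rewrite /nab gND; congr (_ + _); first by apply/funext => S; rewrite /gN /gD DZ.
rewrite -scaleN1r gNZ scaleN1r; congr (- _); rewrite gN_sum; apply: eq_bigr => b _.
rewrite gN_sum; apply: eq_bigr => c _.
by rewrite gN_mul gN_eps gN_iot gepsD gepsN subrK.
Qed.

Lemma gN_gx A : gN (gx D g gi A) = gx D g gi (gN A) - gx D g gi A.
Proof.
rewrite /gx gN_sum -sumrB; apply: eq_bigr => a _; by rewrite gN_up gN_nab.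
Qed.

Lemma gN_eps1 (u : 'I_m -> O) A : gN (eps1 u A) = eps1 u (gN A) + eps1 u A.
Proof.
rewrite /eps1 gN_sum -big_split; apply: eq_bigr => a _ /=.
by rewrite gN_mul gN_eps gmulD.
Qed.

Lemma gN_iot1 (u : 'I_m -> O) A : gN (iot1 gi u A) = iot1 gi u (gN A) - iot1 gi u A.
Proof.
rewrite /iot1 gN_sum -sumrB; apply: eq_bigr => a _ /=.
by rewrite gN_mul gN_up gmulD gmulN.
Qed.

Variables (u : 'I_m -> O) (f f' : O).
Hypothesis fK : f * f' = 1.
Hypothesis fu : forall a, D a f = f * u a.

Lemma iot1_iot A : iot1 gi u A = \sum_a gmul (\sum_e gi a e * u e) (giot a A).
Proof.
rewrite /iot1 /up; under eq_bigr => b _ do rewrite gmul_sum.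
rewrite exchange_big; apply: eq_bigr => a _ /=; rewrite gmul_suml.
by apply: eq_bigr => b _; rewrite gmulA giC mulrC.
Qed.

Lemma gx_conformal A : gx D ((f ^+ 2) *: g) ((f' ^+ 2) *: gi) A =
  gmul (f' ^+ 2) (gx D g gi A + iot1 gi u (gcc A)).
Proof.
(* The change of connection acting on forms, with the index sums absorbed into eps(u), iota(u) and
   the degree operator. *)
have nabE a : nab D ((f ^+ 2) *: g) ((f' ^+ 2) *: gi) a A = nab D g gi a A
    - (eps1 u (giot a A) + gmul (u a) (gN A)
       - \sum_b gmul (g a b) (geps b (iot1 gi u A))).
  rewrite /nab -addrA -opprD; congr (_ - _).
  rewrite -sum_eps_iot gmul_sum iot1_iot {1}/eps1.
  rewrite -big_split -sumrB -big_split; apply: eq_bigr => b _ /=.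
  under eq_bigr => c _ do
    rewrite (gam_conformal DM gT gig fK fu) gmulDl /ctor gmulDl gmulDl gmulNl.
  rewrite big_split /=; congr (_ + _).
  rewrite sumrB big_split /= geps_sum gmul_sum; congr (_ + _ - _).
  - rewrite (bigD1 a) //= eqxx mul1r big1 ?addr0 // => c ca.
    by rewrite (negbTE ca) mul0r g0mul.
  - rewrite (bigD1 b) //= eqxx mul1r big1 ?addr0 // => c ca.
    by rewrite (negbTE ca) mul0r g0mul.
  by apply: eq_bigr => c _; rewrite geps_mul gmulA.
rewrite {1}/gx.
have -> : \sum_a up ((f' ^+ 2) *: gi) a (nab D ((f ^+ 2) *: g) ((f' ^+ 2) *: gi) a A) =
    gmul (f' ^+ 2) (\sum_a up gi a (nab D ((f ^+ 2) *: g) ((f' ^+ 2) *: gi) a A)).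
  rewrite gmul_sum; apply: eq_bigr => a _; rewrite /up gmul_sum.
  by apply: eq_bigr => b _; rewrite mxE gmulA.
congr gmul; under eq_bigr => a _ do rewrite nabE upD upN.
rewrite sumrB; congr (_ + _).
have e1 : \sum_a up gi a (eps1 u (giot a A)) = iot1 gi u A.
  have h a : up gi a (eps1 u (giot a A)) = gmul (\sum_e gi a e * u e) (giot a A)
      - eps1 u (up gi a (giot a A)).
    apply/eqP; rewrite eq_sym subr_eq (gpair_eps gT gig); apply/eqP; congr gmul.
    by apply: eq_bigr => e _; rewrite giC.
  under eq_bigr => a _ do rewrite h.
  rewrite sumrB -iot1_iot [X in _ - X](_ : _ = 0) ?subr0 //.
  rewrite /eps1 exchange_big big1 // => b _ /=.
  rewrite -gmul_sum -geps_sum /up [X in geps b X](_ : _ = 0) ?geps0 ?gmul0 //.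
  by apply: antisum0 => a c; rewrite giot_giot gmulN giC.
have e2 : \sum_a up gi a (gmul (u a) (gN A)) = iot1 gi u (gN A).
  by apply: eq_bigr => a _; rewrite up_mul.
have e3 B : \sum_a up gi a (\sum_b gmul (g a b) (geps b B)) = m%:R *: B - gN B.
  have h a : up gi a (\sum_b gmul (g a b) (geps b B)) =
      \sum_b gmul (g b a) (up gi a (geps b B)).
    rewrite (_ : up gi a _ = \sum_b up gi a (gmul (g a b) (geps b B))); last exact: up_sum.
    by apply: eq_bigr => b _; rewrite up_mul gC.
  under eq_bigr => a _ do rewrite h.
  rewrite exchange_big /= -sum_eps_iot.
  rewrite (eq_bigr (fun b => B - geps b (giot b B))) => [|b _].
    by rewrite sumrB sumr_const card_ord scaler_nat.
  by rewrite -(iot_up gig) geps_giot eqxx opprB addrC subrK.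
under eq_bigr => a _ do rewrite !upD upN.
rewrite sumrB big_split /= e1 e2 e3 gN_iot1 /gcc.
rewrite -(scaleNr 2) iot1_D !iot1_Z.
exact: module_regroup2.
Qed.
End ConformalCodifferential.

Lemma module_regroup3 (R : realType) (F : lmodType R) (r : R) (p q t z : F) :
  t - 2 *: p = 2 *: (- p - q) - (- t - r *: z) - (r *: z - 2 *: q).
Proof. lmod R F. Qed.

(** * Consequences of the Einstein condition *)

Section Einstein.
Context {R : realType} {O : comAlgType R} {m : nat} (D : 'I_m -> O -> O).
Hypothesis m_gt2 : (2 < m)%N.
Hypothesis DD : forall a f h, D a (f + h) = D a f + D a h.
Hypothesis DM : forall a f h, D a (f * h) = D a f * h + f * D a h.
Hypothesis DZ : forall a (r : R) f, D a (r *: f) = r *: D a f.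
Hypothesis DC : forall a b f, D a (D b f) = D b (D a f).
Variables g gi : 'M[O]_m.
Hypothesis gT : g^T = g.
Hypothesis gig : gi *m g = 1%:M.
Variables s s' : O.
Hypothesis sK : s * s' = 1.
Local Notation cov := ({set 'I_m} -> O).
Implicit Types (a b c e : 'I_m) (A B : cov) (S : {set 'I_m}).
Let giC := gi_sym gT gig.
Let gC := g_sym gT.
Local Notation Ric := (gRic D g gi).
Let v a := D a s.
Let h := ghess D g gi v.
Let H := gtr gi h.

Definition gJ : O := (2 * (m%:R - 1))^-1 *: gtr gi Ric.
Definition gP a b : O := (m%:R - 2)^-1 *: (Ric a b - gJ * g a b).
Definition grho : O := - (m%:R)^-1 *: (H + gJ * s).

Hypothesis Ein : forall b e,
  gRic D ((s' ^+ 2) *: g) ((s ^+ 2) *: gi) b e = - (m%:R - 1) * (s' ^+ 2 * g b e).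

Lemma natr_cancel k (x : O) : (0 < k)%N -> k%:R * x = 0 -> x = 0.
Proof.
move=> k0; rewrite mulr_natl -scaler_nat => /eqP.
by rewrite scaler_eq0 pnatr_eq0 eqn0Ngt k0 => /eqP.
Qed.

Let sK' : s' * s = 1. Proof. by rewrite mulrC. Qed.

Let Ds' a : D a s' = s' * (- s' * v a).
Proof.
have := DM a s s'; rewrite sK (D1 DM) => /eqP; rewrite eq_sym addrC addr_eq0 => /eqP e.
rewrite -[LHS]mul1r -sK' -mulrA e /v; ring.
Qed.

Let u a := - s' * v a.

Let hess_u a b : ghess D g gi u a b = - s' * h a b + u a * u b.
Proof.
rewrite /h /ghess /u DM (DN DZ) Ds' mulrBr mulr_sumr.
under eq_bigr => c _ do rewrite mulrCA.
ring.
Qed.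

Let U_scale : (\sum_c u c * (\sum_e gi c e * u e)) = s' ^+ 2 * gpair gi v v.
Proof.
rewrite (pair_U gi u) /gpair mulr_sumr; apply: eq_bigr => a _.
rewrite mulr_sumr; apply: eq_bigr => b _; rewrite /u; ring.
Qed.

Let div_u : gdiv D g gi u = - s' * H + s' ^+ 2 * gpair gi v v.
Proof.
rewrite (gdiv_hess DD DM DZ gT gig) /H /gtr /gpair !mulr_sumr -big_split.
apply: eq_bigr => a _ /=; rewrite !mulr_sumr -big_split; apply: eq_bigr => b _ /=.
rewrite hess_u /u; ring.
Qed.

Let L : O := - s' * H + (m%:R - 1) * (s' ^+ 2 * gpair gi v v) - (m%:R - 1) * s' ^+ 2.

(** The transformation law with u = - d log s, solved for the Ricci tensor of g: up to a multiple of
    g it is the Hessian of s. *)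
Let RicE b e : Ric b e = - (m%:R - 2) * (s' * h b e) + L * g b e.
Proof.
have uC a c : D a (u c) = D c (u a).
  rewrite /u !DM !(DN DZ) !Ds' /v (DC c a); ring.
have := Ric_shift DD DM DZ gT gig b e
  (gam_conformal DM gT gig sK' Ds') uC.
rewrite -/(gRic D _ _ b e) Ein U_scale div_u hess_u => E.
apply/eqP; rewrite -subr_eq0; apply/eqP.
move/eqP: E; rewrite eq_sym -subr_eq0 => /eqP <-; rewrite /L /u; ring.
Qed.

Let trg : gtr gi g = m%:R.
Proof.
rewrite /gtr; under eq_bigr => a _ do under eq_bigr => b _ do rewrite gC.
under eq_bigr => a _ do rewrite (giK gig) eqxx.
by rewrite sumr_const card_ord.
Qed.

Let E1 : 2 * (m%:R - 1) * gJ = - (m%:R - 2) * (s' * H) + m%:R * L.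
Proof.
have -> : 2 * (m%:R - 1) * gJ = gtr gi Ric.
  rewrite /gJ -[X in X * _](_ : (2 * (m%:R - 1) : R)%:A = _).
    rewrite mulr_algl scalerA divff ?scale1r // mulf_neq0 ?pnatr_eq0 //.
    by rewrite subr_eq0 pnatr_eq1; move: m_gt2; case: m => [|[|[|]]].
  by rewrite -scalerA scalerBl scale1r [m%:R *: _]scaler_nat [LHS]scaler_nat mulr_natl.
rewrite -[X in _ + X * L]trg /H /gtr mulr_sumr mulr_sumr mulr_suml -big_split; apply: eq_bigr => a _.
rewrite !mulr_sumr mulr_suml -big_split; apply: eq_bigr => b _ /=.
rewrite RicE; ring.
Qed.

Let E2 a b : (m%:R - 2) * gP a b = Ric a b - gJ * g a b.
Proof.
rewrite /gP -[X in X * _](_ : (m%:R - 2 : R)%:A = _).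
  rewrite mulr_algl scalerA divff ?scale1r // subr_eq0 eqr_nat.
  by move: m_gt2; case: m => [|[|[|]]].
by rewrite scalerBl !scaler_nat.
Qed.

Let E3 : m%:R * grho = - (H + gJ * s).
Proof.
rewrite /grho -[X in X * _](_ : (m%:R : R)%:A = _).
  rewrite mulr_algl scaleNr scalerN scalerA divff ?scale1r // pnatr_eq0.
  by move: m_gt2; case: m.
by rewrite scaler_nat.
Qed.

Let n1 : (m%:R - 1 : O) = m.-1%:R.
Proof. by rewrite -subn1 natrB //; case: m m_gt2. Qed.
Let n2 : (m%:R - 2 : O) = (m - 2)%:R.
Proof. by rewrite natrB // ltnW. Qed.

(** The equation saying that the scale tractor of s is parallel. [RicE] makes the left side a
    multiple of g, and the definition of rho makes its trace vanish; integer denominators are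
    cleared first. *)
Lemma hess_Einstein a b : h a b + s * gP a b + grho * g a b = 0.
Proof.
apply: (@natr_cancel m); first by case: m m_gt2.
apply: (@natr_cancel (m - 2)); first by rewrite subn_gt0.
rewrite -n2.
transitivity (m%:R * (m%:R - 2) * h a b + s * m%:R * ((m%:R - 2) * gP a b)
  + (m%:R - 2) * (m%:R * grho) * g a b); first by ring.
rewrite E2 E3 RicE.
transitivity ((s * (2 * (m%:R - 1) * gJ) - s * (2 * (m%:R - 1) * gJ)) * g a b);
  last by ring.
rewrite {1}E1.
transitivity (m%:R * (m%:R - 2) * h a b * (1 - s * s')
  + s * (m%:R * L - 2 * (m%:R - 1) * gJ) * g a b - (m%:R - 2) * H * g a b); first by ring.
transitivity (- (m%:R - 2) * H * g a b * (s * s')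
  + s * (m%:R * L - 2 * (m%:R - 1) * gJ) * g a b); last by ring.
rewrite sK; ring.
Qed.

(** The squared length of the scale tractor, normalised by the scalar curvature of the Einstein
    metric. *)
Lemma rho_Einstein : 2 * (grho * s) + gpair gi v v = 1.
Proof.
apply/eqP; rewrite -subr_eq0; apply/eqP.
apply: (@natr_cancel m); first by case: m m_gt2.
apply: (@natr_cancel m.-1); first by case: m m_gt2 => [|[]].
rewrite -n1.
transitivity ((m%:R - 1) * 2 * s * (m%:R * grho)
  + m%:R * (m%:R - 1) * (gpair gi v v - 1)); first by ring.
rewrite E3.
transitivity (- (s ^+ 2 * (2 * (m%:R - 1) * gJ)) - 2 * (m%:R - 1) * s * H
  + m%:R * (m%:R - 1) * (gpair gi v v - 1)); first by ring.
rewrite E1 /L.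
transitivity ((m%:R - 2) * s * H * (s * s') + m%:R * s * H * (s * s')
  - m%:R * (m%:R - 1) * (gpair gi v v - 1) * (s * s') ^+ 2 - 2 * (m%:R - 1) * s * H
  + m%:R * (m%:R - 1) * (gpair gi v v - 1)); first by ring.
rewrite sK; ring.
Qed.

Definition gJ2 A : cov := gmul gJ A - 2 *: gPder gi gP A.

(** [commutators] for u = d s, with the Hessian replaced by - s P - rho g. This expresses the
    curvature term s (J - 2P) through first-order operators. *)
Lemma gJ2_Einstein A : gmul s (gJ2 A) = gd D (iot1 gi v A) + iot1 gi v (gd D A)
  - gx D g gi (eps1 v A) - eps1 v (gx D g gi A) - gmul grho (gcc A).
Proof.
rewrite (commutators DD DM DZ gT gig) => [|a b]; last exact: DC.
rewrite -/h -/H.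
have -> : gPder gi h A = - gmul s (gPder gi gP A) - gmul grho (gN A).
  rewrite -sum_eps_iot /gPder !gmul_sum -sumrN -sumrB; apply: eq_bigr => a _.
  rewrite (iot_up gig) geps_sum !gmul_sum -sumrN -sumrB; apply: eq_bigr => b _.
  rewrite geps_mul !gmulA -!gmulNl -gmulDl; congr gmul.
  by apply/eqP; rewrite -subr_eq0 !opprB !opprK addrA addrAC hess_Einstein.
have -> : H = - (gJ * s) - (m%:R : R) *: grho.
  apply/eqP; rewrite eq_sym subr_eq scaler_nat -mulr_natl E3; apply/eqP; ring.
rewrite /gJ2 /gcc gmulDl !gmulNl !gmulD !gmulN !gmulZ (gmulZl grho m%:R A).
rewrite gmulA [s * _]mulrC.
exact: module_regroup3.
Qed.
End Einstein.

(** * One-sided partial derivatives and smooth functions *)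

Section PartialDerivatives.
Context {R : realType} {n : nat}.
Local Notation E := (@halfspace R n).
Implicit Types (i j : 'I_n.+1) (x y : 'rV[R]_n.+1) (f h : 'rV[R]_n.+1 -> R) (t l : R).

Definition slide i x t : 'rV[R]_n.+1 := x + t *: delta_mx ord0 i.

Lemma slideE i x t j : slide i x t ord0 j = x ord0 j + t * (j == i)%:R.
Proof. by rewrite !mxE eqxx. Qed.

Lemma slide0 i x : slide i x 0 = x.
Proof. by rewrite /slide scale0r addr0. Qed.

Lemma slide_add i x t l : slide i (slide i x t) l = slide i x (t + l).
Proof. by rewrite /slide scalerDl addrA. Qed.

Lemma slideC i j x t l : slide i (slide j x t) l = slide j (slide i x l) t.
Proof. by rewrite /slide addrAC. Qed.

Lemma slide_half i x t : E x -> 0 <= t -> E (slide i x t).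
Proof.
by rewrite /halfspace /= => x0 t0; rewrite slideE addr_ge0 // mulr_ge0.
Qed.

(** [pd] takes a default value where the limit does not exist; this relation also records the
    convergence. *)
Definition ispd i f x l : Prop := quotient_at i f x @ along E i x --> l.

#[global] Instance along_filter i x : Filter (along E i x).
Proof. by rewrite /along; exact: within_filter. Qed.

(** Steps t > 0 never leave the half-space, so one-sided limits at the boundary are unique. *)
Lemma along_proper i x : E x -> ProperFilter (along E i x).
Proof.
move=> Ex; apply: Build_ProperFilter_ex => B; rewrite /along /within /= => /nbhs_ballP[e /= e0 h].
exists (e / 2); apply: (h (e / 2)).
- by rewrite /ball /= sub0r normrN ger0_norm ?divr_ge0 // ?ltW // ltr_pdivrMr // ltr_pMr // ltr1n.
- by rewrite /= mulf_neq0 // ?lt0r_neq0 // invr_gt0.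
- by apply: slide_half => //; rewrite divr_ge0 // ltW.
Qed.

Lemma along_near i x (P : set R) :
  (\forall t \near 0^', E (slide i x t) -> P t) -> along E i x P.
Proof. by []. Qed.

Lemma along_cvg_eq i x (f1 f2 : R -> R) l : (\forall t \near along E i x, f1 t = f2 t) ->
  f1 @ along E i x --> l -> f2 @ along E i x --> l.
Proof.
move=> e; apply: cvg_trans; apply: near_eq_cvg.
by apply: filterS e => t /esym.
Qed.

Lemma ispd_unique i f x l : E x -> ispd i f x l -> pd E i f x = l.
Proof. by move=> Ex h; apply: (@cvg_lim _ _ _ _ (along_proper i Ex)). Qed.

Lemma ispdP i f x : E x -> cvg (quotient_at i f x @ along E i x) ->
  ispd i f x (pd E i f x).
Proof. by []. Qed.

Lemma ispd_cst i x l : ispd i (fun=> l) x 0.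
Proof.
rewrite /ispd (_ : quotient_at i _ x = fun=> 0); first exact: cvg_cst.
by apply/funext => t; rewrite /quotient_at subrr mulr0.
Qed.

Lemma ispdD i f h x l l' : ispd i f x l -> ispd i h x l' ->
  ispd i (fun y => f y + h y) x (l + l').
Proof.
move=> a b; apply: along_cvg_eq (cvgD a b); apply: nearW => t.
by rewrite /quotient_at !fctE -mulrDr opprD addrACA.
Qed.

Lemma along_id i x : (fun t : R => t) @ along E i x --> (0 : R).
Proof.
have h : (fun t : R => t) @ 0^' --> (0 : R) by apply: cvg_within_filter; exact: cvg_id.
by apply: cvg_trans h; apply: cvg_app; exact: cvg_within.
Qed.

Lemma along_neq0 i x : \forall t \near along E i x, t != 0.
Proof. by apply: along_near; apply: filterS (nbhs_dnbhs_neq (0 : R)) => t + _. Qed.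

Lemma ispd_cvg i f x l : ispd i f x l -> f (slide i x t) @[t --> along E i x] --> f x.
Proof.
move=> h; rewrite -[X in _ --> X]add0r -[X in _ --> X + _](mul0r l).
apply: along_cvg_eq (cvgD (cvgM (along_id i x) h) (cvg_cst (f x))); near=> t.
 rewrite -[LHS]/(t * (t^-1 * (f (slide i x t) - f x)) + f x) mulVKf ?subrK //.
by near: t; exact: along_neq0.
Unshelve. all: by end_near. Qed.

Lemma ispdM i f h x l l' : ispd i f x l -> ispd i h x l' ->
  ispd i (fun y => f y * h y) x (l * h x + f x * l').
Proof.
move=> a b; apply: along_cvg_eq (cvgD (cvgM a (ispd_cvg b)) (cvgM (cvg_cst (f x)) b)).
apply: nearW => t.
rewrite -[LHS]/(quotient_at i f x t * h (slide i x t) + f x * quotient_at i h x t).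
rewrite /quotient_at /slide; ring.
Qed.

Lemma ispdV i f x l : E x -> f x != 0 -> ispd i f x l ->
  ispd i (fun y => (f y)^-1) x (- l * ((f x)^-1 * (f x)^-1)).
Proof.
move=> Ex fx a; have c := ispd_cvg a.
apply: along_cvg_eq (cvgM (cvgN a) (cvgM (cvgV fx c) (cvg_cst (f x)^-1))); near=> t.
have ft : f (slide i x t) != 0 by near: t; exact: cvgr_neq0 c fx.
rewrite -[LHS]/(- (t^-1 * (f (slide i x t) - f x)) * ((f (slide i x t))^-1 * (f x)^-1)).
rewrite /quotient_at -/(slide i x t) mulNr -mulrA -mulrN; congr (_ * _).
by field; rewrite ft fx.
Unshelve. all: by end_near. Qed.

Lemma ispd_sqrt i f x l : E x -> 0 < f x -> ispd i f x l ->
  ispd i (fun y => Num.sqrt (f y)) x (l / (Num.sqrt (f x) + Num.sqrt (f x))).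
Proof.
move=> Ex fx a; have c := ispd_cvg a.
have s0 : 0 < Num.sqrt (f x) by rewrite sqrtr_gt0.
have cs : Num.sqrt (f (slide i x t)) @[t --> along E i x] --> Num.sqrt (f x).
  by apply: continuous_cvg c; exact: sqrt_continuous.
have s1 : Num.sqrt (f x) + Num.sqrt (f x) != 0 by rewrite gt_eqF // addr_gt0.
apply: along_cvg_eq (cvgM a (cvgV s1 (cvgD cs (cvg_cst (Num.sqrt (f x)))))); near=> t.
have ft : 0 < f (slide i x t) by near: t; exact: cvgr_gt c _ fx.
rewrite -[LHS]/(t^-1 * (f (slide i x t) - f x)
  * (Num.sqrt (f (slide i x t)) + Num.sqrt (f x))^-1).
rewrite /quotient_at -/(slide i x t) -mulrA; congr (_ * _).
rewrite -{1}(sqr_sqrtr (ltW ft)) -{1}(sqr_sqrtr (ltW fx)) subr_sqr mulfK //.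
by rewrite gt_eqF // addr_gt0 // sqrtr_gt0.
Unshelve. all: by end_near. Qed.

Lemma ispd_congr i f h x l : f x = h x ->
  (\forall t \near 0^', E (slide i x t) -> f (slide i x t) = h (slide i x t)) ->
  ispd i f x l -> ispd i h x l.
Proof.
move=> e0 e1 a; apply: along_cvg_eq a; apply: filterS (along_near e1) => t e.
by rewrite /quotient_at e0 -/(slide i x t) e.
Qed.

Lemma ispd_coord i j x : ispd i (fun y => y ord0 j) x (j == i)%:R.
Proof.
apply: along_cvg_eq (cvg_cst ((j == i)%:R : R)); near=> t; rewrite /quotient_at slideE addrAC subrr add0r mulKf //.
by near: t; exact: along_neq0.
Unshelve. all: by end_near. Qed.
End PartialDerivatives.

Section Smooth.
Context {R : realType} {n : nat}.
Local Notation E := (@halfspace R n).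
Implicit Types (i j a b : 'I_n.+1) (x y : 'rV[R]_n.+1) (f h F G : 'rV[R]_n.+1 -> R) (t l s : R).

Lemma along_eps a x (g : R -> R) l : g @ along E a x --> l <->
  (forall e, 0 < e -> exists2 d : R, 0 < d &
    forall t, t != 0 -> `|t| < d -> E (slide a x t) -> `|l - g t| < e).
Proof.
split=> [/cvgrPdist_lt h e e0 | h].
  have := h e e0; rewrite /along near_withinE => /nbhs_ballP[d /= d0 hd].
  exists d => // t t0 td Et; apply: (hd t) => //.
  by rewrite /ball /= sub0r normrN.
apply/cvgrPdist_lt => e /h[d d0 hd].
apply: along_near; near=> t => Et; apply: hd => //.
  by near: t; exact: nbhs_dnbhs_neq.
by near: t; exact: dnbhs0_lt.
Unshelve. all: by end_near. Qed.

(** Only forward steps occur, which keeps the segment in the half-space in every coordinate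
    direction. *)
Lemma mean_value a F G y s : 0 < s -> E y ->
  (forall u : R, 0 <= u <= s -> ispd a F (slide a y u) (G (slide a y u))) ->
  exists2 c, 0 < c < s & F (slide a y s) - F y = G (slide a y c) * s.
Proof.
move=> s0 Ey hF.
have Eu u : 0 <= u -> E (slide a y u) by apply: slide_half.
pose g u := F (slide a y u).
have dg u : u \in `]0, s[ -> is_derive u 1 g (G (slide a y u)).
  rewrite in_itv /= => /andP[u0 us].
  have h0 : (fun t => t^-1 *: ((g \o shift u) (t *: 1) - g u)) @ 0^'
      --> G (slide a y u).
    have hu : 0 <= u <= s by rewrite !ltW.
    apply/cvgrPdist_lt => e e0; have [d d0 hd] := (along_eps a _ _ _).1 (hF u hu) e e0.
    near=> t; have t0 : t != 0 by near: t; exact: nbhs_dnbhs_neq.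
    have td : `|t| < d by near: t; exact: dnbhs0_lt.
    have tu : `|t| < u by near: t; exact: dnbhs0_lt.
    have ut : 0 <= u + t by move: tu; rewrite ltr_norml => /andP[? _]; lra.
    have := hd t t0 td; rewrite slide_add => /(_ (Eu _ ut)).
    rewrite /quotient_at -/(slide a (slide a y u) t) slide_add.
    by rewrite /= [t%:A](mulr1 t) /g /shift /= [t + u]addrC.
  apply: DeriveDef; first by apply/cvg_ex; exists (G (slide a y u)).
  exact: cvg_lim.
have cg : {within `[0, s], continuous g}.
  apply/subspace_continuousP => u; rewrite /= in_itv /= => u01.
  have u0 : 0 <= u by case/andP: u01.
  apply/cvgrPdist_lt => e e0.
  have [d d0 hd] := (along_eps a _ _ _).1 (ispd_cvg (hF u u01)) e e0.
  rewrite near_withinE; near=> t => /=; rewrite in_itv /= => /andP[t0 _].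
  have [->|tu] := eqVneq t u; first by rewrite subrr normr0.
  have := hd (t - u); rewrite slide_add [u + _]addrC subrK; apply.
  - by rewrite subr_eq0.
  - by rewrite distrC; near: t; apply: cvgr_dist_lt => //; exact: cvg_id.
  exact: Eu.
have [c c01 e] := MVT s0 dg cg.
exists c; first by move: c01; rewrite in_itv.
by move: e; rewrite /g slide0 subr0.
Unshelve. all: by end_near. Qed.

Variable V : set 'rV[R]_n.+1.
Hypothesis VE : V `<=` E.
Hypothesis Vopen : forall x, V x -> exists2 d : R, 0 < d &
  forall y, E y -> (forall j, `|y ord0 j - x ord0 j| < d) -> V y.

Definition cont f := forall x, V x -> forall e : R, 0 < e -> exists2 d : R, 0 < d &
  forall y, V y -> (forall j, `|y ord0 j - x ord0 j| < d) -> `|f y - f x| < e.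

Lemma contP f : {within V, continuous f} <-> cont f.
Proof.
split=> [/subspace_continuousP h x Vx e e0 | h].
  have /cvgrPdist_lt/(_ e e0) := h x Vx.
  rewrite near_withinE => /nbhs_ballP[d /= d0 hd]; exists d => // y Vy yx.
  rewrite distrC; apply: (hd y) => //; split=> // i j.
  by rewrite (ord1 i) /ball /= distrC.
apply/subspace_continuousP => x Vx; apply/cvgrPdist_lt => e e0.
have [d d0 hd] := h x Vx e e0; rewrite near_withinE; apply/nbhs_ballP; exists d => //= y.
move=> [_ yx] Vy; rewrite distrC; apply: hd => // j.
by have := yx ord0 j; rewrite /ball /= distrC.
Qed.

Lemma slide_near x i (d : R) t : `|t| < d -> forall j, `|slide i x t ord0 j - x ord0 j| < d.
Proof.
move=> td j; rewrite slideE addrAC subrr add0r; apply: le_lt_trans td.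
by case: (j == i); rewrite ?mulr1 ?mulr0 ?normr0.
Qed.

Lemma ispd_eq i f h x l : V x -> (forall y, V y -> f y = h y) ->
  ispd i f x l -> ispd i h x l.
Proof.
move=> Vx e; apply: ispd_congr; first exact: e.
have [d d0 hd] := Vopen Vx; near=> t => Et; apply: e; apply: hd => //.
by apply: slide_near; near: t; exact: dnbhs0_lt.
Unshelve. all: by end_near. Qed.

Lemma pd_eq i f h x : V x -> (forall y, V y -> f y = h y) -> pd E i f x = pd E i h x.
Proof.
move=> Vx e; rewrite /pd; congr lim; rewrite eqEsubset; split; apply: near_eq_cvg;
  have [d d0 hd] := Vopen Vx; apply: along_near; near=> t => Et;
  rewrite /quotient_at (e x) // e // -/(slide i x t); apply: hd => //;
  by apply: slide_near; near: t; exact: dnbhs0_lt.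
Unshelve. all: by end_near. Qed.

(** Coinduction for smoothness: iterated partial derivatives of a member of K stay in K, up to
    values outside V. *)
Lemma smooth_ind (K : set ('rV[R]_n.+1 -> R)) :
  (forall f, K f -> cont f) ->
  (forall f i, K f -> exists2 h, K h & forall x, V x -> ispd i f x (h x)) ->
  forall f, K f -> smooth_on E V f.
Proof.
move=> Kc Kd f Kf.
have H (q : seq 'I_n.+1) : exists2 h, K h & forall x, V x -> foldr (pd E) f q x = h x.
  elim: q => [|i q [h Kh hh]]; first by exists f.
  have [k Kk hk] := Kd h i Kh; exists k => // x Vx /=.
  by apply: ispd_unique (VE Vx) _; apply: ispd_eq (hk x Vx) => // y Vy; rewrite hh.
move=> q; have [h Kh hh] := H q; split=> [|i x Vx].
  apply/contP => x Vx e /(Kc h Kh x Vx)[d d0 hd]; exists d => // y Vy yx.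
  by rewrite !hh //; exact: hd.
have [k Kk hk] := Kd h i Kh; apply/cvg_ex; exists (k x).
by apply: ispd_eq (hk x Vx) => // y Vy; rewrite hh.
Qed.

Local Notation smooth := (smooth_on E V).

Lemma smooth_cont f : smooth f -> cont f.
Proof. by move=> /(_ [::])[/contP]. Qed.
Lemma smooth_pd f i : smooth f -> smooth (pd E i f).
Proof. by move=> h q; have := h (rcons q i); rewrite foldr_rcons. Qed.
Lemma smooth_ispd f i x : smooth f -> V x -> ispd i f x (pd E i f x).
Proof. by move=> /(_ [::])[_ h] Vx; apply: ispdP; [exact: VE | exact: h]. Qed.

Lemma smooth_eq f h : (forall x, V x -> f x = h x) -> smooth f -> smooth h.
Proof.
move=> e sf; apply: (smooth_ind (K := [set h | exists2 f, smooth f &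
  forall x, V x -> f x = h x])); last by exists f.
- move=> g [k /smooth_cont c ek] x Vx r /(c x Vx)[d d0 hd]; exists d => // y Vy yx.
  by rewrite -!ek //; exact: hd.
- move=> g i [k sk ek]; exists (pd E i k); first by exists (pd E i k) => //; exact: smooth_pd.
  by move=> x Vx; apply: (ispd_eq Vx ek); exact: smooth_ispd.
Qed.

Inductive algebraic : ('rV[R]_n.+1 -> R) -> Prop :=
| alg_smooth f : smooth f -> algebraic f
| alg_cst l : algebraic (fun=> l)
| alg_coord j : algebraic (fun x => x ord0 j)
| alg_add f h : algebraic f -> algebraic h -> algebraic (fun x => f x + h x)
| alg_mul f h : algebraic f -> algebraic h -> algebraic (fun x => f x * h x)
| alg_inv f : algebraic f -> (forall x, V x -> f x != 0) -> algebraic (fun x => (f x)^-1).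

Lemma algebraic_smooth f : algebraic f -> smooth f.
Proof.
have cn g : cont g <-> forall x, V x -> g @ within V (nbhs x) --> g x.
  by rewrite -contP; exact: subspace_continuousP.
apply: smooth_ind => {f} [f af | f i af].
  apply/cn => x Vx; elim: af => {f} [f /smooth_cont/cn|l|j|f h _ cf _ ch|f h _ cf _ ch|f _ cf f0].
  - exact.
  - exact: cvg_cst.
  - move: x Vx; apply/cn => x Vx e e0; exists e => // y Vy; exact.
  - exact: cvgD.
  - exact: cvgM.
  - by apply: cvgV => //; exact: f0.
elim: af => {f} [f sf|l|j|f h af [f' af' hf] ah [h' ah' hh]|f h af [f' af' hf] ah [h' ah' hh]
  |f af [f' af' hf] f0].
- by exists (pd E i f); [apply/alg_smooth/smooth_pd | move=> x; exact: smooth_ispd].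
- by exists (fun=> 0); [exact: alg_cst | move=> x _; exact: ispd_cst].
- by exists (fun=> (j == i)%:R); [exact: alg_cst | move=> x _; exact: ispd_coord].
- by exists (fun x => f' x + h' x); [exact: alg_add | move=> x Vx; apply: ispdD; auto].
- exists (fun x => f' x * h x + f x * h' x).
    by apply: alg_add; exact: alg_mul.
  by move=> x Vx; apply: ispdM; auto.
exists (fun x => - 1 * f' x * ((f x)^-1 * (f x)^-1)).
  by do !apply: alg_mul => //; [exact: (alg_cst (- 1)) | exact: alg_inv | exact: alg_inv].
by move=> x Vx; rewrite mulN1r; apply: ispdV; auto.
Qed.
End Smooth.

(** * Symmetry of second derivatives up to the boundary *)

Section Schwarz.
Context {R : realType} {n : nat}.
Local Notation E := (@halfspace R n).
Implicit Types (i j a b : 'I_n.+1) (x y : 'rV[R]_n.+1) (f h F G : 'rV[R]_n.+1 -> R) (t l s : R).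
Variable V : set 'rV[R]_n.+1.
Hypothesis VE : V `<=` E.
Hypothesis Vopen : forall x, V x -> exists2 d : R, 0 < d &
  forall y, E y -> (forall j, `|y ord0 j - x ord0 j| < d) -> V y.
Local Notation smooth := (smooth_on E V).

Lemma slide2_near a b x (d u v : R) : 0 <= u < d / 2 -> 0 <= v < d / 2 ->
  forall j, `|slide a (slide b x v) u ord0 j - x ord0 j| < d.
Proof.
move=> /andP[u0 ud] /andP[v0 vd] j; rewrite !slideE.
rewrite ger0_norm; case: (j == a); case: (j == b); rewrite ?mulr1 ?mulr0; lra.
Qed.

(** The second difference over a small square with x as its lowest corner lies in the half-space;
    evaluated in either order by two mean values, it compares the mixed derivatives at nearby
    points. *)
Lemma pdC f a b x : smooth f -> V x -> pd E a (pd E b f) x = pd E b (pd E a f) x.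
Proof.
move=> sf Vx.
have [d0 d00 hV] := Vopen Vx.
suff mixed e : 0 < e -> `|pd E a (pd E b f) x - pd E b (pd E a f) x| < e.
  apply/eqP; rewrite -subr_eq0 -normr_eq0; apply/negPn/negP => ne.
  by have := mixed _ (_ : 0 < `|pd E a (pd E b f) x - pd E b (pd E a f) x|);
    rewrite ltxx normr_gt0 -normr_eq0 => /(_ ne).
move=> e0; have e2 : 0 < e / 2 by rewrite divr_gt0.
have [d1 d10 h1] := smooth_cont (smooth_pd a (smooth_pd b sf)) Vx e2.
have [d2 d20 h2] := smooth_cont (smooth_pd b (smooth_pd a sf)) Vx e2.
pose d := Num.min d0 (Num.min d1 d2); pose s := d / 4.
have dp : 0 < d by rewrite !lt_min d00 d10.
have [dd0 dd1 dd2] : [/\ d <= d0, d <= d1 & d <= d2].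
  by rewrite /d !ge_min !lexx !orbT.
have s0 : 0 < s by rewrite divr_gt0.
have sd : s < d / 2 by rewrite /s; lra.
have box (p q : 'I_n.+1) u v : 0 <= u <= s -> 0 <= v <= s ->
    V (slide p (slide q x v) u) /\ forall j, `|slide p (slide q x v) u ord0 j - x ord0 j| < d.
  move=> /andP[u0 us] /andP[v0 vs].
  have hd := @slide2_near p q x d u v _ _; split.
    apply: hV => [|j]; first by do 2!apply: slide_half => //; exact: VE.
    by apply: lt_le_trans (hd _ _ j) dd0; rewrite ?u0 ?v0 /=; lra.
  by apply: hd; rewrite ?u0 ?v0 /=; lra.
(* The second difference is symmetric in p and q, so using this for both orders equates the two
   mixed derivatives at two points of the square. *)
have rect (p q : 'I_n.+1) : exists u v, [/\ 0 <= u <= s, 0 <= v <= s &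
    f (slide p (slide q x s) s) - f (slide q x s) - (f (slide p x s) - f x)
    = pd E q (pd E p f) (slide q (slide p x u) v) * s * s].
  have ss : 0 <= s <= s by rewrite lexx ltW.
  have z0 : 0 <= (0 : R) <= s by rewrite lexx ltW.
  pose F y := f (slide q y s) - f y.
  pose G y := pd E p f (slide q y s) - pd E p f y.
  have [u /andP[u0 us] eu] : exists2 u, 0 < u < s & F (slide p x s) - F x = G (slide p x u) * s.
    apply: mean_value => //; first exact: VE.
    move=> u us.
    have i1 : ispd p (fun y => f (slide q y s)) (slide p x u) (pd E p f (slide q (slide p x u) s)).
      apply/along_eps => r r0.
      have [r1 r10 hr] := (along_eps _ _ _ _).1
        (smooth_ispd VE (i := p) sf (box q p s u ss us).1) r r0.
      exists r1 => // t t0 tr Et.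
      have := hr t t0 tr; rewrite slideC => /(_ (slide_half _ Et (ltW s0))).
      by rewrite /quotient_at -!/(slide _ _ _) [slide p (slide q _ _) t]slideC.
    have Vu : V (slide p x u) by have := (box p p u 0 us z0).1; rewrite slide0.
    have i2 := smooth_ispd VE (i := p) sf Vu.
    have := ispdD i1 (ispdM (ispd_cst p (slide p x u) (- 1)) i2).
    rewrite mul0r add0r /G mulN1r /F; congr (ispd _ _ _ _).
    by apply/funext => y; rewrite mulN1r.
  have us' : 0 <= u <= s by rewrite !ltW.
  have [v /andP[v0 vs] ev] : exists2 v, 0 < v < s & pd E p f (slide q (slide p x u) s)
      - pd E p f (slide p x u) = pd E q (pd E p f) (slide q (slide p x u) v) * s.
    apply: mean_value => //; first by apply: slide_half; [exact: VE | exact: ltW].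
    move=> v vs; apply: (smooth_ispd VE (smooth_pd _ sf)).
    exact: (box q p v u vs us').1.
  exists u, v; split; rewrite ?ltW //.
  move: eu; rewrite /F /G ev slideC => <-; ring.
have [u [v [us vs e1]]] := rect b a; have [u' [v' [us' vs' e3]]] := rect a b.
have : pd E a (pd E b f) (slide a (slide b x u) v) =
    pd E b (pd E a f) (slide b (slide a x u') v').
  move: (pd E a (pd E b f) _) (pd E b (pd E a f) _) e1 e3 => Z Z'.
  rewrite (slideC b a).
  move: (f (slide a (slide b x s) s)) (f (slide a x s)) (f (slide b x s)) (f x).
  move=> w1 w2 w3 w4 e1 e3; have sn : s != 0 by rewrite gt_eqF.
  apply: (mulIf sn); apply: (mulIf sn); rewrite -e1 -e3; ring.
have [V1 c1] := box a b v u vs us; have [V2 c2] := box b a v' u' vs' us'.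
have := h1 _ V1 (fun j => lt_le_trans (c1 j) dd1).
have := h2 _ V2 (fun j => lt_le_trans (c2 j) dd2).
set X := pd E a (pd E b f) x; set Y := pd E b (pd E a f) x.
set Z := pd E b _ (slide _ _ _); set Z' := pd E a _ (slide _ _ _) => p q r.
rewrite r in q => {r Z'}; clearbody X Y Z.
have -> : X - Y = - (Z - X) + (Z - Y) by rewrite opprB addrA subrK.
by apply: le_lt_trans (ler_normD _ _) _; rewrite normrN [e]splitr; exact: ltrD.
Qed.
End Schwarz.

(** * Division by the transverse coordinate *)

Section Hadamard.
Context {R : realType} {n : nat}.
Local Notation E := (@halfspace R n).
Implicit Types (i j a b : 'I_n.+1) (x y : 'rV[R]_n.+1) (f h F N : 'rV[R]_n.+1 -> R) (t l s : R).
Variable V : set 'rV[R]_n.+1.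
Hypothesis VE : V `<=` E.
Hypothesis Vopen : forall x, V x -> exists2 d : R, 0 < d &
  forall y, E y -> (forall j, `|y ord0 j - x ord0 j| < d) -> V y.
Hypothesis Vseg : forall x s, V x -> 0 <= s -> s <= x ord0 ord0 -> V (slide ord0 x (- s)).
Local Notation smooth := (smooth_on E V).
Local Notation x0 x := (x ord0 ord0).

Definition foot x := slide ord0 x (- x0 x).

Lemma footE x j : foot x ord0 j = if j == ord0 then 0 else x ord0 j.
Proof.
rewrite slideE; case: eqP => [->|_]; first by rewrite mulr1 subrr.
by rewrite mulr0 addr0.
Qed.

Lemma slide_foot x t : slide ord0 (foot x) t = slide ord0 x (t - x0 x).
Proof. by rewrite slide_add addrC. Qed.

Lemma foot_V x : V x -> V (foot x).
Proof. by move=> Vx; apply: Vseg => //; exact: VE. Qed.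

Lemma slide_foot_V x u : V x -> 0 <= u <= x0 x -> V (slide ord0 (foot x) u).
Proof.
move=> Vx /andP[u0 ux]; rewrite slide_foot (_ : u - x0 x = - (x0 x - u)); last by ring.
by apply: Vseg => //; lra.
Qed.

Lemma coord_slide_foot x u : x0 (slide ord0 (foot x) u) = u.
Proof. by rewrite slideE footE eqxx mulr1 add0r. Qed.

Lemma slide_footK x : slide ord0 (foot x) (x0 x) = x.
Proof. by rewrite slide_foot subrr slide0. Qed.

Lemma ispd_pow i k y :
  ispd i (fun y => x0 y ^+ k) y (((@ord0 n) == i)%:R * (k%:R * x0 y ^+ k.-1)).
Proof.
elim: k => [|k IH].
  rewrite mul0r mulr0 (_ : (fun _ => _) = fun=> 1) ?expr0 //; exact: ispd_cst.
have -> : (fun y : 'rV[R]_n.+1 => x0 y ^+ k.+1) = (fun y => x0 y * x0 y ^+ k).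
  by apply/funext => z; rewrite exprS.
have := ispdM (@ispd_coord R n i ord0 y) IH; congr (ispd _ _ _ _).
rewrite [X in _ + X]mulrCA -mulrDr; congr (_ * _).
case: k {IH} => [|k]; rewrite /= ?expr0 ?mul0r ?mulr0 ?addr0 ?mul1r //.
by rewrite mulrCA -exprS -[X in X + _]mul1r -mulrDl addrC natr1.
Qed.

Arguments ispd_pow : clear implicits.

(* Cauchy's mean value theorem against a power of the transverse coordinate. *)
Lemma cauchy_value N (H : R -> R) k x : V x -> 0 < x0 x -> N (foot x) = 0 ->
  (forall u, 0 <= u <= x0 x -> ispd ord0 N (slide ord0 (foot x) u) (u ^+ k * H u)) ->
  exists2 c, 0 < c < x0 x & N x / x0 x ^+ k.+1 = H c / k.+1%:R.
Proof.
move=> Vx xp N0 hN.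
have Ef : E (foot x) by apply: VE; exact: foot_V.
have [|c c01] := mean_value (a := ord0) (y := foot x) (F := fun y => N y * x0 x ^+ k.+1 + (- N x) * x0 y ^+ k.+1)
  (G := fun y => x0 y ^+ k * H (x0 y) * x0 x ^+ k.+1 + (- N x) * (k.+1%:R * x0 y ^+ k))
  xp Ef.
  move=> u hu; apply: ispdD.
    have := ispdM (hN u hu) (ispd_cst ord0 (slide ord0 (foot x) u) (x0 x ^+ k.+1)).
    by rewrite mulr0 addr0 coord_slide_foot.
  have := ispdM (ispd_cst ord0 (slide ord0 (foot x) u) (- N x)) (ispd_pow ord0 k.+1 (slide ord0 (foot x) u)).
  by rewrite mul0r add0r eqxx mul1r.
rewrite slide_footK coord_slide_foot N0 mul0r add0r footE eqxx expr0n /= mulr0 subr0.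
rewrite mulNr subrr => /esym/eqP; rewrite mulf_eq0 (gt_eqF xp) orbF => /eqP e.
exists c => //; case/andP: c01 => c0 _.
have cn : c ^+ k != 0 by rewrite expf_neq0 // gt_eqF.
have xn : x0 x ^+ k.+1 != 0 by rewrite expf_neq0 // gt_eqF.
have kn : k.+1%:R != 0 :> R by rewrite pnatr_eq0.
apply/eqP; rewrite eqr_div //; apply/eqP; apply: (mulfI cn).
move/eqP: e; rewrite mulNr subr_eq0 => /eqP e; rewrite [RHS]mulrA e; ring.
Qed.

(** The quotient of N by the power k+1 of the transverse coordinate. When its derivative across the
    boundary is F times the k-th power, the limit at the boundary is F / (k+1). *)
Definition quo k N F x : R :=
  if x0 x == 0 then F x / k.+1%:R else N x / x0 x ^+ k.+1.

(** Only k = 0 is wanted, but transverse differentiation raises k by one; admitting all k makes the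
    class closed under partial derivatives, as [smooth_ind] demands. *)
Definition quo_class : set ('rV[R]_n.+1 -> R) := [set f | exists k N F,
  [/\ smooth N, smooth F, forall x, V x -> x0 x = 0 -> N x = 0,
    forall x, V x -> pd E ord0 N x = x0 x ^+ k * F x & f = quo k N F]].

(** Every value of the quotient is a value of F / (k+1) at a point between x and its foot, which
    yields continuity at the boundary. *)
Lemma quo_mid k N F x : smooth N -> (forall x, V x -> x0 x = 0 -> N x = 0) ->
  (forall x, V x -> pd E ord0 N x = x0 x ^+ k * F x) -> V x ->
  exists2 c, 0 <= c <= x0 x & quo k N F x = F (slide ord0 (foot x) c) / k.+1%:R.
Proof.
move=> sN N0 NF Vx; have Ex := VE Vx; rewrite /quo; case: eqP => [xz|/eqP xz].
  exists 0; first by rewrite lexx Ex.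
  by rewrite slide_foot sub0r xz oppr0 slide0.
have xp : 0 < x0 x by rewrite lt_neqAle eq_sym xz.
have [||c /andP[c0 cx] e] := cauchy_value (k := k) (N := N)
  (H := fun u => F (slide ord0 (foot x) u)) Vx xp.
- by apply: N0; [exact: foot_V | rewrite footE eqxx].
- move=> u hu; have Vu := slide_foot_V Vx hu.
  by have := smooth_ispd VE (i := ord0) sN Vu; rewrite NF // coord_slide_foot.
by exists c; rewrite ?ltW.
Qed.

Let V' : set 'rV[R]_n.+1 := [set x | V x /\ 0 < x0 x].

Lemma interior_sub : V' `<=` E. Proof. by move=> x [/VE]. Qed.

Lemma interior_open x : V' x -> exists2 d : R, 0 < d &
  forall y, E y -> (forall j, `|y ord0 j - x ord0 j| < d) -> V' y.
Proof.
move=> [Vx xp]; have [d d0 hd] := Vopen Vx; exists (Num.min d (x0 x)).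
  by rewrite lt_min d0.
move=> y Ey yx; split; first by apply: hd => // j; have := yx j; rewrite lt_min => /andP[].
have := yx ord0; rewrite lt_min => /andP[_]; rewrite ltr_norml => /andP[h _].
by move: h; rewrite ltrBrDr addNr.
Qed.

Lemma smooth_sub (W : set 'rV[R]_n.+1) f : W `<=` V -> smooth f -> smooth_on E W f.
Proof.
move=> WV sf q; have [c d] := sf q; split; last by move=> i x /WV; exact: d.
exact: continuous_subspaceW c.
Qed.

Lemma smooth_pow k : algebraic V' (fun x => x0 x ^+ k).
Proof.
elim: k => [|k IH].
  by rewrite (_ : (fun _ => _) = fun=> 1); [exact: alg_cst | apply/funext => x].
have -> : (fun y : 'rV[R]_n.+1 => x0 y ^+ k.+1) = (fun y => x0 y * x0 y ^+ k).
  by apply/funext => z; rewrite exprS.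
by apply: alg_mul => //; exact: alg_coord.
Qed.

Lemma quo_interior k N F : smooth N ->
  smooth_on E V' (fun x => N x * (x0 x ^+ k.+1)^-1).
Proof.
move=> sN; apply: (algebraic_smooth interior_sub interior_open); apply: alg_mul.
  by apply: alg_smooth; apply: smooth_sub sN => x [].
apply: alg_inv; first exact: smooth_pow.
by move=> x [_ xp]; rewrite expf_neq0 // gt_eqF.
Qed.

Lemma quo_interior_eq k N F x : V' x -> N x * (x0 x ^+ k.+1)^-1 = quo k N F x.
Proof. by move=> [_ xp]; rewrite /quo gt_eqF. Qed.

Lemma quo_cont f : quo_class f -> cont V f.
Proof.
move=> [k [N [F [sN sF N0 NF ->]]]] x Vx e e0.
have kn : 0 < k.+1%:R :> R by rewrite ltr0n.
have [xz|xz] := eqVneq (x0 x) 0; last first.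
  have xp : 0 < x0 x by rewrite lt_neqAle eq_sym xz; exact: VE.
  have Vx' : V' x by [].
  have [d d0 hd] := smooth_cont (quo_interior k F sN) Vx' e0.
  have [d' d'0 hd'] := interior_open Vx'.
  exists (Num.min d d') => [|y Vy yx]; first by rewrite lt_min d0.
  have Vy' : V' y.
    by apply: hd' => [|j]; [exact: VE | have := yx j; rewrite lt_min => /andP[]].
  rewrite -!quo_interior_eq //; apply: hd => // j.
  by have := yx j; rewrite lt_min => /andP[].
have [d d0 hd] := smooth_cont sF Vx (mulr_gt0 e0 kn).
exists d => // y Vy yx; have [c /andP[c0 cy] ->] := quo_mid sN N0 NF Vy.
rewrite /quo xz eqxx -mulrBl normrM normfV (ger0_norm (ltW kn)) ltr_pdivrMr //.
apply: hd => [|j]; first by apply: slide_foot_V => //; rewrite c0.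
have := yx j; rewrite slideE footE; case: eqP => [->|_]; last by rewrite mulr0 addr0.
rewrite add0r mulr1 xz !subr0; apply: le_lt_trans.
by rewrite !ger0_norm // (le_trans c0).
Qed.

Lemma quo_ispd f i : quo_class f ->
  exists2 h, quo_class h & forall x, V x -> ispd i f x (h x).
Proof.
move=> [k [N [F [sN sF N0 NF ->]]]].
have kn : k.+1%:R != 0 :> R by rewrite pnatr_eq0.
have inner x : V' x -> ispd i (quo k N F) x (pd E i N x * (x0 x ^+ k.+1)^-1 +
    N x * (- (((@ord0 n) == i)%:R * (k.+1%:R * x0 x ^+ k)) *
           ((x0 x ^+ k.+1)^-1 * (x0 x ^+ k.+1)^-1))).
  move=> Vx; have [Vx0 xp] := Vx.
  apply: (ispd_eq interior_open Vx (@quo_interior_eq k N F)).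
  apply: ispdM; first exact: (smooth_ispd VE).
  apply: ispdV; [exact: VE | by rewrite expf_neq0 // gt_eqF | exact: ispd_pow].
have [i0|i0] := eqVneq i ord0; last first.
  exists (quo k (pd E i N) (pd E i F)).
    exists k, (pd E i N), (pd E i F); split=> //; try exact: smooth_pd.
      move=> x Vx xz; apply: ispd_unique (VE Vx) _.
      apply: ispd_congr (ispd_cst i x 0); first by rewrite N0.
      have [d d0 hd] := Vopen Vx; near=> t => Et; apply/esym/N0; last first.
        by rewrite slideE xz add0r eq_sym (negbTE i0) mulr0.
      by apply: hd => //; apply: slide_near; near: t; exact: dnbhs0_lt.
    move=> x Vx; rewrite (pdC VE Vopen ord0 i sN Vx).
    rewrite (pd_eq Vopen i Vx NF); apply: ispd_unique (VE Vx) _.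
    have := ispdM (ispd_pow i k x) (smooth_ispd VE (i := i) sF Vx).
    by rewrite eq_sym (negbTE i0) !mul0r add0r.
  move=> x Vx; rewrite /quo; case: eqP => [xz|/eqP xz].
    have := ispdM (smooth_ispd VE (i := i) sF Vx) (ispd_cst i x (k.+1%:R)^-1).
    rewrite mulr0 addr0; apply: ispd_congr; first by rewrite /quo xz eqxx.
    near=> t => Et; rewrite /quo slideE xz add0r [ord0 == i]eq_sym (negbTE i0).
    by rewrite mulr0 eqxx.
  have xp : 0 < x0 x by rewrite lt_neqAle eq_sym xz; exact: VE.
  have := inner x (conj Vx xp).
  by rewrite eq_sym (negbTE i0) !mul0r oppr0 mul0r mulr0 addr0.
rewrite i0 in inner *.
(* The numerator of the transverse derivative over the power k+2. The terms with F cancel in its own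
   derivative, which is the power k+1 times that of F. *)
pose N2 x := x0 x ^+ k.+1 * F x + (- k.+1%:R) * N x.
have powV (j : nat) : algebraic V (fun x => x0 x ^+ j).
  elim: j => [|j IH].
    by rewrite (_ : (fun _ => _) = fun=> 1); [exact: alg_cst | apply/funext => x].
  have -> : (fun y : 'rV[R]_n.+1 => x0 y ^+ j.+1) = (fun y => x0 y * x0 y ^+ j).
    by apply/funext => z; rewrite exprS.
  by apply: alg_mul => //; exact: alg_coord.
exists (quo k.+1 N2 (pd E ord0 F)).
  exists k.+1, N2, (pd E ord0 F); split=> //.
  - apply: (algebraic_smooth VE Vopen); apply: alg_add; apply: alg_mul => //.
    + exact: alg_smooth.
    + exact: alg_cst.
    + exact: alg_smooth.
  - exact: smooth_pd.
  - by move=> x Vx xz; rewrite /N2 xz N0 // expr0n mul0r mulr0 addr0.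
  move=> x Vx; apply: ispd_unique (VE Vx) _.
  have := ispdD (ispdM (ispd_pow ord0 k.+1 x) (smooth_ispd VE (i := ord0) sF Vx))
    (ispdM (ispd_cst ord0 x (- k.+1%:R)) (smooth_ispd VE (i := ord0) sN Vx)).
  by rewrite NF // eqxx /=; congr (ispd _ _ _ _); ring.
move=> x Vx; have [xz|xz] := eqVneq (x0 x) 0; last first.
  have xp : 0 < x0 x by rewrite lt_neqAle eq_sym xz; exact: VE.
  have := inner x (conj Vx xp); rewrite eqxx NF // /quo (negbTE xz).
  congr (ispd _ _ _ _); rewrite /N2 [true%:R]mulr1n mul1r !exprS.
  have : x0 x ^+ k != 0 by rewrite expf_neq0.
  by move: (x0 x ^+ k) (k.+1%:R) => p q pn; field; rewrite pn xz.
rewrite {2}/quo xz eqxx; apply/along_eps => e e0.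
have k2 : 0 < k.+2%:R :> R by rewrite ltr0n.
have [d d0 hd] := (along_eps _ _ _ _).1 (smooth_ispd VE (i := ord0) sF Vx) (e * k.+2%:R)
  (mulr_gt0 e0 k2).
have [d1 d10 hd1] := Vopen Vx.
exists (Num.min d d1) => [|t t0 td Et]; first by rewrite lt_min d0.
have tp : 0 < t by rewrite lt_neqAle eq_sym t0; move: Et; rewrite /halfspace /= slideE xz add0r mulr1.
have Vt : V (slide ord0 x t).
  by apply: hd1 => //; apply: slide_near; move: td; rewrite lt_min => /andP[].
have xt : x0 (slide ord0 x t) = t by rewrite slideE xz add0r mulr1.
have xtp : 0 < x0 (slide ord0 x t) by rewrite xt.
have ft : foot (slide ord0 x t) = x.
  by rewrite /foot xt slide_add subrr slide0.
(* Subtracting the boundary value turns the derivative into u^(k+1) times the difference quotient of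
   F at x. [cauchy_value] then bounds the quotient of [quo] by that of F. *)
pose M y := N y + - (F x / k.+1%:R) * x0 y ^+ k.+1.
have [||c /andP[c0 cy] ec] := @cauchy_value M (fun u => (F (slide ord0 x u) - F x) / u) k.+1
  (slide ord0 x t) Vt xtp.
- by rewrite ft /M N0 // xz expr0n mulr0 addr0.
- rewrite xt ft => u /andP[u0 ut].
  have Vu : V (slide ord0 x u) by rewrite -[x]ft; apply: slide_foot_V; rewrite // xt u0.
  have := ispdD (smooth_ispd VE (i := ord0) sN Vu)
    (ispdM (ispd_cst ord0 _ (- (F x / k.+1%:R))) (ispd_pow ord0 k.+1 (slide ord0 x u))).
  rewrite NF // eqxx slideE xz add0r mulr1 /=; congr (ispd _ _ _ _).
  have [->|un] := eqVneq u 0.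
    rewrite slide0; move: (k.+1%:R) kn => r rn.
    by rewrite exprS !mul0r !add0r; field.
  by rewrite exprS; move: (k.+1%:R) kn (u ^+ k) => r rn p; field; rewrite rn un.
rewrite /quotient_at -/(slide ord0 x t) /quo xt (negbTE t0) xz eqxx.
have -> : t^-1 * (N (slide ord0 x t) / t ^+ k.+1 - F x / k.+1%:R) =
    quotient_at ord0 F x c / k.+2%:R.
  rewrite /quotient_at -/(slide ord0 x c) [c^-1 * _]mulrC.
  move: ec; rewrite xt /M xt => <-; rewrite !exprS.
  have : t ^+ k != 0 by rewrite expf_neq0.
  move: (k.+1%:R) kn (t ^+ k) => r rn p pn.
  by field; rewrite rn t0 pn.
rewrite -mulrBl normrM normfV (ger0_norm (ltW k2)) ltr_pdivrMr //.
rewrite xt in cy.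
apply: hd; rewrite ?gt_eqF //; last by apply: slide_half; [exact: VE | exact: ltW].
rewrite ger0_norm ?ltW // (lt_trans cy) //.
by move: td; rewrite lt_min => /andP[+ _]; rewrite ger0_norm // ltW.
Unshelve. all: by end_near. Qed.

Lemma Hadamard f : smooth f -> (forall x, V x -> x0 x = 0 -> f x = 0) ->
  exists2 h, smooth h & forall x, V x -> f x = x0 x * h x /\ (x0 x = 0 -> h x = pd E ord0 f x).
Proof.
move=> sf f0; exists (quo 0 f (pd E ord0 f)).
  apply: (smooth_ind VE Vopen quo_cont) => [g i|]; first exact: quo_ispd.
  exists 0%N, f, (pd E ord0 f); split=> //; first exact: smooth_pd.
  by move=> x Vx; rewrite expr0 mul1r.
move=> x Vx; rewrite /quo expr1; split=> [|->]; last by rewrite eqxx divr1.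
by case: eqP => [xz|/eqP xz]; [rewrite xz mul0r f0 | rewrite mulrC divfK].
Qed.
End Hadamard.

(** * The ring of smooth functions on a region *)

Section Region.
Context (R : realType) (n : nat).
Local Notation E := (@halfspace R n).

Record region := Region {
  rset : set 'rV[R]_n.+1;
  rset_sub : rset `<=` E;
  rset_open : forall x, rset x -> exists2 d : R, 0 < d &
    forall y, E y -> (forall j, `|y ord0 j - x ord0 j| < d) -> rset y;
  base : 'rV[R]_n.+1;
  baseP : rset base }.

(** Outside V the function is frozen at its value at the base point. Elements are then determined by
    their values on V, and constants belong to the ring, which an extension by 0 would not allow. *)
Definition smooth_pred (V : region) : {pred 'rV[R]_n.+1 -> R} :=
  [pred f | `[< smooth_on E (rset V) f /\ forall x, ~ rset V x -> f x = f (base V) >]].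

Lemma smooth_predP (V : region) f :
  reflect (smooth_on E (rset V) f /\ forall x, ~ rset V x -> f x = f (base V)) (f \in smooth_pred V).
Proof. exact: asboolP. Qed.

Section Closed.
Variable V : region.
Let alg := algebraic_smooth (@rset_sub V) (@rset_open V).

Fact smooth_pred_subring : subring_closed (smooth_pred V).
Proof.
split.
- apply/smooth_predP; split=> //; exact: alg (alg_cst _ 1).
- move=> f h /smooth_predP[sf cf] /smooth_predP[sh ch]; apply/smooth_predP; split.
    apply: (smooth_eq (@rset_sub V) (@rset_open V) (f := fun x => f x + -1 * h x)).
      by move=> x _; rewrite mulN1r.
    apply: alg; apply: alg_add; first exact: alg_smooth.
    by apply: alg_mul; [exact: alg_cst | exact: alg_smooth].
  by move=> x /[dup] /cf ? /ch ?; rewrite !fctE; congr (_ - _).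
move=> f h /smooth_predP[sf cf] /smooth_predP[sh ch]; apply/smooth_predP; split.
  by apply: alg; apply: alg_mul; exact: alg_smooth.
by move=> x /[dup] /cf ? /ch ?; rewrite !fctE; congr (_ * _).
Qed.
HB.instance Definition _ := GRing.isSubringClosed.Build _ (smooth_pred V) smooth_pred_subring.

Fact smooth_pred_scale : GRing.scaler_closed (smooth_pred V).
Proof.
move=> r f /smooth_predP[sf cf]; apply/smooth_predP; split.
  by apply: alg; apply: (alg_mul (alg_cst _ r)); exact: alg_smooth.
by move=> x /cf e; rewrite /GRing.scale /= e.
Qed.
End Closed.

Record pre_sfun (V : region) := SFun { sval_ :> 'rV[R]_n.+1 -> R; svalP : sval_ \in smooth_pred V }.
Section Struct.
Variable V : region.
HB.instance Definition _ := [isSub of pre_sfun V for @sval_ V].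
HB.instance Definition _ := [Choice of pre_sfun V by <:].
HB.instance Definition _ := [SubChoice_isSubComNzRing of pre_sfun V by <:].
HB.instance Definition _ := GRing.isScaleClosed.Build R _ (smooth_pred V) (@smooth_pred_scale V).
HB.instance Definition _ := [SubZmodule_isSubLmodule of pre_sfun V by <:].
Fact pre_sfun_scaleAl (r : R) (f h : pre_sfun V) : r *: (f * h) = r *: f * h.
Proof. by apply/val_inj/funext => x /=; rewrite !fctE scalerAl. Qed.
HB.instance Definition _ := GRing.Lmodule_isLalgebra.Build R (pre_sfun V) pre_sfun_scaleAl.
Fact pre_sfun_scaleAr (r : R) (f h : pre_sfun V) : r *: (f * h) = f * (r *: h).
Proof. by apply/val_inj/funext => x /=; rewrite !fctE scalerAr. Qed.
HB.instance Definition _ := GRing.Lalgebra_isAlgebra.Build R (pre_sfun V) pre_sfun_scaleAr.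
End Struct.

Record function_ring (V : region) := FunctionRing {
  fO :> comAlgType R;
  fev : 'rV[R]_n.+1 -> fO -> R;
  fmk : ('rV[R]_n.+1 -> R) -> fO;
  fevD : forall x F G, fev x (F + G) = fev x F + fev x G;
  fevM : forall x F G, fev x (F * G) = fev x F * fev x G;
  fevZ : forall x (r : R) F, fev x (r *: F) = r * fev x F;
  fev1 : forall x, fev x 1 = 1;
  fev_ext : forall F G, (forall x, rset V x -> fev x F = fev x G) -> F = G;
  fev_smooth : forall F, smooth_on E (rset V) (fun x => fev x F);
  fmkE : forall f x, smooth_on E (rset V) f -> rset V x -> fev x (fmk f) = f x }.

(* Opaque, so that unification never unfolds the ring operations. *)
Fact smooth_functions (V : region) : function_ring V.
Proof.
pose extend f x : R := if `[< rset V x >] then f x else f (base V).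
have ext_pred f : smooth_on E (rset V) f -> extend f \in smooth_pred V.
  move=> sf; apply/smooth_predP; split.
    apply: (smooth_eq (@rset_sub V) (@rset_open V) (f := f)) => // x Vx.
    by rewrite /extend asboolT.
  by move=> x Vx; rewrite /extend asboolF // asboolT //; exact: baseP.
apply: (@FunctionRing V (pre_sfun V) (fun x F => sval_ F x)
  (fun f => if pselect (smooth_on E (rset V) f) is left sf then SFun (ext_pred f sf)
    else 0)) => //.
- move=> F G e; apply/val_inj/funext => x /=.
  case/smooth_predP: (svalP F) (svalP G) => _ cF /smooth_predP[_ cG].
  have [Vx|nVx] := pselect (rset V x); first exact: e.
  by rewrite cF // cG //; apply: e; exact: baseP.
- by move=> F; case/smooth_predP: (svalP F).
- by move=> f x sf Vx; case: pselect => // {}sf; rewrite /= /extend asboolT.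
Qed.
End Region.

Notation sfun V := (fO (smooth_functions V)).

Section SmoothFunctions.
Context {R : realType} {n : nat} (V : region R n).
Local Notation E := (@halfspace R n).
Local Notation V_ := (rset V).
Implicit Types (F G : sfun V) (f h : 'rV[R]_n.+1 -> R) (x : 'rV[R]_n.+1).
Local Notation smooth := (smooth_on E V_).
Let VE := @rset_sub R n V.
Let Vo := @rset_open R n V.
Let alg := algebraic_smooth VE Vo.

Definition ev x F : R := fev x F.

Lemma evD x F G : ev x (F + G) = ev x F + ev x G. Proof. exact: fevD. Qed.
Lemma evM x F G : ev x (F * G) = ev x F * ev x G. Proof. exact: fevM. Qed.
Lemma evZ x (r : R) F : ev x (r *: F) = r * ev x F. Proof. exact: fevZ. Qed.
Lemma ev1 x : ev x 1 = 1. Proof. exact: fev1. Qed.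
Lemma evN x F : ev x (- F) = - ev x F. Proof. by rewrite -scaleN1r evZ mulN1r. Qed.
Lemma evB x F G : ev x (F - G) = ev x F - ev x G. Proof. by rewrite evD evN. Qed.
Lemma ev0 x : ev x 0 = 0. Proof. by rewrite -(scale0r 0) evZ mul0r. Qed.
Lemma ev_sum x (I : Type) (r : seq I) (P : pred I) (F : I -> sfun V) :
  ev x (\sum_(i <- r | P i) F i) = \sum_(i <- r | P i) ev x (F i).
Proof. exact: (big_morph _ (evD x) (ev0 x)). Qed.
Lemma evX x F k : ev x (F ^+ k) = ev x F ^+ k.
Proof. by elim: k => [|k IH]; rewrite ?expr0 ?ev1 // !exprS evM IH. Qed.

Fact ev_zmod x : zmod_morphism (ev x). Proof. by move=> F G; rewrite evB. Qed.
HB.instance Definition _ x := GRing.isZmodMorphism.Build (sfun V) R (ev x) (ev_zmod x).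
Fact ev_monoid x : monoid_morphism (ev x).
Proof. by split=> [|F G]; rewrite ?ev1 ?evM. Qed.
HB.instance Definition _ x := GRing.isMonoidMorphism.Build (sfun V) R (ev x) (ev_monoid x).

Lemma sfun_ext F G : (forall x, V_ x -> ev x F = ev x G) -> F = G.
Proof. exact: fev_ext. Qed.
Lemma sfun_smooth F : smooth (fun x => ev x F). Proof. exact: fev_smooth. Qed.
Definition mks f : sfun V := fmk (smooth_functions V) f.
Lemma mksE f x : smooth f -> V_ x -> ev x (mks f) = f x. Proof. exact: fmkE. Qed.

Fact sD_key : unit. Proof. exact: tt. Qed.
Definition sD a F : sfun V := locked_with sD_key (mks (pd E a (fun x => ev x F))).

Lemma sDE a F x : V_ x -> ev x (sD a F) = pd E a (fun y => ev y F) x.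
Proof. by move=> Vx; rewrite /sD unlock mksE //; apply: smooth_pd; exact: sfun_smooth. Qed.

Lemma sD_ispd a F x : V_ x -> ispd a (fun y => ev y F) x (ev x (sD a F)).
Proof. by move=> Vx; rewrite sDE //; apply: (smooth_ispd VE) => //; exact: sfun_smooth. Qed.

Lemma sD_eq a f F x : (forall y, V_ y -> f y = ev y F) -> V_ x ->
  pd E a f x = ev x (sD a F).
Proof. by move=> e Vx; rewrite sDE //; exact: (pd_eq Vo). Qed.

Lemma sDD a F G : sD a (F + G) = sD a F + sD a G.
Proof.
apply: sfun_ext => x Vx; rewrite [RHS]evD (sDE a (F + G) Vx); apply: ispd_unique (VE Vx) _.
rewrite (_ : (fun y => _) = fun y => ev y F + ev y G); last by apply/funext => y; rewrite evD.
by apply: ispdD; exact: sD_ispd.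
Qed.

Lemma sDM a F G : sD a (F * G) = sD a F * G + F * sD a G.
Proof.
apply: sfun_ext => x Vx; rewrite [RHS]evD [X in X + _]evM [X in _ + X]evM (sDE a (F * G) Vx); apply: ispd_unique (VE Vx) _.
rewrite (_ : (fun y => _) = fun y => ev y F * ev y G); last by apply/funext => y; rewrite evM.
by apply: ispdM; exact: sD_ispd.
Qed.

Lemma sDZ a (r : R) F : sD a (r *: F) = r *: sD a F.
Proof.
apply: sfun_ext => x Vx; rewrite [RHS]evZ (sDE a (r *: F) Vx); apply: ispd_unique (VE Vx) _.
rewrite (_ : (fun y => _) = fun y => r * ev y F); last by apply/funext => y; rewrite evZ.
by have := ispdM (ispd_cst a x r) (@sD_ispd a F x Vx); rewrite mul0r add0r.
Qed.

Lemma sDC a b F : sD a (sD b F) = sD b (sD a F).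
Proof.
apply: sfun_ext => x Vx.
have h c e : pd E c (fun y => ev y (sD e F)) x = pd E c (pd E e (fun y => ev y F)) x.
  by apply: (pd_eq Vo) => // y Vy; rewrite sDE.
apply: etrans (etrans (sDE a (sD b F) Vx) (h a b)) _.
apply: etrans _ (esym (etrans (sDE b (sD a F) Vx) (h b a))).
exact: (pdC VE Vo a b (@sfun_smooth F) Vx).
Qed.

Lemma sfun_inv F : (forall x, V_ x -> ev x F != 0) -> exists G, F * G = 1.
Proof.
move=> F0; have sG : smooth (fun x => (ev x F)^-1).
  by apply: alg; apply: alg_inv => //; apply: alg_smooth; exact: sfun_smooth.
exists (mks (fun x => (ev x F)^-1)); apply: sfun_ext => x Vx.
by rewrite evM (mksE sG Vx) ev1 divff // F0.
Qed.
End SmoothFunctions.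

(** * From components in a chart to the ring of functions *)

Section Bridge.
Context {R : realType} {n : nat} (V : region R n).
Local Notation E := (@halfspace R n).
Local Notation V_ := (rset V).
Local Notation m := n.+1.
Local Notation cov := ({set 'I_m} -> sfun V).
Local Notation form := ('rV[R]_m -> {set 'I_m} -> R).
Local Notation D := (@sD R n V).
Implicit Types (a b c e : 'I_m) (A B : form) (x : 'rV[R]_m) (S : {set 'I_m}) (F : cov).

(** Values outside V are ignored; this is harmless because V is relatively open in the half-space,
    so derivatives at points of V see only V. *)
Definition agree A F := forall x, V_ x -> forall S, A x S = ev x (F S).

Variables (g : 'rV[R]_m -> 'M[R]_m) (gV giV : 'M[sfun V]_m).
Hypothesis hg : forall x, V_ x -> g x = map_mx (ev x) gV.
Hypothesis gig : giV *m gV = 1%:M.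
Variables (sigma : 'rV[R]_m -> R) (s : sfun V).
Hypothesis hs : forall x, V_ x -> sigma x = ev x s.
Hypothesis gT : gV^T = gV.

Lemma ginvE x : V_ x -> ginv g x = map_mx (ev x) giV.
Proof.
move=> Vx; have h : map_mx (ev x) giV *m g x = 1%:M.
  by rewrite hg // -map_mxM gig map_mx1.
by rewrite /ginv -[RHS]mulmx1 -(mulmxV (mulmx1_unit h).2) mulmxA h mul1mx.
Qed.

Lemma ginv_ev x a b : V_ x -> ginv g x a b = ev x (giV a b).
Proof. by move=> Vx; rewrite ginvE // mxE. Qed.

Lemma g_ev x a b : V_ x -> g x a b = ev x (gV a b).
Proof. by move=> Vx; rewrite hg // mxE. Qed.

Lemma pd_g a b c x : V_ x -> pd E a (fun y => g y b c) x = ev x (D a (gV b c)).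
Proof. by move=> Vx; apply: sD_eq => // y Vy; rewrite g_ev. Qed.

Lemma Gamma_ev c a b x : V_ x -> Gamma E g c a b x = ev x (gam D gV giV a c b).
Proof.
move=> Vx; rewrite /Gamma mxE ev_sum mulr_sumr; apply: eq_bigr => e _.
rewrite (ginv_ev _ _ Vx) !(pd_g _ _ _ Vx) evM.
rewrite [low _ _ _ _ _]mxE.
rewrite (evM x hf) evB evD.
rewrite /hf evZ ev1 mulr1.
by rewrite mulrCA.
Qed.

Lemma pd_Gamma d c a b x : V_ x ->
  pd E d (Gamma E g c a b) x = ev x (D d (gam D gV giV a c b)).
Proof. by move=> Vx; apply: sD_eq => // y Vy; rewrite Gamma_ev. Qed.

Lemma Ric_ev b e x : V_ x -> Ric E g b e x = ev x (gRic D gV giV b e).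
Proof.
move=> Vx; rewrite /Ric /gRic ev_sum; apply: eq_bigr => a _.
rewrite /Riem !(pd_Gamma _ _ _ _ Vx) evD evB ev_sum; congr (_ + _).
by apply: eq_bigr => f _; rewrite evB !evM /= !(Gamma_ev _ _ _ Vx).
Qed.

Lemma J_ev x : V_ x -> J E g x = ev x (gJ D gV giV).
Proof.
move=> Vx; rewrite /J /gJ evZ mulrC /Scal; congr (_ * _).
rewrite ev_sum; apply: eq_bigr => a _; rewrite ev_sum; apply: eq_bigr => b _.
by rewrite evM /= Ric_ev // ginv_ev.
Qed.

Lemma P_ev a b x : V_ x -> P E g a b x = ev x (gP D gV giV a b).
Proof.
by move=> Vx; rewrite /P /gP evZ mulrC evB evM /= (Ric_ev _ _ Vx) (J_ev Vx) (g_ev _ _ Vx).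
Qed.

Lemma hess_ev a b x : V_ x -> hess E g sigma a b x = ev x (ghess D gV giV (D^~ s) a b).
Proof.
move=> Vx; rewrite /hess /ghess evB ev_sum; congr (_ - _).
  apply: sD_eq => // y Vy; exact: sD_eq.
by apply: eq_bigr => c _; rewrite evM (Gamma_ev _ _ _ Vx) (sD_eq _ hs).
Qed.

Lemma rho_ev x : V_ x -> rho E g sigma x = ev x (grho D gV giV s).
Proof.
move=> Vx; rewrite /rho /grho evZ evD evM (J_ev Vx) (hs Vx); congr (_ * (_ + _)).
rewrite ev_sum; apply: eq_bigr => a _; rewrite ev_sum; apply: eq_bigr => b _.
by rewrite evM /= hess_ev // ginv_ev.
Qed.

Lemma sgn_ev a S x : sgn a S = ev x (gsgn a S : sfun V) :> R.
Proof. by rewrite evX evN ev1. Qed.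

Lemma eps_ev a A F S x : V_ x -> agree A F -> eps a (A x) S = ev x (geps a F S).
Proof.
move=> Vx h; rewrite /eps /geps; case: ifP => _; rewrite ?ev0 // evM /=.
by rewrite -sgn_ev h.
Qed.

Lemma iot_ev a A F S x : V_ x -> agree A F -> iot a (A x) S = ev x (giot a F S).
Proof.
move=> Vx h; rewrite /iot /giot; case: ifP => _; rewrite ?ev0 // evM /=.
by rewrite -sgn_ev h.
Qed.

Lemma agree0 : agree 0 0.
Proof. by move=> x Vx S; rewrite ev0. Qed.
Lemma agreeD A B F G : agree A F -> agree B G -> agree (A + B) (F + G).
Proof. by move=> hA hB x Vx S; rewrite addrfctE evD /= -hA // -hB. Qed.
Lemma agreeN A F : agree A F -> agree (- A) (- F).
Proof. by move=> hA x Vx S; rewrite opprfctE evN /= -hA. Qed.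
Lemma agreeZ (r : R) A F : agree A F -> agree (r *: A) (r *: F).
Proof. by move=> hA x Vx S; rewrite scalrfctE evZ -hA. Qed.
Lemma agree_mul f h A F : (forall x, V_ x -> f x = ev x h) -> agree A F ->
  agree (fmul f A) (gmul h F).
Proof. by move=> hf hA x Vx S; rewrite /fmul /gmul evM /= -hf // -hA. Qed.

Lemma agree_d A F : agree A F -> agree (ext_d E A) (gd D F).
Proof.
move=> h x Vx S; rewrite /ext_d /gd fct_sumE ev_sum; apply: eq_bigr => a _.
apply: (@eps_ev a (fun x T => pd E a (fun y => A y T) x)) => // y Vy T.
by apply: sD_eq => // z Vz; rewrite h.
Qed.

Lemma agree_nabla a A F : agree A F -> agree (nabla E g a A) (nab D gV giV a F).
Proof.
move=> h x Vx S; rewrite /nabla /nab addrfctE opprfctE evB /=; congr (_ - _).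
  by apply: sD_eq => // z Vz; rewrite h.
rewrite fct_sumE ev_sum; apply: eq_bigr => b _.
rewrite fct_sumE ev_sum; apply: eq_bigr => c _.
rewrite evM (Gamma_ev _ _ _ Vx); congr (_ * _).
apply: (@eps_ev b (fun x => iot c (A x))) => // y Vy T; exact: iot_ev.
Qed.

Lemma agree_codiff A F : agree A F -> agree (codiff E g A) (gx D gV giV F).
Proof.
move=> h x Vx S; rewrite /codiff /gx /up fct_sumE ev_sum; apply: eq_bigr => a _.
rewrite fct_sumE ev_sum; apply: eq_bigr => b _.
rewrite evM (ginv_ev _ _ Vx); congr (_ * _).
by apply: (@iot_ev b (nabla E g a A)) => //; exact: agree_nabla.
Qed.

Lemma agree_iota A F : agree A F -> agree (iota_nu E g sigma A) (iot1 giV (D^~ s) F).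
Proof.
move=> h x Vx S; rewrite (iot1_iot gT gig) /iota_nu fct_sumE ev_sum.
apply: eq_bigr => a _; rewrite evM /= (iot_ev _ _ Vx h); congr (_ * _).
rewrite /nu ev_sum; apply: eq_bigr => b _; rewrite evM (ginv_ev _ _ Vx).
by rewrite (sD_eq _ hs).
Qed.

Lemma agree_J2P A F : agree A F -> agree (J2P E g A) (gJ2 D gV giV F).
Proof.
move=> h; apply: agreeD; first by apply: agree_mul => //; exact: J_ev.
apply: agreeN; apply: agreeZ => x Vx S; rewrite /Pder /gPder fct_sumE ev_sum.
apply: eq_bigr => a _; rewrite /Pmix; under eq_bigr => b _ do rewrite mulr_suml.
rewrite exchange_big fct_sumE ev_sum; apply: eq_bigr => c _ /=.
rewrite /up geps_sum gmul_sum fct_sumE ev_sum; apply: eq_bigr => b _ /=.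
rewrite geps_mul gmulA evM evM /= -(P_ev _ _ Vx) -(ginv_ev _ _ Vx); congr (_ * _).
apply: (@eps_ev a (fun x => iot b (A x))) => // y Vy T; exact: iot_ev.
Qed.

Lemma agree_rho A F : agree A F ->
  agree (fmul (rho E g sigma) A) (gmul (grho D gV giV s) F).
Proof. by apply: agree_mul; exact: rho_ev. Qed.

Lemma agree_sigma A F : agree A F -> agree (fmul sigma A) (gmul s F).
Proof. exact: agree_mul. Qed.

Lemma agree_Lapl A F : agree A F ->
  agree (Lapl E g A) (LapF (gd D) (gx D gV giV) F).
Proof.
by move=> h; apply: agreeD; [apply/agree_d/agree_codiff | apply/agree_codiff/agree_d].
Qed.

Definition tagree (T : tractor) (T' : tr cov) :=
  [/\ agree (north T) (nN T'), agree (west T) (nW T'), agree (east T) (nE T')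
    & agree (south T) (nS T')].

Lemma tagree_add T1 T2 T1' T2' : tagree T1 T1' -> tagree T2 T2' ->
  tagree (tadd T1 T2) (addT T1' T2').
Proof. by case=> ? ? ? ? []; split; exact: agreeD. Qed.

Lemma tagree_scale (r : R) T T' : tagree T T' -> tagree (tscale r T) (scaleT r T').
Proof. by case; split; exact: agreeZ. Qed.

Lemma tagree_Xs T T' : tagree T T' -> tagree (Xs T) (XsT T').
Proof. by case; split=> //; exact: agree0. Qed.

Ltac agree_tac :=
  cbn [north west east south Is Dt Ds nN nW nE nS IsT DtT DsT];
  repeat lazymatch goal with
  | |- agree (J2P _ _ _) _ => apply: agree_J2P
  | |- agree (Lapl _ _ _) _ => apply: agree_Lapl
  | |- agree (iota_nu _ _ _ _) _ => apply: agree_iota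
  | |- agree (ext_d _ _) _ => apply: agree_d
  | |- agree (codiff _ _ _) _ => apply: agree_codiff
  | |- agree (fmul (rho _ _ _) _) _ => apply: agree_rho
  | |- agree (fmul _ _) _ => apply: agree_sigma
  | |- agree (- _) _ => apply: agreeN
  | |- agree (_ *: _) _ => apply: agreeZ
  | |- agree (_ + _) _ => apply: agreeD
  | |- _ => assumption
  end.

Lemma tagree_Is T T' : tagree T T' -> tagree (Is E g sigma T)
  (IsT (gmul s) (iot1 giV (D^~ s)) (gmul (grho D gV giV s)) T').
Proof. by case; split; agree_tac. Qed.

Lemma tagree_Dt k w T T' : tagree T T' -> tagree (Dt E g k w T)
  (DtT m%:R (gd D) (gx D gV giV) (gJ2 D gV giV) k w T').
Proof. by case; split; agree_tac. Qed.

Lemma tagree_Ds k w T T' : tagree T T' -> tagree (Ds E g k w T)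
  (DsT m%:R (gd D) (gx D gV giV) (gJ2 D gV giV) k w T').
Proof. by case; split; agree_tac. Qed.

Local Notation yV := (yT m%:R (gd D) (gx D gV giV) (gJ2 D gV giV) (gmul s)
  (iot1 giV (D^~ s)) (gmul (grho D gV giV s))).
Local Notation ypowV := (ypowT m%:R (gd D) (gx D gV giV) (gJ2 D gV giV) (gmul s)
  (iot1 giV (D^~ s)) (gmul (grho D gV giV s))).
Local Notation DbarV := (DbarT m%:R (gd D) (gx D gV giV) (gJ2 D gV giV) (gmul s)
  (iot1 giV (D^~ s)) (gmul (grho D gV giV s))).

Lemma tagree_y k w T T' : tagree T T' -> tagree (yt E g sigma k w T) (yV k w T').
Proof.
move=> h; apply: tagree_scale; apply: tagree_add.
  by apply: tagree_Is; exact: tagree_Dt.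
by apply: tagree_Dt; exact: tagree_Is.
Qed.

Lemma tagree_ypow j k w T T' : tagree T T' ->
  tagree (ypow E g sigma j k w T) (ypowV j k w T').
Proof. by elim: j w T T' => //= j IH w T T' h; apply: IH; exact: tagree_y. Qed.

Lemma tagree_Dbar k w T T' : tagree T T' -> tagree (Dbar E g sigma k w T) (DbarV k w T').
Proof.
move=> h; apply: tagree_scale; apply: tagree_add; last first.
  by apply: tagree_scale; apply: tagree_Xs; exact: tagree_ypow.
by apply: tagree_add; [exact: tagree_Ds | apply: tagree_Is; exact: tagree_y].
Qed.
End Bridge.

(** * The local theorem *)

Section PackLinear.
Context {R : realType} {F : lmodType R} (f : F -> F) (fl : linear f).
HB.instance Definition _ := GRing.isLinear.Build R F F _ f fl.
Definition pack_linear : {linear F -> F} := f.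
End PackLinear.

Lemma linear_of (R : realType) (F : lmodType R) (f : F -> F) :
  (forall u v, f (u + v) = f u + f v) -> (forall (r : R) u, f (r *: u) = r *: f u) ->
  linear f.
Proof. by move=> fD fZ r u v; rewrite fD fZ. Qed.

(** * Restriction to the interior *)

Section Restriction.
Context {R : realType} {n : nat} (V : region R n).
Local Notation E := (@halfspace R n).
Local Notation m := n.+1.
Local Notation x0 x := (x ord0 ord0).
Variables (p1 : 'rV[R]_m) (Vp1 : rset V p1 /\ 0 < x0 p1).

Definition inner : region R n := @Region R n [set x | rset V x /\ 0 < x0 x]
  (@interior_sub R n (rset V) (@rset_sub R n V))
  (@interior_open R n (rset V) (@rset_open R n V)) p1 Vp1.

Lemma innerP x : rset inner x <-> rset V x /\ 0 < x0 x. Proof. by []. Qed.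

Definition res (F : sfun V) : sfun inner := mks inner (fun x => ev x F).

Lemma resE F x : rset inner x -> ev x (res F) = ev x F.
Proof.
move=> Vx; rewrite mksE //; apply: smooth_sub (sfun_smooth F) => y.
by case/innerP.
Qed.

Lemma along_lim i x (f : R -> R) l : E x -> f @ along E i x --> l ->
  lim (f @ along E i x) = l.
Proof. by move=> Ex h; apply: (@cvg_lim _ _ _ _ (along_proper i Ex)). Qed.

(** A boundary value is the limit of the values along the transverse direction. *)
Lemma res_inj F G : res F = res G -> F = G.
Proof.
move=> e; apply: sfun_ext => x Vx.
have [x0p|x0n] := ltP 0 (x0 x).
  by have := congr1 (ev x) e; rewrite !resE.
have Ex := rset_sub Vx; have x00 : x0 x = 0 by apply/eqP; rewrite eq_le x0n.
have Fc := ispd_cvg (@sD_ispd R n V ord0 F x Vx).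
have Gc := ispd_cvg (@sD_ispd R n V ord0 G x Vx).
rewrite -(along_lim Ex Fc); apply: along_lim => //; apply: along_cvg_eq Gc.
have [d d0 hd] := rset_open Vx; apply: along_near; near=> t => Et.
have Vt : rset V (slide ord0 x t).
  by apply: hd => //; apply: slide_near; near: t; exact: dnbhs0_lt.
have tp : 0 < t.
  rewrite lt_neqAle eq_sym; apply/andP; split; first by near: t; exact: nbhs_dnbhs_neq.
  by move: Et; rewrite /halfspace /= slideE x00 add0r eqxx mulr1.
have It : rset inner (slide ord0 x t) by split=> //; rewrite slideE x00 add0r eqxx mulr1.
by have := congr1 (ev (slide ord0 x t)) e; rewrite !resE.
Unshelve. all: by end_near. Qed.

Definition resf (A : {set 'I_m} -> sfun V) : {set 'I_m} -> sfun inner := fun S => res (A S).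

Lemma resf_inj A B : resf A = resf B -> A = B.
Proof. by move=> e; apply/funext => S; apply: res_inj; have := congr1 (fun h => h S) e. Qed.

Definition toform (W : region R n) (A : {set 'I_m} -> sfun W) :
  'rV[R]_m -> {set 'I_m} -> R := fun x S => ev x (A S).

Lemma agree_toform (W : region R n) (A : {set 'I_m} -> sfun W) : agree (toform A) A.
Proof. by []. Qed.

Lemma agree_res A F : @agree R n V A F -> agree A (resf F).
Proof. by move=> h x Vx S; rewrite resE // h //; case/innerP: Vx. Qed.

Lemma agree_inj (W : region R n) A F G : @agree R n W A F -> agree A G -> F = G.
Proof. by move=> h k; apply/funext => S; apply: sfun_ext => x Vx; rewrite -h // k. Qed.

Lemma resf0 : resf 0 = 0.
Proof. by apply/funext => S; apply: sfun_ext => x Vx; rewrite resE // !ev0. Qed.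
Lemma resfD A B : resf (A + B) = resf A + resf B.
Proof. by apply/funext => S; apply: sfun_ext => x Vx; rewrite resE // !evD !resE. Qed.
Lemma resfZ (r : R) A : resf (r *: A) = r *: resf A.
Proof. by apply/funext => S; apply: sfun_ext => x Vx; rewrite resE // !evZ resE. Qed.
Lemma resf_mul f A : resf (gmul f A) = gmul (res f) (resf A).
Proof. by apply/funext => S; apply: sfun_ext => x Vx; rewrite resE // !evM !resE. Qed.
Lemma resf_gN A : resf (gN A) = gN (resf A).
Proof. by apply/funext => S; apply: sfun_ext => x Vx; rewrite resE // !evZ resE. Qed.
Lemma resf_gcc A : resf (gcc A) = gcc (resf A).
Proof. by rewrite /gcc -!scaleNr resfD !resfZ resf_gN. Qed.
Lemma resM f h : res (f * h) = res f * res h.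
Proof. by apply: sfun_ext => x Vx; rewrite resE // !evM !resE. Qed.
Lemma res1 : res 1 = 1.
Proof. by apply: sfun_ext => x Vx; rewrite resE // !ev1. Qed.
Lemma res_D a f : res (sD a f) = sD a (res f).
Proof.
apply: sfun_ext => x Vx; rewrite resE //; have [VVx _] := (innerP x).1 Vx.
rewrite (sDE a f VVx) (sDE a (res f) Vx).
by apply: (pd_eq (@rset_open R n inner)) => // y Vy; rewrite resE.
Qed.
End Restriction.

Lemma ev_nat (R : realType) n (W : region R n) x k : ev x (k%:R : sfun W) = k%:R.
Proof. by elim: k => [|k IH]; rewrite ?ev0 // -!natr1 evD ev1 IH. Qed.

(** * The calculus of a scale and the local operators *)

Section ScaleCalculus.
Context {R : realType} {n : nat} (V : region R n).
Local Notation E := (@halfspace R n).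
Local Notation m := n.+1.
Local Notation x0 x := (x ord0 ord0).
Hypothesis n_gt1 : (1 < n)%N.
Variables (p1 : 'rV[R]_m) (Vp1 : rset V p1 /\ 0 < x0 p1).
Local Notation I := (inner Vp1).
Local Notation res := (@res R n V p1 Vp1).
Local Notation resf := (@resf R n V p1 Vp1).
Variables (g : 'rV[R]_m -> 'M[R]_m) (gV giV : 'M[sfun V]_m).
Hypothesis hg : forall x, rset V x -> g x = map_mx (ev x) gV.
Hypothesis gig : giV *m gV = 1%:M.
Hypothesis gT : gV^T = gV.
Variables (sigma : 'rV[R]_m -> R) (s : sfun V).
Hypothesis hs : forall x, rset V x -> sigma x = ev x s.
Hypothesis s_pos : forall x, rset I x -> 0 < sigma x.
Hypothesis Einstein : forall x a b, rset I x ->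
  let go y := sigma y ^- 2 *: g y in Ric E go a b x = - n%:R * go x a b.

Local Notation D := (@sD R n I).
Local Notation DD := (@sDD R n I).
Local Notation DM := (@sDM R n I).
Local Notation DZ := (@sDZ R n I).
Local Notation DC := (@sDC R n I).
Let gI : 'M[sfun I]_m := map_mx res gV.
Let giI : 'M[sfun I]_m := map_mx res giV.
Let sI := res s.

Lemma hgI x : rset I x -> g x = map_mx (ev x) gI.
Proof.
move=> Ix; have [Vx _] := (innerP Vp1 x).1 Ix; rewrite hg //.
by apply/matrixP => i j; rewrite !mxE resE.
Qed.

Lemma gigI : giI *m gI = 1%:M.
Proof.
apply/matrixP => i j; rewrite !mxE; apply: sfun_ext => x Ix; rewrite ev_sum.
have [Vx _] := (innerP Vp1 x).1 Ix.
have := congr1 (fun M : 'M[sfun V]_m => ev x (M i j)) gig; rewrite !mxE ev_sum.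
have -> : ev x (1 *+ (i == j) : sfun V) = ev x (1 *+ (i == j) : sfun I).
  by case: (i == j); rewrite ?mulr1n ?mulr0n ?ev1 ?ev0.
move=> <-; apply: eq_bigr => k _; by rewrite !mxE !evM !resE.
Qed.

Lemma gTI : gI^T = gI.
Proof.
by apply/matrixP => i j; rewrite !mxE; have := congr1 (fun M : 'M[sfun V]_m => M i j) gT;
  rewrite mxE => ->.
Qed.

Lemma hsI x : rset I x -> sigma x = ev x sI.
Proof. by move=> Ix; rewrite resE // hs //; case: ((innerP Vp1 x).1 Ix). Qed.

Definition spow (a : int) : sfun I := mks I (fun x => sigma x ^ a).

Lemma sigma_smooth : smooth_on E (rset I) sigma.
Proof.
by apply: (smooth_eq (@rset_sub R n I) (@rset_open R n I) _ (sfun_smooth sI)) => x Ix;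
  rewrite hsI.
Qed.

Lemma spowE a x : rset I x -> ev x (spow a) = sigma x ^ a.
Proof.
move=> Ix; rewrite mksE //.
apply: (algebraic_smooth (@rset_sub R n I) (@rset_open R n I)).
have pw k : algebraic (rset I) (fun x => sigma x ^+ k).
  elim: k => [|k IH]; first exact: (alg_cst _ 1).
  rewrite (_ : (fun x => sigma x ^+ k.+1) = fun x => sigma x * sigma x ^+ k).
    by apply: alg_mul => //; apply: alg_smooth; exact: sigma_smooth.
  by apply/funext => y; rewrite exprS.
case: a => k; first exact: pw.
by apply: alg_inv; [exact: pw | move=> y Iy; rewrite expf_neq0 // gt_eqF // s_pos].
Qed.

Lemma spowD a b : spow (a + b) = spow a * spow b.
Proof.
apply: sfun_ext => x Ix; rewrite evM !spowE // expfzDr //.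
by rewrite gt_eqF // s_pos.
Qed.

Lemma spow0 : spow 0 = 1.
Proof. by apply: sfun_ext => x Ix; rewrite spowE // ev1 expr0z. Qed.

Lemma spow1 : spow 1 = sI.
Proof. by apply: sfun_ext => x Ix; rewrite spowE // expr1z hsI. Qed.

Lemma spow1r : spow 1 = res s. Proof. exact: spow1. Qed.

Let si := spow (-1).

Lemma sK : sI * si = 1.
Proof. by rewrite -spow1 /si -spowD subrr spow0. Qed.

Lemma D_spow a b : D b (spow a) = a%:~R *: (spow (a - 1) * D b sI).
Proof.
have Dsi : D b si = - (si * si * D b sI).
  have := DM b sI si; rewrite sK (D1 DM) => e; have : si * (D b sI * si + sI * D b si) = 0.
    by rewrite -e mulr0.
  rewrite mulrDr mulrA mulrA [si * sI]mulrC sK mul1r addrC => /eqP.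
  by rewrite addr_eq0 => /eqP ->; congr (- _); rewrite mulrAC.
elim/int_ind: a => [|k IH|k IH].
- by rewrite spow0 (D1 DM) scale0r.
- rewrite -addn1 PoszD spowD DM IH spow1 addrK -scalerAl.
  have -> : spow (k%:Z - 1) * D b sI * sI = spow k%:Z * D b sI.
    by rewrite mulrAC -spow1 -spowD subrK.
  by rewrite intrD scalerDl scale1r.
have -> : - k.+1%:Z = - k%:Z - 1 by rewrite -addn1 PoszD opprD.
rewrite [in LHS]spowD DM IH -/si Dsi -scalerAl.
have -> : spow (- k%:Z - 1) * D b sI * si = spow (- k%:Z - 1 - 1) * D b sI.
  by rewrite mulrAC -spowD.
have -> : spow (- k%:Z) * - (si * si * D b sI) = - (spow (- k%:Z - 1 - 1) * D b sI).
  by rewrite mulrN !spowD !mulrA.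
by rewrite -[X in _ + X]scaleN1r -scalerDl intrD.
Qed.

Lemma eps1_scaled u u' f (r : R) (A : {set 'I_m} -> sfun I) :
  (forall c, u c = r *: (f * u' c)) -> eps1 u A = r *: gmul f (eps1 u' A).
Proof.
move=> e; rewrite /eps1 gmul_sum scaler_sumr; apply: eq_bigr => c _.
by rewrite e gmulZl gmulA.
Qed.
Lemma iot1_scaled u u' f (r : R) (A : {set 'I_m} -> sfun I) :
  (forall c, u c = r *: (f * u' c)) -> iot1 giI u A = r *: gmul f (iot1 giI u' A).
Proof.
move=> e; rewrite /iot1 gmul_sum scaler_sumr; apply: eq_bigr => c _.
by rewrite e gmulZl gmulA.
Qed.

Let Ein b e : gRic D ((si ^+ 2) *: gI) ((sI ^+ 2) *: giI) b e =
  - (m%:R - 1) * (si ^+ 2 * gI b e).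
Proof.
have hgo x : rset I x -> sigma x ^- 2 *: g x = map_mx (ev x) ((si ^+ 2) *: gI).
  move=> Ix; apply/matrixP => i j; rewrite !mxE (hgI Ix) !mxE evM evX spowE //.
  by rewrite exprVn.
have gigo : ((sI ^+ 2) *: giI) *m ((si ^+ 2) *: gI) = 1%:M.
  by rewrite -scalemxAl -scalemxAr gigI scalerA -exprMn sK expr1n scale1r.
apply: sfun_ext => x Ix.
rewrite -(Ric_ev hgo gigo b e Ix) Einstein // hgo // !mxE -natr1 addrK mulNr [RHS]evM evN.
rewrite [RHS]mulNr; by rewrite ev_nat.
Qed.

Let m_gt2 : (2 < m)%N := n_gt1.
Let rho_E := rho_Einstein m_gt2 DD DM DZ DC gTI gigI sK Ein.
Let J2_E := gJ2_Einstein m_gt2 DD DM DZ DC gTI gigI sK Ein.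

Local Notation cov := ({set 'I_m} -> sfun I).
Local Notation d := (gd D).
Local Notation x := (gx D gI giI).
Local Notation e := (eps1 (D^~ sI)).
Local Notation i := (iot1 giI (D^~ sI)).

Fact gd_lin : linear (d : cov -> cov).
Proof.
apply: linear_of => [u v|r u]; rewrite /gd.
  by rewrite -big_split; apply: eq_bigr => a _; rewrite (gDD DD) gepsD.
by rewrite scaler_sumr; apply: eq_bigr => a _; rewrite (gDZ DZ) gepsZ.
Qed.
Fact gx_lin : linear (x : cov -> cov).
Proof. by apply: linear_of => [u v|r u]; [exact: (gxD DD) | exact: (gxZ DZ)]. Qed.
Fact e_lin : linear (e : cov -> cov).
Proof. by apply: linear_of => [u v|r u]; [exact: eps1_D | exact: eps1_Z]. Qed.
Fact i_lin : linear (i : cov -> cov).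
Proof. by apply: linear_of => [u v|r u]; [exact: iot1_D | exact: iot1_Z]. Qed.
Fact cc_lin : linear (@gcc R (sfun I) m).
Proof.
apply: linear_of => [u v|r u]; rewrite /gcc; first by rewrite gND !scalerDr opprD addrACA.
by rewrite gNZ scalerBr !scalerA ![r * _]mulrC.
Qed.
Fact mul_lin f : linear (gmul f : cov -> cov).
Proof. by apply: linear_of => [u v|r u]; [exact: gmulD | exact: gmulZ]. Qed.

Lemma gcc_shift (f : cov -> cov) (r : R) v : (forall v, gN (f v) = f (gN v) + r *: f v) ->
  linear f -> gcc (f v) = f (gcc v) - (2 * r) *: f v.
Proof.
move=> h fl; rewrite /gcc h.
have fZ c u : f (c *: u) = c *: f u.
  have f0 : f 0 = 0 by have := fl (-1) 0 0; rewrite scaler0 addr0 scaleN1r addNr.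
  by have := fl c u 0; rewrite f0 !addr0.
have -> : f (m%:R *: v - 2 *: gN v) = m%:R *: f v - 2 *: f (gN v).
  by rewrite -!scaleNr addrC fl fZ addrC.
by rewrite scalerDr scalerA opprD addrA.
Qed.

(** Built on the interior, where sigma is invertible. The definition is transparent so that its
    fields compute to the concrete operators. *)
Definition scale_calculus : calculus cov m%:R.
Proof.
refine (@Calculus R cov m%:R (pack_linear gd_lin) (pack_linear gx_lin) (pack_linear e_lin)
  (pack_linear i_lin) (pack_linear cc_lin) (fun a => pack_linear (mul_lin (spow a)))
  (gmul (grho D gI giI sI)) (gJ2 D gI giI) _ _ _ _ _ _ _ _ _ _ _ _ _ _ _).
- exact: (gd_dd DD DZ DC).
- exact: (gx_gx DD DM DZ DC gTI gigI).
- by move=> a b v; rewrite /= gmulA spowD.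
- by move=> v; rewrite /= spow0 g1mul.
- move=> a v /=; rewrite (gd_mul DM) (eps1_scaled _ (u' := D^~ sI) (f := spow (a - 1)) (r := a%:~R)) //.
  by move=> c; exact: D_spow.
- move=> a v /=; rewrite (gx_mul DM) (iot1_scaled _ (u' := D^~ sI) (f := spow (a - 1)) (r := a%:~R)) //.
  by move=> c; exact: D_spow.
- by move=> a v; exact: eps1_mul.
- by move=> a v; exact: iot1_mul.
- move=> v /=; rewrite (gcc_shift (r := 1) _ _ gd_lin) ?mulr1 // => u.
  by rewrite scale1r (gN_gd DZ).
- move=> v /=; rewrite (gcc_shift (r := -1) _ _ gx_lin) ?mulrN1 ?scaleNr ?opprK // => u.
  by rewrite scaleN1r (gN_gx DZ).
- move=> v /=; rewrite (gcc_shift (r := 1) _ _ e_lin) ?mulr1 // => u.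
  by rewrite scale1r gN_eps1.
- move=> v /=; rewrite (gcc_shift (r := -1) _ _ i_lin) ?mulrN1 ?scaleNr ?opprK // => u.
  by rewrite scaleN1r gN_iot1.
- by move=> a v /=; rewrite /gcc gmulD gmulN !gmulZ gN_mul.
- move=> v /=; rewrite -addrA -opprD (eps1_iot1 gTI gigI) -[X in X - _]g1mul -gmulNl -gmulDl.
  have -> : 1 - gpair giI (D^~ sI) (D^~ sI) = 2 * (grho D gI giI sI * sI).
    by apply/eqP; rewrite subr_eq; apply/eqP/esym/rho_E.
  rewrite gmulA -gmulZl; congr gmul.
  rewrite -/si mulr_natl mulrnAr mulrCA [si * _]mulrC sK mulr1.
  by rewrite -[X in _ *: X]scaler_nat scalerA mulVf ?scale1r // pnatr_eq0.
- move=> v; rewrite /= -(J2_E v) gmulA -/si [si * _]mulrC sK g1mul.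
  by [].
Defined.

Local Notation C := scale_calculus.
Local Notation covV := ({set 'I_m} -> sfun V).
Local Notation DV := (@sD R n V).
Local Notation dV := (gd DV).
Local Notation xV := (gx DV gV giV).
Local Notation iV := (iot1 giV (DV^~ s)).
Local Notation rV_ := (grho DV gV giV s).
Local Notation JV := (gJ2 DV gV giV).

Lemma res_d w : d (resf w) = resf (dV w).
Proof.
apply: (agree_inj (A := ext_d E (toform w))); last by apply/agree_res/agree_d.
by apply: agree_d; apply: agree_res.
Qed.
Lemma res_x w : x (resf w) = resf (xV w).
Proof.
apply: (agree_inj (A := codiff E g (toform w))).
  by apply: (agree_codiff hgI gigI); apply: agree_res.
by apply: agree_res; exact: (agree_codiff hg gig).
Qed.
Lemma res_i w : i (resf w) = resf (iV w).
Proof.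
apply: (agree_inj (A := iota_nu E g sigma (toform w))).
  by apply: (agree_iota hgI gigI hsI gTI); apply: agree_res.
by apply: agree_res; exact: (agree_iota hg gig hs gT).
Qed.
Lemma res_J2 w : gJ2 D gI giI (resf w) = resf (JV w).
Proof.
apply: (agree_inj (A := J2P E g (toform w))).
  by apply: (agree_J2P hgI gigI); apply: agree_res.
by apply: agree_res; exact: (agree_J2P hg gig).
Qed.
Lemma res_rho w : gmul (grho D gI giI sI) (resf w) = resf (gmul rV_ w).
Proof.
apply: (agree_inj (A := fmul (rho E g sigma) (toform w))).
  by apply: (agree_rho hgI gigI hsI); apply: agree_res.
by apply: agree_res; exact: (agree_rho hg gig hs).
Qed.
Lemma res_e w : e (resf w) = resf (eps1 (DV^~ s) w).
Proof.
apply/funext => S; apply: sfun_ext => y Iy; rewrite resE // /eps1 !fct_sumE !ev_sum.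
apply: eq_bigr => a _; rewrite !evM -[D a sI](res_D Vp1) resE //; congr (_ * _).
have [Vy _] := (innerP Vp1 y).1 Iy.
rewrite -(@eps_ev R n V a (toform w) w S y Vy) //.
by rewrite -(@eps_ev R n I a (toform w) (resf w) S y Iy) //; exact: agree_res.
Qed.

(** Regular elements are the restrictions of forms on the whole region, which reaches the
    boundary. *)
Definition scale_regular : regular C.
Proof.
refine (@Regular R cov m%:R C (fun v => exists w, v = resf w) _ _ _ _ _ _ _ _ _ _).
- by exists 0; rewrite resf0.
- by move=> _ _ [w ->] [w' ->]; exists (w + w'); rewrite resfD.
- by move=> r _ [w ->]; exists (r *: w); rewrite resfZ.
- by move=> _ [w ->]; exists (dV w); exact: res_d.
- by move=> _ [w ->]; exists (xV w); exact: res_x.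
- by move=> _ [w ->]; exists (eps1 (DV^~ s) w); exact: res_e.
- by move=> _ [w ->]; exists (iV w); exact: res_i.
- by move=> _ [w ->]; exists (gmul s w); rewrite resf_mul /= spow1.
- by move=> _ [w ->]; exists (gmul rV_ w); exact: res_rho.
by move=> _ [w ->]; exists (JV w); exact: res_J2.
Defined.
Local Notation G := scale_regular.

Lemma hasdegP (p : R) w : hasdeg C p (resf w) <-> gN w = p *: w.
Proof.
have mod (u v : covV) : gcc u = (m%:R - 2 * p) *: v <-> m%:R *: u - 2 *: gN u = (m%:R - 2 * p) *: v.
  by [].
rewrite /hasdeg /= -resf_gcc -resfZ; split=> [/resf_inj|h].
  rewrite /gcc scalerBl => /addrI/oppr_inj; rewrite -scalerA.
  move/(congr1 (fun z => 2^-1 *: z)); rewrite !(scalerA 2^-1 2) mulVf ?pnatr_eq0 //.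
  by rewrite !scale1r.
by rewrite /gcc h scalerBl scalerA.
Qed.

(** The Einstein metric is singular at the boundary, but this identity involves only smooth
    quantities and extends there by injectivity of restriction. *)
Lemma hess_region a b : ghess DV gV giV (DV^~ s) a b + s * gP DV gV giV a b
  + rV_ * gV a b = 0.
Proof.
apply: (@res_inj R n V p1 Vp1); apply: sfun_ext => y Iy; rewrite !resE // ev0.
have [Vy _] := (innerP Vp1 y).1 Iy.
have := congr1 (ev y) (hess_Einstein m_gt2 DD DM DZ DC gTI gigI sK Ein a b).
rewrite ev0 2!evD 2!evM 2!evD 2!evM -(hess_ev hgI gigI hsI _ _ Iy) -(P_ev hgI gigI _ _ Iy).
rewrite -(rho_ev hgI gigI hsI Iy) -(hess_ev hg gig hs _ _ Vy) -(P_ev hg gig _ _ Vy).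
by rewrite -(rho_ev hg gig hs Vy) -(hs Vy) -(hsI Iy) -(g_ev hg _ _ Vy) -(g_ev hgI _ _ Iy).
Qed.

Lemma pair_region : 2 * (rV_ * s) + gpair giV (DV^~ s) (DV^~ s) = 1.
Proof.
apply: (@res_inj R n V p1 Vp1); apply: sfun_ext => y Iy; rewrite !resE // ev1.
have [Vy _] := (innerP Vp1 y).1 Iy.
have := congr1 (ev y) rho_E; rewrite ev1 !evD !evM !ev_nat.
rewrite -(rho_ev hgI gigI hsI Iy) -(rho_ev hg gig hs Vy) -(hs Vy) -(hsI Iy) => e1.
rewrite -[RHS]e1; congr (_ + _); rewrite /gpair ev_sum [RHS]ev_sum; apply: eq_bigr => a _.
rewrite ev_sum [RHS]ev_sum; apply: eq_bigr => b _; rewrite !evM.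
by rewrite -!(res_D Vp1) !resE // !mxE resE.
Qed.

Section Local.
Hypothesis sigma0 : forall y, rset V y -> x0 y = 0 -> sigma y = 0.
Variables k l : nat.
Hypothesis hn : n = (l + 2 * k)%N.
Hypothesis l2 : (2 <= l)%N.

Let hm : m%:R = l%:R + 1 + 2 * k%:R :> R.
Proof. by rewrite hn -natr1 natrD natrM; ring. Qed.

Lemma s_bd y : rset V y -> x0 y = 0 -> ev y s = 0.
Proof. by move=> Vy y0; rewrite -hs // sigma0. Qed.

Lemma order_one w : O G 1 (resf w) -> exists w', w = gmul s w'.
Proof.
move=> [w' e1]; exists w'; apply: (@resf_inj R n V p1 Vp1); rewrite resf_mul -spow1r -e1 /=.
by rewrite gmulA -spowD subrr spow0 g1mul.
Qed.

(** The tractor is computed twice: over the region, where it can be evaluated at boundary points,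
    and over the interior, where [detour_leading] applies. Both agree with the component formulas,
    and an error of order 1 vanishes where sigma does. *)
Lemma detour_boundary A AV W : agree A AV -> gN AV = k%:R *: AV -> iV AV = gmul s W ->
  exists BV HV, [/\ gN BV = k%:R *: BV,
    op_sp C (- l%:Z) (codE C (d (resf (AV + gmul s BV)))) = resf HV &
    forall y S, rset V y -> x0 y = 0 -> detour_local E g sigma k A y S =
      (l%:R * (l%:R + 2) * ((l.-1)`!)%:R ^+ 2) * ev y (HV S)].
Proof.
move=> hA dA iA.
have GA : G (resf AV) by exists AV.
have oA : O G 1 (op_i C (resf AV)).
  by exists W; rewrite /= res_i iA resf_mul gmulA -spow1r -spowD addNr spow0 g1mul.
have [_ [[BV ->] hB [HV eH] o1]] := detour_leading hm l2 GA ((hasdegP _ _).2 dA) oA.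
have eB : resf (AV + gmul s BV) = resf AV + op_sp C 1 (resf BV).
  by rewrite resfD resf_mul /= spow1r.
exists BV, HV; split; [exact/hasdegP | by rewrite eB | move=> y S Vy y0].
pose T0 := botT AV.
pose TV := ypowT m%:R dV xV JV (gmul s) iV (gmul rV_) l k%:R (- k%:R)
  (DbarT m%:R dV xV JV (gmul s) iV (gmul rV_) (k%:R + 1) (1 - k%:R) T0).
have hl : (m.-1 - 2 * k)%N = l by rewrite /= hn addnK.
have tV : tagree (ypow E g sigma l k%:R (- k%:R) (Dbar E g sigma (k%:R + 1) (1 - k%:R)
    (Xt (q A)))) TV.
  apply: (tagree_ypow hg gig hs gT); apply: (tagree_Dbar hg gig hs gT).
  by split=> //=; rewrite ?oppr0; exact: agree0.
have tI : tagree (ypow E g sigma l k%:R (- k%:R) (Dbar E g sigma (k%:R + 1) (1 - k%:R)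
    (Xt (q A)))) (detour C k%:R l (resf AV)).
  rewrite /detour /= spow1.
  apply: (tagree_ypow hgI gigI hsI gTI); apply: (tagree_Dbar hgI gigI hsI gTI).
  by split=> //=; rewrite ?oppr0; [exact: agree0 | exact: agree0 | exact: agree0 | exact: agree_res].
have eT : nW (detour C k%:R l (resf AV)) = resf (nW TV).
  by case: tI => _ h _ _; apply: (agree_inj h); apply: agree_res; case: tV.
move: o1; rewrite eT eH -scaleNr -resfZ -resfD => /order_one[W' eW].
rewrite /detour_local hl; case: tV => _ h _ _; rewrite (h y Vy S).
have := congr1 (fun F : covV => ev y (F S)) eW.
rewrite addrfctE evD scalrfctE evZ /gmul evM s_bd // mul0r mulNr => /eqP.
by rewrite subr_eq0 => /eqP.
Qed.

(* d sigma is a nonzero multiple of dx^0 along the boundary. *)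
Hypothesis Ds_tangent : forall y a, rset V y -> x0 y = 0 -> a != ord0 -> ev y (DV a s) = 0.
Hypothesis Ds_normal : forall y, rset V y -> x0 y = 0 -> ev y (DV ord0 s) != 0.

Lemma eps1_boundary (w : covV) y (S : {set 'I_m}) : rset V y -> x0 y = 0 -> ord0 \notin S ->
  ev y (eps1 (DV^~ s) w ((@ord0 n) |: S)%SET) = 0 -> ev y (w S) = 0.
Proof.
move=> Vy y0 oS; rewrite /eps1 fct_sumE ev_sum (bigD1 ord0) //= big1 ?addr0 => [|a a0].
  rewrite /gmul evM => /eqP; rewrite mulf_eq0 (negbTE (Ds_normal Vy y0)) /=.
  rewrite /geps finset.setU11 evM finset.setU1K // mulf_eq0 => /orP[|/eqP //].
  by rewrite -sgn_ev /sgn expf_eq0 oppr_eq0 oner_eq0 andbF.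
by rewrite /gmul evM Ds_tangent // mul0r.
Qed.

Lemma Q_boundary A AV DA W HV : agree A AV -> AV = DA + gmul s W -> dV DA = 0 ->
  gN DA = k.+1%:R *: DA -> gN W = k.+1%:R *: W ->
  op_sp C (- l%:Z) (codE C (resf DA)) = resf HV ->
  exists YV Y1, [/\ iV YV = gmul s Y1,
    xV YV = Y1 - ((l - 2)`!)%:R ^+ 2 *: HV &
    forall y (S : {set 'I_m}), rset V y -> x0 y = 0 -> rho E g sigma y = 0 -> ord0 \notin S ->
      Q_local E g sigma k.+1 A y S = ev y (YV S)].
Proof.
move=> hA eA dDA gDA gW eH.
have GD : G (resf DA) by exists DA.
have GW : G (resf W) by exists W.
have k1 : k.+1%:R = k%:R + 1 :> R by rewrite natr1.
have hD : hasdeg C (k%:R + 1) (resf DA) by apply/hasdegP; rewrite -k1.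
have hW : hasdeg C (k%:R + 1) (resf W) by apply/hasdegP; rewrite -k1.
have dD : op_d C (resf DA) = 0 by rewrite /= res_d dDA resf0.
have oD : O G l%:Z (codE C (resf DA)) by exists HV.
have := qop_leading hm l2 GD hD dD oD GW hW.
have -> : resf DA + op_sp C 1 (resf W) = resf AV by rewrite eA resfD resf_mul /= spow1r.
move=> [_ [_ [_ [_ [[[YV ->] [Y1 ->] [N ->] [S' ->]] eY iY xY]]]]].
pose T := (Xt (Yt E g (q A))).
pose TV := ypowT m%:R dV xV JV (gmul s) iV (gmul rV_) (l - 2) (k%:R + 3) (- k%:R - 1) (eastT AV).
have tV : tagree (ypow E g sigma (l - 2) (k%:R + 3) (- k%:R - 1) T) TV.
  apply: (tagree_ypow hg gig hs gT).
  by split=> //=; [exact: agree0 | exact: agree0 | apply: agreeN | exact: agree0].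
have tI : tagree (ypow E g sigma (l - 2) (k%:R + 3) (- k%:R - 1) T) (qop C k%:R l (resf AV)).
  rewrite /qop /= spow1; apply: (tagree_ypow hgI gigI hsI gTI).
  by split=> //=; [exact: agree0 | exact: agree0 | apply: agreeN; exact: agree_res | exact: agree0].
have eT : nE (qop C k%:R l (resf AV)) = resf (nE TV).
  by case: tI => _ _ h _; apply: (agree_inj h); apply: agree_res; case: tV.
exists YV, Y1; split.
- by move: iY; rewrite /= res_i spow1r -resf_mul => /resf_inj.
- apply: (@resf_inj R n V p1 Vp1); rewrite -res_x -scaleNr resfD resfZ -eH.
  by rewrite -xY addrC subrK.
move=> y S Vy y0 rho0 oS.
have hl : (m.-1 - 2 * k.+1)%N = (l - 2)%N by rewrite /= hn; lia.
have e1 : k.+1%:R + 2 = k%:R + 3 :> R by rewrite -natr1; ring.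
have e2 : - k.+1%:R = - k%:R - 1 :> R by rewrite -natr1 opprD.
rewrite /Q_local hl e1 e2 -/T.
(* X-star leaves a zero northern slot, so kappa drops out and the eastern slot of the power of y
   remains. *)
transitivity (kappa E g y * 0 + east (ypow E g sigma (l - 2) (k%:R + 3) (- k%:R - 1) T) y S).
  by [].
case: tV => _ _ h _; rewrite mulr0 add0r (h y Vy S).
apply/eqP; rewrite -subr_eq0 -evB; apply/eqP.
(* Where sigma and rho vanish, the difference is annihilated by eps(d sigma), so it has no
   tangential components. *)
apply: (eps1_boundary (w := nE TV - YV)) => //.
have := eY; rewrite eT /= spow1r -!resf_mul.
have -> : resf (nE TV) - resf YV = resf (nE TV - YV).
  by rewrite -!(scaleN1r (resf YV)) -resfZ -resfD scaleN1r.
rewrite res_e res_rho -resfD => /resf_inj ->.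
by rewrite addrfctE evD /gmul !evM s_bd // mul0r -(rho_ev hg gig hs Vy) rho0 mul0r addr0.
Qed.
End Local.
End ScaleCalculus.

(** * Geometry of the boundary *)

Section ConformalCodE.
Context {R : realType} {O : comAlgType R} {m : nat} (D : 'I_m -> O -> O).
Hypothesis DM : forall a f h, D a (f * h) = D a f * h + f * D a h.
Variables g gi : 'M[O]_m.
Hypothesis gT : g^T = g.
Hypothesis gig : gi *m g = 1%:M.
Variables f f' s : O.
Hypothesis fK : f * f' = 1.

(** Both sides are the codifferential of the same metric s^-2 g, written in the scales f^2 g and g.
    This is how an extension built in one scale is used in another. *)
Lemma codE_conformal (A : {set 'I_m} -> O) :
  gmul ((f * s) ^+ 2) (gx D ((f ^+ 2) *: g) ((f' ^+ 2) *: gi) A)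
    - gmul (f * s) (iot1 ((f' ^+ 2) *: gi) (D^~ (f * s)) (gcc A)) =
  gmul (s ^+ 2) (gx D g gi A) - gmul s (iot1 gi (D^~ s) (gcc A)).
Proof.
pose u c := f' * D c f.
have fu c : D c f = f * u c by rewrite /u mulrA fK mul1r.
have e1 : iot1 ((f' ^+ 2) *: gi) (D^~ (f * s)) (gcc A) =
    gmul (f' ^+ 2 * (f * s)) (iot1 gi u (gcc A)) + gmul (f' ^+ 2 * f) (iot1 gi (D^~ s) (gcc A)).
  rewrite /iot1 !gmul_sum -big_split; apply: eq_bigr => c _ /=.
  have -> : up ((f' ^+ 2) *: gi) c (gcc A) = gmul (f' ^+ 2) (up gi c (gcc A)).
    by rewrite /up gmul_sum; apply: eq_bigr => b _; rewrite mxE gmulA.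
  rewrite !gmulA -gmulDl DM fu; congr gmul; move: (D c s) (u c) => p q; ring.
rewrite (gx_conformal DM gT gig fK fu) e1 !gmulD !gmulA.
have c1 : (f * s) ^+ 2 * f' ^+ 2 = s ^+ 2.
  transitivity ((f * f') ^+ 2 * s ^+ 2); first by ring.
  by rewrite fK expr1n mul1r.
have c2 : f * s * (f' ^+ 2 * (f * s)) = s ^+ 2.
  transitivity ((f * f') ^+ 2 * s ^+ 2); first by ring.
  by rewrite fK expr1n mul1r.
have c3 : f * s * (f' ^+ 2 * f) = s.
  transitivity ((f * f') ^+ 2 * s); first by ring.
  by rewrite fK expr1n mul1r.
by rewrite c1 c2 c3 opprD addrA addrK.
Qed.
End ConformalCodE.

Section Lift.
Context {R : realType} {n : nat}.
Local Notation lf := (lift (@ord0 n)).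
Implicit Types (a b : 'I_n) (S : {set 'I_n}) (A : {set 'I_n.+1} -> R).
Definition lset S : {set 'I_n.+1} := (lf @: S)%SET.

Lemma mem_lset a S : (lf a \in lset S) = (a \in S).
Proof. by rewrite /lset finset.mem_imset //; exact: lift_inj. Qed.

Lemma ord0_lset S : ord0 \notin lset S.
Proof. by apply/finset.imsetP => -[a _ /eqP]; rewrite (negbTE (neq_lift _ _)). Qed.

Lemma lsetU a S : lset (a |: S)%SET = (lf a |: lset S)%SET.
Proof. by rewrite /lset finset.imsetU1. Qed.

Lemma lsetD a S : lset (S :\ a)%SET = (lset S :\ lf a)%SET.
Proof.
apply/finset.setP => j; case: (unliftP ord0 j) => [b ->|->].
  by rewrite mem_lset !finset.in_setD1 mem_lset (inj_eq lift_inj).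
by rewrite (negbTE (ord0_lset _)) finset.in_setD1 (negbTE (ord0_lset _)) andbF.
Qed.

(** The lift is increasing and the index 0 is absent, so the same inversions are counted. *)
Lemma sgn_lset a S : sgn (lf a) (lset S) = sgn a S :> R.
Proof.
rewrite /sgn; congr (_ ^+ _).
transitivity #|(lf @: [set j in S | (j < a)%N])%SET|; last first.
  by rewrite card_imset; [apply: eq_card => j; rewrite !inE | exact: lift_inj].
apply: eq_card => j; rewrite [LHS]inE.
case: (unliftP ord0 j) => [b ->|->].
  by rewrite (@finset.mem_imset _ _ (@lift _ ord0) [set j in S | (j < a)%N]%SET b (@lift_inj _ ord0)) finset.in_set mem_lset.
rewrite (negbTE (ord0_lset S)); symmetry; apply/negbTE/finset.imsetP => -[b _ /eqP].
by rewrite (negbTE (neq_lift _ _)).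
Qed.

Lemma eps_lset a A S : eps a (fun T => A (lset T)) S = eps (lf a) A (lset S).
Proof. by rewrite /eps mem_lset sgn_lset lsetD. Qed.

Lemma iot_lset a A S : iot a (fun T => A (lset T)) S = iot (lf a) A (lset S).
Proof. by rewrite /iot mem_lset sgn_lset lsetU. Qed.

Lemma emb_ord0 (x : 'rV[R]_n) : emb x ord0 ord0 = 0.
Proof. by rewrite mxE unlift_none. Qed.

Lemma emb_lift (x : 'rV[R]_n) a : emb x ord0 (lf a) = x ord0 a.
Proof. by rewrite mxE liftK. Qed.

Lemma emb_slide (x : 'rV[R]_n) a t : emb (x + t *: delta_mx ord0 a) = slide (lf a) (emb x) t.
Proof.
apply/rowP => j; rewrite slideE; case: (unliftP ord0 j) => [b ->|->].
  by rewrite !emb_lift !mxE eqxx (inj_eq lift_inj).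
by rewrite !emb_ord0 (negbTE (neq_lift _ _)) mulr0 addr0.
Qed.

Lemma emb_half (x : 'rV[R]_n) : halfspace (emb x).
Proof. by rewrite /halfspace /= emb_ord0. Qed.

(** Tangential steps from a boundary point never leave the half-space, so the two filters
    coincide. *)
Lemma pd_emb (V : region R n) a (f : 'rV[R]_n -> R) (h : 'rV[R]_n.+1 -> R) x :
  rset V (emb x) -> (forall z, rset V (emb z) -> f z = h (emb z)) ->
  pd setT a f x = pd (@halfspace R n) (lf a) h (emb x).
Proof.
move=> Vx e; rewrite /pd.
have ea : along setT a x = along (@halfspace R n) (lf a) (emb x).
  rewrite /along; suff -> : [set t : R | [set: 'rV[R]_n] (x + t *: delta_mx ord0 a)] =
    [set t | halfspace (emb x + t *: delta_mx ord0 (lf a))] by [].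
  apply/seteqP; split=> t //= _.
  by have := emb_half (x + t *: delta_mx ord0 a); rewrite emb_slide.
rewrite ea; have [d d0 hd] := rset_open Vx.
have eq : \forall t \near along (@halfspace R n) (lf a) (emb x),
    quotient_at a f x t = quotient_at (lf a) h (emb x) t.
  apply: along_near; near=> t => Et; rewrite /quotient_at (e x Vx) -/(slide _ _ _) -emb_slide.
  rewrite e // emb_slide; apply: hd => //; apply: slide_near.
  by near: t; exact: dnbhs0_lt.
congr lim; rewrite eqEsubset; split; apply: near_eq_cvg => //.
by apply: filterS eq => t ->.
Unshelve. all: by end_near. Qed.
End Lift.

Section BoundaryGeometry.
Context {R : realType} {n : nat} (V : region R n).
Local Notation E := (@halfspace R n).
Local Notation m := n.+1.
Local Notation D := (@sD R n V).
Local Notation o := (@ord0 n).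
Local Notation lf := (lift o).
Hypothesis n_gt0 : (0 < n)%N.
Variables (g : 'rV[R]_m -> 'M[R]_m) (gV giV : 'M[sfun V]_m).
Hypothesis hg : forall x, rset V x -> g x = map_mx (ev x) gV.
Hypothesis gig : giV *m gV = 1%:M.
Hypothesis gT : gV^T = gV.
Variables (sigma : 'rV[R]_m -> R) (s : sfun V).
Hypothesis hs : forall x, rset V x -> sigma x = ev x s.
Local Notation rV_ := (grho D gV giV s).
Hypothesis hessE : forall a b, ghess D gV giV (D^~ s) a b + s * gP D gV giV a b
  + rV_ * gV a b = 0.
Hypothesis pairE : 2 * (rV_ * s) + gpair giV (D^~ s) (D^~ s) = 1.
Variables (x' : 'rV[R]_n).
Local Notation y := (emb x').
Hypothesis Vy : rset V y.
Hypothesis sy : ev y s = 0.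
Hypothesis Ds_tangent : forall a, a != o -> ev y (D a s) = 0.

Let p := ev y (D o s).
Let Gi a b := ev y (giV a b).
Let GiC a b : Gi a b = Gi b a. Proof. by rewrite /Gi (gi_sym gT gig). Qed.

Let GiG a b : \sum_c Gi a c * ev y (gV c b) = (a == b)%:R.
Proof.
have := congr1 (ev y) (giK gig a b); rewrite ev_sum ev_nat => <-.
by apply: eq_bigr => c _; rewrite evM.
Qed.

Let sum_Ds (F : 'I_m -> R) : \sum_a F a * ev y (D a s) = F o * p.
Proof.
rewrite (bigD1 o) //= big1 ?addr0 // => a a0.
by rewrite Ds_tangent // mulr0.
Qed.

Let pairG : ev y (gpair giV (D^~ s) (D^~ s)) = Gi o o * p * p.
Proof.
rewrite /gpair ev_sum (eq_bigr (fun a => (Gi a o * p) * ev y (D a s))) ?sum_Ds // => a _.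
rewrite ev_sum mulrAC -(sum_Ds (fun b => Gi a b * ev y (D a s))).
by apply: eq_bigr => b _; rewrite !evM.
Qed.

Let pairy : Gi o o * p * p = 1.
Proof.
by have := congr1 (ev y) pairE; rewrite evD !evM sy !mulr0 add0r ev1 pairG.
Qed.

Let hessy a b : ev y (ghess D gV giV (D^~ s) a b) = - ev y rV_ * ev y (gV a b).
Proof.
have := congr1 (ev y) (hessE a b); rewrite 2!evD 2!evM sy mul0r addr0 ev0 => /eqP.
by rewrite addr_eq0 mulNr => /eqP.
Qed.

(** The tangential projection of the inverse metric, [Gi a o * p] being the components of the unit
    normal nu. It annihilates the index 0. *)
Let K a b := Gi a b - (Gi a o * p) * (Gi b o * p).
Let K_o a : K a o = 0.
Proof.
rewrite /K (_ : _ * _ * _ = Gi a o * (Gi o o * p * p)); last first.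
  by move: (Gi a o) (Gi o o) (p) => u v w; ring.
by rewrite pairy mulr1 subrr.
Qed.
Let KC a b : K a b = K b a. Proof. by rewrite /K GiC [X in _ - X]mulrC. Qed.

Let sum_K a (F : 'I_m -> R) : \sum_b K a (lf b) * F (lf b) = \sum_b K a b * F b.
Proof. by rewrite big_ord_recl K_o mul0r add0r. Qed.

(** In iota(nu) B at S minus 0, every term but that of dx^0 involves a tangential component, and the
    coefficient of the remaining one is nonzero by |d sigma| = 1. *)
Lemma boundary_vanish (B : {set 'I_m} -> sfun V) : (forall T, ev y (B (lset T)) = 0) ->
  (forall S, ev y (iot1 giV (D^~ s) B S) = 0) -> forall S, ev y (B S) = 0.
Proof.
move=> hT hi.
have h0 (S : {set 'I_m}) : o \notin S -> ev y (B S) = 0.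
  move=> oS; rewrite (_ : S = lset [set a | lf a \in S]%SET) //; apply/finset.setP => j.
  case: (unliftP ord0 j) => [b ->|->]; first by rewrite mem_lset finset.in_set.
  by rewrite (negbTE oS) (negbTE (ord0_lset _)).
move=> S; have [oS|/h0//] := boolP (o \in S).
have := hi (S :\ o)%SET; rewrite (iot1_iot gT gig) fct_sumE ev_sum (bigD1 o) //=.
rewrite [X in _ + X]big1 ?addr0 => [|c c0]; last first.
  rewrite /gmul /giot evM; case: ifP => _; first by rewrite ev0 mulr0.
  rewrite evM [ev y (B _)]h0 ?mulr0 ?mulr0 //.
  by rewrite finset.in_setU1 finset.in_setD1 eqxx orbF eq_sym.
rewrite /gmul /giot finset.setD11 evM evM finset.setD1K // => /eqP.
rewrite !mulf_eq0 => /orP[h|/orP[h|/eqP//]]; exfalso.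
  have e1 : ev y (\sum_e giV o e * D e s) = Gi o o * p.
    rewrite ev_sum -(sum_Ds (fun b => Gi o b)); apply: eq_bigr => b _; exact: evM.
  move: h; rewrite e1 => /eqP h; have := pairy; rewrite h mul0r => /eqP.
  by rewrite eq_sym oner_eq0.
by move: h; rewrite evX evN ev1 expf_eq0 oppr_eq0 oner_eq0 andbF.
Qed.

Let nuE b z : rset V z -> nu E g sigma b z = ev z (\sum_a giV b a * D a s).
Proof.
move=> Vz; rewrite /nu ev_sum; apply: eq_bigr => a _.
by rewrite evM (ginv_ev hg gig _ _ Vz) (sD_eq _ hs Vz).
Qed.

(** On Sigma the Hessian of sigma is - rho g, so the mean curvature is - rho, and the Robin operator
    on the constant density 1 is rho itself. *)
Lemma Robin_rho : robin E g sigma 1 (fun=> 1) y = 0 -> rho E g sigma y = 0.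
Proof.
pose Q := gpair giV (D^~ s) (D^~ s).
have sqE z : rset V z -> \sum_b nu E g sigma b z * pd E b sigma z = ev z Q.
  move=> Vz; rewrite /Q /gpair exchange_big ev_sum; apply: eq_bigr => b _ /=.
  rewrite (nuE b Vz) (sD_eq _ hs Vz) -evM mulr_suml !ev_sum; apply: eq_bigr => a _.
  by rewrite (gi_sym gT gig a b).
have Qy : ev y Q = 1 by rewrite pairG pairy.
have cE b z : rset V z -> ev z (D b s) * (Num.sqrt (ev z Q))^-1 = conormal E g sigma b z.
  by move=> Vz; rewrite /conormal sqE // (sD_eq _ hs Vz).
have cy b : conormal E g sigma b y = ev y (D b s) by rewrite -cE // Qy sqrtr1 invr1 mulr1.
(* Differentiating the normalisation |d sigma|^-1 contributes a multiple of d sigma, which K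
   annihilates. *)
pose c a := ev y (D a Q) / (1 + 1).
have dc a b : pd E a (conormal E g sigma b) y = ev y (D a (D b s)) - ev y (D b s) * c a.
  apply: ispd_unique (emb_half x') _; apply: (ispd_eq (@rset_open R n V) Vy (cE b)).
  have i1 := @sD_ispd R n V a (D b s) y Vy; have i2 := @sD_ispd R n V a Q y Vy.
  have Qp : 0 < ev y Q by rewrite Qy.
  have := ispd_sqrt (emb_half x') Qp i2; rewrite Qy sqrtr1 => i3.
  have sn : Num.sqrt (ev y Q) != 0 by rewrite Qy sqrtr1 oner_eq0.
  have := ispdM i1 (ispdV (emb_half x') sn i3); rewrite Qy sqrtr1 invr1 !mulr1.
  by rewrite mulrN.
have ny a : normal E g sigma a y = Gi a o * p.
  rewrite /normal -(sum_Ds (fun b => Gi a b)); apply: eq_bigr => b _.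
  by rewrite cy (ginv_ev hg gig _ _ Vy).
have -> : robin E g sigma 1 (fun=> 1) y = rho E g sigma y.
  rewrite /robin big1 => [|a _]; last first.
    by rewrite (ispd_unique (emb_half x') (ispd_cst a y 1)) mulr0.
  rewrite sub0r mul1r mulr1 /mean_curvature.
  have -> : \sum_a \sum_b (ginv g y a b - normal E g sigma a y * normal E g sigma b y) *
    (pd E a (conormal E g sigma b) y - \sum_c Gamma E g c a b y * conormal E g sigma c y)
    = \sum_a (\sum_b K a b * (- ev y rV_ * ev y (gV a b))
        - (\sum_b K a b * ev y (D b s)) * c a).
    apply: eq_bigr => a _; rewrite mulr_suml -sumrB; apply: eq_bigr => b _.
    rewrite -hessy (ginv_ev hg gig _ _ Vy) !ny dc /ghess evB ev_sum -/(Gi a b) -/(K a b).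
    rewrite (eq_bigr (fun e => ev y (gam D gV giV a e b * D e s))) => [|e _]; last first.
      by rewrite evM cy (Gamma_ev hg gig _ _ _ Vy).
    by rewrite addrAC mulrBr mulrA.
  have -> : \sum_a (\sum_b K a b * (- ev y rV_ * ev y (gV a b))
        - (\sum_b K a b * ev y (D b s)) * c a) = - ev y rV_ * (m%:R - 1).
    transitivity (\sum_a (- ev y rV_) * (1 - Gi a o * p * p * (o == a)%:R)).
      apply: eq_bigr => a _; rewrite sum_Ds K_o mul0r mul0r subr0.
      transitivity (- ev y rV_ * (\sum_b (Gi a b * ev y (gV b a)
          - Gi a o * p * p * (Gi o b * ev y (gV b a))))).
        rewrite mulr_sumr; apply: eq_bigr => b _; rewrite /K (GiC b o) (g_sym gT a b).
        move: (Gi a b) (ev y (gV b a)) (Gi a o) (Gi o b) (p) (ev y rV_) => t1 t2 t3 t4 t5 t6.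
        ring.
      by rewrite sumrB -mulr_sumr !GiG eqxx.
    rewrite -mulr_sumr sumrB sumr_const card_ord; congr (_ * (_ - _)).
    rewrite (bigD1 o) //= big1 ?addr0 => [|a a0]; first by rewrite mulr1 pairy.
    by rewrite eq_sym (negbTE a0) mulr0.
  have m1 : m%:R - 1 != 0 :> R by rewrite -natr1 addrK pnatr_eq0 -lt0n.
  by rewrite (rho_ev hg gig hs Vy) mulNr mulrN opprK mulrCA mulVf ?mulr1.
by [].
Qed.

Variables (gS : 'rV[R]_n -> 'M[R]_n) (CS : 'rV[R]_n -> {set 'I_n} -> R).
Variables (YV Y1 : {set 'I_m} -> sfun V).
Hypothesis hgS : forall z, rset V (emb z) ->
  gS z = \matrix_(a, b) g (emb z) (lf a) (lf b).
Hypothesis hCS : forall z S, rset V (emb z) -> CS z S = ev (emb z) (YV (lset S)).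
Hypothesis hY : iot1 giV (D^~ s) YV = gmul s Y1.
Hypothesis rhoy : ev y rV_ = 0.

Lemma ginv_boundary a b : ginv gS x' a b = K (lf a) (lf b).
Proof.
pose KM : 'M[R]_n := \matrix_(a, b) K (lf a) (lf b).
have h : KM *m gS x' = 1%:M.
  apply/matrixP => i j; rewrite !mxE hgS //.
  rewrite (eq_bigr (fun c => K (lf i) (lf c) * ev y (gV (lf c) (lf j)))) => [|c _]; last first.
    by rewrite !mxE (g_ev hg).
  rewrite (sum_K (lf i) (fun c => ev y (gV c (lf j)))) /K.
  rewrite (eq_bigr (fun c => Gi (lf i) c * ev y (gV c (lf j)) -
    (Gi (lf i) o * p * p) * (Gi o c * ev y (gV c (lf j))))) => [|c _]; last first.
    rewrite (GiC c o); move: (Gi (lf i) c) (ev y _) (Gi _ o) (Gi o c) (p) => t1 t2 t3 t4 t5.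
    by ring.
  rewrite sumrB -mulr_sumr !GiG (inj_eq lift_inj) (negbTE (neq_lift _ _)) mulr0 subr0.
  by [].
have -> : ginv gS x' = KM.
  by rewrite /ginv -[RHS]mulmx1 -(mulmxV (mulmx1_unit h).2) mulmxA h mul1mx.
by rewrite mxE.
Qed.

(** The upper index is raised by K instead of the full inverse metric, which subtracts its normal
    part. *)
Lemma Gamma_boundary c a b : Gamma setT gS c a b x' =
  ev y (gam D gV giV (lf a) (lf c) (lf b))
  - Gi (lf c) o * p * p * ev y (gam D gV giV (lf a) o (lf b)).
Proof.
have pg i j k : pd setT i (fun z => gS z j k) x' = ev y (D (lf i) (gV (lf j) (lf k))).
  rewrite (@pd_emb R n V i _ (fun z => g z (lf j) (lf k)) x' Vy) //; last first.
    by move=> z Vz; rewrite hgS // mxE.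
  by rewrite (pd_g hg).
rewrite /Gamma mulr_sumr.
rewrite (eq_bigr (fun e => K (lf c) (lf e) * ev y (low D gV (lf a) (lf e) (lf b)))).
  rewrite (sum_K (lf c) (fun e => ev y (low D gV (lf a) e (lf b)))) /K.
  rewrite [gam _ _ _ _ (lf c) _]mxE [gam _ _ _ _ o _]mxE !ev_sum mulr_sumr -sumrB.
  apply: eq_bigr => e _.
  rewrite 2!evM -!/(Gi _ _) (GiC e o).
  move: (Gi (lf c) e) (ev y _) (Gi (lf c) o) (Gi o e) (p) => t1 t2 t3 t4 t5; ring.
move=> e _; rewrite ginv_boundary !pg [low _ _ _ _ _]mxE (evM y hf) evB evD /hf evZ ev1 mulr1.
by rewrite mulrCA.
Qed.

Let iota_y S : \sum_c Gi c o * p * ev y (giot c YV S) = 0.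
Proof.
have := congr1 (fun F : {set 'I_m} -> sfun V => ev y (F S)) hY.
rewrite (iot1_iot gT gig) fct_sumE ev_sum {2}/gmul evM sy mul0r => e.
rewrite -[RHS]e; apply: eq_bigr => c _; rewrite /gmul evM; congr (_ * _).
rewrite ev_sum -(sum_Ds (fun b => Gi c b)).
by apply: eq_bigr => b _; rewrite evM.
Qed.

Let ev_eps a (B : {set 'I_m} -> sfun V) S :
  ev y (geps a B S) = eps a (fun T => ev y (B T)) S.
Proof. by rewrite -(@eps_ev R n V a (toform B) B S y Vy). Qed.
Let ev_iot a (B : {set 'I_m} -> sfun V) S :
  ev y (giot a B S) = iot a (fun T => ev y (B T)) S.
Proof. by rewrite -(@iot_ev R n V a (toform B) B S y Vy). Qed.

(** The ambient term contracting with the index 0 is matched by the normal parts subtracted in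
    [Gamma_boundary], because iota(nu) annihilates the form along Sigma. *)
Lemma nabla_boundary a S : nabla setT gS a CS x' S = ev y (nab D gV giV (lf a) YV (lset S)).
Proof.
rewrite /nabla /nab addrfctE opprfctE evB; congr (_ - _).
  rewrite (@pd_emb R n V a _ (fun z => ev z (YV (lset S))) x' Vy) //; last first.
    by move=> z Vz; exact: hCS.
  by rewrite -(sDE (lf a) (YV (lset S)) Vy).
rewrite fct_sumE ev_sum big_ord_recl.
rewrite [X in _ = X + _](_ : _ = 0) ?add0r; last first.
  rewrite fct_sumE ev_sum big1 // => c _.
  by rewrite /gmul /geps (negbTE (ord0_lset S)) mulr0 ev0.
apply: eq_bigr => b _; rewrite fct_sumE ev_sum big_ord_recl /=.
have CSy : CS x' = fun T => ev y (YV (lset T)) by apply/funext => T; exact: hCS.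
have eS c : eps b (iot c (CS x')) S = eps (lf b) (fun T => ev y (giot (lf c) YV T)) (lset S).
  rewrite -(eps_lset b (fun T => ev y (giot (lf c) YV T))); congr (eps b _ S).
  by apply/funext => T; rewrite CSy (iot_lset c (fun T => ev y (YV T))) ev_iot.
under eq_bigr => c _ do rewrite Gamma_boundary eS mulrBl.
rewrite sumrB; apply/eqP; rewrite subr_eq addrAC; apply/eqP.
rewrite -[LHS]add0r; congr (_ + _); last first.
  by apply: eq_bigr => c _; rewrite /gmul evM ev_eps.
symmetry; rewrite /gmul evM ev_eps.
rewrite /eps; case: ifP => _; last by rewrite mulr0 add0r big1 // => c _; rewrite mulr0.
have := iota_y (lset S :\ lf b)%SET; rewrite big_ord_recl.
set q := ev y (gam D gV giV (lf a) o (lf b)); set t := sgn _ _ => e0.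
transitivity (q * t * p * 0); last by rewrite mulr0.
rewrite -[X in _ = _ * X]e0 mulrDr; congr (_ + _); last first.
  rewrite mulr_sumr; apply: eq_bigr => c _.
  move: (Gi _ o) (ev y _) (p) (q) (t) => t1 t2 t3 t4 t5; ring.
transitivity (q * t * ev y (giot o YV (lset S :\ lf b)%SET) * (Gi o o * p * p)).
  by rewrite pairy mulr1 mulrA.
move: (Gi o o) (ev y _) (p) (q) (t) => t1 t2 t3 t4 t5; ring.
Qed.

(** delta_Sigma contracts with K, so it differs from delta by the contraction with nu in both
    indices. That term is the normal derivative of iota(nu) Y = sigma Y1, namely Y1. *)
Lemma divergence_boundary S :
  codiff setT gS CS x' S = ev y (gx D gV giV YV (lset S)) - ev y (Y1 (lset S)).
Proof.
pose N a b := ev y (giot b (nab D gV giV a YV) (lset S)).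
have e1 : codiff setT gS CS x' S = \sum_a \sum_b K a b * N a b.
  rewrite [RHS]big_ord_recl [X in _ = X + _]big1 ?add0r => [|b _]; last first.
    by rewrite KC K_o mul0r.
  rewrite /codiff; apply: eq_bigr => a _; rewrite -(sum_K (lf a) (N (lf a))).
  apply: eq_bigr => b _; rewrite ginv_boundary; congr (_ * _).
  have -> : nabla setT gS a CS x' = fun T => ev y (nab D gV giV (lf a) YV (lset T)).
    by apply/funext => T; exact: nabla_boundary.
  by rewrite (iot_lset b (fun T => ev y (nab D gV giV (lf a) YV T))) -ev_iot.
have e2 : ev y (gx D gV giV YV (lset S)) = \sum_a \sum_b Gi a b * N a b.
  rewrite /gx /up fct_sumE ev_sum; apply: eq_bigr => a _.
  by rewrite fct_sumE ev_sum; apply: eq_bigr => b _; rewrite /gmul evM.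
have e3 a : \sum_b Gi b o * p * N a b = ev y (D a s) * ev y (Y1 (lset S)).
  have := nab_iot1 (@sDD R n V) (@sDM R n V) (@sDZ R n V) gT gig (D^~ s) a YV.
  rewrite hY (nab_mul (@sDM R n V)).
  move=> /(congr1 (fun F : {set 'I_m} -> sfun V => ev y (F (lset S)))).
  rewrite !addrfctE 2!evD {1 2}/gmul 2!evM sy mul0r addr0 => ->.
  rewrite [X in _ = _ + X](_ : _ = 0) ?addr0; last first.
    rewrite fct_sumE ev_sum big1 // => b _.
    by rewrite /gmul evM hessy rhoy oppr0 !mul0r.
  rewrite (iot1_iot gT gig) fct_sumE ev_sum; apply: eq_bigr => b _.
  rewrite /gmul evM; congr (_ * _); rewrite ev_sum -(sum_Ds (fun c => Gi b c)).
  by apply: eq_bigr => c _; rewrite evM.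
rewrite e1 e2 -[X in _ - X](_ : \sum_a Gi a o * p * (\sum_b Gi b o * p * N a b) = _).
  rewrite -sumrB; apply: eq_bigr => a _; rewrite mulr_sumr -sumrB.
  apply: eq_bigr => b _; rewrite /K.
  move: (Gi a b) (N a b) (Gi a o) (Gi b o) (p) => t1 t2 t3 t4 t5; ring.
under eq_bigr => a _ do rewrite e3 mulrA mulrAC.
by rewrite (sum_Ds (fun a => Gi a o * p * ev y (Y1 (lset S)))) mulrAC pairy mul1r.
Qed.
End BoundaryGeometry.

(** * Divisibility by powers of sigma *)

Section ScaleOrder.
Context {R : realType} {n : nat} (V : region R n).
Local Notation E := (@halfspace R n).
Local Notation m := n.+1.
Local Notation x0 x := (x ord0 ord0).
Hypothesis n_gt1 : (1 < n)%N.
Variables (p1 : 'rV[R]_m) (Vp1 : rset V p1 /\ 0 < x0 p1).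
Local Notation I := (inner Vp1).
Variables (g : 'rV[R]_m -> 'M[R]_m) (gV giV : 'M[sfun V]_m).
Hypothesis hg : forall x, rset V x -> g x = map_mx (ev x) gV.
Hypothesis gig : giV *m gV = 1%:M.
Hypothesis gT : gV^T = gV.
Variables (sigma : 'rV[R]_m -> R) (s : sfun V).
Hypothesis hs : forall x, rset V x -> sigma x = ev x s.
Hypothesis s_pos : forall x, rset I x -> 0 < sigma x.
Hypothesis Einstein : forall x a b, rset I x ->
  let go y := sigma y ^- 2 *: g y in Ric E go a b x = - n%:R * go x a b.
Local Notation C := (scale_calculus n_gt1 hg gig gT hs s_pos Einstein).
Local Notation D := (@sD R n V).
Local Notation sp := (spow Vp1 sigma).
Local Notation cov := ({set 'I_m} -> sfun V).
Implicit Types (u v w H : cov).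

Lemma spow_nat l : sp l%:Z = res Vp1 (s ^+ l).
Proof.
elim: l => [|l IH]; first by rewrite (spow0 hs s_pos) expr0 res1.
by rewrite -addn1 PoszD (spowD hs s_pos) IH (spow1r hs s_pos) -resM addn1 exprSr.
Qed.

Lemma spowNK l : sp (- l%:Z) * sp l%:Z = 1.
Proof. by rewrite -(spowD hs s_pos) addNr (spow0 hs s_pos). Qed.

Lemma spow_cancel l u v : gmul (s ^+ l) u = gmul (s ^+ l) v -> u = v.
Proof.
move=> /(congr1 (resf Vp1)); rewrite !resf_mul -spow_nat.
move=> /(congr1 (gmul (sp (- l%:Z)))); rewrite !gmulA spowNK !g1mul; exact: resf_inj.
Qed.

Lemma codE_resf w : codE C (resf Vp1 w) =
  resf Vp1 (gmul (s ^+ 2) (gx D gV giV w) - gmul s (iot1 giV (D^~ s) (gcc w))).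
Proof.
rewrite -(scaleN1r (gmul s _)) resfD resfZ scaleN1r !resf_mul -spow_nat.
rewrite -(spow1r hs s_pos) -(res_x Vp1 hg gig) -(res_i Vp1 hg gig gT hs) resf_gcc.
by [].
Qed.

Lemma codE_order l w H : op_sp C (- l%:Z) (codE C (resf Vp1 w)) = resf Vp1 H <->
  gmul (s ^+ 2) (gx D gV giV w) - gmul s (iot1 giV (D^~ s) (gcc w)) = gmul (s ^+ l) H.
Proof.
rewrite codE_resf; set B := (_ - _); split=> [e1|->].
  apply: (@resf_inj R n V p1 Vp1); rewrite resf_mul -spow_nat -e1 /=.
  by rewrite gmulA mulrC spowNK g1mul.
by rewrite resf_mul -spow_nat /= gmulA spowNK g1mul.
Qed.

Lemma iot1_scale (r : R) w : iot1 giV (D^~ s) (r *: w) = r *: iot1 giV (D^~ s) w.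
Proof.
apply: (@resf_inj R n V p1 Vp1); rewrite resfZ -!(res_i Vp1 hg gig gT hs) resfZ.
by have := i_lin (Vp1 := Vp1) giV s r (resf Vp1 w) 0; rewrite addr0 => ->;
  rewrite (_ : iot1 _ _ 0 = 0) ?addr0 // /iot1 big1 // => c _; rewrite up0 gmul0.
Qed.

(** m - 2 deg is the nonzero number l - 1 in degree k + 1, and all other terms are divisible by
    sigma^2. *)
Lemma closed_normal k l w H : n = (l + 2 * k)%N -> (2 <= l)%N -> gN w = k.+1%:R *: w ->
  gmul (s ^+ 2) (gx D gV giV w) - gmul s (iot1 giV (D^~ s) (gcc w)) = gmul (s ^+ l) H ->
  exists Z, iot1 giV (D^~ s) w = gmul s Z.
Proof.
move=> hn l2 gw.
have -> : gcc w = (l%:R - 1) *: w.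
  rewrite /gcc gw scalerA -scalerBl; congr (_ *: _).
  by rewrite hn -!natr1 natrD natrM; ring.
have l1 : l%:R - 1 != 0 :> R.
  by rewrite -(prednK (ltnW l2)) -natr1 addrK pnatr_eq0 -lt0n; lia.
have -> : s ^+ l = s * (s * s ^+ (l - 2)).
  by rewrite -!exprS -addn2 subnK.
rewrite iot1_scale; set x := gx _ _ _ _; set i := iot1 _ _ _; set t := s ^+ (l - 2) => e1.
exists ((l%:R - 1)^-1 *: (x - gmul t H)).
have e2 : gmul (s ^+ 1) (gmul s x - (l%:R - 1) *: i) = gmul (s ^+ 1) (gmul (s * t) H).
  by rewrite expr1 gmulD gmulN !gmulA -e1 expr2.
have e3 := spow_cancel e2; apply: (scalerI l1); rewrite -[LHS](subKr (gmul s x)) e3.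
apply/funext => S; rewrite /gmul !scalrfctE !addrfctE !opprfctE /=.
by rewrite -scalerAr scalerA mulfV // scale1r mulrBr mulrA.
Qed.
End ScaleOrder.

(** The derivative in direction 0 enters d only through dx^0, which is absent from tangential
    components. *)
Lemma d_boundary (R : realType) n (V : region R n) (A : 'rV[R]_n -> {set 'I_n} -> R)
    (F : {set 'I_n.+1} -> sfun V) z T : rset V (emb z) ->
  (forall z' T', rset V (emb z') -> A z' T' = ev (emb z') (F (lset T'))) ->
  ext_d setT A z T = ev (emb z) (gd (@sD R n V) F (lset T)).
Proof.
move=> Vz e; rewrite -(agree_d (agree_toform F) Vz) /ext_d big_ord_recl.
rewrite [X in _ = X + _](_ : _ = 0) ?add0r; last by rewrite /eps (negbTE (ord0_lset T)).
apply: eq_bigr => a _.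
rewrite -(eps_lset a (fun S => pd (@halfspace R n) _ (fun y => toform F y S) _)); congr (eps a _ T).
apply/funext => T'.
apply: (@pd_emb R n V a (A^~ T') (fun y => toform F y (lset T')) z Vz) => z' Vz'; exact: e.
Qed.

(** * Boxes in the half-space *)

Section Box.
Context {R : realType} {n : nat}.
Local Notation E := (@halfspace R n).
Implicit Types (p y z : 'rV[R]_n.+1).

Lemma open_box (W : set 'rV[R]_n.+1) p : open W -> W p ->
  exists2 r : R, 0 < r & forall y, (forall j, `|y ord0 j - p ord0 j| < r) -> W y.
Proof.
move=> oW Wp; have /nbhs_ballP[r /= r0 hr] : nbhs p W by apply: open_nbhs_nbhs; split.
exists r => // y hy; apply: hr; split=> // i j.
by rewrite (ord1 i) /ball /= distrC; exact: hy.
Qed.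

Definition box p (r : R) := [set y | E y /\ forall j, `|y ord0 j - p ord0 j| < r].

Lemma box_sub p r : box p r `<=` E. Proof. by move=> y []. Qed.

Lemma box_open p (r : R) : 0 < r -> forall y, box p r y -> exists2 d : R, 0 < d &
  forall z, E z -> (forall j, `|z ord0 j - y ord0 j| < d) -> box p r z.
Proof.
move=> r0 y [_ hy]; exists (\big[Num.min/r]_j (r - `|y ord0 j - p ord0 j|)).
  by apply: (big_ind (fun u => 0 < u)) => // [u v hu hv|j _]; rewrite ?lt_min ?hu // subr_gt0.
move=> z Ez hz; split=> // j.
have := lt_le_trans (hz j) (@bigmin_le_cond _ _ _ r j xpredT (fun j => r - `|y ord0 j - p ord0 j|) isT).
rewrite ltrBrDr; apply: le_lt_trans.
by rewrite (_ : z _ _ - p _ _ = (z ord0 j - y ord0 j) + (y ord0 j - p ord0 j)) ?ler_normD // subrKA.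
Qed.

(** With the centre on the boundary, lowering the transverse coordinate only brings a point closer
    to it. *)
Lemma box_seg p r y (s : R) : p ord0 ord0 = 0 -> box p r y -> 0 <= s -> s <= y ord0 ord0 ->
  box p r (slide ord0 y (- s)).
Proof.
move=> p0 [_ hy] s0 sy; split=> [|j]; rewrite /halfspace /= slideE.
  by rewrite eqxx mulr1 subr_ge0.
case: eqP => [->|_]; last by rewrite mulr0 addr0.
have := hy ord0; rewrite p0 !subr0 mulr1 => h.
apply: le_lt_trans h; rewrite !ger0_norm ?subr_ge0 //; last exact: le_trans sy.
by rewrite gerBl.
Qed.
End Box.

(** * Charts of the manifold *)

Section Chart.
Context {R : realType} {n : nat} {M : Type} (U : atlas R n.+1 M) (i : chart U).
Local Notation E := (@halfspace R n).
Local Notation m := n.+1.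
Local Notation imb := (@img R n M (bd U) i).
Local Notation x0 x := (x ord0 ord0).
Hypothesis parK : forall p, dom i p -> par i (crd i p) = p.

Lemma emb_surj (y : 'rV[R]_m) : x0 y = 0 -> exists z, y = emb z.
Proof.
move=> y0; exists (\row_a y ord0 (lift ord0 a)); apply/rowP => j.
by case: (unliftP ord0 j) => [b ->|->]; rewrite ?emb_lift ?emb_ord0 ?mxE.
Qed.

Lemma img_bd z : img i (emb z) <-> imb z.
Proof.
split=> [[p dp e]|[p [dp p0] <-]].
  exists p; first by split=> //; rewrite e emb_ord0.
  by apply/rowP => a; rewrite mxE e emb_lift.
exists p => //; apply/rowP => j.
by case: (unliftP ord0 j) => [b ->|->]; rewrite ?emb_lift ?emb_ord0 ?mxE.
Qed.

Lemma boundary_emb z : img i (emb z) -> boundary U (par i (emb z)).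
Proof. by move=> [p dp e]; exists i; rewrite -e parK //; split=> //; rewrite e emb_ord0. Qed.

Variables (c : set (metricf U)) (sigma : metricf U -> M -> R).
Hypothesis PE : poincare_einstein c sigma.
Variable V : region R n.
Hypothesis Vsub : rset V `<=` img i.
Hypothesis Vin : forall y, rset V y -> 0 < x0 y -> ~ boundary U (par i y).
Hypothesis Vseg : forall y s, rset V y -> 0 <= s -> s <= x0 y -> rset V (slide ord0 y (- s)).
Variables (p1 : 'rV[R]_m) (Vp1 : rset V p1 /\ 0 < x0 p1).
Local Notation cov := ({set 'I_m} -> sfun V).
Local Notation D := (@sD R n V).

Definition sfn (f : M -> R) : sfun V := mks V (rep f i).

Lemma sfnE f y : smooth_fun E U f -> rset V y -> rep f i y = ev y (sfn f).
Proof. by move=> sf Vy; rewrite mksE //; exact: smooth_sub Vsub (sf i). Qed.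

Definition form_fun (A : formf U) : cov := fun S => mks V (fun y => A i y S).

Lemma form_funE k A : is_form E k A -> agree (A i) (form_fun A).
Proof. by move=> [sA _ _] y Vy S; rewrite mksE //; exact: smooth_sub Vsub (sA i S). Qed.

Lemma form_fun_degree k A : is_form E k A -> gN (form_fun A) = k%:R *: form_fun A.
Proof.
move=> fA; have hA := form_funE fA; case: fA => _ dA _; apply/funext => S.
have [<-//|Sk] := eqVneq #|S| k; apply: sfun_ext => y Vy; rewrite !evZ -hA //.
by rewrite dA ?mulr0 //; [exact: Vsub | exact/eqP].
Qed.

Section Scale.
Variables (g : metricf U) (gc : c g).
Local Notation sg := (rep (sigma g) i).
Local Notation s := (sfn (sigma g)).

Lemma scale_fun y : rset V y -> sg y = ev y s.
Proof. by move=> Vy; apply: sfnE => //; case: PE => _ [sm _] _; exact: sm. Qed.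

Lemma scale_pos y : rset (inner Vp1) y -> 0 < sg y.
Proof. by case: PE => _ _ /(_ g gc)[pos _ _ _] [Vy y0]; apply: pos; exact: Vin. Qed.

Lemma scale_bd y : rset V y -> x0 y = 0 -> sg y = 0.
Proof.
case: PE => _ _ /(_ g gc)[_ zero _ _] Vy /emb_surj[z e]; apply: zero.
by rewrite e; apply: boundary_emb; rewrite -e; exact: Vsub.
Qed.

Lemma scale_Einstein y a b : rset (inner Vp1) y ->
  let go z := sg z ^- 2 *: g i z in Ric E go a b y = - n%:R * go y a b.
Proof.
case: PE => _ _ /(_ g gc)[_ _ _ ein] [Vy y0].
by apply: ein; [exact: Vsub | exact: Vin].
Qed.

Lemma scale_tangent y a : rset V y -> x0 y = 0 -> a != ord0 -> ev y (D a s) = 0.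
Proof.
case: (unliftP ord0 a) => [b ->|->]; last by rewrite eqxx.
move=> Vy y0 _; have Ey := rset_sub Vy; have i1 := @sD_ispd R n V (lift ord0 b) s y Vy.
have zero z : rset V z -> x0 z = 0 -> ev z s = 0 by move=> Vz z0; rewrite -scale_fun // scale_bd.
have i2 : ispd (lift ord0 b) (fun=> 0) y (ev y (D (lift ord0 b) s)).
  apply: ispd_congr i1; first exact: zero.
  have [d d0 hd] := rset_open Vy; near=> t => Et; apply: zero.
    by apply: hd => //; apply: slide_near; near: t; exact: dnbhs0_lt.
  by rewrite slideE y0 (negbTE (neq_lift _ _)) mulr0 addr0.
by rewrite -(ispd_unique Ey i2) (ispd_unique Ey (ispd_cst _ _ _)).
Unshelve. all: by end_near. Qed.

Lemma scale_normal y : rset V y -> x0 y = 0 -> ev y (D ord0 s) != 0.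
Proof.
move=> Vy y0; have [z e] := emb_surj y0.
case: PE => _ _ /(_ g gc)[_ _ nz _].
have /nz[a] : imb z by apply/img_bd; rewrite -e; exact: Vsub.
rewrite -e (sD_eq a scale_fun Vy); case: (eqVneq a ord0) => [->/eqP//|a0].
by rewrite scale_tangent.
Qed.

(** Hadamard gives F = x^0 h and sigma = x^0 u. The factor u is a unit: at the boundary it is the
    transverse derivative of sigma, inside it is nonzero since sigma > 0. *)
Lemma divides_scale F : (forall y, rset V y -> x0 y = 0 -> ev y F = 0) ->
  exists H, F = s * H.
Proof.
move=> F0; have s0 y : rset V y -> x0 y = 0 -> ev y s = 0.
  by move=> Vy y0; rewrite -scale_fun // scale_bd.
have had := Hadamard (@rset_sub R n V) (@rset_open R n V) Vseg.
have [h sh hh] := had _ (sfun_smooth F) F0.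
have [u su hu] := had _ (sfun_smooth s) s0.
have u0 y : rset V y -> ev y (mks V u) != 0.
  move=> Vy; rewrite mksE //; have [y0|yn] := eqVneq (x0 y) 0.
    by rewrite (hu y Vy).2 // -sDE //; exact: scale_normal.
  have yp : 0 < x0 y by rewrite lt_neqAle eq_sym yn; exact: (rset_sub Vy).
  have : ev y s != 0 by rewrite -scale_fun // gt_eqF // scale_pos.
  by rewrite (hu y Vy).1 mulf_eq0 negb_or => /andP[].
have [v uv] := sfun_inv u0; exists (v * mks V h); apply: sfun_ext => y Vy.
have := congr1 (ev y) uv; rewrite evM ev1 mksE // => uv1.
rewrite 2!evM (mksE sh Vy) (hh y Vy).1 (hu y Vy).1 mulrA -[in RHS](mulrA (x0 y)) uv1.
by rewrite mulr1.
Qed.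

Lemma form_divides (F : cov) : (forall y S, rset V y -> x0 y = 0 -> ev y (F S) = 0) ->
  exists W, F = gmul s W.
Proof.
move=> F0; have /choice[W hW] : forall S, exists H, F S = s * H.
  by move=> S; apply: divides_scale => y; exact: F0.
by exists W; apply/funext => S; exact: hW.
Qed.
End Scale.

Variable g0 : metricf U.
Hypothesis g0m : is_metric E g0.

Lemma local_metric : exists G Gi : 'M[sfun V]_m,
  [/\ forall y, rset V y -> g0 i y = map_mx (ev y) G, Gi *m G = 1%:M & G^T = G].
Proof.
case: g0m => sm sy pos _; pose G : 'M[sfun V]_m := \matrix_(a, b) mks V (fun y => g0 i y a b).
have hG y : rset V y -> g0 i y = map_mx (ev y) G.
  by move=> Vy; apply/matrixP => a b; rewrite !mxE mksE //; exact: smooth_sub Vsub (sm i a b).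
have dG y : rset V y -> ev y (\det G) != 0.
  move=> Vy; rewrite -det_map_mx -hG //; apply/negP => /det0P[v v0 vG].
  by have := pos i y v (Vsub Vy) v0; rewrite vG mul0mx mxE ltxx.
have [d Gd] := sfun_inv dG; exists G, (d *: \adj G); split=> //.
  by rewrite -scalemxAl mul_adj_mx scale_scalar_mx mulrC Gd.
apply/matrixP => a b; rewrite mxE; apply: sfun_ext => y Vy.
have e : (map_mx (ev y) G)^T = map_mx (ev y) G by rewrite -hG // sy //; exact: Vsub.
by have := congr1 (fun B : 'M[R]_m => B a b) e; rewrite !mxE.
Qed.

Lemma local_factor (Om : M -> R) (g : metricf U) : conformal E Om g0 g ->
  exists w', sfn Om * w' = 1.
Proof.
move=> [sO pO _]; apply: sfun_inv => y Vy; rewrite -sfnE //.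
by have [p dp e] := Vsub Vy; rewrite gt_eqF // /rep -e parK //; exact: pO dp.
Qed.

Lemma scaled_metric Om (q : metricf U) w' (G Gi : 'M[sfun V]_m) :
  conformal E Om g0 q -> sfn Om * w' = 1 ->
  (forall y, rset V y -> g0 i y = map_mx (ev y) G) -> Gi *m G = 1%:M -> G^T = G ->
  [/\ forall y, rset V y -> q i y = map_mx (ev y) (sfn Om ^+ 2 *: G),
    (w' ^+ 2 *: Gi) *m (sfn Om ^+ 2 *: G) = 1%:M & (sfn Om ^+ 2 *: G)^T = sfn Om ^+ 2 *: G].
Proof.
move=> [sO _ qE] wK hG GiG GT; split=> [y Vy||].
- rewrite (qE i y (Vsub Vy)) -/(rep Om i y) (sfnE sO Vy) hG //.
  by apply/matrixP => a b; rewrite !mxE evM evX.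
- by rewrite -scalemxAl -scalemxAr scalerA GiG -exprMn mulrC wK expr1n scale1r.
by rewrite linearZ /= GT.
Qed.

Lemma gN_add (A B : cov) : gN (A + B) = gN A + gN B.
Proof. by apply/funext => S; rewrite /gN !addrfctE scalerDr. Qed.

Lemma gN_opp (A : cov) : gN (- A) = - gN A.
Proof. by apply/funext => S; rewrite /gN !opprfctE scalerN. Qed.

Variables (k l : nat).
Hypothesis hn : n = (l + 2 * k)%N.
Hypothesis l2 : (2 <= l)%N.
Hypothesis n_gt1 : (1 < n)%N.
Hypothesis g0c : c g0.
Variables (g h : metricf U) (Og Oh : M -> R).
Hypothesis gc : c g.
Hypothesis hc : c h.
Hypothesis cg : conformal E Og g0 g.
Hypothesis ch : conformal E Oh g0 h.
Hypothesis sgE : forall p, sigma g p = Og p * sigma g0 p.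
Hypothesis shE : forall p, sigma h p = Oh p * sigma g0 p.
Variables (A A2 : formf U) (AS : formf (bd U)).
Hypothesis fA : is_form E k A.
Hypothesis extA : extends h (sigma h) AS A.
Hypothesis fA2 : is_form E k.+1 A2.
Hypothesis extA2 : extends g (sigma g) (d_bd AS) A2.
Hypothesis rob : forall z, imb z ->
  robin E (g i) (rep (sigma g) i) 1 (fun=> 1) (emb z) = 0.
Variables (gS : 'rV[R]_n -> 'M[R]_n) (CS : 'rV[R]_n -> {set 'I_n} -> R).
Hypothesis hgS : forall z, imb z -> gS z = res_metric g i z.
Hypothesis hCS : forall z T, imb z -> CS z T =
  Q_local E (g i) (rep (sigma g) i) k.+1 (A2 i) (emb z) (lset T).

(** L_k is computed in the scale h and Q_{k+1} in the scale g, but delta_o is common to both, so the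
    extension corrected in the scale h also serves in g. Its coefficient H acquires the power l of
    Oh / Og because sigma_h is Oh / Og times sigma_g. *)
Lemma chart_identity x T : rset V (emb x) ->
  detour_local E (h i) (rep (sigma h) i) k (A i) (emb x) (lset T) *
    (Oh (par i (emb x)) / Og (par i (emb x))) ^+ l =
  gamma n k * codiff setT gS CS x T.
Proof.
move=> Vx; have [G [Gi [hG GiG GT]]] := local_metric.
have [wg' wgK] := local_factor cg; have [wh' whK] := local_factor ch.
have [hgg gigg gTg] := scaled_metric cg wgK hG GiG GT.
have [hgh gigh gTh] := scaled_metric ch whK hG GiG GT.
pose wg := sfn Og; pose wh := sfn Oh; pose s0 := sfn (sigma g0).
pose sg := sfn (sigma g); pose sh := sfn (sigma h).
have ss q : c q -> smooth_fun E U (sigma q) by case: PE => _ [sm _] _; exact: sm.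
have sO q Om : conformal E Om g0 q -> smooth_fun E U Om by case.
have sV q Om : c q -> conformal E Om g0 q -> (forall p, sigma q p = Om p * sigma g0 p) ->
    sfn (sigma q) = sfn Om * s0.
  move=> qc cq e; apply: sfun_ext => y Vy.
  by rewrite evM -(sfnE (ss q qc)) // -(sfnE (sO _ _ cq)) // -(sfnE (ss g0 g0c)) // /rep e.
have sgV : sg = wg * s0 := sV g Og gc cg sgE.
have shV : sh = wh * s0 := sV h Oh hc ch shE.
have Vimb z : rset V (emb z) -> imb z by move=> Vz; apply/img_bd; exact: Vsub.
have sb q z : c q -> rset V (emb z) -> ev (emb z) (sfn (sigma q)) = 0.
  by move=> qc Vz; rewrite -(scale_fun qc) // (scale_bd qc) // emb_ord0.
pose AV := form_fun A; have hA := form_funE fA; have dA := form_fun_degree fA.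
have [W hW] : exists W, iot1 (wh' ^+ 2 *: Gi) (D^~ sh) AV = gmul sh W.
  apply: (form_divides hc) => y S Vy y0.
  rewrite -(agree_iota hgh gigh (scale_fun hc) gTh hA Vy).
  have [z e] := emb_surj y0; rewrite e; apply: (extA _).2.
  by apply: Vimb; rewrite -e.
have [BV [HV [dB eH dL]]] := detour_boundary n_gt1 hgh gigh gTh (scale_fun hc)
  (scale_pos hc) (scale_Einstein hc) (scale_bd hc) hn l2 hA dA hW.
pose F := AV + gmul sh BV; pose DA : cov := gd D F.
move: eH; rewrite res_d => /codE_order; rewrite -/sh -/wh -/F -/DA.
rewrite {1 2 3}shV (codE_conformal (@sDM R n V) GT GiG s0 whK) => oh.
pose f := wh * wg'.
have fs : sg * f = sh.
  rewrite sgV shV /f -[RHS]mul1r -wgK -/wg; move: (wg) (wg') (wh) (s0) => t1 t2 t3 t4; ring.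
have og : gmul (sg ^+ 2) (gx D (wg ^+ 2 *: G) (wg' ^+ 2 *: Gi) DA) -
    gmul sg (iot1 (wg' ^+ 2 *: Gi) (D^~ sg) (gcc DA)) = gmul (sg ^+ l) (gmul (f ^+ l) HV).
  by rewrite {1 2 3}sgV (codE_conformal (@sDM R n V) GT GiG s0 wgK) oh gmulA -exprMn fs.
have dF : gN F = k%:R *: F.
  rewrite gN_add gN_mul dA dB scalerDr; congr (_ + _).
  by apply/funext => S; rewrite /gmul !scalrfctE scalerAr.
have gDA : gN DA = k.+1%:R *: DA.
  rewrite /DA (gN_gd (@sDZ R n V)) dF -natr1 scalerDl scale1r; congr (_ + _).
  by rewrite /gd scaler_sumr; apply: eq_bigr => a _; rewrite (gDZ (@sDZ R n V)) gepsZ.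
have dDA : gd D DA = 0 by exact: (gd_dd (@sDD R n V) (@sDZ R n V) (@sDC R n V)).
have [Z hZ] := closed_normal n_gt1 hgg gigg gTg (scale_fun gc) (scale_pos gc) hn l2 gDA og.
have pairE := pair_region n_gt1 hgg gigg gTg (scale_fun gc) (scale_pos gc) (scale_Einstein gc).
have hessE := hess_region n_gt1 hgg gigg gTg (scale_fun gc) (scale_pos gc) (scale_Einstein gc).
pose AV2 := form_fun A2; have hA2 := form_funE fA2; have dA2 := form_fun_degree fA2.
have tang z : rset V (emb z) -> forall a, a != ord0 -> ev (emb z) (D a sg) = 0.
  by move=> Vz a; apply: (scale_tangent gc) => //; exact: emb_ord0.
(* The prescribed extension and d F have the same tangential part d_Sigma A and no normal part along
   Sigma. They differ by a multiple of sigma, which is the freedom that [Q_boundary] admits. *)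
have bv y S : rset V y -> x0 y = 0 -> ev y ((AV2 - DA) S) = 0.
  move=> Vy /emb_surj[z e]; move: Vy; rewrite {}e => Vz.
  apply: (boundary_vanish gigg gTg pairE (sb g z gc Vz) (tang z Vz)) => {}S.
    rewrite addrfctE opprfctE evB -hA2 //; have := (extA2 (Vimb _ Vz)).1 S.
    rewrite /res_form -/(lset S) => ->; apply/eqP; rewrite subr_eq0; apply/eqP.
    apply: (@d_boundary R n V (AS i) F z S Vz) => z' T' Vz'; rewrite -(extA (Vimb _ Vz')).1 /res_form -/(lset T').
    by rewrite /F addrfctE evD -hA // /gmul evM sb // mul0r addr0.
  have -> : iot1 (wg' ^+ 2 *: Gi) (D^~ sg) (AV2 - DA) =
      iot1 (wg' ^+ 2 *: Gi) (D^~ sg) AV2 - iot1 (wg' ^+ 2 *: Gi) (D^~ sg) DA.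
    by rewrite !(iot1_iot gTg gigg) -sumrB; apply: eq_bigr => a _;
      rewrite giotD giotN gmulD gmulN.
  rewrite addrfctE opprfctE evB -(agree_iota hgg gigg (scale_fun gc) gTg hA2 Vz).
  by rewrite (extA2 (Vimb _ Vz)).2 hZ /gmul evM sb // mul0r subrr.
have [W2 hW2] := form_divides gc bv.
have eA2 : AV2 = DA + gmul sg W2 by rewrite -hW2 addrC subrK.
have gW2 : gN W2 = k.+1%:R *: W2.
  apply: (@spow_cancel R n V p1 Vp1 (rep (sigma g) i) sg (scale_fun gc) (scale_pos gc) 1).
  rewrite expr1 -gN_mul -hW2 gN_add gN_opp dA2 gDA -scalerBr hW2.
  by apply/funext => S; rewrite /gmul !scalrfctE scalerAr.
have [YV [Y1 [hY hx hQ]]] := Q_boundary (scale_bd gc) hn l2 (scale_tangent gc)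
  (scale_normal gc) hA2 eA2 dDA gDA gW2 ((codE_order n_gt1 hgg gigg gTg (scale_fun gc)
  (scale_pos gc) (scale_Einstein gc) l DA (gmul (f ^+ l) HV)).2 og).
have rho0 z : rset V (emb z) -> rho E (g i) (rep (sigma g) i) (emb z) = 0.
  move=> Vz; apply: (Robin_rho (ltnW n_gt1) hgg gigg gTg (scale_fun gc) hessE pairE Vz
    (sb g z gc Vz) (tang z Vz)); exact: rob (Vimb _ Vz).
have hC z S : rset V (emb z) -> CS z S = ev (emb z) (YV (lset S)).
  by move=> Vz; rewrite (hCS _ (Vimb _ Vz)) hQ ?emb_ord0 ?rho0 ?ord0_lset.
have hgS' z : rset V (emb z) -> gS z = \matrix_(a, b) g i (emb z) (lift ord0 a) (lift ord0 b).
  by move=> Vz; rewrite (hgS (Vimb _ Vz)).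
have rhoy := rho0 x Vx; rewrite (rho_ev hgg gigg (scale_fun gc) Vx) in rhoy.
rewrite (dL _ _ Vx (emb_ord0 x)).
rewrite (divergence_boundary hgg gigg gTg hessE pairE Vx (sb g x gc Vx) (tang x Vx)
  hgS' hC hY rhoy) hx.
have -> : Oh (par i (emb x)) / Og (par i (emb x)) = ev (emb x) f.
  have := congr1 (ev (emb x)) wgK; rewrite evM ev1 -(sfnE (sO _ _ cg) Vx) /rep => e.
  have Og0 : Og (par i (emb x)) != 0.
    by apply: contra_eq_neq e => ->; rewrite mul0r eq_sym oner_eq0.
  rewrite /f evM -(sfnE (sO _ _ ch) Vx) /rep; congr (_ * _).
  by rewrite -[LHS]mulr1 -e mulrA mulVf // mul1r.
have -> : ev (emb x) ((Y1 - ((l - 2)`!)%:R ^+ 2 *: gmul (f ^+ l) HV) (lset T)) =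
    ev (emb x) (Y1 (lset T)) - ((l - 2)`!)%:R ^+ 2 * (ev (emb x) f ^+ l * ev (emb x) (HV (lset T))).
  by rewrite -(evX (emb x) f l) -(evM (emb x) (f ^+ l)) -evZ -evB.
rewrite /gamma.
have -> : n%:R - 2 * k%:R = l%:R :> R by rewrite [in LHS]hn natrD natrM addrK.
(* The quotient of the two squared factorials is the factor (l - 1)^2 of gamma_k. *)
have -> : (l.-1)`!%:R = (l%:R - 1) * ((l - 2)`!)%:R :> R.
  have -> : l%:R - 1 = ((l - 2).+1)%:R :> R.
    by apply/eqP; rewrite subr_eq natr1; apply/eqP; congr (_%:R); lia.
  have -> : l.-1 = (l - 2).+1 by lia.
  by rewrite factS natrM.
move: (ev _ (HV _)) (ev _ (Y1 _)) (ev _ f ^+ l) ((l - 2)`!%:R) (l%:R : R) => t1 t2 t3 t4 t5.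
ring.
Qed.
End Chart.

(** [boundary] asks only for some chart with first coordinate 0. Near x one has sigma = x^0 u with u
    nowhere zero, so a point with x^0 > 0 has sigma nonzero and is a boundary point in no chart. *)
Lemma exists_region (R : realType) (n : nat) (M : topologicalType) (U : atlas R n.+1 M)
    (c : set (metricf U)) (sigma : metricf U -> M -> R) (g0 : metricf U) (i : chart U) x :
  is_manifold (@halfspace R n) U -> poincare_einstein c sigma -> c g0 ->
  @img R n M (bd U) i x ->
  exists (V : region R n), [/\ rset V `<=` @img R n.+1 M U i,
    forall y, rset V y -> 0 < y ord0 ord0 -> ~ boundary U (par i y),
    forall y s, rset V y -> 0 <= s -> s <= y ord0 ord0 -> rset V (slide ord0 y (- s)),
    rset V (emb x) & exists p1, rset V p1 /\ 0 < p1 ord0 ord0].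
Proof.
move=> [_ _ _ charts _] PE g0c imx.
have [_ [W oW imgE] parK _ _] := charts i.
have im0 : img i (emb x) := (img_bd i x).2 imx.
have : (W `&` @halfspace R n) (emb x) by rewrite -imgE.
move=> [W0 E0]; have [r1 r10 hr1] := open_box oW W0.
have cen r : 0 < r -> box (emb x) r (emb x) by move=> r0; split=> // j; rewrite subrr normr0.
pose V1 := @Region R n (box (emb x) r1) (@box_sub R n _ r1) (box_open r10) (emb x) (cen r1 r10).
have V1sub : rset V1 `<=` img i by move=> y [Ey hy]; rewrite imgE; split=> //; exact: hr1.
pose s := sfn i V1 (sigma g0).
have hs := scale_fun PE V1sub g0c.
have s0 y : rset V1 y -> y ord0 ord0 = 0 -> ev y s = 0.
  by move=> Vy y0; rewrite -hs // (scale_bd parK PE V1sub g0c).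
have [u su hu] := Hadamard (@rset_sub R n V1) (@rset_open R n V1)
  (fun y t => box_seg (emb_ord0 x)) (sfun_smooth s) s0.
have Vx : rset V1 (emb x) := cen r1 r10.
(* At the centre u is the transverse derivative of sigma; the box is then shrunk until u has no zero
   in it. *)
have ux : u (emb x) != 0.
  rewrite (hu _ Vx).2 ?emb_ord0 // -sDE //.
  exact: (scale_normal parK PE V1sub g0c Vx (emb_ord0 x)).
have u0 : 0 < `|u (emb x)| by rewrite normr_gt0.
have [d d0 hd] := smooth_cont su Vx u0.
pose r := Num.min d r1; have r0 : 0 < r by rewrite lt_min d0.
pose V := @Region R n (box (emb x) r) (@box_sub R n _ r) (box_open r0) (emb x) (cen r r0).
have V1V : rset V `<=` rset V1.
  by move=> y [Ey hy]; split=> // j; apply: lt_le_trans (hy j) _; rewrite ge_min lexx orbT.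
exists V; split=> //.
- by move=> y /V1V/V1sub.
- move=> y Vy y0 by_.
  case: PE => _ _ /(_ g0 g0c)[_ zero _ _].
  have := hs y (V1V y Vy); rewrite (hu y (V1V y Vy)).1 /rep zero // => /esym/eqP.
  rewrite mulf_eq0 gt_eqF //= => /eqP uy.
  have := hd y (V1V y Vy); rewrite uy sub0r normrN ltxx => h.
  suff : false by []. apply: h => j; apply: lt_le_trans (Vy.2 j) _.
  by rewrite ge_min lexx.
- by move=> y t; exact: box_seg (emb_ord0 x).
- exact: (cen r r0).
have r2 : 0 < r / 2 by rewrite divr_gt0.
exists (slide ord0 (emb x) (r / 2)).
have h0 : slide ord0 (emb x) (r / 2) ord0 ord0 = r / 2.
  by rewrite slideE emb_ord0 eqxx mulr1 add0r.
split; last by rewrite h0.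
split; first by rewrite /halfspace /= h0 ltW.
by apply: slide_near; rewrite gtr0_norm // gtr_pMr // invf_lt1 // ltr1n.
Qed.

(** L_k A has conformal weight 2k - n; the power of omega accounts for its trivialisation in a scale
    other than the one chosen for Q. *)
Theorem theorem6p19 (R : realType) (n : nat) (M : topologicalType)
    (U : atlas R n.+1 M) (c : set (metricf U)) (sigma : metricf U -> M -> R)
    (n_ge4 : (4 <= n)%N) (n_even : ~~ odd n)
    (mfdM : is_manifold halfspace U)
    (PE : poincare_einstein c sigma)
    (gS : metricf (bd U)) (gSc : boundary_class c gS)
    (k : nat) (k_le : (k <= n./2 - 1)%N)
    (AS : formf (bd U)) (ASk : is_form setT k AS)
    (* any scale hS = omega^2 gS in which L_k AS is trivialised *)
    (hS : metricf (bd U)) (omega : M -> R) (gShS : conformal setT omega gS hS)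
    (BS CS : formf (bd U))
    (LAS : is_detour c sigma k AS hS BS)
    (QdAS : is_Q c sigma gS k.+1 (d_bd AS) CS) :
  forall (i : chart (bd U)) x S, img i x ->
    BS i x S = omega (par i x) ^ ((2 * k)%:Z - n%:Z) *
               (gamma n k * delta_bd gS CS i x S).
Proof.
move=> i x S imx; have [_ _ _ charts _] := mfdM.
have [_ _ parK _ _] := charts i.
have [[g0 g0m cE] [_ dw] _] := PE.
have g0c : c g0.
  rewrite cE; exists (fun=> 1); split=> // [j|j y _]; last by rewrite expr1n scale1r.
  have [_ [W oW ej] _ _ _] := charts j.
  apply: (@algebraic_smooth R n (@img R n.+1 M U j)); last exact: (alg_cst _ 1).
    by rewrite ej => y [].
  move=> y; rewrite ej => -[Wy _]; have [d d0 hd] := open_box oW Wy.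
  by exists d => // z Ez hz; split=> //; exact: hd.
have [V [Vsub Vin Vseg Vx [p1 Vp1]]] := exists_region mfdM PE g0c imx.
(* For even n the bound on k gives n - 2k at least 2, the smallest value for which the coefficients
   of D-bar-star have no pole. *)
have [l [hn l2]] : exists l, n = (l + 2 * k)%N /\ (2 <= l)%N.
  exists (n - 2 * k)%N; have := odd_double_half n.
  by rewrite (negbTE n_even) add0n -muln2; move: k_le n_ge4; lia.
have n_gt1 : (1 < n)%N by lia.
have [h [A [hc hind fA extA hB]]] := LAS.
have [tau [g [A2 [_ [gc tau1] [gind rob] [fA2 extA2] hC]]]] := QdAS.
have := gc; rewrite {1}cE => -[Og cg]; have := hc; rewrite {1}cE => -[Oh ch].
have sgE p : sigma g p = Og p * sigma g0 p by rewrite (dw g0 g Og g0c gc cg) expr1z.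
have shE p : sigma h p = Oh p * sigma g0 p by rewrite (dw g0 h Oh g0c hc ch) expr1z.
have rob' z : @img R n M (bd U) i z ->
    robin halfspace (g i) (@rep R n M U (sigma g) i) 1 (fun=> 1) (emb z) = 0.
  move=> imz; have := rob i z imz.
  by rewrite (_ : @rep R n M U (tau g) i = fun=> 1) //; apply/funext => y; rewrite /rep tau1.
have key := chart_identity parK PE Vsub Vin Vseg Vp1 g0m hn l2 n_gt1 g0c gc hc cg ch
  sgE shE fA extA fA2 extA2 rob' (gind i) (fun z T => hC i z T) S Vx.
have [p dp ep] : @img R n.+1 M U i (emb x) := (img_bd i x).2 imx.
pose q := @par R n.+1 M U i (emb x); have qE : q = p by rewrite /q -ep parK.
have [_ posg eg] := cg; have [_ posh eh] := ch; have [_ poso eo] := gShS.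
have Og0 : 0 < Og q by rewrite qE; exact: posg dp.
have Oh0 : 0 < Oh q by rewrite qE; exact: posh dp.
have om0 : 0 < omega q.
  by rewrite qE; apply: (poso i); split=> //; rewrite ep emb_ord0.
(* A single diagonal entry in a tangential direction, positive by definiteness, suffices to compare
   the conformal factors; positivity then permits taking square roots. *)
pose b : 'I_n.+1 := lift ord0 (Ordinal (ltnW n_gt1)).
have gbb : 0 < g0 i (emb x) b b.
  case: g0m => _ _ pos _; have := pos i (emb x) (delta_mx ord0 b) (Vsub _ Vx).
  rewrite trmx_delta -rowE -colE !mxE; apply; apply/eqP => /rowP/(_ b).
  by rewrite !mxE !eqxx => /eqP; rewrite oner_eq0.
have OhE : Oh q = omega q * Og q.
  have := eo i x imx; rewrite hind // gind //.
  move=> /matrixP/(_ (Ordinal (ltnW n_gt1)) (Ordinal (ltnW n_gt1))); rewrite !mxE -/b.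
  rewrite (eh i _ (Vsub _ Vx)) (eg i _ (Vsub _ Vx)) !mxE mulrA => e.
  have := mulIf (lt0r_neq0 gbb) e; rewrite -exprMn => e2.
  by apply: (@pexpIrn R 2 _ _ _ _ _ e2) => //; rewrite nnegrE ltW // mulr_gt0.
move: key; rewrite -/q OhE mulfK ?gt_eqF // => key.
rewrite hB // /res_form -/(lset S) -[X in _ * X]key.
have -> : (2 * k)%:Z - n%:Z = - l%:Z.
  by move: (hn); lia.
by rewrite -exprnN mulrCA mulVf ?mulr1 // expf_neq0 // gt_eqF.
Qed.
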